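(* Let $(\mathcal M,g)$ be a pp-wave with parallel null vector field $V$. If $(\mathcal M,g)$ is strongly indecomposable, Ricci-flat and locally $V^\perp$-homogeneous, then $(\mathcal M,g)$ is a plane wave.
   Context: $\nabla$ is the Levi-Civita connection of $g$, and $R(X,Y)=[\nabla_X,\nabla_Y]-\nabla_{[X,Y]}$ is its curvature, which via the metric is also regarded as the curvature endomorphism $R:\Lambda^2T\mathcal M\to\Lambda^2T\mathcal M$. A Lorentzian manifold $(\mathcal M,g)$ is a pp-wave if it admits a parallel null vector field $V$ (i.e. $V\neq 0$, $g(V,V)=0$, $\nabla V=0$) and if its curvature endomorphism is non-zero (not identically zero) and satisfies $R|_{V^\perp\wedge V^\perp}=0$, where $V^\perp=\{X\in T\mathcal M\mid g(X,V)=0\}$. A plane wave is a pp-wave satisfying in addition $\nabla_UR=0$ for all $U\in V^\perp$. The distribution $V^\perp$ is parallel and defines a foliation of $\mathcal M$ into totally geodesic leaves of codimension $1$. $(\mathcal M,g)$ is locally $V^\perp$-homogeneous if for all $p,q\in\mathcal M$ lying in the same leaf of $V^\perp$ there is a neighbourhood $\mathcal U$ of $p$ in $\mathcal M$ and an isometry $\phi$ between $(\mathcal U,g)$ and $(\phi(\mathcal U),g)$ that maps $p$ to $q$. $(\mathcal M,g)$ is strongly indecomposable if no point has a neighbourhood on which $g$ is a product metric (i.e. a semi-Riemannian product of two metrics on manifolds of positive dimension). *)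

(* Defs.v *)
From mathcomp Require Import all_boot all_order all_algebra.
From mathcomp Require Import all_classical all_reals all_analysis.

Set Implicit Arguments.
Unset Strict Implicit.
Unset Printing Implicit Defensive.

Import Order.TTheory GRing.Theory Num.Theory.
Import numFieldNormedType.Exports.

Local Open Scope classical_set_scope.
Local Open Scope ring_scope.

(* C^k and C^oo regularity of f on A, meant for A open: the iterated partial
   derivatives up to order k exist and are continuous at the points of A. *)
Fixpoint Ck (R : realType) (n k : nat) (A : set 'rV[R]_n) (f : 'rV[R]_n -> R)
    : Prop :=
  (forall x, A x -> {for x, continuous f}) /\
  match k with
  | 0%N => True
  | k'.+1 => forall a : 'I_n,
      (forall x, A x -> derivable f x (delta_mx 0 a)) /\
      Ck k' A (fun x => 'D_(delta_mx 0 a) f x)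
  end.

Definition Cinf (R : realType) (n : nat) (A : set 'rV[R]_n)
    (f : 'rV[R]_n -> R) : Prop :=
  forall k, Ck k A f.

(* Only the values of cmap on cdom, and of cinv on cmap @` cdom, matter. *)
Record chart (R : realType) (n : nat) (T : topologicalType) := Chart {
  cdom : set T;
  cmap : T -> 'rV[R]_n;
  cinv : 'rV[R]_n -> T;
  cdom_open : open cdom;
  cimg_open : open (cmap @` cdom);
  cmapK : forall p, cdom p -> cinv (cmap p) = p;
  cmap_cont : forall p, cdom p -> {for p, continuous cmap};
  cinv_cont : forall x, (cmap @` cdom) x -> {for x, continuous cinv} }.

(* Smooth n-manifolds without boundary, not assumed connected.  The atlas need
   not be maximal; chart_at singles out a chart around each point. *)
Record manifold (R : realType) (n : nat) := Manifold {
  points :> topologicalType;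
  hausdorff_points : hausdorff_space points;
  second_countable_points : @second_countable points;
  chart_index : Type;
  atlas : chart_index -> chart R n points;
  chart_at : points -> chart_index;
  mem_chart_at : forall p, cdom (atlas (chart_at p)) p;
  transition_smooth : forall (i j : chart_index) (a : 'I_n),
    Cinf (cmap (atlas i) @` (cdom (atlas i) `&` cdom (atlas j)))
         (fun x => cmap (atlas j) (cinv (atlas i) x) 0 a) }.

Section Calculus.
Context {R : realType} {n : nat} {M : manifold R n}.

Definition smooth_on (U : set M) (f : M -> R) : Prop :=
  forall i, Cinf (cmap (atlas i) @` (cdom (atlas i) `&` U))
                 (f \o cinv (atlas i)).

(* The tangent space at p is identified with 'rV[R]_n by means of the chart
   chart_at p, so that a vector field is a function M -> 'rV[R]_n.  der f p v
   is the derivative at p, along the tangent vector v, of f. *)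
Definition der (f : M -> R) (p : M) (v : 'rV[R]_n) : R :=
  let c := atlas (chart_at p) in 'D_v (f \o cinv c) (cmap c p).

Definition coord (i : chart_index M) (a : 'I_n) : M -> R :=
  fun q => cmap (atlas i) q 0 a.

Definition smooth_vfield (X : M -> 'rV[R]_n) : Prop :=
  forall i a, smooth_on (cdom (atlas i)) (fun p => der (coord i a) p (X p)).

(* Lie bracket: [X,Y]^a = X(Y^a) - Y(X^a) in the chart chosen at p. *)
Definition lie (X Y : M -> 'rV[R]_n) : M -> 'rV[R]_n := fun p =>
  \row_a let xa := coord (chart_at p) a in
         der (fun q => der xa q (Y q)) p (X p)
         - der (fun q => der xa q (X q)) p (Y p).

End Calculus.

Section Maps.
Context {R : realType} {m n : nat} {M : manifold R m} {N : manifold R n}.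

Definition smooth_map (U : set M) (F : M -> N) : Prop :=
  (forall p, U p -> {for p, continuous F}) /\
  forall j a, smooth_on (U `&` F @^-1` cdom (atlas j)) (coord j a \o F).

Definition tangent_map (F : M -> N) (p : M) (v : 'rV[R]_m) : 'rV[R]_n :=
  \row_a der (coord (chart_at (F p)) a \o F) p v.

End Maps.

Section SemiRiemannian.
Context {R : realType} {n : nat} {M : manifold R n}.
Implicit Types (g : M -> 'M[R]_n) (X Y Z W U V : M -> 'rV[R]_n).

(* A field of bilinear forms is given by its Gram matrices. *)
Definition inner g (p : M) (v w : 'rV[R]_n) : R := (v *m g p *m w^T) 0 0.

(* (P *m G *m P^T) is diag(-1, .., -1, 1, .., 1) with k entries -1. *)
Definition has_index (k : nat) (G : 'M[R]_n) : Prop :=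
  (k <= n)%N /\
  exists2 P, P \in unitmx &
    P *m G *m P^T = diag_mx (\row_(a < n) (if (a < k)%N then -1 else 1)).

Definition metric (k : nat) g : Prop :=
  (forall p, has_index k (g p)) /\
  (forall X Y, smooth_vfield X -> smooth_vfield Y ->
     smooth_on setT (fun p => inner g p (X p) (Y p))).

Definition lorentzian g : Prop := metric 1 g.

Implicit Types nabla : (M -> 'rV[R]_n) -> (M -> 'rV[R]_n) -> (M -> 'rV[R]_n).

(* nabla X Y is the covariant derivative of Y along X; its values on non-smooth
   fields are irrelevant. *)
Definition connection nabla : Prop :=
  [/\ forall X Y, smooth_vfield X -> smooth_vfield Y ->
        smooth_vfield (nabla X Y),
      forall X X' Y, smooth_vfield X -> smooth_vfield X' -> smooth_vfield Y ->
        forall p, nabla (X \+ X') Y p = nabla X Y p + nabla X' Y p,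
      forall f X Y, smooth_on setT f -> smooth_vfield X -> smooth_vfield Y ->
        forall p, nabla (fun q => f q *: X q) Y p = f p *: nabla X Y p,
      forall X Y Y', smooth_vfield X -> smooth_vfield Y -> smooth_vfield Y' ->
        forall p, nabla X (Y \+ Y') p = nabla X Y p + nabla X Y' p &
      forall f X Y, smooth_on setT f -> smooth_vfield X -> smooth_vfield Y ->
        forall p, nabla X (fun q => f q *: Y q) p
                  = der f p (X p) *: Y p + f p *: nabla X Y p].

Definition levi_civita g nabla : Prop :=
  [/\ connection nabla,
      forall X Y, smooth_vfield X -> smooth_vfield Y ->
        forall p, nabla X Y p - nabla Y X p = lie X Y p &
      forall X Y Z, smooth_vfield X -> smooth_vfield Y -> smooth_vfield Z ->
        forall p, der (fun q => inner g q (Y q) (Z q)) p (X p)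
                  = inner g p (nabla X Y p) (Z p)
                    + inner g p (Y p) (nabla X Z p)].

Definition curv nabla X Y Z : M -> 'rV[R]_n :=
  nabla X (nabla Y Z) \- nabla Y (nabla X Z) \- nabla (lie X Y) Z.

(* (nabla_U R)(X,Y)Z, by the Leibniz rule. *)
Definition dcurv nabla U X Y Z : M -> 'rV[R]_n :=
  nabla U (curv nabla X Y Z) \- curv nabla (nabla U X) Y Z
  \- curv nabla X (nabla U Y) Z \- curv nabla X Y (nabla U Z).

(* Ric(Y,Z) at p is the trace of x |-> R(x,Y)Z, computed in the standard basis
   of the tangent space at p, extended to smooth vector fields E a. *)
Definition ricci_flat nabla : Prop :=
  forall (p : M) (E : 'I_n -> M -> 'rV[R]_n) Y Z,
    (forall a, smooth_vfield (E a)) -> (forall a, E a p = delta_mx 0 a) ->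
    smooth_vfield Y -> smooth_vfield Z ->
    \sum_a curv nabla (E a) Y Z p 0 a = 0.

Definition orth_section g V X : Prop :=
  smooth_vfield X /\ forall p, inner g p (X p) (V p) = 0.

Definition parallel_null g nabla V : Prop :=
  [/\ smooth_vfield V,
      forall p, V p <> 0,
      forall p, inner g p (V p) (V p) = 0 &
      forall X, smooth_vfield X -> forall p, nabla X V p = 0].

(* The endomorphism of Lambda^2 TM induced by the curvature vanishes on the
   bivector x /\ y iff R(x,y) = 0. *)
Definition pp_wave g nabla V : Prop :=
  [/\ parallel_null g nabla V,
      exists X Y Z, [/\ smooth_vfield X, smooth_vfield Y, smooth_vfield Z &
        exists p, curv nabla X Y Z p <> 0] &
      forall X Y Z, orth_section g V X -> orth_section g V Y ->
        smooth_vfield Z -> forall p, curv nabla X Y Z p = 0].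

Definition plane_wave g nabla V : Prop :=
  pp_wave g nabla V /\
  forall U X Y Z, orth_section g V U ->
    smooth_vfield X -> smooth_vfield Y -> smooth_vfield Z ->
    forall p, dcurv nabla U X Y Z p = 0.

(* The range of F is a connected (injectively immersed) integral manifold of
   the orthogonal distribution of V; the immersion property follows from the
   equality of dimensions. *)
Definition integral_manifold g V (L : manifold R n.-1) (F : L -> M) : Prop :=
  [/\ connected [set: L], smooth_map setT F, injective F &
      forall x, range (tangent_map F x)
                = [set w | inner g (F x) w (V (F x)) = 0]].

(* The leaves are the maximal connected integral manifolds, so two points are
   in the same leaf iff some connected integral manifold contains both. *)
Definition same_leaf g V (p q : M) : Prop :=
  exists (L : manifold R n.-1) (F : L -> M),
    [/\ integral_manifold g V F, range F p & range F q].

Definition isometry_on g (U : set M) (phi : M -> M) : Prop :=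
  [/\ open (phi @` U), smooth_map U phi,
      exists2 psi : M -> M, smooth_map (phi @` U) psi &
        forall p, U p -> psi (phi p) = p &
      forall p, U p -> forall v w,
        inner g (phi p) (tangent_map phi p v) (tangent_map phi p w)
        = inner g p v w].

Definition locally_orth_homogeneous g V : Prop :=
  forall p q, same_leaf g V p q ->
    exists (U : set M) (phi : M -> M),
      [/\ open U, U p, isometry_on g U phi & phi p = q].

End SemiRiemannian.

(* (U, g) is isometric to a product (M1, g1) x (M2, g2) of semi-Riemannian
   manifolds of positive dimension, by means of p |-> (F1 p, F2 p).  Smoothness
   of the inverse bijection is automatic, as the tangent maps are injective. *)
Definition product_on (R : realType) (n : nat) (M : manifold R n)
    (g : M -> 'M[R]_n) (U : set M) : Prop :=
  exists (n1 n2 k1 k2 : nat) (M1 : manifold R n1) (M2 : manifold R n2)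
      (g1 : M1 -> 'M[R]_n1) (g2 : M2 -> 'M[R]_n2) (F1 : M -> M1) (F2 : M -> M2),
    [/\ [/\ (0 < n1)%N, (0 < n2)%N & (n1 + n2)%N = n],
        metric k1 g1 /\ metric k2 g2,
        smooth_map U F1 /\ smooth_map U F2,
        set_bij U setT (fun p => (F1 p, F2 p)) &
        forall p, U p -> forall v w,
          inner g p v w
          = inner g1 (F1 p) (tangent_map F1 p v) (tangent_map F1 p w)
            + inner g2 (F2 p) (tangent_map F2 p v) (tangent_map F2 p w)].

Definition strongly_indecomposable (R : realType) (n : nat) (M : manifold R n)
    (g : M -> 'M[R]_n) : Prop :=
  forall p : M, ~ exists U : set M, [/\ open U, U p & product_on g U].

(* Main.v *)
(** Let W be a null vector field with g(W, V) = 1 and put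
    T(x, y) = g(R(W, x)y, W) for x, y in V^perp.  On a pp-wave the symmetric
    tensor T on the screen bundle V^perp / V determines the curvature, and the
    connection induced on the screen bundle is flat along the leaves of V^perp.
    The second Bianchi identity makes the leafwise derivative DT totally
    symmetric and Ricci-flatness makes T trace-free, so T is harmonic along the
    leaves.

    If R vanishes at p, then by homogeneity it vanishes on the leaf through p,
    and DT = 0 at p.  If R does not vanish at p, the composites R(x, y)R(z, w)
    span the line of V at p, so every local isometry sends V to a multiple of V
    at the points considered and multiplies T by a constant.  With f = |T|^2 and
    a = d(log f), the functions |a|^2, |DT|^2 / f, |T(a, .)|^2 / f and
    T(a, a)^2 / f are therefore constant on leaves.  The Bochner formula for
    log f gives Da = 0; hence T(a, a)|a|^2 = 0, then |a|^2 T(a, .) = 0, then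
    |a|^2 (D_k T)(a, .) = 0 for all k, and finally a = 0.  Thus f is constant on
    leaves; its leafwise Laplacian is 2|DT|^2, so DT = 0, which is the plane
    wave condition.

    Leaves are built from a potential of the closed form g(V, .) and the
    implicit function theorem. *)
Require Import Defs.
From HB Require Import structures.
From mathcomp Require Import all_boot all_order all_algebra.
From mathcomp Require Import all_classical all_reals all_analysis.
From mathcomp Require Import ring lra.

Set Implicit Arguments.
Unset Strict Implicit.
Unset Printing Implicit Defensive.
Import Order.TTheory GRing.Theory Num.Theory.
Import numFieldNormedType.Exports.

Local Open Scope classical_set_scope.
Local Open Scope ring_scope.
Import Defs.

(** * Neighbourhood filters, pointwise continuity, directional derivatives *)

Section Near.
Context {T : topologicalType}.
Implicit Types (x : T) (P Q : T -> Prop) (A : set T).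

(** The obstacle is that a local isometry only rescales [V], by an unknown factor: f = |T|^2 is no
    invariant, and homogeneity makes constant only ratios of degree zero in T. T(a, a) enters
    squared so that no root of f is needed. The isometries are unrelated to one another; they serve
    only to show that the derivatives of these ratios along V^perp vanish.

    What remains is an identity between derivatives at a point. It is proved in a commutative ring
    with derivations [D k], later the smooth functions on an open set where f is invertible, so that
    no differentiability condition has to be carried. Positivity survives as the rule that a
    vanishing sum of squares has vanishing terms. The screen frame is not parallel, so connection
    coefficients [w] appear, but flatness along the leaves lets second covariant derivatives commute
    and leaves no curvature term in Bochner's formula.

    T(a, a)|a|^2 = 0 comes from a clash of two factors: s = T(a, a) satisfies D(s^2) = s^2 a with a
    parallel, so the Laplacian of s^2 is s^2 |a|^2; but s is harmonic, so it is also 2|Ds|^2, which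
    is only half of that. *)

Lemma near_mono x P Q : (forall y, P y -> Q y) ->
  (\forall y \near x, P y) -> \forall y \near x, Q y.
Proof. by move=> PQ; apply: filterS. Qed.

Lemma near_and x P Q : (\forall y \near x, P y) -> (\forall y \near x, Q y) ->
  \forall y \near x, P y /\ Q y.
Proof. by move=> HP HQ; exact: filterI. Qed.

Lemma near_open x A : open A -> A x -> \forall y \near x, A y.
Proof. by move=> oA Ax; exact: open_nbhs_nbhs. Qed.

Lemma near_at x P : (\forall y \near x, P y) -> P x.
Proof. exact: nbhs_singleton. Qed.

Lemma near_near x P : (\forall y \near x, P y) -> \forall y \near x, \forall z \near y, P z.
Proof. by move=> H; exact: nbhs_interior. Qed.

Lemma near_exists_open x P : (\forall y \near x, P y) ->
  exists A, [/\ open A, A x & forall y, A y -> P y].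
Proof.
by move=> H; have := H; rewrite /prop_near1 nbhsE => -[A [oA Ax] AP]; exists A; split.
Qed.

Lemma near_true x P : (forall y, P y) -> \forall y \near x, P y.
Proof. by move=> H; exact: nearW. Qed.

End Near.

Section PointwiseContinuity.
Context {R : realType} {T : topologicalType}.
Implicit Types (f g : T -> R) (x : T).

Lemma cont_at_add f g x : {for x, continuous f} -> {for x, continuous g} ->
  {for x, continuous (fun y => f y + g y)}.
Proof. by move=> cf cg; exact: cvgD. Qed.

Lemma cont_at_opp f x : {for x, continuous f} -> {for x, continuous (fun y => - f y)}.
Proof. by move=> cf; exact: cvgN. Qed.

Lemma cont_at_mul f g x : {for x, continuous f} -> {for x, continuous g} ->
  {for x, continuous (fun y => f y * g y)}.
Proof. by move=> cf cg; exact: cvgM. Qed.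

Lemma cont_at_inv f x : f x != 0 -> {for x, continuous f} ->
  {for x, continuous (fun y => (f y)^-1)}.
Proof. by move=> f0 cf; exact: cvgV. Qed.

Lemma cont_at_cst (U : topologicalType) (c : U) x : {for x, continuous (fun _ : T => c)}.
Proof. exact: cvg_cst. Qed.

Lemma cont_at_sum (I : Type) (r : seq I) (P : pred I) (F : I -> T -> R) x :
  (forall i, P i -> {for x, continuous (F i)}) ->
  {for x, continuous (fun y => \sum_(i <- r | P i) F i y)}.
Proof. by move=> cF; apply: cvg_big => //; exact: add_continuous. Qed.

Lemma cont_at_ext (U : topologicalType) (f g : T -> U) x :
  (\forall y \near x, f y = g y) -> {for x, continuous f} -> {for x, continuous g}.
Proof.
move=> fg cf; have fgx := nbhs_singleton fg.
move=> /= B; rewrite -fgx => /cf; rewrite /nbhs /= => H.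
by apply: filterS2 fg H => y; rewrite /= => ->.
Qed.

Lemma cont_at_eps f x : (forall eps : R, 0 < eps -> \forall y \near x, `|f x - f y| < eps) ->
  {for x, continuous f}.
Proof. by move=> H; apply/cvgrPdist_lt. Qed.

Lemma cont_at_near f x (eps : R) : 0 < eps -> {for x, continuous f} ->
  \forall y \near x, `|f x - f y| < eps.
Proof. by move=> e0 /cvgrPdist_lt/(_ _ e0). Qed.

End PointwiseContinuity.

Lemma cont_at_comp (T U V : topologicalType) (f : T -> U) (g : U -> V) x :
  {for x, continuous f} -> {for f x, continuous g} -> {for x, continuous (g \o f)}.
Proof. by move=> cf cg; exact: continuous_comp. Qed.

Lemma cont_at_row (R : realType) (n : nat) (T : topologicalType) (F : T -> 'rV[R]_n) x :
  (forall a : 'I_n, {for x, continuous (fun y => F y 0 a)}) -> {for x, continuous F}.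
Proof.
move=> cF; apply/(@cvgrPdist_lt _ 'rV[R]_n) => eps eps0.
have : \forall t \near x, forall a : 'I_n, `|F x 0 a - F t 0 a| < eps.
  apply: (@filter_forall _ _ (fun (a : 'I_n) t => `|F x 0 a - F t 0 a| < eps) (nbhs x) _) => a.
  by have /cvgrPdist_lt /(_ _ eps0) := cF a.
apply: filterS => t H; rewrite {1}/Num.norm /= mx_normrE.
by apply/bigmax_ltP; split => // -[i b] _ /=; rewrite ord1 !mxE.
Qed.

Lemma cont_at_coord (R : realType) (n : nat) (x : 'rV[R]_n) (a : 'I_n) :
  {for x, continuous (fun y : 'rV[R]_n => y 0 a)}.
Proof. exact: coord_continuous. Qed.

Section DirectionalDerivatives.
Context {R : realType}.

Lemma is_derive_line (V W : normedModType R) (f : V -> W) (x v : V) (s : R) :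
  derivable f (s *: v + x) v ->
  is_derive s 1 (fun t => f (t *: v + x)) ('D_v f (s *: v + x)).
Proof.
move=> df; have E : (fun h => h^-1 *: (f ((h *: 1 + s) *: v + x) - f (s *: v + x)))
    = (fun h => h^-1 *: (f (h *: v + (s *: v + x)) - f (s *: v + x))).
  by apply/funext => h; rewrite scalerDl addrA scaler1.
by apply: DeriveDef; rewrite /derivable /derive /= E.
Qed.

(** The intermediate point is located by |s| <= |t| only, so that one statement serves both signs of
    t; for t < 0 the mean value theorem is applied on [t, 0]. *)
Lemma MVT_line (V : normedModType R) (f : V -> R) (x v : V) (t : R) :
  (forall s : R, `|s| <= `|t| -> derivable f (s *: v + x) v) ->
  exists2 s : R, `|s| <= `|t| & f (t *: v + x) - f x = t * 'D_v f (s *: v + x).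
Proof.
move=> df; pose phi (s : R) := f (s *: v + x).
have dphi (s : R) : `|s| <= `|t| -> is_derive s 1 phi ('D_v f (s *: v + x)).
  by move=> /df; exact: is_derive_line.
have cphi (a b : R) : (forall s : R, a <= s <= b -> `|s| <= `|t|) ->
    {within `[a, b], continuous phi}.
  move=> H; apply: derivable_within_continuous => s; rewrite in_itv /= => /H /dphi.
  by case.
have -> : f x = phi 0 by rewrite /phi scale0r add0r.
case: (leP 0 t) => t0.
- have := @MVT_segment R phi (fun s => 'D_v f (s *: v + x)) 0 t t0.
  case.
  + move=> s; rewrite in_itv /= => /andP[s0 st]; apply: dphi.
    by rewrite !ger0_norm ?ltW // (lt_trans s0).
  + by apply: cphi => s /andP[s0 st]; rewrite !ger0_norm // (le_trans s0).
  move=> s; rewrite in_itv /= => /andP[s0 st] E; exists s.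
    by rewrite !ger0_norm // (le_trans s0).
  by rewrite -/(phi t) E subr0 mulrC.
- have := @MVT_segment R phi (fun s => 'D_v f (s *: v + x)) t 0 (ltW t0).
  case.
  + move=> s; rewrite in_itv /= => /andP[s0 st]; apply: dphi.
    by rewrite !ltr0_norm // lerN2 ltW.
  + by apply: cphi => s /andP[s0 st]; rewrite !ler0_norm // ?lerN2 // ltW.
  move=> s; rewrite in_itv /= => /andP[s0 st] E; exists s.
    by rewrite !ler0_norm ?lerN2 // ltW.
  by rewrite -/(phi t) -[LHS]opprB E sub0r mulrN mulrC opprK.
Qed.

Lemma diff_of_estimate (V W : normedModType R) (f : V -> W) (df : {linear V -> W}) x :
  continuous df ->
  (forall eps : R, 0 < eps -> \forall h \near (0 : V),
     `|f (h + x) - f x - df h| <= eps * `|h|) ->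
  differentiable f x /\ 'd f x = df :> (V -> W).
Proof.
move=> cdf H.
have E : f \o shift x = cst (f x) + df +o_ 0 id.
  apply/eqaddoP => eps eps0; apply: filterS (H _ eps0) => h.
  by rewrite opprD addrA.
have dE := diff_unique cdf E; split => //.
by apply/diff_locallyP; rewrite dE.
Qed.

End DirectionalDerivatives.

Section C1.
Context {R : realType} {n : nat}.
Implicit Types (f : 'rV[R]_n -> R) (x v : 'rV[R]_n).
Local Notation e a := (delta_mx 0 a : 'rV[R]_n).

(** The corners of the coordinate path from 0 to [h]: consecutive corners differ in one coordinate,
    so that the mean value theorem for a single partial derivative applies between them. *)
Definition trunc_row (k : nat) (h : 'rV[R]_n) : 'rV[R]_n :=
  \row_b (if (b < k)%N then h 0 b else 0).

Lemma mx_norm_le (h : 'rV[R]_n) (r : R) : 0 <= r ->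
  (`|h| <= r) <-> (forall b, `|h 0 b| <= r).
Proof.
move=> r0; rewrite {1}/Num.norm /= mx_normrE; split => [H b|H].
  by apply: le_trans H; apply: (le_bigmax _ (fun i : 'I_1 * 'I_n => `|h i.1 i.2|) (ord0, b)).
by apply/bigmax_leP; split => // -[i b] _ /=; rewrite ord1.
Qed.

Lemma coord_norm_le (h : 'rV[R]_n) b : `|h 0 b| <= `|h|.
Proof. exact: (mx_norm_le h (normr_ge0 h)).1. Qed.

Lemma mx_norm_lt (h : 'rV[R]_n) (r : R) : 0 < r ->
  (`|h| < r) <-> (forall b, `|h 0 b| < r).
Proof.
move=> r0; rewrite {1}/Num.norm /= mx_normrE; split => [H b|H].
  by apply: le_lt_trans H; apply: (le_bigmax _ (fun i : 'I_1 * 'I_n => `|h i.1 i.2|) (ord0, b)).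
by apply/bigmax_ltP; split => // -[i b] _ /=; rewrite ord1.
Qed.

Lemma trunc_rowS (k : 'I_n) h : trunc_row k.+1 h = h 0 k *: e k + trunc_row k h.
Proof.
apply/rowP => b; rewrite !mxE /= ltnS leq_eqVlt.
have [->|bk] := eqVneq b k; first by rewrite eqxx ltnn mulr1 addr0.
by rewrite (negbTE (_ : (b : nat) != k)) //= mulr0 add0r.
Qed.

Lemma row_sum_delta' (h : 'rV[R]_n) : h = \sum_a h 0 a *: e a.
Proof.
apply/rowP => b; rewrite summxE (bigD1 b) //= !mxE !eqxx mulr1 big1 ?addr0 //.
by move=> i ib; rewrite !mxE eq_sym (negbTE ib) andbF mulr0.
Qed.

Lemma C1_estimate f x (A : set 'rV[R]_n) : open A -> A x ->
  (forall y, A y -> forall a : 'I_n, derivable f y (e a)) ->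
  (forall a : 'I_n, {for x, continuous (fun y => 'D_(e a) f y)}) ->
  forall eps, 0 < eps -> \forall h \near (0 : 'rV[R]_n),
    `|f (h + x) - f x - \sum_a h 0 a * 'D_(e a) f x| <= eps * `|h|.
Proof.
move=> oA Ax df cf eps eps0.
have n1 : 0 < n%:R + 1 :> R by rewrite -[1]/(1%:R) -natrD ltr0n addn1.
(* Each of the n coordinate moves may cost [d * |h|]; dividing by n + 1 instead of n keeps [d]
   positive when n = 0. *)
pose d := eps / (n%:R + 1); have d0 : 0 < d by rewrite divr_gt0.
have : \forall y \near x, A y /\ forall a : 'I_n, `|'D_(e a) f y - 'D_(e a) f x| <= d.
  apply: filterI; first exact: open_nbhs_nbhs.
  apply: (@filter_forall _ _ (fun (a : 'I_n) y => `|'D_(e a) f y - 'D_(e a) f x| <= d) (nbhs x) (nbhs_filter x)) => a.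
  have /cvgrPdist_le /(_ _ d0) := cf a.
  by apply: filterS => y; rewrite distrC.
move=> /nbhs_ballP[r /= r0 Hr].
apply/nbhs_ballP; exists r => //= h; rewrite -ball_normE /= sub0r normrN => hr.
have inb (y : 'rV[R]_n) : `|y| <= `|h| -> ball x r (y + x).
  by move=> yh; rewrite -ball_normE /= opprD addrCA subrr addr0 normrN (le_lt_trans yh).
(* Telescoping along the coordinate path: after k moves the accumulated error is at most k times the
   allowance of one move. *)
suff H k : (k <= n)%N -> `|f (trunc_row k h + x) - f x
     - \sum_(a < n | (a < k)%N) h 0 a * 'D_(e a) f x| <= k%:R * (d * `|h|).
  have hn : trunc_row n h = h by apply/rowP => b; rewrite mxE ltn_ord.
  have := H n (leqnn n); rewrite hn => le1.
  have Hs : \sum_(a < n) h 0 a * 'D_(e a) f x = \sum_(a < n | (a < n)%N) h 0 a * 'D_(e a) f x.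
    by apply: eq_bigl => a; rewrite ltn_ord.
  rewrite Hs.
  apply: (le_trans le1); rewrite mulrA ler_wpM2r // /d mulrCA -[leRHS]mulr1 ler_wpM2l ?ltW //.
  by rewrite ltr_pdivrMr // mul1r ltrDl.
elim: k => [|k IH] kn.
  have -> : trunc_row 0 h = 0 by apply/rowP => b; rewrite !mxE.
  by rewrite add0r subrr big_pred0 // subr0 normr0 mul0r.
pose k' := Ordinal kn.
have [|s sh E] := @MVT_line R _ f (trunc_row k h + x) (e k') (h 0 k').
  move=> s sh; rewrite addrA; apply: df; apply: (proj1 (Hr _ _)); apply: inb.
  apply/mx_norm_le => // b; rewrite !mxE /=.
  have [->|bk] := eqVneq b k'; first by rewrite ltnn mulr1 addr0 (le_trans sh) // coord_norm_le.
  by rewrite mulr0 add0r; case: ifP => _; rewrite ?normr0 // coord_norm_le.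
rewrite (trunc_rowS k') -(addrA (h 0 k' *: e k') _ x).
have -> : \sum_(a < n | (a < k.+1)%N) h 0 a * 'D_(e a) f x =
   h 0 k' * 'D_(e k') f x + \sum_(a < n | (a < k)%N) h 0 a * 'D_(e a) f x.
  rewrite (bigD1 k') //=; congr (_ + _); apply: eq_bigl => a.
  by rewrite ltnS [RHS]ltn_neqAle andbC.
have -> : f (h 0 k' *: e k' + (trunc_row k h + x)) - f x
    - (h 0 k' * 'D_(e k') f x + \sum_(a < n | (a < k)%N) h 0 a * 'D_(e a) f x)
  = h 0 k' * ('D_(e k') f (s *: e k' + (trunc_row k h + x)) - 'D_(e k') f x) +
    (f (trunc_row k h + x) - f x - \sum_(a < n | (a < k)%N) h 0 a * 'D_(e a) f x).
  rewrite mulrBr -E; ring.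
apply: (le_trans (ler_normD _ _)); rewrite -[k.+1]addn1 natrD mulrDl addrC.
apply: lerD; first by apply: IH; exact: ltnW.
rewrite normrM mul1r mulrC ler_pM //; last exact: coord_norm_le.
rewrite addrA; apply: (proj2 (Hr _ _)); apply: inb.
apply/mx_norm_le => // b; rewrite !mxE /=.
have [->|bk] := eqVneq b k'; first by rewrite ltnn mulr1 addr0 (le_trans sh) // coord_norm_le.
by rewrite mulr0 add0r; case: ifP => _; rewrite ?normr0 // coord_norm_le.
Qed.

(** The candidate for the differential, bundled below as a linear map because [diff_of_estimate]
    expects one. *)
Definition grad_form f x (v : 'rV[R]_n) : R := \sum_a v 0 a * 'D_(e a) f x.

Lemma grad_form_linear f x : linear (grad_form f x).
Proof.
move=> k u v; rewrite /grad_form scaler_sumr -big_split; apply: eq_bigr => a _ /=.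
by rewrite !mxE mulrDl; congr (_ + _); rewrite -mulrA.
Qed.
HB.instance Definition _ f x :=
  GRing.isLinear.Build R 'rV[R]_n R _ (grad_form f x) (grad_form_linear f x).

Lemma C1_differentiable f x (A : set 'rV[R]_n) : open A -> A x ->
  (forall y, A y -> forall a : 'I_n, derivable f y (e a)) ->
  (forall a : 'I_n, {for x, continuous (fun y => 'D_(e a) f y)}) ->
  differentiable f x /\ forall v, 'D_v f x = \sum_a v 0 a * 'D_(e a) f x.
Proof.
move=> oA Ax df cf.
have cg : continuous (grad_form f x).
  move=> v; apply: cont_at_sum => a _.
  by apply: cont_at_mul; [exact: cont_at_coord|exact: cont_at_cst].
have [D dE] := diff_of_estimate cg (C1_estimate oA Ax df cf).
split => // v; by rewrite deriveE // dE.
Qed.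

End C1.

Section DirectionalRules.
Context {R : realType} {V : normedModType R}.
Implicit Types (f g : V -> R) (x v : V).

Lemma isd_add f g x v (df dg : R) : is_derive x v f df -> is_derive x v g dg ->
  is_derive x v (fun y => f y + g y) (df + dg).
Proof. exact: is_deriveD. Qed.

Lemma isd_opp f x v (df : R) : is_derive x v f df ->
  is_derive x v (fun y => - f y) (- df).
Proof. exact: is_deriveN. Qed.

Lemma isd_mul f g x v (df dg : R) : is_derive x v f df -> is_derive x v g dg ->
  is_derive x v (fun y => f y * g y) (f x * dg + g x * df).
Proof. exact: is_deriveM. Qed.

Lemma isd_inv f x v (df : R) : f x != 0 -> is_derive x v f df ->
  is_derive x v (fun y => (f y)^-1) (- (f x)^-1 * (f x)^-1 * df).
Proof.
move=> f0 [dfx <-]; apply: DeriveDef; first exact: derivableV.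
by rewrite deriveV // -exprVn expr2 mulNr.
Qed.

Lemma isd_sum (I : Type) (r : seq I) (P : pred I) (F : I -> V -> R) (dF : I -> R) x v :
  (forall i, P i -> is_derive x v (F i) (dF i)) ->
  is_derive x v (fun y => \sum_(i <- r | P i) F i y) (\sum_(i <- r | P i) dF i).
Proof.
move=> H; elim: r => [|i r IH].
  rewrite big_nil; have -> : (fun y => \sum_(i <- [::] | P i) F i y) = cst 0 :> (V -> R).
    by apply/funext => y; rewrite big_nil.
  exact: is_derive_cst.
rewrite big_cons; case: ifPn => Pi.
  have -> : (fun y => \sum_(j <- i :: r | P j) F j y) =
    (fun y => F i y + \sum_(j <- r | P j) F j y).
    by apply/funext => y; rewrite big_cons Pi.
  by apply: isd_add => //; exact: H.
have -> // : (fun y => \sum_(j <- i :: r | P j) F j y) = (fun y => \sum_(j <- r | P j) F j y).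
by apply/funext => y; rewrite big_cons (negbTE Pi).
Qed.

Lemma isd_comp1 (h : R -> R) f x v (df dh : R) : differentiable f x ->
  is_derive x v f df -> is_derive (f x) 1 h dh ->
  is_derive x v (fun y => h (f y)) (dh * df).
Proof.
move=> Df [_ dfE] [Dh dhE]; have Dh' : differentiable h (f x) by exact/derivable1_diffP.
have Dc : differentiable (h \o f) x by exact: differentiable_comp.
apply: DeriveDef; first exact: diff_derivable.
rewrite deriveE // diff_comp //= -(deriveE v Df) dfE.
by rewrite -[df in LHS]mulr1 -[df * 1]/(df *: (1 : R)) linearZ /= -(deriveE (1 : R) Dh') dhE [RHS]mulrC.
Qed.

End DirectionalRules.

Section DifferentiableRow.
Context {R : realType} {V : normedModType R} {n : nat}.

Lemma differentiable_row (F : V -> 'rV[R]_n) (x : V) :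
  (forall b : 'I_n, differentiable (fun y => F y 0 b) x) -> differentiable F x.
Proof.
move=> dF; have -> : F = \sum_(b < n) (fun y => F y 0 b *: (delta_mx 0 b : 'rV[R]_n)).
  by apply/funext => y; rewrite fct_sumE; exact: row_sum_delta'.
by apply: differentiable_sum => b; exact: differentiableZl.
Qed.

Lemma derive_row (F : V -> 'rV[R]_n) (x v : V) :
  (forall b : 'I_n, differentiable (fun y => F y 0 b) x) ->
  'D_v F x = \row_b 'D_v (fun y => F y 0 b) x.
Proof.
move=> dF; rewrite derive_mx; last exact/diff_derivable/differentiable_row.
by apply/rowP => b; rewrite !mxE.
Qed.

Lemma derive_comp_row (F : V -> 'rV[R]_n) (f : 'rV[R]_n -> R) (x v : V) :
  (forall b : 'I_n, differentiable (fun y => F y 0 b) x) ->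
  differentiable f (F x) ->
  differentiable (f \o F) x /\
  'D_v (f \o F) x = 'D_(\row_b 'D_v (fun y => F y 0 b) x) f (F x).
Proof.
move=> dF df; have dF' := differentiable_row dF; split.
  exact: differentiable_comp.
rewrite [LHS]deriveE; last exact: differentiable_comp.
by rewrite diff_comp //= -[X in 'd f _ X]deriveE // derive_row // [RHS]deriveE.
Qed.

Lemma derive_linear (f : V -> R) (x : V) (k : R) (u v : V) : differentiable f x ->
  'D_(k *: u + v) f x = k * 'D_u f x + 'D_v f x.
Proof. by move=> df; rewrite !deriveE // linearP. Qed.

End DifferentiableRow.

(** * Calculus of C^k functions on open subsets of R^n *)

Section CkCalculus.
Context {R : realType} {n : nat}.
Implicit Types (f g : 'rV[R]_n -> R) (x v : 'rV[R]_n) (A B : set 'rV[R]_n) (k : nat).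
Local Notation e a := (delta_mx 0 a : 'rV[R]_n).

Lemma Ck_cont k A f x : Ck k A f -> A x -> {for x, continuous f}.
Proof. by case: k => [|k] [cf _]; exact: cf. Qed.

Lemma CkS_isd k A f x (a : 'I_n) : Ck k.+1 A f -> A x -> is_derive x (e a) f ('D_(e a) f x).
Proof. by move=> [_ /(_ a)[df _]] Ax; apply: derivableP; exact: df. Qed.

Lemma CkS_derive k A f (a : 'I_n) : Ck k.+1 A f -> Ck k A (fun x => 'D_(e a) f x).
Proof. by move=> [_ /(_ a)[]]. Qed.

Lemma Ck_sub k A B f : B `<=` A -> Ck k A f -> Ck k B f.
Proof.
move=> BA; elim: k f => [|k IH] f [cf df]; split.
- by move=> x /BA; exact: cf.
- by [].
- by move=> x /BA; exact: cf.
- by move=> a; have [d1 d2] := df a; split => [x /BA|]; [exact: d1|exact: IH].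
Qed.

Lemma Ck_ext k A f g : open A -> (forall x, A x -> f x = g x) -> Ck k A f -> Ck k A g.
Proof.
move=> oA; have nA x : A x -> \forall y \near x, A y by move=> Ax; exact: open_nbhs_nbhs.
elim: k f g => [|k IH] f g fg [cf df].
  split=> // x Ax; apply: (cont_at_ext _ (cf x Ax)).
  by apply: filterS (nA x Ax) => y; exact: fg.
split=> [x Ax|a].
  apply: (cont_at_ext _ (cf x Ax)).
  by apply: filterS (nA x Ax) => y; exact: fg.
have [d1 d2] := df a; split=> [x Ax|].
  apply: near_eq_derivable (d1 x Ax).
  by apply: filterS (nA x Ax) => y; exact: fg.
apply: IH d2 => x Ax; apply: near_eq_derive.
by apply: filterS (nA x Ax) => y; exact: fg.
Qed.

Lemma Ck_le k A f : Ck k.+1 A f -> Ck k A f.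
Proof.
elim: k f => [|k IH] f [cf df]; split => // a.
by have [d1 d2] := df a; split => //; exact: IH.
Qed.

Lemma Ck_1 k A f : Ck k.+1 A f -> Ck 1 A f.
Proof. by elim: k => [//|k IH] /Ck_le. Qed.

Lemma Ck1_differentiable A f x : open A -> Ck 1 A f -> A x -> differentiable f x.
Proof.
move=> oA Cf Ax; apply: (proj1 (C1_differentiable oA Ax _ _)).
  by move=> y Ay a; have [_ /(_ a)[d _]] := Cf; exact: d.
by move=> a; exact: Ck_cont (CkS_derive a Cf) Ax.
Qed.

Lemma Ck1_derive A f x v : open A -> Ck 1 A f -> A x ->
  'D_v f x = \sum_a v 0 a * 'D_(e a) f x.
Proof.
move=> oA Cf Ax; apply: (proj2 (C1_differentiable oA Ax _ _)).
  by move=> y Ay a; have [_ /(_ a)[d _]] := Cf; exact: d.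
by move=> a; exact: Ck_cont (CkS_derive a Cf) Ax.
Qed.

(** The candidates [d a] need to be correct on A only: A is open, so replacing them by the total
    functions ['D_(e a) f] changes nothing there. Continuity of f itself comes for free from
    continuity of the partial derivatives. *)
Lemma CkS_intro k A f (d : 'I_n -> 'rV[R]_n -> R) : open A ->
  (forall a x, A x -> is_derive x (e a) f (d a x)) ->
  (forall a, Ck k A (d a)) -> Ck k.+1 A f.
Proof.
move=> oA fd Cd; have Ed a x : A x -> d a x = 'D_(e a) f x by move=> /(fd a)[].
have Cd' a : Ck k A (fun x => 'D_(e a) f x) by apply: Ck_ext (Cd a) => // x; exact: Ed.
split=> [x Ax|a].
  apply: differentiable_continuous; apply: (proj1 (C1_differentiable oA Ax _ _)).
    by move=> y Ay a; have [] := fd a _ Ay.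
  by move=> a; exact: Ck_cont (Cd' a) Ax.
by split=> // x Ax; have [] := fd a x Ax.
Qed.

Lemma Ck_cst k A (c : R) : Ck k A (fun=> c).
Proof.
elim: k c => [|k IH] c; first by split => // x _; exact: cont_at_cst.
split => [x _|a]; first exact: cont_at_cst.
split => [x _|]; first exact: derivable_cst.
have -> : (fun x : 'rV[R]_n => 'D_(e a) (fun=> c) x) = (fun=> 0); last exact: IH.
by apply/funext => x; rewrite derive_cst.
Qed.

Lemma isd_coord x v (a : 'I_n) : is_derive x v (fun y => y 0 a) (v 0 a).
Proof.
have Da : differentiable (fun y : 'rV[R]_n => y 0 a) x by exact: differentiable_coord.
apply: DeriveDef; first exact: diff_derivable.
rewrite /derive; apply: cvg_lim => //=.
have -> : (fun h : R => h^-1 *: ((h *: v + x) 0 a - x 0 a)) = (fun h => (h^-1 * h) * v 0 a).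
  by apply/funext => h; rewrite !mxE addrK; exact: mulrA.
rewrite -[X in _ --> X]mul1r; apply: cvgM; last exact: cvg_cst.
apply: cvg_near_cst.
by near=> h; rewrite mulVf //; near: h; exact: nbhs_dnbhs_neq.
Unshelve. all: by end_near. Qed.

Lemma Ck_coord k A (a : 'I_n) : open A -> Ck k A (fun y => y 0 a).
Proof.
move=> oA; case: k => [|k]; first by split => // x _; exact: cont_at_coord.
apply: (@CkS_intro _ _ _ (fun b _ => e b 0 a)) => // [b x _|b]; last exact: Ck_cst.
exact: isd_coord.
Qed.

Lemma Ck_add k A f g : open A -> Ck k A f -> Ck k A g -> Ck k A (fun x => f x + g x).
Proof.
move=> oA; elim: k f g => [|k IH] f g Cf Cg.
  split => // x Ax; exact: cont_at_add (Ck_cont Cf Ax) (Ck_cont Cg Ax).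
apply: (@CkS_intro _ _ _ (fun a x => 'D_(e a) f x + 'D_(e a) g x)) => // [a x Ax|a].
  exact: isd_add (CkS_isd a Cf Ax) (CkS_isd a Cg Ax).
by apply: IH; exact: CkS_derive.
Qed.

Lemma Ck_mul k A f g : open A -> Ck k A f -> Ck k A g -> Ck k A (fun x => f x * g x).
Proof.
move=> oA; elim: k f g => [|k IH] f g Cf Cg.
  split => // x Ax; exact: cont_at_mul (Ck_cont Cf Ax) (Ck_cont Cg Ax).
apply: (@CkS_intro _ _ _ (fun a x => f x * 'D_(e a) g x + g x * 'D_(e a) f x)) => // [a x Ax|a].
  exact: isd_mul (CkS_isd a Cf Ax) (CkS_isd a Cg Ax).
by apply: Ck_add => //; apply: IH; try exact: CkS_derive; exact: Ck_le.
Qed.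

Lemma Ck_opp k A f : open A -> Ck k A f -> Ck k A (fun x => - f x).
Proof.
move=> oA Cf; apply: (@Ck_ext _ _ (fun x => -1 * f x)) => // [x _|]; first by rewrite mulN1r.
by apply: Ck_mul => //; exact: Ck_cst.
Qed.

Lemma Ck_sum (I : Type) (r : seq I) (P : pred I) (F : I -> 'rV[R]_n -> R) k A : open A ->
  (forall i, P i -> Ck k A (F i)) -> Ck k A (fun x => \sum_(i <- r | P i) F i x).
Proof.
move=> oA CF; elim: r => [|i r IH].
  by apply: (@Ck_ext _ _ (fun=> 0)) => // [x _|]; [rewrite big_nil|exact: Ck_cst].
case: (boolP (P i)) => Pi.
  apply: (@Ck_ext _ _ (fun x => F i x + \sum_(i <- r | P i) F i x)) => // [x _|].
    by rewrite big_cons Pi.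
  by apply: Ck_add => //; exact: CF.
apply: (@Ck_ext _ _ (fun x => \sum_(i <- r | P i) F i x)) => // x _.
by rewrite big_cons (negbTE Pi).
Qed.

Lemma Ck_prod (I : Type) (r : seq I) (P : pred I) (F : I -> 'rV[R]_n -> R) k A : open A ->
  (forall i, P i -> Ck k A (F i)) -> Ck k A (fun x => \prod_(i <- r | P i) F i x).
Proof.
move=> oA CF; elim: r => [|i r IH].
  by apply: (@Ck_ext _ _ (fun=> 1)) => // [x _|]; [rewrite big_nil|exact: Ck_cst].
case: (boolP (P i)) => Pi.
  apply: (@Ck_ext _ _ (fun x => F i x * \prod_(i <- r | P i) F i x)) => // [x _|].
    by rewrite big_cons Pi.
  by apply: Ck_mul => //; exact: CF.
apply: (@Ck_ext _ _ (fun x => \prod_(i <- r | P i) F i x)) => // x _.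
by rewrite big_cons (negbTE Pi).
Qed.

Lemma Ck_inv k A f : open A -> (forall x, A x -> f x != 0) -> Ck k A f ->
  Ck k A (fun x => (f x)^-1).
Proof.
move=> oA f0; elim: k => [|k IH] Cf.
  by split => // x Ax; exact: cont_at_inv (f0 _ Ax) (Ck_cont Cf Ax).
apply: (@CkS_intro _ _ _ (fun a x => - (f x)^-1 * (f x)^-1 * 'D_(e a) f x)) => // [a x Ax|a].
  exact: isd_inv (f0 _ Ax) (CkS_isd a Cf Ax).
have Ci : Ck k A (fun x => (f x)^-1) by apply: IH; exact: Ck_le.
apply: Ck_mul => //; last exact: CkS_derive.
by apply: Ck_mul => //; exact: Ck_opp.
Qed.

(* [H] is a class of functions closed under differentiation on [I]. *)
Lemma Ck_comp1 (H : (R -> R) -> Prop) (I : set R) k A (h : R -> R) f : open A ->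
  (forall h, H h -> exists2 h', H h' & forall t, I t -> is_derive t 1 h (h' t)) ->
  (forall x, A x -> I (f x)) -> H h -> Ck k A f -> Ck k A (fun x => h (f x)).
Proof.
move=> oA HH fI; elim: k h => [|k IH] h Hh Cf.
  split => // x Ax; have [h' _ dh] := HH _ Hh.
  apply: (@cont_at_comp _ _ _ f h); first exact: Ck_cont Cf Ax.
  have [dhx _] := dh _ (fI _ Ax).
  by apply: differentiable_continuous; exact/derivable1_diffP.
have [h' Hh' dh] := HH _ Hh.
apply: (@CkS_intro _ _ _ (fun a x => h' (f x) * 'D_(e a) f x)) => // [a x Ax|a].
  apply: isd_comp1 (CkS_isd a Cf Ax) (dh _ (fI _ Ax)).
  exact: Ck1_differentiable oA (Ck_1 Cf) Ax.
by apply: Ck_mul => //; [apply: IH => //; exact: Ck_le|exact: CkS_derive].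
Qed.

End CkCalculus.

(** Induction on k: by the chain rule the partial derivatives of the composite are sums of products
    of those of F with ['D f \o F], to which the induction hypothesis applies. *)
Lemma Ck_comp (R : realType) (m n k : nat) (A : set 'rV[R]_m) (B : set 'rV[R]_n)
    (F : 'rV[R]_m -> 'rV[R]_n) (f : 'rV[R]_n -> R) : open A -> open B ->
  (forall x, A x -> B (F x)) -> (forall b : 'I_n, Ck k A (fun x => F x 0 b)) ->
  Ck k B f -> Ck k A (f \o F).
Proof.
move=> oA oB AB; elim: k f => [|k IH] f CF Cf.
  split => // x Ax; apply: cont_at_comp; last by apply: Ck_cont Cf _; exact: AB.
  by apply: cont_at_row => a; exact: Ck_cont (CF a) Ax.
apply: (@CkS_intro _ _ _ _ _ (fun a x => \sum_(b < n)
   'D_(delta_mx 0 a) (fun x => F x 0 b) x * ('D_(delta_mx 0 b) f \o F) x)) => // [a x Ax|a].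
  have dF b : differentiable (fun y => F y 0 b) x.
    exact: Ck1_differentiable oA (Ck_1 (CF b)) Ax.
  have df : differentiable f (F x).
    exact: Ck1_differentiable oB (Ck_1 Cf) (AB _ Ax).
  have [D E] := derive_comp_row (delta_mx 0 a) dF df.
  apply: DeriveDef; first exact: diff_derivable.
  rewrite E (Ck1_derive _ oB (Ck_1 Cf) (AB _ Ax)).
  by apply: eq_bigr => b _; rewrite mxE.
apply: Ck_sum => // b _; apply: Ck_mul => //; first exact: CkS_derive.
by apply: IH; [move=> c; exact: Ck_le|exact: CkS_derive].
Qed.

(** * Symmetry of second partial derivatives *)

Section Schwarz.
Context {R : realType} {n : nat}.
Implicit Types (f : 'rV[R]_n -> R) (x v w : 'rV[R]_n) (A : set 'rV[R]_n).
Local Notation e a := (delta_mx 0 a : 'rV[R]_n).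

Lemma isd_shift f w x v df : is_derive (w + x) v f df ->
  is_derive x v (fun y => f (w + y)) df.
Proof.
have E : (fun h : R => h^-1 *: (f (w + (h *: v + x)) - f (w + x))) =
         (fun h : R => h^-1 *: (f (h *: v + (w + x)) - f (w + x))).
  by apply/funext => h; rewrite addrCA.
by case=> d1 d2; apply: DeriveDef; rewrite /derivable /derive /= E.
Qed.

(** The mean value theorem is applied in direction a to the increment [G] of f, then in direction b
    to the partial derivative. The left side is symmetric under exchange of (a, s) with (b, t),
    which is the source of the equality of mixed derivatives. *)
Lemma double_difference f x A (a b : 'I_n) (s t : R) : open A -> Ck 2 A f ->
  (forall s' t' : R, `|s'| <= `|s| -> `|t'| <= `|t| -> A (s' *: e a + (t' *: e b + x))) ->
  exists s' t' : R, [/\ `|s'| <= `|s|, `|t'| <= `|t| &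
    f (s *: e a + (t *: e b + x)) - f (t *: e b + x) - (f (s *: e a + x) - f x) =
    s * (t * 'D_(e b) ('D_(e a) f) (s' *: e a + (t' *: e b + x)))].
Proof.
move=> oA Cf HA.
pose G y := f (t *: e b + y) - f y.
have A0 s' : `|s'| <= `|s| -> A (s' *: e a + x).
  by move=> Hs; rewrite -[x]add0r -(scale0r (e b)); apply: HA => //; rewrite normr0.
have dG s' : `|s'| <= `|s| -> is_derive (s' *: e a + x) (e a) G
    ('D_(e a) f (t *: e b + (s' *: e a + x)) - 'D_(e a) f (s' *: e a + x)).
  move=> Hs; apply: isd_add; last by apply: isd_opp; apply: CkS_isd Cf _; exact: A0.
  by apply: isd_shift; apply: CkS_isd Cf _; rewrite addrCA; exact: HA.
have [s' Hs' E] : exists2 s', `|s'| <= `|s| & G (s *: e a + x) - G x = s * 'D_(e a) G (s' *: e a + x).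
  by apply: (@MVT_line R _ G x (e a) s) => s' /dG[].
have [_ dGE] := dG _ Hs'; rewrite dGE in E.
have [t' Ht' E'] : exists2 t', `|t'| <= `|t| &
    'D_(e a) f (t *: e b + (s' *: e a + x)) - 'D_(e a) f (s' *: e a + x) =
    t * 'D_(e b) ('D_(e a) f) (t' *: e b + (s' *: e a + x)).
  apply: (@MVT_line R _ ('D_(e a) f) (s' *: e a + x) (e b) t) => t' Ht'.
  have := CkS_isd b (CkS_derive a Cf) (HA s' t' Hs' Ht').
  by rewrite (addrCA (s' *: e a)); case.
exists s', t'; split => //; rewrite (addrCA (s' *: e a)) -E' -E /G.
by rewrite (addrCA (t *: e b)); ring.
Qed.

Lemma dist_le_aux (s eps P Q U W : R) : 0 < s -> s * (s * U) = s * (s * W) ->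
  `|P - W| < eps / 2 -> `|Q - U| < eps / 2 -> `|P - Q| <= eps.
Proof.
move=> s0 /(mulfI (lt0r_neq0 s0))/(mulfI (lt0r_neq0 s0)) -> B1 B2.
have -> : P - Q = (P - W) - (Q - W) by ring.
by apply: (le_trans (ler_normB _ _)); rewrite (splitr eps) lerD // ltW.
Qed.

Lemma schwarz f x A (a b : 'I_n) : open A -> Ck 2 A f -> A x ->
  'D_(e a) ('D_(e b) f) x = 'D_(e b) ('D_(e a) f) x.
Proof.
move=> oA Cf Ax.
have cab : {for x, continuous (fun y => 'D_(e a) ('D_(e b) f) y)}.
  exact: Ck_cont (CkS_derive a (CkS_derive b Cf)) Ax.
have cba : {for x, continuous (fun y => 'D_(e b) ('D_(e a) f) y)}.
  exact: Ck_cont (CkS_derive b (CkS_derive a Cf)) Ax.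
apply/eqP; rewrite -subr_eq0 -normr_le0; apply/ler_addgt0Pl => eps eps0; rewrite addr0.
have e2 : 0 < eps / 2 by rewrite divr_gt0.
have : \forall y \near x, [/\ A y,
    `|'D_(e a) ('D_(e b) f) x - 'D_(e a) ('D_(e b) f) y| < eps / 2 &
    `|'D_(e b) ('D_(e a) f) x - 'D_(e b) ('D_(e a) f) y| < eps / 2].
  have H1 : \forall y \near x, A y by exact: open_nbhs_nbhs.
  have H2 : \forall y \near x, `|'D_(e a) ('D_(e b) f) x - 'D_(e a) ('D_(e b) f) y| < eps / 2.
    by have /cvgrPdist_lt/(_ _ e2) := cab.
  have H3 : \forall y \near x, `|'D_(e b) ('D_(e a) f) x - 'D_(e b) ('D_(e a) f) y| < eps / 2.
    by have /cvgrPdist_lt/(_ _ e2) := cba.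
  by apply: near_mono (near_and H1 (near_and H2 H3)) => y [h1 [h2 h3]].
move=> /nbhs_ballP[r /= r0 Hr].
(* Two moves of length at most s stay at distance at most r / 2 from x. *)
pose s := r / 4; have s0 : 0 < s by rewrite divr_gt0.
have inb (i j : 'I_n) (s' t' : R) : `|s'| <= `|s| -> `|t'| <= `|s| ->
    ball x r (s' *: e i + (t' *: e j + x)).
  rewrite (gtr0_norm s0) => Hs Ht; rewrite -ball_normE /= addrA opprD addrCA subrr addr0 normrN.
  apply: (le_lt_trans (ler_normD _ _)); rewrite !normrZ.
  have ne (l : 'I_n) : `|e l| <= 1 :> R.
    apply/mx_norm_le => // c; rewrite mxE; case: eqP => _ /=; last by rewrite normr0.
    by case: eqP => _; rewrite ?normr0 ?normr1.
  have H1 : `|s'| * `|e i| <= s * 1 by apply: ler_pM.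
  have H2 : `|t'| * `|e j| <= s * 1 by apply: ler_pM.
  apply: (le_lt_trans (lerD H1 H2)); rewrite /s !mulr1; lra.
have [s1 [t1 [Hs1 Ht1 E1]]] := @double_difference f x A a b s s oA Cf
  (fun s' t' Hs Ht => let: And3 h _ _ := Hr _ (inb a b s' t' Hs Ht) in h).
have [s2 [t2 [Hs2 Ht2 E2]]] := @double_difference f x A b a s s oA Cf
  (fun s' t' Hs Ht => let: And3 h _ _ := Hr _ (inb b a s' t' Hs Ht) in h).
have [_ _ B1] := Hr _ (inb a b s1 t1 Hs1 Ht1).
have [_ B2 _] := Hr _ (inb b a s2 t2 Hs2 Ht2).
have mid : f (s *: e a + (s *: e b + x)) - f (s *: e b + x) - (f (s *: e a + x) - f x)
   = f (s *: e b + (s *: e a + x)) - f (s *: e a + x) - (f (s *: e b + x) - f x).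
  by rewrite (addrCA (s *: e b)); ring.
exact: dist_le_aux s0 (etrans (esym E1) (etrans mid E2)) B2 B1.
Qed.

End Schwarz.

(** * Derivations of a commutative ring *)

Section Derivation.
Context {A : comPzRingType}.
Implicit Types (d : A -> A) (x y : A).

Definition derivation d : Prop :=
  (forall x y, d (x + y) = d x + d y) /\ (forall x y, d (x * y) = d x * y + x * d y).

Context {d : A -> A} (dd : derivation d).

Lemma derivD x y : d (x + y) = d x + d y. Proof. exact: dd.1. Qed.
Lemma derivM x y : d (x * y) = d x * y + x * d y. Proof. exact: dd.2. Qed.
Lemma deriv0 : d 0 = 0.
Proof. by apply: (addrI (d 0)); rewrite -derivD !addr0. Qed.
Lemma derivN x : d (- x) = - d x.
Proof. by apply/eqP; rewrite -addr_eq0 -derivD addNr deriv0. Qed.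
Lemma derivB x y : d (x - y) = d x - d y. Proof. by rewrite derivD derivN. Qed.
Lemma deriv_sum (I : Type) (r : seq I) (P : pred I) (F : I -> A) :
  d (\sum_(i <- r | P i) F i) = \sum_(i <- r | P i) d (F i).
Proof. exact: (big_morph d derivD deriv0). Qed.

Lemma map_deriv_mul (m n p : nat) (X : 'M[A]_(m, n)) (Y : 'M[A]_(n, p)) :
  map_mx d (X *m Y) = map_mx d X *m Y + X *m map_mx d Y.
Proof.
apply/matrixP => i j; rewrite !mxE deriv_sum -big_split; apply: eq_bigr => k _ /=.
by rewrite !mxE derivM.
Qed.

Lemma map_derivB (m n : nat) (X Y : 'M[A]_(m, n)) :
  map_mx d (X - Y) = map_mx d X - map_mx d Y.
Proof. by apply/matrixP => i j; rewrite !mxE derivB. Qed.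
Lemma map_deriv0 (m n : nat) : map_mx d (0 : 'M[A]_(m, n)) = 0.
Proof. by apply/matrixP => i j; rewrite !mxE deriv0. Qed.

Lemma deriv_tr (m : nat) (X : 'M[A]_m) : d (\tr X) = \tr (map_mx d X).
Proof. by rewrite deriv_sum; apply: eq_bigr => i _; rewrite mxE. Qed.

End Derivation.

(** * The Bochner argument on a flat screen bundle, over a ring with derivations *)

Section FlatScreen.
Context {A : comPzRingType} {m : nat}.
(* D k and Dv are the derivatives along E_k and V, and w k i l is the
   coefficient of E_l in nabla_{E_k} E_i, modulo V. *)
Variables (D : 'I_m -> A -> A) (Dv : A -> A) (w : 'I_m -> 'M[A]_m) (wv : 'M[A]_m).
Variables (c : 'I_m -> 'I_m -> A) (cv : 'I_m -> A).
Hypothesis D_deriv : forall k, derivation (D k).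
Hypothesis Dv_deriv : derivation Dv.
Hypothesis w_anti : forall k i j, w k i j = - w k j i.
Hypothesis bracket : forall k l x, D k (D l x) - D l (D k x) =
  \sum_r (w k l r - w l k r) * D r x + c k l * Dv x.
Hypothesis bracket_v : forall j x, Dv (D j x) - D j (Dv x) =
  \sum_r wv j r * D r x + cv j * Dv x.
Hypothesis flat : forall k l,
  map_mx (D k) (w l) - map_mx (D l) (w k) + w l *m w k - w k *m w l =
  \sum_r (w k l r - w l k r) *: w r + c k l *: wv.

Local Notation dM k := (map_mx (D k)).

(** Covariant derivative along [E_k] in the bundle associated with the action [rho] of the
    connection matrices: the commutator for symmetric two-tensors, the matrix product for
    columns. *)
Definition nabla_rep (p : nat) (rho : 'M[A]_m -> 'M[A]_(m, p) -> 'M[A]_(m, p))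
  (u : 'M[A]_(m, p)) (k : 'I_m) := dM k u - rho (w k) u.
(** The tensorial second derivative; [l] is the direction of the outer derivative. The last sum
    differentiates along nabla_{E_l} E_k, whose V-component is dropped because it contributes
    nothing to a [u] parallel along V. *)
Definition nabla2_rep (p : nat) (rho : 'M[A]_m -> 'M[A]_(m, p) -> 'M[A]_(m, p))
  (u : 'M[A]_(m, p)) (l k : 'I_m) :=
  dM l (nabla_rep rho u k) - rho (w l) (nabla_rep rho u k)
  - \sum_r w l k r *: nabla_rep rho u r.

(** The commutator of the derivatives is computed by [bracket], the curvature by [flat]. Both leave
    a term with the coefficient of V, namely [c l k], and these two cancel because [u] is parallel
    along V. Treating [rho] abstractly serves T and the gradient a with one proof. *)
Lemma ricci_identity (p : nat) (rho : 'M[A]_m -> 'M[A]_(m, p) -> 'M[A]_(m, p))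
    (u : 'M[A]_(m, p)) (l k : 'I_m) :
  (forall X Y v, rho (X + Y) v = rho X v + rho Y v) ->
  (forall x X v, rho (x *: X) v = x *: rho X v) ->
  (forall X v v', rho X (v + v') = rho X v + rho X v') ->
  (forall X v, rho X (- v) = - rho X v) ->
  (forall X Y v, rho X (rho Y v) - rho Y (rho X v) = rho (X *m Y - Y *m X) v) ->
  (forall k X v, dM k (rho X v) = rho (dM k X) v + rho X (dM k v)) ->
  map_mx Dv u = rho wv u -> nabla2_rep rho u l k = nabla2_rep rho u k l.
Proof.
move=> rD rZ rDr rNr rC rd Dvu.
have rN X v : rho (- X) v = - rho X v by rewrite -scaleN1r rZ scaleN1r.
have rS (F : 'I_m -> 'M[A]_m) v : rho (\sum_r F r) v = \sum_r rho (F r) v.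
  apply: (big_morph (fun X => rho X v)) => [X Y|]; first exact: rD.
  by rewrite -[0 in LHS](scale0r 0) rZ scale0r.
have brM : dM l (dM k u) - dM k (dM l u) =
    \sum_r (w l k r - w k l r) *: dM r u + c l k *: rho wv u.
  apply/matrixP => i j; rewrite !mxE bracket summxE; congr (_ + _).
    by apply: eq_bigr => r _; rewrite !mxE.
  by rewrite -Dvu mxE.
have fl : rho (dM l (w k)) u - rho (dM k (w l)) u + (rho (w k) (rho (w l) u) - rho (w l) (rho (w k) u))
   = \sum_r (w l k r - w k l r) *: rho (w r) u + c l k *: rho wv u.
  rewrite rC -rN -!rD addrA flat rD rS rZ; congr (_ + _).
  by apply: eq_bigr => r _; rewrite rZ.
rewrite /nabla2_rep /nabla_rep !map_derivB // !rd !rDr !rNr.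
apply/eqP; rewrite -subr_eq0; apply/eqP.
(* The terms regroup into the commutator of derivatives, the curvature combination [fl], two pairs
   that cancel identically (each [rho] of one index against the derivative of the other), and the
   terms along nabla_{E_l} E_k and nabla_{E_k} E_l. *)
have -> : forall a1 a2 a3 a4 a5 b1 b2 b3 b4 b5 S1 S2 : 'M[A]_(m, p),
    a1 - (a2 + a3) - (a4 - a5) - S1 - (b1 - (b2 + b3) - (b4 - b5) - S2) =
    (a1 - b1) - (a2 - b2 + (b5 - a5)) + (b3 - a4) + (b4 - a3) - (S1 - S2).
  move=> *; apply/matrixP => i j; rewrite !mxE; ring.
rewrite brM fl subrr addr0 subrr addr0 -sumrB.
rewrite opprD addrACA subrr addr0 -sumrB -sumrB big1 // => r _.
apply/matrixP => i j; rewrite !mxE; ring.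
Qed.

(** For antisymmetric X this is X Y + Y X^T, the action of the connection on both indices of a
    two-tensor Y. *)
Definition bracket_mx (X Y : 'M[A]_m) := X *m Y - Y *m X.

Local Notation nabT := (nabla_rep bracket_mx).
Local Notation nab2T := (nabla2_rep bracket_mx).
Local Notation nabV := (nabla_rep (@mulmx A m m 1)).
Local Notation nab2V := (nabla2_rep (@mulmx A m m 1)).

Lemma ricci_identity_mx (X : 'M[A]_m) l k : map_mx Dv X = bracket_mx wv X ->
  nab2T X l k = nab2T X k l.
Proof.
apply: ricci_identity; rewrite /bracket_mx.
- by move=> *; rewrite mulmxDl mulmxDr; apply/matrixP => i j; rewrite !mxE; ring.
- by move=> *; rewrite -scalemxAl -scalemxAr scalerBr.
- by move=> *; rewrite mulmxDl mulmxDr; apply/matrixP => i j; rewrite !mxE; ring.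
- by move=> *; rewrite mulmxN mulNmx; apply/matrixP => i j; rewrite !mxE; ring.
- move=> Y Z v; rewrite !mulmxBl !mulmxBr !mulmxA.
  by apply/matrixP => i j; rewrite !mxE; ring.
- move=> k' Y v; rewrite map_derivB // !map_deriv_mul //.
  by apply/matrixP => i j; rewrite !mxE; ring.
Qed.

Lemma ricci_identity_vec (x : 'cV[A]_m) l k : map_mx Dv x = wv *m x ->
  nab2V x l k = nab2V x k l.
Proof.
apply: ricci_identity.
- by move=> *; rewrite mulmxDl.
- by move=> *; rewrite -scalemxAl.
- by move=> *; rewrite mulmxDr.
- by move=> *; rewrite mulmxN.
- by move=> Y Z v; rewrite mulmxBl !mulmxA.
- by move=> k' Y v; rewrite map_deriv_mul.
Qed.

Lemma trB (X Y : 'M[A]_m) : \tr (X - Y) = \tr X - \tr Y.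
Proof. exact: raddfB. Qed.

Lemma tr_bracket (X Y : 'M[A]_m) : \tr (bracket_mx X Y) = 0.
Proof. by rewrite trB mxtrace_mulC subrr. Qed.

Lemma trZr x (X Y : 'M[A]_m) : \tr (X *m (x *: Y)) = x * \tr (X *m Y).
Proof. by rewrite -scalemxAr mxtraceZ. Qed.

(** The connection terms add up to the trace of the commutator of [w k] with X Y, which is zero. *)
Lemma deriv_trM k (X Y : 'M[A]_m) :
  D k (\tr (X *m Y)) = \tr (nabT X k *m Y) + \tr (X *m nabT Y k).
Proof.
rewrite deriv_tr // map_deriv_mul // mxtraceD /nabla_rep /bracket_mx.
rewrite !mulmxBl !mulmxBr !raddfB /= !mulmxA.
rewrite -(mulmxA (w k) X Y) (mxtrace_mulC (w k)); ring.
Qed.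

Definition dotv (u v : 'cV[A]_m) := \sum_j u j 0 * v j 0.

Lemma dotvC u v : dotv u v = dotv v u.
Proof. by apply: eq_bigr => j _; rewrite mulrC. Qed.
Lemma dotvDl u u' v : dotv (u + u') v = dotv u v + dotv u' v.
Proof. by rewrite -big_split; apply: eq_bigr => j _ /=; rewrite mxE mulrDl. Qed.
Lemma dotvZl x u v : dotv (x *: u) v = x * dotv u v.
Proof. by rewrite mulr_sumr; apply: eq_bigr => j _ /=; rewrite mxE mulrA. Qed.
Lemma dotv0l v : dotv 0 v = 0.
Proof. by rewrite /dotv big1 // => j _; rewrite mxE mul0r. Qed.
Lemma dotv0r v : dotv v 0 = 0.
Proof. by rewrite dotvC dotv0l. Qed.
Lemma dotvDr u u' v : dotv v (u + u') = dotv v u + dotv v u'.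
Proof. by rewrite !(dotvC v) dotvDl. Qed.
Lemma dotvZr x u v : dotv v (x *: u) = x * dotv v u.
Proof. by rewrite !(dotvC v) dotvZl. Qed.
Lemma dotv_suml (I : Type) (r : seq I) (F : I -> 'cV[A]_m) v :
  dotv (\sum_(i <- r) F i) v = \sum_(i <- r) dotv (F i) v.
Proof. by apply: (big_morph (fun u => dotv u v)) => [x y|]; [exact: dotvDl|exact: dotv0l]. Qed.

Lemma dotv_anti k u v : dotv (w k *m u) v + dotv u (w k *m v) = 0.
Proof.
rewrite /dotv.
under eq_bigr do rewrite mxE mulr_suml.
rewrite exchange_big -big_split big1 // => i _ /=.
rewrite mxE mulr_sumr -big_split big1 // => j _ /=.
by rewrite (w_anti k j i); ring.
Qed.

Lemma deriv_dotv k u v : D k (dotv u v) = dotv (nabV u k) v + dotv u (nabV v k).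
Proof.
have -> : D k (dotv u v) = dotv (dM k u) v + dotv u (dM k v).
  by rewrite deriv_sum // -big_split; apply: eq_bigr => j _; rewrite derivM // !mxE.
have E x : dM k x = nabV x k + w k *m x by rewrite /nabla_rep subrK.
by rewrite !E dotvDl dotvDr addrACA dotv_anti addr0.
Qed.

Lemma deriv_mulmx k (X : 'M[A]_m) (u : 'cV[A]_m) :
  nabV (X *m u) k = nabT X k *m u + X *m nabV u k.
Proof.
rewrite /nabla_rep /bracket_mx map_deriv_mul // !mulmxBl !mulmxBr !mulmxA.
by apply/matrixP => i j; rewrite !mxE; ring.
Qed.

Lemma nabVE u k j : nabV u k j 0 = D k (u j 0) - \sum_l w k j l * u l 0.
Proof. by rewrite !mxE. Qed.

(** Trace of the leafwise Hessian; the first-order term is the derivative along nabla_{E_k} E_k up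
    to its V-component. *)
Definition laplacian x := \sum_k (D k (D k x) - \sum_r w k k r * D r x).

Variables (T : 'M[A]_m) (f finv : A).
(** The only form in which positivity is available in the ring. It yields that 2 is cancellable and
    that there are no nilpotents, both used constantly below. *)
Hypothesis A_real : forall (I : finType) (x : I -> A), \sum_i x i * x i = 0 -> forall i, x i = 0.
Hypothesis T_sym : forall i j, T i j = T j i.
Hypothesis T_tr : \tr T = 0.
Hypothesis T_v : map_mx Dv T = bracket_mx wv T.
Local Notation t := (nabT T).
Hypothesis t_sym : forall k i j, t k i j = t i k j.
Hypothesis fE : f = \tr (T *m T).
Hypothesis f_inv : f * finv = 1.

Let two0 (x : A) : x + x = 0 -> x = 0.
Proof.
(* Over [bool] the sum of squares is x^2 + x^2 = (x + x) x. *)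
move=> x0; have := @A_real bool (fun=> x); rewrite big_bool /= => /(_ _ true); apply.
by rewrite -mulrDl x0 mul0r.
Qed.

Let sq0 (x : A) : x * x = 0 -> x = 0.
Proof.
move=> x0; have := @A_real bool (fun=> x); rewrite big_bool /= => /(_ _ true); apply.
by rewrite x0 addr0.
Qed.

Let f_cancel (x y : A) : f * x = f * y -> x = y.
Proof. by move=> /(congr1 (fun z => finv * z)); rewrite !mulrA (mulrC finv) f_inv !mul1r. Qed.

(** T is symmetric and [w k] antisymmetric, so their commutator is symmetric. *)
Let t_symr k i j : t k i j = t k j i.
Proof.
rewrite !mxE (T_sym j i).
have -> : \sum_j0 w k i j0 * T j0 j = - \sum_j0 T j j0 * w k j0 i.
  by rewrite -sumrN; apply: eq_bigr => r _; rewrite w_anti T_sym; ring.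
have -> : \sum_j0 w k j j0 * T j0 i = - \sum_j0 T i j0 * w k j0 j.
  by rewrite -sumrN; apply: eq_bigr => r _; rewrite w_anti (T_sym i); ring.
ring.
Qed.

Let t_tr k : \tr (t k) = 0.
Proof.
by rewrite /nabla_rep trB tr_bracket subr0 -deriv_tr // T_tr deriv0.
Qed.

Let t2_sym l k i j : nab2T T l k i j = nab2T T l k j i.
Proof.
rewrite [LHS]mxE [RHS]mxE; congr (_ + _); last first.
  rewrite [LHS]mxE [RHS]mxE !summxE; congr (- _); apply: eq_bigr => r _.
  by rewrite [LHS]mxE [RHS]mxE t_symr.
rewrite [LHS]mxE [RHS]mxE [X in X + _]mxE [X in _ = X + _]mxE t_symr; congr (_ + _).
rewrite [LHS]mxE [RHS]mxE; congr (- _).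
rewrite [LHS]mxE [RHS]mxE addrC; congr (_ + _); rewrite !mxE -?sumrN; apply: eq_bigr => r _.
  by rewrite w_anti t_symr; ring.
by rewrite (w_anti l i) (t_symr k r j); ring.
Qed.

Let t2_perm l k i j : nab2T T l k i j = nab2T T l i k j.
Proof.
have E k' i' : nab2T T l k' i' j = D l (t k' i' j) - \sum_s w l i' s * t k' s j
    + \sum_s t k' i' s * w l s j - \sum_s w l k' s * t s i' j.
  rewrite [LHS]mxE; congr (_ + _); last first.
    by rewrite mxE summxE; congr (- _); apply: eq_bigr => r _; rewrite mxE.
  rewrite mxE [X in X + _]mxE -addrA; congr (_ + _).
  by rewrite mxE mxE [X in - (X + _)]mxE [X in - (_ + X)]mxE [X in - (_ - X)]mxE; ring.
rewrite !E t_sym.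
have -> : \sum_s t k i s * w l s j = \sum_s t i k s * w l s j.
  by apply: eq_bigr => s _; rewrite t_sym.
have -> : \sum_s w l i s * t k s j = \sum_s w l i s * t s k j.
  by apply: eq_bigr => s _; rewrite t_sym.
have -> : \sum_s w l k s * t s i j = \sum_s w l k s * t i s j.
  by apply: eq_bigr => s _; rewrite t_sym.
ring.
Qed.

Let t2_tr l k : \tr (nab2T T l k) = 0.
Proof.
rewrite /nabla2_rep trB (trB (dM l _)) tr_bracket -deriv_tr // t_tr deriv0 // subr0 sub0r.
have -> : \tr (\sum_r w l k r *: t r) = \sum_r \tr (w l k r *: t r) by exact: raddf_sum.
rewrite big1 ?oppr0 // => r _.
by rewrite mxtraceZ t_tr mulr0.
Qed.

(** Summing over k: nabla_k nabla_k T_ij = nabla_k nabla_i T_kj = nabla_i nabla_k T_kj = nabla_i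
    nabla_j T_kk = 0, by total symmetry of DT, the Ricci identity, total symmetry again and
    trace-freeness. *)
Let harmonic : \sum_k nab2T T k k = 0.
Proof.
apply/matrixP => i j; rewrite summxE mxE -[RHS](t2_tr i j).
apply: eq_bigr => k _.
by rewrite t2_perm ricci_identity_mx // t2_sym t2_perm.
Qed.

Lemma tr_sqr_deriv k : D k f = \tr (T *m t k) + \tr (T *m t k).
Proof. by rewrite fE deriv_trM; congr (_ + _); exact: mxtrace_mulC. Qed.

Let N := \sum_k \tr (t k *m t k).

(** Differentiating |T|^2 twice gives 2|DT|^2 plus twice the pairing of T with its Laplacian, and
    the latter is zero by [harmonic]. *)
Let lap_f : laplacian f = N + N.
Proof.
have -> : laplacian f = \sum_k (\tr (t k *m t k) + \tr (t k *m t k)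
    + (\tr (T *m nab2T T k k) + \tr (T *m nab2T T k k))).
  apply: eq_bigr => k _; rewrite tr_sqr_deriv derivD // deriv_trM.
  have -> : \sum_r w k k r * D r f = \tr (T *m \sum_r w k k r *: t r) + \tr (T *m \sum_r w k k r *: t r).
    rewrite -mxtraceD -mulmxDr -big_split /= mulmx_sumr raddf_sum /=; apply: eq_bigr => r _.
    by rewrite mulmxDr mxtraceD trZr tr_sqr_deriv mulrDr.
  by rewrite /nabla2_rep mulmxBr raddfB /= -/(nabT (t k) k); ring.
have H0 : \sum_k \tr (T *m nab2T T k k) = 0.
  have -> : \sum_k \tr (T *m nab2T T k k) = \tr (T *m \sum_k nab2T T k k).
    by rewrite mulmx_sumr; apply/esym; exact: raddf_sum.
  by rewrite harmonic mulmx0 mxtrace0.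
by rewrite big_split /= [X in X + _]big_split /= [X in _ + X]big_split /= H0 !addr0.
Qed.

(** The gradient of log f, written without a logarithm. *)
Let a : 'cV[A]_m := \col_k (finv * D k f).
Let mu := dotv a a.
Let B := nabV a.

Let fa k : f * a k 0 = D k f.
Proof. by rewrite mxE mulrA f_inv mul1r. Qed.

Let Dvf : Dv f = 0.
Proof.
rewrite fE deriv_tr // map_deriv_mul // T_v /bracket_mx mxtraceD mulmxBl mulmxBr !trB !mulmxA.
by rewrite (mxtrace_mulC (T *m T)) mulmxA; ring.
Qed.

(** f times the Hessian of log f. Identities about a are proved after multiplication by f and then
    cancelled, which keeps inverses out of the derivations. *)
Let fB k j : f * B k j 0 = D k (D j f) - \sum_r w k j r * D r f - f * (a k 0 * a j 0).
Proof.
have : D k (f * a j 0) = D k f * a j 0 + f * D k (a j 0) by rewrite derivM.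
rewrite fa => ->; rewrite -(fa k) nabVE mulrDr mulrN mulr_sumr.
have -> : \sum_i f * (w k j i * a i 0) = \sum_r w k j r * D r f.
  by apply: eq_bigr => r _; rewrite -fa; ring.
ring.
Qed.

(** A Hessian is symmetric because the connection is torsion-free; the V-term of the bracket is
    absent since f is constant along V. *)
Let B_sym k j : B k j 0 = B j k 0.
Proof.
apply: f_cancel; rewrite !fB; apply/eqP; rewrite -subr_eq0.
have -> : D k (D j f) - \sum_r w k j r * D r f - f * (a k 0 * a j 0) -
  (D j (D k f) - \sum_r w j k r * D r f - f * (a j 0 * a k 0)) =
  D k (D j f) - D j (D k f) - (\sum_r w k j r * D r f - \sum_r w j k r * D r f) by ring.
rewrite bracket Dvf mulr0 addr0 -sumrB -sumrB big1 // => r _; ring.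
Qed.

(** The commutator of the derivatives along V and [E_j], applied to f, reduces to the connection
    term because the derivative of f along V vanishes. This parallelism is what [ricci_identity_vec]
    asks of a. *)
Let a_v : map_mx Dv a = wv *m a.
Proof.
apply/matrixP => j i; rewrite (ord1 i) mxE; apply: f_cancel.
have : Dv (f * a j 0) = Dv f * a j 0 + f * Dv (a j 0) by rewrite derivM.
rewrite Dvf mul0r add0r => <-; rewrite fa.
have := bracket_v j f; rewrite Dvf deriv0 // subr0 mulr0 addr0 => ->.
by rewrite mxE mulr_sumr; apply: eq_bigr => r _; rewrite -fa; ring.
Qed.

Let divB := \sum_k B k k 0.

(** The first-order equation Dx = x a holds for f and, by the invariance of its ratio, for s^2; one
    more derivative gives the Laplacian. *)
Let lap_mul x : (forall k, D k x = x * a k 0) -> laplacian x = x * (mu + divB).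
Proof.
move=> Dx; rewrite /mu /dotv /divB -big_split mulr_sumr; apply: eq_bigr => k _ /=.
rewrite Dx (derivM (D_deriv k)) Dx nabVE.
have -> : \sum_r w k k r * D r x = x * \sum_i w k k i * a i 0.
  by rewrite mulr_sumr; apply: eq_bigr => r _; rewrite Dx; ring.
ring.
Qed.

Hypothesis mu_const : forall k, D k mu = 0.
Hypothesis N_const : forall k, D k (N * finv) = 0.

(** [lap_mul] and [lap_f] give f (|a|^2 + div a) = 2|DT|^2, so div a is 2|DT|^2 / f - |a|^2, a
    combination of two constants. *)
Let divB_const k : D k divB = 0.
Proof.
have E : f * (mu + divB) = N + N.
  by rewrite -lap_f; apply/esym/lap_mul => j; rewrite fa.
have -> : divB = N * finv + N * finv - mu.
  by apply: f_cancel; apply: (addrI (f * mu)); rewrite -mulrDr E; ring: f_inv.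
by rewrite derivB // derivD // N_const mu_const; ring.
Qed.

Let Ba k : dotv (B k) a = 0.
Proof. by apply: two0; have := mu_const k; rewrite /mu deriv_dotv -/B (dotvC a). Qed.

Let B2_sym l k j : nab2V a l k j 0 = nab2V a l j k 0.
Proof.
have E k' j' : nab2V a l k' j' 0 = D l (B k' j' 0) - \sum_s w l j' s * B k' s 0
   - \sum_s w l k' s * B s j' 0.
  rewrite [LHS]mxE; congr (_ + _).
    by rewrite mxE [X in X + _]mxE; congr (_ + _); rewrite mxE [X in - X]mxE.
  by rewrite mxE summxE; congr (- _); apply: eq_bigr => s _; rewrite mxE.
rewrite !E B_sym.
have -> : \sum_s w l j s * B k s 0 = \sum_s w l j s * B s k 0.
  by apply: eq_bigr => s _; rewrite B_sym.
have -> : \sum_s w l k s * B s j 0 = \sum_s w l k s * B j s 0.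
  by apply: eq_bigr => s _; rewrite B_sym.
ring.
Qed.

(** The trace of the derivative is the derivative of the trace [divB]: the connection terms pair the
    antisymmetric [w j] with the symmetric B. *)
Let B2_tr j : \sum_k nab2V a j k k 0 = 0.
Proof.
have -> : \sum_k nab2V a j k k 0 = D j divB
    - (\sum_k \sum_s w j k s * B k s 0 + \sum_k \sum_s w j k s * B s k 0).
  rewrite /divB deriv_sum // -big_split -sumrB; apply: eq_bigr => k _ /=.
  rewrite [LHS]mxE [X in X + _]mxE [X in X + _ + _]mxE opprD addrA; congr (_ + _ + _).
    by rewrite mxE [X in - X]mxE.
  by rewrite mxE summxE; congr (- _); apply: eq_bigr => s _; rewrite mxE.
rewrite divB_const sub0r [X in X + _]exchange_big -big_split big1 ?oppr0 // => k _ /=.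
rewrite -big_split big1 // => s _ /=; rewrite (w_anti j s k) (B_sym s k); ring.
Qed.

(** Bochner's formula: the divergence of the vanishing vector <B_k, a> is |B|^2 plus the pairing of
    a with its Laplacian. By symmetry of B and the Ricci identity that Laplacian is the gradient of
    div a, which is zero, so |B|^2 = 0. *)
Let B0 k j : B k j 0 = 0.
Proof.
have H : \sum_k dotv (B k) (B k) = 0.
  have : \sum_k (D k (dotv (B k) a) - \sum_r w k k r * dotv (B r) a) = 0.
    by rewrite big1 // => i _; rewrite Ba deriv0 // big1 ?subr0 // => r _; rewrite Ba mulr0.
  have -> : \sum_k (D k (dotv (B k) a) - \sum_r w k k r * dotv (B r) a) =
      \sum_k dotv (nab2V a k k) a + \sum_k dotv (B k) (B k).
    rewrite -big_split; apply: eq_bigr => i _ /=; rewrite deriv_dotv -/(B i).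
    rewrite /nabla2_rep -/B !dotvDl -/(nabV (B i) i).
    have -> : dotv (- (\sum_r w i i r *: B r)) a = - \sum_r w i i r * dotv (B r) a.
      rewrite -scaleN1r dotvZl mulN1r dotv_suml; congr (- _).
      by apply: eq_bigr => r _; rewrite dotvZl.
    ring.
  have -> : \sum_k dotv (nab2V a k k) a = 0.
    rewrite /dotv exchange_big big1 // => i _ /=; rewrite -mulr_suml.
    have -> : \sum_k nab2V a k k i 0 = 0; last by rewrite mul0r.
    rewrite -[RHS](B2_tr i); apply: eq_bigr => l _.
    by rewrite B2_sym ricci_identity_vec.
  by rewrite add0r.
move: H; rewrite /dotv pair_bigA /= => H.
exact: (@A_real _ (fun p : 'I_m * 'I_m => B p.1 p.2 0) H (k, j)).
Qed.

Let B00 k : B k = 0.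
Proof. by apply/matrixP => j i; rewrite (ord1 i) B0 mxE. Qed.

Let b := T *m a.
Let s := dotv a b.

Hypothesis s_const : forall k, D k (s * s * finv) = 0.
Hypothesis b_const : forall k, D k (dotv b b * finv) = 0.

(** Logarithmic differentiation: what is a constant multiple of f has the same logarithmic gradient
    a. *)
Let ratio_const x : (forall k, D k (x * finv) = 0) -> forall k, D k x = x * a k 0.
Proof.
move=> H k; have E : D k (x * finv * f) = x * finv * D k f by rewrite derivM // H mul0r add0r.
have Ex : x * finv * f = x by rewrite -mulrA (mulrC finv) f_inv mulr1.
by rewrite Ex -fa in E; rewrite E mulrA Ex.
Qed.

Let nab_b k : nabV b k = t k *m a.
Proof. by rewrite deriv_mulmx -/(B k) B00 mulmx0 addr0. Qed.

Let Ds k : D k s = dotv a (t k *m a).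
Proof. by rewrite deriv_dotv nab_b -/(B k) B00 dotv0l add0r. Qed.

(** As a is parallel, derivatives of T(a, a) fall on T only, and T is harmonic. *)
Let lap_s : laplacian s = 0.
Proof.
have -> : laplacian s = dotv a ((\sum_k nab2T T k k) *m a).
  rewrite mulmx_suml dotvC dotv_suml; apply: eq_bigr => k _.
  rewrite Ds deriv_dotv -/(B k) B00 dotv0l add0r deriv_mulmx -/(B k) B00 mulmx0 addr0.
  rewrite dotvC /nabla2_rep -/(nabT (t k) k).
  move: (nabT (t k) k) => Y; rewrite mulmxBl dotvDl; congr (_ + _).
  rewrite -scaleN1r dotvZl mulN1r mulmx_suml dotv_suml; congr (- _).
  by apply: eq_bigr => r _; rewrite Ds -scalemxAl dotvZl dotvC.
by rewrite harmonic mul0mx dotv0r.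
Qed.

(** Let G = |Ds|^2. The Laplacian of s^2 is s^2 mu by [lap_mul] and 2 G by harmonicity of s, while
    squaring 2 s Ds = s^2 a gives 4 s^2 G = s^4 mu. Hence 2 s^4 mu = s^4 mu, so s^4 mu = 0, and
    [sq0] applied twice lowers the exponent. *)
Let s_mu : s * mu = 0.
Proof.
have Dz := ratio_const s_const.
have E1 : laplacian (s * s) = s * s * mu.
  rewrite lap_mul // /divB; congr (_ * _).
  by rewrite big1 ?addr0 // => k _; rewrite B0.
have Dz2 k : D k (s * s) = s * D k s + s * D k s by rewrite derivM //; ring.
pose G := \sum_k D k s * D k s.
have E2 : laplacian (s * s) = G + G.
  have -> : laplacian (s * s) = \sum_k (D k s * D k s + D k s * D k s
      + (s + s) * (D k (D k s) - \sum_r w k k r * D r s)).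
    apply: eq_bigr => k _; rewrite Dz2 (derivD (D_deriv k)) (derivM (D_deriv k)).
    have -> : \sum_r w k k r * D r (s * s) = (s + s) * \sum_r w k k r * D r s.
      by rewrite mulr_sumr; apply: eq_bigr => r _; rewrite Dz2; ring.
    ring.
  rewrite big_split /= -mulr_sumr -/(laplacian s) lap_s mulr0 addr0.
  by rewrite big_split.
have E3 : (s + s) * (s + s) * G = s * s * (s * s) * mu.
  rewrite /G /mu (_ : dotv a a = \sum_k a k 0 * a k 0) // [LHS]mulr_sumr [RHS]mulr_sumr; apply: eq_bigr => k _.
  have E : (s + s) * D k s = s * s * a k 0 by rewrite -Dz Dz2; ring.
  have -> : (s + s) * (s + s) * (D k s * D k s) = ((s + s) * D k s) * ((s + s) * D k s) by ring.
  by rewrite E; ring.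
have E4 : s * s * (s * s) * mu = 0.
  have : s * s * (G + G + (G + G)) = s * s * (s * s) * mu by rewrite -E3; ring.
  rewrite -E2 E1 => E; have {}E : s * s * (s * s) * mu + s * s * (s * s) * mu = s * s * (s * s) * mu.
    by rewrite -{3}E; ring.
  by apply: (addrI (s * s * (s * s) * mu)); rewrite E addr0.
have E5 : s * s * mu = 0.
  apply: sq0; have -> : s * s * mu * (s * s * mu) = s * s * (s * s) * mu * mu by ring.
  by rewrite E4 mul0r.
apply: sq0; have -> : s * mu * (s * mu) = s * s * mu * mu by ring.
by rewrite E5 mul0r.
Qed.

Let mu_Ds k : mu * D k s = 0.
Proof. by have := derivM (D_deriv k) s mu; rewrite s_mu deriv0 // mu_const mulr0 addr0 mulrC. Qed.

(** Total symmetry of DT lets the differentiation index trade places with an argument of T. *)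
Let t_aa j : \sum_k a k 0 * (t k *m a) j 0 = D j s.
Proof.
rewrite Ds; apply: eq_bigr => k _; congr (_ * _).
by rewrite !mxE; apply: eq_bigr => i _; rewrite t_sym.
Qed.

(** Pairing a with D|b|^2 = |b|^2 a gives |b|^2 mu = 2 sum_j b_j D_j s. Multiplied by mu the right
    side vanishes by [mu_Ds], so the squares of the entries of mu b add up to zero. *)
Let mu_b j : mu * b j 0 = 0.
Proof.
have Dq := ratio_const b_const.
have E : dotv b b * mu = \sum_j (b j 0 * D j s + b j 0 * D j s).
  transitivity (\sum_k a k 0 * D k (dotv b b)).
    by rewrite /mu /dotv mulr_sumr; apply: eq_bigr => k _; rewrite Dq /dotv; ring.
  have Db k : D k (dotv b b) = \sum_j (b j 0 * (t k *m a) j 0 + b j 0 * (t k *m a) j 0).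
    by rewrite deriv_dotv nab_b dotvC big_split.
  under eq_bigr do rewrite Db mulr_sumr.
  rewrite exchange_big; apply: eq_bigr => i _ /=.
  by rewrite -t_aa mulr_sumr -big_split; apply: eq_bigr => k _ /=; ring.
have H : \sum_j (mu * b j 0) * (mu * b j 0) = 0.
  transitivity (mu * (dotv b b * mu)).
    by rewrite /dotv mulr_suml mulr_sumr; apply: eq_bigr => i _; ring.
  rewrite E mulr_sumr big1 // => i _.
  by rewrite mulrDr mulrCA mu_Ds mulr0 addr0.
exact: (@A_real _ (fun j => mu * b j 0) H j).
Qed.

(** Differentiating mu b = 0, with mu constant and a parallel, gives mu (D_k T) a = 0. By total
    symmetry f mu = sum_k a_k D_k f is a combination of entries of the (D_k T) a, so f mu^2 = 0. *)
Let mu0 : mu = 0.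
Proof.
have mb : mu *: b = 0 by apply/matrixP => j i; rewrite (ord1 i) mxE mu_b mxE.
have mt k : mu *: (t k *m a) = 0.
  have : map_mx (D k) (mu *: b) = mu *: map_mx (D k) b.
    by apply/matrixP => i j; rewrite !mxE derivM // mu_const mul0r add0r.
  rewrite mb map_deriv0 // -nab_b /nabla_rep scalerBr => <-.
  by rewrite scalemxAr mb mulmx0 subr0.
have E : mu * (f * mu) = 0.
  have -> : f * mu = \sum_k a k 0 * D k f.
    by rewrite /mu /dotv mulr_sumr; apply: eq_bigr => k _; rewrite -fa; ring.
  have -> : \sum_k a k 0 * D k f = \sum_i \sum_j (T i j + T i j) * (t j *m a) i 0.
    under eq_bigr do rewrite tr_sqr_deriv mulrDr.
    rewrite big_split /=.
    have -> : \sum_k a k 0 * \tr (T *m t k) = \sum_i \sum_j T i j * (t j *m a) i 0.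
      under eq_bigr do rewrite mulr_sumr.
      rewrite exchange_big; apply: eq_bigr => i _ /=.
      under eq_bigr do rewrite [(T *m _) _ _]mxE mulr_sumr.
      rewrite exchange_big; apply: eq_bigr => j _ /=.
      rewrite mxE mulr_sumr; apply: eq_bigr => k _.
      by rewrite t_sym t_symr; ring.
    by rewrite -big_split; apply: eq_bigr => i _; rewrite -big_split; apply: eq_bigr => j _ /=; ring.
  rewrite mulr_sumr big1 // => i _; rewrite mulr_sumr big1 // => j _.
  by have := congr1 (fun X : 'cV[A]_m => X i 0) (mt j); rewrite mulrCA !mxE => ->; rewrite mulr0.
apply: sq0; apply: f_cancel; rewrite mulr0 -E; ring.
Qed.

(** Now a = 0, so f has zero derivatives and [lap_f] leaves |DT|^2 = 0. The trace form [N] is a sum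
    of squares because each D_k T is symmetric. *)
Lemma flat_screen_parallel k i j : t k i j = 0.
Proof.
have a0 l : a l 0 = 0 by exact: (@A_real _ (fun j => a j 0) mu0 l).
have D0 l : D l f = 0 by rewrite -fa a0 mulr0.
have N0 : N = 0.
  apply: two0; rewrite -lap_f /laplacian big1 // => l _.
  by rewrite D0 deriv0 // big1 ?subr0 // => r _; rewrite D0 mulr0.
have H : \sum_p t p.1 p.2.1 p.2.2 * t p.1 p.2.1 p.2.2 = 0.
  rewrite -[RHS]N0 /N -(pair_bigA _ (fun k q => t k q.1 q.2 * t k q.1 q.2)) /=.
  apply: eq_bigr => l _; rewrite -(pair_bigA _ (fun p q => t l p q * t l p q)) /=.
  by apply: eq_bigr => p _; rewrite mxE; apply: eq_bigr => q _; rewrite (t_symr l q p).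
exact: (@A_real _ (fun p : 'I_m * ('I_m * 'I_m) => t p.1 p.2.1 p.2.2) H (k, (i, j))).
Qed.

End FlatScreen.

(** * Smooth cut-off functions on R^n *)

Section FlatFunction.
Context {R : realType}.
Implicit Types (P : {poly R}) (x y : R).

(** The usual flat function is the case P = 1. Allowing every polynomial P makes the family stable
    under differentiation, so that smoothness follows from [Ck_comp1] without formulas for higher
    derivatives. *)
Definition flat_fun P x : R := if 0 < x then P.[x^-1] * expR (- x^-1) else 0.

Lemma exprn_le_expR k : exists2 C : R, 0 <= C & forall y : R, 0 < y -> y ^+ k <= C * expR y.
Proof.
case: k => [|k].
  exists 1 => // z z0; rewrite expr0 mul1r ltW // expR_gt1; exact: z0.
(* With k standing for the positive exponent, the k-th power of z <= k exp (z / k) gives the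
   constant k^k. *)
exists (k.+1%:R ^+ k.+1) => [|z z0]; first by rewrite exprn_ge0.
have k0 : 0 < k.+1%:R :> R by rewrite ltr0n.
have E : expR z = expR (z / k.+1%:R) ^+ k.+1.
  by rewrite -expRM_natl mulrCA divff ?mulr1 // gt_eqF.
have H : z <= k.+1%:R * expR (z / k.+1%:R).
  have H := expR_ge1Dx (z / k.+1%:R).
  have {}H : z / k.+1%:R <= expR (z / k.+1%:R) by apply: le_trans H; rewrite lerDr.
  by rewrite ler_pdivrMr // mulrC in H.
rewrite E -exprMn; apply: lerXn2r => //; rewrite nnegrE ltW // mulr_gt0 // expR_gt0 //.
Qed.

Lemma poly_le_expR P : exists2 C : R, 0 <= C & forall y, 0 < y -> `|P.[y]| <= C * expR y.
Proof.
have [C HC] : exists C : nat -> R, forall k, 0 <= C k /\ forall y : R, 0 < y -> y ^+ k <= C k * expR y.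
  have H k : {C : R | 0 <= C /\ forall y : R, 0 < y -> y ^+ k <= C * expR y}.
    by apply: cid; have [C C0 HC] := exprn_le_expR k; exists C.
  by exists (fun k => sval (H k)) => k; exact: (svalP (H k)).
exists (\sum_(i < size P) `|P`_i| * C i).
  by apply: sumr_ge0 => i _; rewrite mulr_ge0 //; exact: (HC i).1.
move=> y y0; rewrite horner_coef (le_trans (ler_norm_sum _ _ _)) // mulr_suml ler_sum // => i _.
have yi : 0 <= y ^+ i by rewrite exprn_ge0 // ltW.
rewrite normrM -mulrA ler_wpM2l // ger0_norm //.
exact: (HC i).2.
Qed.

(** The exponential beats the polynomial X^2 P at 1 / x. The bound is quadratic so that the
    difference quotient at 0 tends to 0. *)
Lemma flat_fun_le P : exists2 C : R, 0 <= C & forall x, `|flat_fun P x| <= C * x ^+ 2.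
Proof.
have [C C0 H] := poly_le_expR ('X^2 * P); exists C => // x; rewrite /flat_fun; case: ifPn => x0; last first.
  by rewrite normr0 mulr_ge0 // sqr_ge0.
have xi : 0 < x^-1 by rewrite invr_gt0.
have := H _ xi; rewrite hornerM hornerXn normrM exprVn normfV (ger0_norm (sqr_ge0 x)) => H1.
rewrite normrM (ger0_norm (expR_ge0 _)) expRN ler_pdivrMr ?expR_gt0 //.
by rewrite ler_pdivrMl ?exprn_gt0 // in H1; rewrite mulrAC mulrC.
Qed.

(** For x > 0 the chain rule at 1 / x produces the factor X^2, and the exponential contributes P
    against - P'. At 0 the quadratic bound gives derivative 0. *)
Lemma flat_fun_is_derive P x :
  is_derive x 1 (flat_fun P) (flat_fun ('X^2 * (P - P^`())) x).
Proof.
case: (ltrgtP 0 x) => [x0|x0|<-].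
- apply: (@near_eq_is_derive _ _ _ (fun y => P.[y^-1] * expR (- y^-1))).
    by near=> y; rewrite /flat_fun ifT //; near: y; exact: lt_nbhsr.
  have x0' : x != 0 by rewrite gt_eqF.
  have di : is_derive x 1 (fun y : R => y^-1) (- x^-1 * x^-1).
    by have := isd_inv x0' (is_derive_id x 1); rewrite mulr1.
  have Di : differentiable (fun y : R => y^-1) x by apply/derivable1_diffP; case: di.
  have d1 := isd_comp1 Di di (is_derive_poly P x^-1).
  have dE w : is_derive w (1 : R) (fun z : R => expR (- z)) (expR (- w) * -1).
    have dn : is_derive w (1 : R) (fun z : R => - z) (-1) by exact: isd_opp.
    have Dn : differentiable (fun z : R => - z) w by apply/derivable1_diffP; case: dn.
    exact: isd_comp1 Dn dn (is_derive_expR (- w)).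
  have d2 := isd_comp1 Di di (dE x^-1).
  have d3 := isd_mul d1 d2; apply: (is_derive_eq d3).
  rewrite /flat_fun x0 hornerM hornerXn hornerD hornerN; ring.
- apply: (@near_eq_is_derive _ _ _ (fun=> 0)); last first.
    by rewrite /flat_fun ltNge (ltW x0) /=; exact: is_derive_cst.
  by near=> y; rewrite /flat_fun ltNge ltW //; near: y; exact: lt_nbhsl.
have -> : flat_fun ('X^2 * (P - P^`())) 0 = 0 by rewrite /flat_fun ltxx.
have [C C0 H] := flat_fun_le P.
have f0 : flat_fun P 0 = 0 by rewrite /flat_fun ltxx.
have lim0 : (fun h : R => h^-1 *: (flat_fun P (h *: 1 + 0) - flat_fun P 0)) @ 0^' --> (0 : R).
  apply/cvgrPdist_le => eps eps0; near=> h.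
  rewrite sub0r normrN f0 subr0 addr0 normrM normfV [h%:A]mulr1.
  have h0 : h != 0 by near: h; exact: nbhs_dnbhs_neq.
  rewrite ler_pdivrMl ?normr_gt0 // (le_trans (H h)) //.
  rewrite -[X in _ * X]real_normK ?num_real // expr2 mulrCA ler_wpM2l //.
  have hC : `|h| <= eps / (C + 1).
    by near: h; apply: dnbhs0_le; rewrite divr_gt0 // ltr_wpDl.
  apply: (le_trans (ler_wpM2l C0 hC)); rewrite mulrCA ger_pMr //.
  by rewrite ler_pdivrMr ?ltr_wpDl // mul1r lerDl.
apply: DeriveDef; first by apply/cvg_ex; exists 0.
exact: cvg_lim lim0.
Unshelve. all: by end_near. Qed.

Lemma Ck_flat_fun (n k : nat) (A : set 'rV[R]_n) (f : 'rV[R]_n -> R) P : open A ->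
  Ck k A f -> Ck k A (fun y : 'rV[R]_n => flat_fun P (f y)).
Proof.
move=> oA Cf; apply: (@Ck_comp1 _ _ (fun h => exists P, h = flat_fun P) setT) => //; last by exists P.
move=> h [Q ->]; exists (flat_fun ('X^2 * (Q - Q^`()))); first by exists ('X^2 * (Q - Q^`())).
by move=> t _; exact: flat_fun_is_derive.
Qed.

(** A smooth step from 0 on x <= 0 to 1 on x >= 1; the denominator is positive since x and 1 - x are
    not both nonpositive. *)
Definition smooth_step x : R := flat_fun 1 x / (flat_fun 1 x + flat_fun 1 (1 - x)).

Lemma flat_fun1_gt0 x : 0 < x -> 0 < flat_fun 1 x.
Proof. by move=> x0; rewrite /flat_fun x0 hornerE mul1r expR_gt0. Qed.

Lemma flat_fun1_ge0 x : 0 <= flat_fun 1 x.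
Proof. by rewrite /flat_fun; case: ifP => // _; rewrite hornerE mul1r expR_ge0. Qed.

Lemma smooth_step_den x : 0 < flat_fun 1 x + flat_fun 1 (1 - x).
Proof.
case: (ltP 0 x) => x0; first by rewrite ltr_pwDl ?flat_fun1_gt0 // flat_fun1_ge0.
by rewrite ltr_wpDl ?flat_fun1_ge0 // flat_fun1_gt0 // subr_gt0 (le_lt_trans x0).
Qed.

Lemma smooth_step1 x : 1 <= x -> smooth_step x = 1.
Proof.
move=> x1; have E : flat_fun 1 (1 - x) = 0 by rewrite /flat_fun subr_gt0 ltNge x1.
by rewrite /smooth_step E addr0 divff // gt_eqF // flat_fun1_gt0 // (lt_le_trans ltr01).
Qed.

Lemma smooth_step0 x : x <= 0 -> smooth_step x = 0.
Proof. by move=> x0; rewrite /smooth_step {1}/flat_fun ltNge x0 /= mul0r. Qed.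

End FlatFunction.

Lemma cube_bump (R : realType) (n : nat) (c : 'rV[R]_n) (r : R) : 0 < r ->
  exists chi : 'rV[R]_n -> R, [/\ forall k, Ck k setT chi,
    forall x, `|x - c| <= r -> chi x = 1 & forall x, chi x != 0 -> `|x - c| <= 2 * r].
Proof.
(* Squared coordinates avoid the non-smooth absolute value: [q a x] is at least 1 when |x_a - c_a|
   <= r and at most 0 beyond sqrt 2 times r, hence beyond 2 r. *)
move=> r0; pose q (a : 'I_n) (x : 'rV[R]_n) := 2 - (x 0 a - c 0 a) * (x 0 a - c 0 a) * (r^-1 * r^-1).
have qE a x : q a x = 2 - (`|(x - c) 0 a| / r) ^+ 2.
  by rewrite /q !mxE exprMn real_normK ?num_real //; ring.
exists (fun x => \prod_a smooth_step (q a x)); split.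
- move=> k; apply: Ck_prod => [|a _]; first exact: openT.
  have oT : open (setT : set 'rV[R]_n) := openT.
  have Cq : Ck k setT (q a).
    apply: Ck_add => //; first exact: Ck_cst.
    apply: Ck_opp => //; apply: Ck_mul => //; last exact: Ck_cst.
    have Cx : Ck k setT (fun x : 'rV[R]_n => x 0 a - c 0 a).
      by apply: Ck_add => //; [exact: Ck_coord|exact: Ck_cst].
    exact: Ck_mul.
  apply: Ck_mul => //; first exact: Ck_flat_fun.
  apply: Ck_inv => // [x _|]; first by rewrite gt_eqF // smooth_step_den.
  apply: Ck_add => //; first exact: Ck_flat_fun.
  by apply: Ck_flat_fun => //; apply: Ck_add => //; [exact: Ck_cst|exact: Ck_opp].
- move=> x xc; rewrite big1 // => a _; apply: smooth_step1; rewrite qE.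
  have : `|(x - c) 0 a| / r <= 1.
    by rewrite ler_pdivrMr // mul1r (le_trans (coord_norm_le _ _)).
  move=> H; have : (`|(x - c) 0 a| / r) ^+ 2 <= 1.
    by rewrite exprn_ile1 // divr_ge0 // ltW.
  lra.
- move=> x /prodf_neq0 H; apply/mx_norm_le; first by rewrite mulr_ge0 // ltW.
  move=> a; have := H a isT; apply: contra_neqT; rewrite -ltNge => xr.
  apply: smooth_step0; rewrite qE.
  have : 2 <= `|(x - c) 0 a| / r by rewrite ler_pdivlMr // ltW.
  move=> h2; have : 2 ^+ 2 <= (`|(x - c) 0 a| / r) ^+ 2.
    by rewrite lerXn2r ?nnegrE // (le_trans _ h2).
  lra.
Qed.

(** * Differentiation under the integral sign and the Poincare lemma *)

Section LeibnizRule.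
Context {R : realType}.
Local Notation mu := (@lebesgue_measure R).

Lemma cont_at_within (f : R -> R) (a b : R) :
  (forall t, a <= t <= b -> {for t, continuous f}) -> {within `[a, b], continuous f}.
Proof.
move=> cf; apply: continuous_in_subspaceT => t; rewrite inE /= in_itv /=; exact: cf.
Qed.

Lemma cont_integrable (f : R -> R) (a b : R) :
  (forall t, a <= t <= b -> {for t, continuous f}) -> mu.-integrable `[a, b] (EFin \o f).
Proof.
move=> cf; apply: continuous_compact_integrable; first exact: segment_compact.
exact: cont_at_within.
Qed.

Lemma leibniz_rule (K K' : R -> R -> R) (d C : R) : 0 < d ->
  (forall s t : R, `|s| < d -> 0 <= t <= 1 -> {for t, continuous (K s)}) ->
  (forall s t : R, `|s| < d -> 0 <= t <= 1 -> is_derive s (1 : R) (K^~ t) (K' s t)) ->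
  (forall s t : R, `|s| < d -> 0 <= t <= 1 -> `|K' s t| <= C) ->
  is_derive (0 : R) (1 : R) (fun s => \int[mu]_(t in `[0, 1]) K s t) (\int[mu]_(t in `[0, 1]) K' 0 t).
Proof.
move=> d0 cK dK bK.
have C0 : 0 <= C by apply: (le_trans _ (bK 0 0 _ _)); rewrite ?normr0 ?lexx ?ler01.
have inI (s : R) : `]-d, d[%classic s -> `|s| < d by rewrite /= in_itv /= ltr_norml.
have I0 : `]-d, d[%classic (0 : R) by rewrite /= in_itv /= oppr_lt0 d0.
have intf s : `]-d, d[%classic s -> mu.-integrable `[0, 1] (EFin \o K s).
  by move=> /inI sd; apply: cont_integrable => t t01; exact: cK.
have mB : measurable (`[0, 1] : set (measurableTypeR R)) by exact: measurable_itv.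
have derf1 s t : `]-d, d[%classic s -> `[0, 1]%classic t -> derivable (K^~ t) s 1.
  by move=> /inI sd /=; rewrite in_itv /= => t01; case: (dK s t sd t01).
have intG : mu.-integrable `[0, 1] (EFin \o (fun _ : R => C)).
  by apply: cont_integrable => t _; exact: cont_at_cst.
have Gub s t : `]-d, d[%classic s -> `[0, 1]%classic t -> `|partial1of2 K s t| <= C.
  move=> /inI sd /=; rewrite in_itv /= => t01; rewrite partial1of2E.
  by case: (dK s t sd t01) => _ ->; exact: bK.
have D1 := @derivable_under_integral R _ _ mu K _ mB 0 (-d) d I0 intf derf1 _ (fun _ => C0) intG Gub.
have D2 := @differentiation_under_integral R _ _ mu K _ mB 0 (-d) d I0 intf derf1 _ (fun _ => C0) intG Gub.
apply: DeriveDef; first exact: D1.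
rewrite -derive1E D2; apply: eq_Rintegral => t; rewrite inE /= in_itv /= => t01.
have sd : `|0 : R| < d by rewrite normr0.
by rewrite partial1of2E; case: (dK 0 t sd t01).
Qed.

Lemma ftc01 (F k : R -> R) :
  (forall t : R, 0 <= t <= 1 -> is_derive t (1 : R) F (k t)) ->
  (forall t : R, 0 <= t <= 1 -> {for t, continuous k}) ->
  \int[mu]_(t in `[0, 1]) k t = F 1 - F 0.
Proof.
move=> dF ck.
have cF t : 0 <= t <= 1 -> {for t, continuous F}.
  by move=> /dF[D _]; apply: differentiable_continuous; exact/derivable1_diffP.
have H : derivable_oo_LRcontinuous F 0 1.
  split.
  - by move=> t; rewrite in_itv /= => /andP[t0 t1]; case: (dF t) => //; rewrite !ltW.
  - by apply: cvg_at_right_filter; apply: cF; rewrite lexx ler01.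
  - by apply: cvg_at_left_filter; apply: cF; rewrite lexx ler01.
rewrite /Rintegral (continuous_FTC2 ltr01 (cont_at_within ck) H) //.
move=> t; rewrite in_itv /= => /andP[t0 t1]; rewrite derive1E.
by have [] := dF t; rewrite ?ltW.
Qed.

End LeibnizRule.

Section Poincare.
Context {R : realType} {n : nat}.
Implicit Types (x y z c : 'rV[R]_n).
Local Notation e a := (delta_mx 0 a : 'rV[R]_n).
Local Notation mu := (@lebesgue_measure R).

Lemma is_derive_of_line (V W : normedModType R) (f : V -> W) (x v : V) df :
  is_derive (0 : R) 1 (fun h => f (h *: v + x)) df -> is_derive x v f df.
Proof.
have E : (fun h : R => h^-1 *: (f ((h *: (1 : R) + 0 : R) *: v + x) - f ((0 : R) *: v + x))) =
    (fun h => h^-1 *: (f (h *: v + x) - f x)).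
  by apply/funext => h; rewrite addr0 scaler1 scale0r add0r.
by case=> d1 d2; apply: DeriveDef; move: d1 d2; rewrite /derivable /derive /= E.
Qed.

Lemma ball_rV c r x : ball c r x <-> `|x - c| < r.
Proof. by rewrite -ball_normE /= distrC. Qed.

Lemma bounded_on_ball (f : 'rV[R]_n -> R) c (r rho : R) : rho < r ->
  (forall x, ball c r x -> {for x, continuous f}) ->
  exists C, forall x, `|x - c| <= rho -> `|f x| <= C.
Proof.
move=> rr cf; pose A := [set x : 'rV[R]_n | `|x - c| <= rho].
have cA : compact A.
  apply: bounded_closed_compact.
    exists (rho + `|c|); split; first exact: num_real.
    move=> M HM x Ax; apply: (le_trans _ (ltW HM)).
    by rewrite -[x](subrK c) (le_trans (ler_normD _ _)) // lerD2r.
  have -> : A = (fun x => `|x - c|) @^-1` [set t | t <= rho] by [].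
  apply: preimage_closed; last exact: closed_le.
  by move=> x _; apply: continuous_comp; [exact: cvgB cvg_id (cvg_cst _)|exact: norm_continuous].
have cfA : {within A, continuous f}.
  apply: continuous_in_subspaceT => x; rewrite inE /= => Ax; apply: cf.
  by apply/ball_rV; exact: le_lt_trans rr.
have /compact_bounded[M [_ HM]] := continuous_compact cfA cA.
exists (M + 1) => x Ax; apply: (HM (M + 1)); first by rewrite ltrDl.
by exists x.
Qed.

Variables (c : 'rV[R]_n) (r : R) (om : 'I_n -> 'rV[R]_n -> R).
Hypothesis r0 : 0 < r.
Hypothesis om_smooth : forall a, Ck 2 (ball c r) (om a).
Hypothesis om_closed : forall x a b, ball c r x -> 'D_(e a) (om b) x = 'D_(e b) (om a) x.

Let seg (t : R) z := c + t *: (z - c).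
(** Integrand of the radial primitive: the form evaluated on z - c at the point [seg t z] of the
    segment from c to z. [dK b] is its partial derivative in direction b. *)
Let K (t : R) z := \sum_a om a (seg t z) * (z 0 a - c 0 a).
Let dK (b : 'I_n) (t : R) z := \sum_a t * 'D_(e b) (om a) (seg t z) * (z 0 a - c 0 a) + om b (seg t z).
Let oB : open (ball c r). Proof. exact: ball_open. Qed.

Let seg_norm t z : 0 <= t <= 1 -> `|seg t z - c| <= `|z - c|.
Proof.
move=> /andP[t0 t1]; rewrite /seg addrC addKr normrZ ger0_norm //.
by rewrite -[leRHS]mul1r ler_wpM2r.
Qed.

Let seg_ball t z : 0 <= t <= 1 -> ball c r z -> ball c r (seg t z).
Proof. by move=> t01 /ball_rV zr; apply/ball_rV; exact: le_lt_trans (seg_norm z t01) zr. Qed.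

Let isd_seg t z v (b : 'I_n) : is_derive z v (fun y => seg t y 0 b) (t * v 0 b).
Proof.
have -> : (fun y => seg t y 0 b) = (fun y => c 0 b + t * (y 0 b + - c 0 b)).
  by apply/funext => y; rewrite !mxE.
have h1 := isd_add (isd_coord z v b) (is_derive_cst (- c 0 b) z v).
have h2 := isd_mul (is_derive_cst t z v) h1.
have h3 := isd_add (is_derive_cst (c 0 b) z v) h2.
by apply: (is_derive_eq h3); rewrite mulr0 addr0 add0r addr0.
Qed.

Let isd_om_seg t z (a b : 'I_n) : 0 <= t <= 1 -> ball c r z ->
  is_derive z (e b) (fun y => om a (seg t y)) (t * 'D_(e b) (om a) (seg t z)).
Proof.
move=> t01 Bz; have Bs := seg_ball t01 Bz.
have Df : differentiable (om a) (seg t z) by exact: Ck1_differentiable oB (Ck_1 (om_smooth a)) Bs.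
have Dseg i : differentiable (fun y => seg t y 0 i) z.
  have -> : (fun y => seg t y 0 i) = (fun y => c 0 i + t * (y 0 i - c 0 i)).
    by apply/funext => y; rewrite !mxE.
  apply: differentiableD; first exact: differentiable_cst.
  apply: differentiableM; first exact: differentiable_cst.
  by apply: differentiableB; [exact: differentiable_coord|exact: differentiable_cst].
have [D1 D2] := derive_comp_row (e b) Dseg Df.
apply: DeriveDef; first exact: (diff_derivable D1).
have E : \row_i 'D_(e b) (fun y => seg t y 0 i) z = t *: e b + 0.
  by apply/rowP => i; rewrite addr0 !mxE; have [_ ->] := isd_seg t z (e b) i; rewrite mxE.
by apply: (etrans D2); rewrite E derive_linear // derive0 addr0.
Qed.

Let isd_K t z (b : 'I_n) : 0 <= t <= 1 -> ball c r z -> is_derive z (e b) (K t) (dK b t z).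
Proof.
move=> t01 Bz.
have H : is_derive z (e b) (K t) (\sum_a (om a (seg t z) * (e b 0 a + 0)
   + (z 0 a - c 0 a) * (t * 'D_(e b) (om a) (seg t z)))).
  apply: isd_sum => a _; apply: isd_mul; first exact: isd_om_seg.
  exact: (isd_add (isd_coord z (e b) a) (is_derive_cst (- c 0 a) z (e b))).
apply: (is_derive_eq H); rewrite big_split /= addrC; congr (_ + _).
  by apply: eq_bigr => a _; ring.
rewrite (bigD1 b) //= mxE !eqxx addr0 mulr1 big1 ?addr0 // => a ab.
by rewrite mxE eqxx (negbTE ab) addr0 mulr0.
Qed.

Let cont_seg t z : {for t, continuous (fun t => seg t z)}.
Proof.
apply: cont_at_row => a.
have -> : (fun t => seg t z 0 a) = (fun t => c 0 a + t * (z 0 a - c 0 a)).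
  by apply/funext => y; rewrite !mxE.
apply: cont_at_add; first exact: cont_at_cst.
by apply: cont_at_mul; [exact: cvg_id|exact: cont_at_cst].
Qed.

Let cont_comp_seg (f : 'rV[R]_n -> R) t z : 0 <= t <= 1 -> ball c r z ->
  Ck 0 (ball c r) f -> {for t, continuous (fun t => f (seg t z))}.
Proof.
move=> t01 Bz Cf; apply: (@cont_at_comp _ _ _ (fun t => seg t z) f); first exact: cont_seg.
by apply: (Ck_cont Cf); exact: seg_ball.
Qed.

(** Closedness turns [dK b t x] into the t-derivative of t * om_b(c + t (x - c)), so differentiating
    under the integral and integrating back gives om_b(x). *)
Lemma poincare : exists u : 'rV[R]_n -> R,
  forall x a, ball c r x -> is_derive x (e a) u (om a x).
Proof.
exists (fun z => \int[mu]_(t in `[0, 1]) K t z) => x b Bx.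
have xr : `|x - c| < r by apply/ball_rV.
have C0 a : Ck 0 (ball c r) (om a) by do 2 apply: Ck_le.
have C1 a a' : Ck 0 (ball c r) (fun x => 'D_(e a) (om a') x) by apply: Ck_le; exact: CkS_derive.
(* Half of the room between x and the sphere: points moved by less than d along e_b stay in a closed
   ball of radius [rho] < r, where the form and its derivatives are bounded. *)
pose d := (r - `|x - c|) / 2; have d0 : 0 < d by rewrite divr_gt0 // subr_gt0.
pose rho := `|x - c| + d.
have rr : rho < r by rewrite /rho /d; lra.
have in_rho s : `|s| < d -> `|s *: e b + x - c| <= rho.
  move=> sd; rewrite -addrA addrC (le_trans (ler_normD _ _)) // lerD2l normrZ.
  have : `|e b| <= 1 :> R.
    apply/mx_norm_le => // i; rewrite mxE; case: eqP => _ /=; last by rewrite normr0.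
    by case: eqP => _; rewrite ?normr0 ?normr1.
  by move=> H; rewrite -[d]mulr1 ler_pM // ltW.
have in_ball s : `|s| < d -> ball c r (s *: e b + x).
  by move=> /in_rho H; apply/ball_rV; exact: le_lt_trans rr.
have [C HC] : exists C, forall z a, `|z - c| <= rho -> `|om a z| <= C /\ `|'D_(e b) (om a) z| <= C.
  have H1 a : {C | forall z, `|z - c| <= rho -> `|om a z| <= C}.
    by apply: cid; apply: (bounded_on_ball rr) => z Bz; exact: Ck_cont (C0 a) Bz.
  have H2 a : {C | forall z, `|z - c| <= rho -> `|'D_(e b) (om a) z| <= C}.
    by apply: cid; apply: (bounded_on_ball rr) => z Bz; exact: Ck_cont (C1 b a) Bz.
  (* The sum of all individual bounds serves as a common bound for the finitely many components. *)
  exists (\sum_a (`|sval (H1 a)| + `|sval (H2 a)|)) => z a zr; rewrite (bigD1 a) //=.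
  have S0 : 0 <= \sum_(i < n | i != a) (`|sval (H1 i)| + `|sval (H2 i)|).
    by apply: sumr_ge0 => i _; rewrite addr_ge0.
  have B1 := svalP (H1 a) z zr; have B2 := svalP (H2 a) z zr.
  have N1 := ler_norm (sval (H1 a)); have N2 := ler_norm (sval (H2 a)).
  have P1 := normr_ge0 (sval (H1 a)); have P2 := normr_ge0 (sval (H2 a)).
  have N3 := le_trans B1 N1; have N4 := le_trans B2 N2.
  split; first by rewrite -addrA ler_wpDr // addr_ge0.
  by rewrite addrAC ler_wpDl // addr_ge0.
apply: is_derive_of_line.
have := @leibniz_rule R (fun s t => K t (s *: e b + x)) (fun s t => dK b t (s *: e b + x)) d
  (\sum_(a < n) C * rho + C) d0.
have FT : \int[mu]_(t in `[0, 1]) dK b t (0 *: e b + x) = om b x.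
  rewrite scale0r add0r.
  have dF (t : R) : 0 <= t <= 1 -> is_derive t (1 : R) (fun t => t * om b (seg t x)) (dK b t x).
    move=> t01; have Bs := seg_ball t01 Bx.
    have Df : differentiable (om b) (seg t x) by exact: Ck1_differentiable oB (Ck_1 (om_smooth b)) Bs.
    have isg (i : 'I_n) : is_derive t (1 : R) (fun t => seg t x 0 i) (x 0 i - c 0 i).
      have -> : (fun t => seg t x 0 i) = (fun t => c 0 i + t * (x 0 i - c 0 i)).
        by apply/funext => y; rewrite !mxE.
      have h2 := isd_mul (is_derive_id t (1 : R)) (is_derive_cst (x 0 i - c 0 i) t (1 : R)).
      have h3 := isd_add (is_derive_cst (c 0 i) t (1 : R)) h2.
      by apply: (is_derive_eq h3); rewrite mulr0 mulr1 !add0r.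
    have Dseg i : differentiable (fun t => seg t x 0 i) t.
      by apply/derivable1_diffP; case: (isg i).
    have [D1 D2] := derive_comp_row (1 : R) Dseg Df.
    have I2 : is_derive t (1 : R) (fun t => om b (seg t x)) (\sum_a (x 0 a - c 0 a) * 'D_(e a) (om b) (seg t x)).
      apply: DeriveDef; first exact: (diff_derivable D1).
      rewrite D2 (Ck1_derive _ oB (Ck_1 (om_smooth b)) Bs); apply: eq_bigr => a _.
      by rewrite mxE; case: (isg a) => _ ->.
    have I3 := isd_mul (is_derive_id t (1 : R)) I2; apply: (is_derive_eq I3).
    rewrite /dK mulr1 mulr_sumr; congr (_ + _); apply: eq_bigr => a _.
    by rewrite (om_closed a b Bs); ring.
  rewrite (ftc01 dF); first by rewrite mul0r subr0 mul1r /seg scale1r addrC subrK.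
  move=> t t01; apply: cont_at_add; last exact: cont_comp_seg.
  apply: cont_at_sum => a _; apply: cont_at_mul; last exact: cont_at_cst.
  by apply: cont_at_mul; [exact: cvg_id|exact: (cont_comp_seg t01 Bx (C1 b a))].
rewrite FT; apply.
- move=> s t /in_ball Bs t01; apply: cont_at_sum => a _.
  by apply: cont_at_mul; [exact: cont_comp_seg|exact: cont_at_cst].
- move=> s t /in_ball Bs t01; case: (isd_K b t01 Bs) => D <-.
  exact: is_derive_line D.
- move=> s t /in_rho Hs t01.
  have Hseg := le_trans (seg_norm (s *: e b + x) t01) Hs.
  rewrite (le_trans (ler_normD _ _)) // lerD //; last by case: (HC _ b Hseg).
  rewrite (le_trans (ler_norm_sum _ _ _)) // ler_sum // => a _.
  have [_ B2] := HC _ a Hseg; have C00 : 0 <= C by apply: le_trans B2.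
  rewrite normrM ler_pM //.
    rewrite normrM -[C]mul1r ler_pM //.
    by move: t01 => /andP[t0 t1]; rewrite ger0_norm.
  apply: le_trans Hs; have := coord_norm_le (s *: e b + x - c) a; by rewrite !mxE.
Qed.

End Poincare.

(** * The implicit function theorem for one equation *)

Section ImplicitFunction.
Context {R : realType} {n : nat}.
Variables (i0 : 'I_n.+1).
Implicit Types (y : 'rV[R]_n) (s : R).
Local Notation e a := (delta_mx 0 a).

Definition insert_coord y s : 'rV[R]_n.+1 :=
  \row_a (if unlift i0 a is Some j then y 0 j else s).

Lemma insert_coord_lift y s j : insert_coord y s 0 (lift i0 j) = y 0 j.
Proof. by rewrite mxE liftK. Qed.

Lemma insert_coord_at y s : insert_coord y s 0 i0 = s.
Proof. by rewrite mxE unlift_none. Qed.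

Lemma insert_coordB y y' s s' : insert_coord y s - insert_coord y' s' = insert_coord (y - y') (s - s').
Proof. by apply/rowP => a; rewrite !mxE; case: unliftP => [j|] _; rewrite ?mxE. Qed.

Lemma insert_coord_norm y s : `|insert_coord y s| <= Num.max `|y| `|s|.
Proof.
apply/mx_norm_le; first by rewrite le_max normr_ge0.
move=> a; rewrite mxE; case: unliftP => [j|] _; rewrite le_max ?lexx ?orbT //.
by rewrite coord_norm_le.
Qed.

Lemma insert_coord_shift y s (h : R) : insert_coord y (h + s) = h *: e i0 + insert_coord y s.
Proof.
apply/rowP => a; rewrite !mxE; case: unliftP => [j|] ->.
  by rewrite eq_sym (negbTE (neq_lift i0 j)) mulr0 add0r.
by rewrite !eqxx mulr1.
Qed.

Lemma insert_coord_shiftl y s (h : R) j :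
  insert_coord (h *: e j + y) s = h *: e (lift i0 j) + insert_coord y s.
Proof.
apply/rowP => a; rewrite !mxE; case: unliftP => [k|] ->; rewrite ?mxE.
  by rewrite (inj_eq (@lift_inj _ i0)).
by rewrite (negbTE (neq_lift i0 j)) mulr0 add0r.
Qed.

Variables (x0 : 'rV[R]_n.+1) (r : R) (u : 'rV[R]_n.+1 -> R).
Hypothesis r0 : 0 < r.
Hypothesis u_smooth : forall k, Ck k (ball x0 r) u.
Hypothesis u_pos : forall x, ball x0 r x -> 0 < 'D_(e i0) u x.

Let y0 : 'rV[R]_n := \row_j x0 0 (lift i0 j).
Let s0 := x0 0 i0.

Let x0E : x0 = insert_coord y0 s0.
Proof. by apply/rowP => a; rewrite !mxE; case: unliftP => [j|] ->; rewrite ?mxE. Qed.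

Let oB : open (ball x0 r). Proof. exact: ball_open. Qed.

Let in_ball y s : `|y - y0| < r -> `|s - s0| < r -> ball x0 r (insert_coord y s).
Proof.
move=> yr sr; apply/ball_rV; rewrite x0E insert_coordB.
by apply: (le_lt_trans (insert_coord_norm _ _)); rewrite gt_max yr.
Qed.

(** The identity gives monotonicity of [u] in the distinguished coordinate; the distance bound makes
    the intermediate points converge when the implicit function is differentiated. *)
Let monoE y s (h : R) : `|y - y0| < r -> `|s - s0| < r -> `|h + s - s0| < r ->
  exists2 x, ball x0 r x & u (insert_coord y (h + s)) - u (insert_coord y s) = h * 'D_(e i0) u x
    /\ `|x - insert_coord y s| <= `|h|.
Proof.
move=> yr sr hr.
case: (leP 0 h) => h0.
- have hyp t : 0 <= t <= h -> `|t + s - s0| < r.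
    move=> /andP[t0 th]; move: sr hr; rewrite !ltr_norml => /andP[a1 a2] /andP[b1 b2].
    by apply/andP; split; lra.
  have := @MVT_segment R (fun t => u (t *: e i0 + insert_coord y s))
     (fun t => 'D_(e i0) u (t *: e i0 + insert_coord y s)) 0 h h0.
  have dd t : 0 <= t <= h -> is_derive t (1 : R) (fun t => u (t *: e i0 + insert_coord y s))
      ('D_(e i0) u (t *: e i0 + insert_coord y s)).
    move=> th; apply: is_derive_line; rewrite -insert_coord_shift.
    by case: (CkS_isd i0 (u_smooth 1) (in_ball yr (hyp t th))).
  case.
  + by move=> t; rewrite in_itv /= => /andP[t0 th]; apply: dd; rewrite !ltW.
  + apply: derivable_within_continuous => t; rewrite in_itv /= => th.
    by case: (dd t th).
  move=> t; rewrite in_itv /= => th; rewrite scale0r add0r subr0 mulrC insert_coord_shift => E.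
  exists (t *: e i0 + insert_coord y s).
    by rewrite -insert_coord_shift; apply: in_ball => //; exact: hyp.
  split; first exact: E.
  rewrite addrK -[t *: _]addr0; have -> : t *: e i0 + 0 = insert_coord 0 (t + 0) :> 'rV[R]_n.+1.
    rewrite insert_coord_shift; congr (_ + _); apply/rowP => a; rewrite !mxE.
    by case: unliftP => [j|] _; rewrite ?mxE.
  apply: (le_trans (insert_coord_norm _ _)); rewrite normr0 addr0 ge_max normr_ge0 /=.
  by move/andP: th => [t0 th]; rewrite !ger0_norm.
- have hyp t : h <= t <= 0 -> `|t + s - s0| < r.
    move=> /andP[t0 th]; move: sr hr; rewrite !ltr_norml => /andP[a1 a2] /andP[b1 b2].
    by apply/andP; split; lra.
  have := @MVT_segment R (fun t => u (t *: e i0 + insert_coord y s))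
     (fun t => 'D_(e i0) u (t *: e i0 + insert_coord y s)) h 0 (ltW h0).
  have dd t : h <= t <= 0 -> is_derive t (1 : R) (fun t => u (t *: e i0 + insert_coord y s))
      ('D_(e i0) u (t *: e i0 + insert_coord y s)).
    move=> th; apply: is_derive_line; rewrite -insert_coord_shift.
    by case: (CkS_isd i0 (u_smooth 1) (in_ball yr (hyp t th))).
  case.
  + by move=> t; rewrite in_itv /= => /andP[t0 th]; apply: dd; rewrite !ltW.
  + apply: derivable_within_continuous => t; rewrite in_itv /= => th.
    by case: (dd t th).
  move=> t; rewrite in_itv /= => th; rewrite scale0r add0r sub0r mulrN mulrC insert_coord_shift => E.
  exists (t *: e i0 + insert_coord y s).
    by rewrite -insert_coord_shift; apply: in_ball => //; exact: hyp.
  split; first by rewrite -[LHS]opprB E opprK.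
  rewrite addrK -[t *: _]addr0; have -> : t *: e i0 + 0 = insert_coord 0 (t + 0) :> 'rV[R]_n.+1.
    rewrite insert_coord_shift; congr (_ + _); apply/rowP => a; rewrite !mxE.
    by case: unliftP => [j|] _; rewrite ?mxE.
  apply: (le_trans (insert_coord_norm _ _)); rewrite normr0 addr0 ge_max normr_ge0 /=.
  by move/andP: th => [t0 th]; rewrite !ler0_norm ?lerN2 // ltW.
Qed.

Let mono y s s' : `|y - y0| < r -> `|s - s0| < r -> `|s' - s0| < r -> s < s' ->
  u (insert_coord y s) < u (insert_coord y s').
Proof.
move=> yr sr s'r ss'; have := @monoE y s (s' - s) yr sr; rewrite subrK => /(_ s'r).
move=> [x Bx [E _]]; rewrite -subr_gt0 E mulr_gt0 //; first by rewrite subr_gt0.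
exact: u_pos.
Qed.

Let ucont x : ball x0 r x -> {for x, continuous u}.
Proof. exact: Ck_cont (u_smooth 0). Qed.

Lemma insert_coord_cont s y : {for y, continuous (fun y => insert_coord y s)}.
Proof.
apply: cont_at_row => a; case: (unliftP i0 a) => [j|] ->.
  have -> : (fun y => insert_coord y s 0 (lift i0 j)) = (fun y : 'rV[R]_n => y 0 j).
    by apply/funext => z; rewrite insert_coord_lift.
  exact: cont_at_coord.
have -> : (fun y => insert_coord y s 0 i0) = (fun=> s).
  by apply/funext => z; rewrite insert_coord_at.
exact: cont_at_cst.
Qed.

Lemma insert_coord_cont2 s y : {for s, continuous (fun s => insert_coord y s)}.
Proof.
apply: cont_at_row => a; case: (unliftP i0 a) => [j|] ->.
  have -> : (fun s => insert_coord y s 0 (lift i0 j)) = (fun=> y 0 j).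
    by apply/funext => z; rewrite insert_coord_lift.
  exact: cont_at_cst.
have -> : (fun s => insert_coord y s 0 i0) = id.
  by apply/funext => z; rewrite insert_coord_at.
exact: cvg_id.
Qed.

Let near_gt y s (v : R) : `|y - y0| < r -> `|s - s0| < r -> v < u (insert_coord y s) ->
  \forall y' \near y, v < u (insert_coord y' s).
Proof.
move=> yr sr h.
have C : {for y, continuous (fun y => u (insert_coord y s))}.
  apply: (@cont_at_comp _ _ _ (fun y => insert_coord y s) u); first exact: insert_coord_cont.
  by apply: ucont; exact: in_ball.
have := C; move=> /(_ [set t | v < t]); apply.
exact: lt_nbhsr.
Qed.

Let near_lt y s (v : R) : `|y - y0| < r -> `|s - s0| < r -> u (insert_coord y s) < v ->
  \forall y' \near y, u (insert_coord y' s) < v.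
Proof.
move=> yr sr h.
have C : {for y, continuous (fun y => u (insert_coord y s))}.
  apply: (@cont_at_comp _ _ _ (fun y => insert_coord y s) u); first exact: insert_coord_cont.
  by apply: ucont; exact: in_ball.
have := C; move=> /(_ [set t | t < v]); apply.
exact: lt_nbhsl.
Qed.

(** Above [y0] the values of [u] at s0 - h and s0 + h lie strictly on the two sides of u x0, and by
    continuity still do above nearby y; the intermediate value theorem gives a solution, and strict
    monotonicity pins it to [s0] above [y0]. *)
Lemma implicit_exists : exists (eps : R) (phi : 'rV[R]_n -> R),
  [/\ 0 < eps, eps <= r, phi y0 = s0 & forall y, ball y0 eps y ->
    `|phi y - s0| < r /\ u (insert_coord y (phi y)) = u x0].
Proof.
pose h := r / 2; have h0 : 0 < h by rewrite divr_gt0.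
have hr : h < r by rewrite /h ltr_pdivrMr // ltr_pMr // ltr1n.
have y0r : `|y0 - y0| < r by rewrite subrr normr0.
have s0r : `|s0 - s0| < r by rewrite subrr normr0.
have sp : `|s0 + h - s0| < r by rewrite addrC addKr gtr0_norm.
have sm : `|s0 - h - s0| < r by rewrite addrC addKr normrN gtr0_norm.
have up : u x0 < u (insert_coord y0 (s0 + h)) by rewrite {1}x0E; apply: mono => //; rewrite ltrDl.
have um : u (insert_coord y0 (s0 - h)) < u x0 by rewrite {1}x0E; apply: mono => //; rewrite gtrBl.
have := near_and (near_gt y0r sp up) (near_lt y0r sm um).
move=> /nbhs_ballP[eps /= eps0 Heps].
pose eps' := Num.min eps r.
have e0 : 0 < eps' by rewrite lt_min eps0.
have sol y : ball y0 eps' y -> exists s, `|s - s0| < r /\ u (insert_coord y s) = u x0.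
  move=> /ball_rV; rewrite lt_min => /andP[ye yr].
  have [H1 H2] : u x0 < u (insert_coord y (s0 + h)) /\ u (insert_coord y (s0 - h)) < u x0.
    by apply: Heps; apply/ball_rV.
  have le1 : s0 - h <= s0 + h by lra.
  have cw : {within `[s0 - h, s0 + h], continuous (fun s => u (insert_coord y s))}.
    apply: cont_at_within => s hs.
    apply: (@cont_at_comp _ _ _ (fun s => insert_coord y s) u); first exact: insert_coord_cont2.
    apply: ucont; apply: in_ball => //; move/andP: hs => [hs1 hs2]; rewrite ltr_norml.
    by apply/andP; split; lra.
  have [] := @IVT R _ _ _ (u x0) le1 cw.
    by rewrite ge_min le_max (ltW H2) (ltW H1) orbT.
  move=> s; rewrite in_itv /= => /andP[hs1 hs2] E; exists s; split => //.
  by rewrite ltr_norml; apply/andP; split; lra.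
exists eps', (fun y => if pselect (ball y0 eps' y) is left H then sval (cid (sol y H)) else 0).
split => //.
- by rewrite ge_min lexx orbT.
- case: pselect => [H|]; last by case; exact: ballxx.
  have [Hr Hu] := svalP (cid (sol y0 H)); set s := sval _ in Hr Hu *.
  case: (ltrgtP s s0) => // lt; exfalso.
    by have := mono y0r Hr s0r lt; rewrite -x0E Hu ltxx.
  by have := mono y0r s0r Hr lt; rewrite -x0E Hu ltxx.
- move=> y By; case: pselect => // H; exact: (svalP (cid (sol y H))).
Qed.

Variables (eps : R) (phi : 'rV[R]_n -> R).
Hypothesis eps_r : eps <= r.
Hypothesis phiP : forall y, ball y0 eps y ->
    `|phi y - s0| < r /\ u (insert_coord y (phi y)) = u x0.

Let yr y : ball y0 eps y -> `|y - y0| < r.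
Proof. by move=> /ball_rV ye; exact: lt_le_trans eps_r. Qed.

Let oE : open (ball y0 eps). Proof. exact: ball_open. Qed.

Let phi_cont y : ball y0 eps y -> {for y, continuous phi}.
Proof.
move=> By; have [pr pu] := phiP By.
apply: cont_at_eps => d d0.
(* Halving makes [d'] strictly smaller than d and keeps phi y - d' and phi y + d' in the range where
   [u] is monotone; the level value is then trapped between them for nearby y'. *)
pose d' := Num.min d ((r - `|phi y - s0|)) / 2.
have d'0 : 0 < d' by rewrite divr_gt0 // lt_min d0 subr_gt0.
have d'd : d' < d.
  have : Num.min d (r - `|phi y - s0|) <= d by rewrite ge_min lexx.
  by move=> h; rewrite /d' ltr_pdivrMr //; apply: (le_lt_trans h); lra.
have d'r : `|phi y - s0| + d' < r.
  have : Num.min d (r - `|phi y - s0|) <= r - `|phi y - s0| by rewrite ge_min lexx orbT.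
  move=> h; have : d' <= (r - `|phi y - s0|) / 2 by rewrite /d' ler_pM2r // invr_gt0.
  by move=> h2; lra.
have sp : `|phi y + d' - s0| < r.
  by rewrite addrAC (le_lt_trans (ler_normD _ _)) // (gtr0_norm d'0).
have sm : `|phi y - d' - s0| < r.
  by rewrite addrAC (le_lt_trans (ler_normB _ _)) // (gtr0_norm d'0).
have up : u x0 < u (insert_coord y (phi y + d')) by rewrite -pu; apply: mono; rewrite ?ltrDl //; exact: yr.
have um : u (insert_coord y (phi y - d')) < u x0 by rewrite -pu; apply: mono; rewrite ?gtrBl //; exact: yr.
have := near_and (near_open oE By) (near_and (near_gt (yr By) sp up) (near_lt (yr By) sm um)).
apply: near_mono => y' [By' [H1 H2]]; have [pr' pu'] := phiP By'.
have L1 : phi y' < phi y + d'.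
  rewrite ltNge le_eqVlt; apply/negP => /orP[/eqP E|lt].
    by move: H1; rewrite E pu' ltxx.
  by have := mono (yr By') sp pr' lt; rewrite pu' ltNge (ltW H1).
have L2 : phi y - d' < phi y'.
  rewrite ltNge le_eqVlt; apply/negP => /orP[/eqP E|lt].
    by move: H2; rewrite -E pu' ltxx.
  by have := mono (yr By') pr' sm lt; rewrite pu' ltNge (ltW H2).
by rewrite ltr_norml; apply/andP; split; lra.
Qed.

Let psi y := insert_coord y (phi y).
Let psi_ball y : ball y0 eps y -> ball x0 r (psi y).
Proof. by move=> By; have [pr _] := phiP By; apply: in_ball => //; exact: yr. Qed.

Lemma cont_at_line (V : normedModType R) (v y : V) (s : R) :
  {for s, continuous (fun h : R => h *: v + y)}.
Proof. by apply: cvgD; [apply: cvgZr_tmp; exact: cvg_id|exact: cvg_cst]. Qed.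

(** The level equation at y and at y + h e_j, split into a move in direction j and one in direction
    i0, gives by two mean value theorems a linear relation between h and the increment of [phi],
    with coefficients at points close to psi y. *)
Let phi_increment y j : ball y0 eps y -> \forall h \near (0 : R),
  exists xi : 'rV[R]_n.+1 * 'rV[R]_n.+1,
  [/\ ball x0 r xi.1, ball x0 r xi.2, `|xi.1 - psi y| <= `|h|,
   `|xi.2 - psi y| <= `|h| + `|phi (h *: e j + y) - phi y| &
   h * 'D_(e (lift i0 j)) u xi.1 + (phi (h *: e j + y) - phi y) * 'D_(e i0) u xi.2 = 0].
Proof.
move=> By; have [pr pu] := phiP By; have yr' := yr By.
have ne (m : nat) (l : 'I_m) : `|(e l : 'rV[R]_m)| <= 1 :> R.
  apply/mx_norm_le => // c; rewrite mxE; case: eqP => _ /=; last by rewrite normr0.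
  by case: eqP => _; rewrite ?normr0 ?normr1.
have N1 : \forall h \near (0 : R), ball y0 eps (h *: e j + y).
  have C := @cont_at_line _ (e j : 'rV[R]_n) y 0.
  have B0 : ball y0 eps ((0 : R) *: e j + y) by rewrite scale0r add0r.
  exact: (C _ (near_open oE B0)).
have N2 : \forall h \near (0 : R), `|h| < r - `|y - y0|.
  by apply: nbhs0_lt; rewrite subr_gt0.
apply: near_mono (near_and N1 N2) => h [By' hr].
have [pr' pu'] := phiP By'; have yr'' := yr By'.
have inb s : `|s| <= `|h| -> ball x0 r (s *: e (lift i0 j) + psi y).
  move=> sh; rewrite /psi -insert_coord_shiftl; apply: in_ball => //.
  rewrite -addrA (le_lt_trans (ler_normD _ _)) //.
  have : `|s *: e j : 'rV[R]_n| <= `|h|.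
    by rewrite normrZ -[leRHS]mulr1 ler_pM ?ne.
  by move=> H; rewrite -ltrBrDr (le_lt_trans H).
have [s sh E1] : exists2 s : R, `|s| <= `|h| & u (h *: e (lift i0 j) + psi y) - u (psi y)
    = h * 'D_(e (lift i0 j)) u (s *: e (lift i0 j) + psi y).
  apply: (@MVT_line R _ u (psi y) (e (lift i0 j)) h) => s /inb Bs.
  by case: (CkS_isd (lift i0 j) (u_smooth 1) Bs).
have := @monoE (h *: e j + y) (phi y) (phi (h *: e j + y) - phi y) yr'' pr.
rewrite subrK => /(_ pr') [x Bx [E2 xh]].
exists (s *: e (lift i0 j) + psi y, x); split => //=.
- by apply: inb.
- by rewrite addrK normrZ -[leRHS]mulr1 ler_pM ?ne.
- have -> : x - psi y = (x - insert_coord (h *: e j + y) (phi y)) + h *: e (lift i0 j).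
    by rewrite insert_coord_shiftl -/(psi y) opprD; apply/rowP => a; rewrite !mxE; ring.
  rewrite (le_trans (ler_normD _ _)) // addrC lerD //.
  by rewrite normrZ -[leRHS]mulr1 ler_pM ?ne.
rewrite -E1 -E2 pu' /psi pu insert_coord_shiftl -/(psi y); ring.
Qed.

Let phi_isd y j : ball y0 eps y ->
  is_derive y (e j) phi (- 'D_(e (lift i0 j)) u (psi y) * ('D_(e i0) u (psi y))^-1).
Proof.
move=> By; have inc := phi_increment j By.
pose P h (xi : 'rV[R]_n.+1 * 'rV[R]_n.+1) := [/\ ball x0 r xi.1, ball x0 r xi.2, `|xi.1 - psi y| <= `|h|,
   `|xi.2 - psi y| <= `|h| + `|phi (h *: e j + y) - phi y| &
   h * 'D_(e (lift i0 j)) u xi.1 + (phi (h *: e j + y) - phi y) * 'D_(e i0) u xi.2 = 0].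
(* A choice of intermediate points for every h. At h = 0 the distance bounds force both to be psi y,
   so the quotient [q] below is continuous at 0 with the expected value. *)
pose xi h := xget (psi y, psi y) [set z | P h z].
have xiP : \forall h \near (0 : R), P h (xi h).
  by apply: near_mono inc => h [z Hz]; apply: xgetPex; exists z.
have xi0 : xi 0 = (psi y, psi y).
  have [_ _ H1 H2 _] := near_at xiP.
  move: H1 H2; rewrite scale0r add0r subrr !normr0 addr0 !normr_le0 !subr_eq0 => /eqP H1 /eqP H2.
  by rewrite [xi 0]surjective_pairing H1 H2.
have dphi0 d : 0 < d -> \forall h \near (0 : R), `|phi (h *: e j + y) - phi y| < d.
  move=> d0; have C : {for (0 : R), continuous (fun h : R => phi (h *: e j + y))}.
    apply: (@cont_at_comp _ _ _ (fun h : R => h *: e j + y) phi); first exact: cont_at_line.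
    by rewrite scale0r add0r; exact: phi_cont.
  have := cont_at_near d0 C; apply: near_mono => h; by rewrite scale0r add0r distrC.
have Ck1 a : Ck 0 (ball x0 r) (fun x => 'D_(e a) u x) by apply: CkS_derive; exact: u_smooth.
have cA1 : {for (0 : R), continuous (fun h => 'D_(e (lift i0 j)) u (xi h).1)}.
  apply: cont_at_eps => d d0.
  have := cont_at_near d0 (Ck_cont (Ck1 (lift i0 j)) (psi_ball By)).
  move=> /nbhs_ballP[del /= del0 Hd]; rewrite xi0 /=.
  have Nh : \forall h \near (0 : R), `|h| < del by exact: nbhs0_lt.
  apply: near_mono (near_and xiP Nh) => h [[_ _ H _ _] hd]; apply: Hd.
  by apply/ball_rV; exact: le_lt_trans hd.
have cB1 : {for (0 : R), continuous (fun h => 'D_(e i0) u (xi h).2)}.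
  apply: cont_at_eps => d d0.
  have := cont_at_near d0 (Ck_cont (Ck1 i0) (psi_ball By)).
  move=> /nbhs_ballP[del /= del0 Hd]; rewrite xi0 /=.
  have del2 : 0 < del / 2 by rewrite divr_gt0.
  have Nh : \forall h \near (0 : R), `|h| < del / 2 by exact: nbhs0_lt.
  apply: near_mono (near_and xiP (near_and Nh (dphi0 _ del2))) => h [[_ _ _ H _] [hd pd]]; apply: Hd.
  by apply/ball_rV; apply: (le_lt_trans H); rewrite [ltRHS]splitr ltrD.
pose q h := - 'D_(e (lift i0 j)) u (xi h).1 * ('D_(e i0) u (xi h).2)^-1.
have cq : {for (0 : R), continuous q}.
  apply: cont_at_mul; first exact: cont_at_opp.
  apply: cont_at_inv => //; rewrite xi0 /= gt_eqF //.
  by apply: u_pos; exact: psi_ball.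
have q0 : q 0 = - 'D_(e (lift i0 j)) u (psi y) * ('D_(e i0) u (psi y))^-1 by rewrite /q xi0.
have L : (fun h : R => h^-1 *: (phi (h *: e j + y) - phi y)) @ 0^' --> q 0.
  have : q @ 0^' --> q 0 by exact: cvg_trans (cvg_app _ (@nbhs_dnbhs _ (0 : R))) cq.
  apply: cvg_trans; apply: near_eq_cvg; near=> h.
  have h0 : h != 0 by near: h; exact: nbhs_dnbhs_neq.
  have [_ B2 _ _ E] : P h (xi h) by near: h; exact: nbhs_dnbhs.
  have B20 : 'D_(e i0) u (xi h).2 != 0 by rewrite gt_eqF // u_pos.
  rewrite /q; apply: (mulfI h0); apply: (mulIf B20).
  rewrite [h * (h^-1 *: _)]mulrA divff // mul1r mulNr mulrN mulNr -!mulrA mulVf // mulr1.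
  by apply/eqP; rewrite -subr_eq0 -opprD oppr_eq0 E.
rewrite -q0; apply: DeriveDef; first by apply/cvg_ex; exists (q 0).
exact: cvg_lim L.
Unshelve. all: by end_near. Qed.

(** Bootstrapping: the derivative of [phi] is a smooth expression in psi y, that is in y and phi y,
    so C^k implies C^(k+1). *)
Let phi_smooth k : Ck k (ball y0 eps) phi.
Proof.
elim: k => [|k IH]; first by split => // y; exact: phi_cont.
apply: (@CkS_intro _ _ _ _ _ (fun j y => - ('D_(e (lift i0 j)) u \o psi) y * (('D_(e i0) u \o psi) y)^-1)) => //.
  by move=> j y By; exact: phi_isd.
have Cpsi b : Ck k (ball y0 eps) (fun y => psi y 0 b).
  case: (unliftP i0 b) => [j|] ->.
    by apply: Ck_ext (Ck_coord k j oE) => // y _; rewrite insert_coord_lift.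
  by apply: Ck_ext IH => // y _; rewrite insert_coord_at.
have CD a : Ck k (ball y0 eps) ('D_(e a) u \o psi).
  exact: (Ck_comp oE oB psi_ball Cpsi (CkS_derive a (u_smooth k.+1))).
move=> j; apply: Ck_mul => //; first exact: Ck_opp.
by apply: Ck_inv => // y By; rewrite gt_eqF //= u_pos //; exact: psi_ball.
Qed.

Lemma implicit_smooth : (forall k, Ck k (ball y0 eps) phi) /\
  forall y, ball y0 eps y -> ball x0 r (insert_coord y (phi y)).
Proof. by split; [exact: phi_smooth|exact: psi_ball]. Qed.

End ImplicitFunction.

Lemma implicit_function (R : realType) (n : nat) (i0 : 'I_n.+1) (x0 : 'rV[R]_n.+1) (r : R)
    (u : 'rV[R]_n.+1 -> R) : 0 < r -> (forall k, Ck k (ball x0 r) u) ->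
  (forall x, ball x0 r x -> 0 < 'D_(delta_mx 0 i0) u x) ->
  let y0 : 'rV[R]_n := \row_j x0 0 (lift i0 j) in
  exists (eps : R) (phi : 'rV[R]_n -> R),
  [/\ 0 < eps, phi y0 = x0 0 i0, forall k, Ck k (ball y0 eps) phi &
    forall y, ball y0 eps y -> ball x0 r (insert_coord i0 y (phi y)) /\
      u (insert_coord i0 y (phi y)) = u x0].
Proof.
move=> r0 Cu up y0; have [eps [phi [e0 er p0 pP]]] := implicit_exists r0 Cu up.
have [C1 C2] := implicit_smooth Cu up er pP.
by exists eps, phi; split => // y By; split; [exact: C2|have [] := pP y By].
Qed.

(** * Smooth functions on a manifold, chart by chart *)

Section CkLocal.
Context {R : realType} {n : nat}.
Local Notation e a := (delta_mx 0 a : 'rV[R]_n).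

(** [Ck] constrains derivatives in the full space at each point of the set, so it is a condition
    point by point, and the local sets [B] may be arbitrary. *)
Lemma Ck_local k (A : set 'rV[R]_n) (f : 'rV[R]_n -> R) :
  (forall x, A x -> exists B : set 'rV[R]_n, B x /\ Ck k B f) -> Ck k A f.
Proof.
elim: k f => [|k IH] f H.
  by split=> // x Ax; have [B [Bx CB]] := H x Ax; exact: Ck_cont CB Bx.
split=> [x Ax|a]; first by have [B [Bx CB]] := H x Ax; exact: Ck_cont CB Bx.
split=> [x Ax|]; first by have [B [Bx CB]] := H x Ax; case: (CkS_isd a CB Bx).
by apply: IH => x Ax; have [B [Bx CB]] := H x Ax; exists B; split => //; exact: CkS_derive.
Qed.

End CkLocal.

Section SmoothFunctions.
Context {R : realType} {n : nat} {M : manifold R n}.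
Implicit Types (i j : chart_index M) (p q : M) (f g : M -> R) (U V : set M).
Local Notation e a := (delta_mx 0 a : 'rV[R]_n).
Local Notation dom i := (cdom (atlas i)).
Local Notation xm i := (cmap (atlas i)).
Local Notation xi i := (cinv (atlas i)).

Definition loc i U := xm i @` (dom i `&` U).

Lemma locP i U x : loc i U x <-> exists p, [/\ dom i p, U p, xm i p = x & xi i x = p].
Proof.
split=> [[p [ip Up] <-]|[p [ip Up <- _]]]; last by exists p.
by exists p; split => //; rewrite cmapK.
Qed.

Lemma loc_intro i U p : dom i p -> U p -> loc i U (xm i p).
Proof. by move=> ip Up; exists p. Qed.

Lemma near_cinv i p (P : M -> Prop) : dom i p -> (\forall q \near p, P q) ->
  \forall x \near xm i p, P (xi i x).
Proof.
move=> ip NP; have cx : (xm i @` dom i) (xm i p) by exists p.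
have C := cinv_cont cx; rewrite -{1}(cmapK ip) in NP.
exact: (C _ NP).
Qed.

Lemma near_cdom i p : dom i p -> \forall q \near p, dom i q.
Proof. by move=> ip; apply: near_open => //; exact: cdom_open. Qed.

Lemma near_cmap i p (P : 'rV[R]_n -> Prop) : dom i p -> (\forall x \near xm i p, P x) ->
  \forall q \near p, P (xm i q).
Proof. by move=> ip NP; exact: (cmap_cont ip NP). Qed.

Lemma near_cmapK i p : dom i p -> \forall x \near xm i p, dom i (xi i x) /\ xm i (xi i x) = x.
Proof.
move=> ip; have N : \forall x \near xm i p, (xm i @` dom i) x.
  by apply: near_open; [exact: cimg_open|exists p].
by apply: near_mono N => x [q iq <-]; rewrite cmapK.
Qed.

Lemma open_loc i U : open U -> open (loc i U).
Proof.
move=> oU; rewrite openE => x [p [ip Up] <-].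
have N1 := near_cinv ip (near_open oU Up).
apply: near_mono (near_and N1 (near_cmapK ip)) => y [Uy [iy <-]].
exact: loc_intro.
Qed.

Arguments open_loc i {U} _.

Lemma smooth_on_sub U V f : V `<=` U -> smooth_on U f -> smooth_on V f.
Proof.
move=> VU Uf i k; apply: Ck_sub (Uf i k) => x [p [ip /VU Up] <-].
exact: loc_intro.
Qed.

Lemma smooth_on_local U f :
  (forall p, U p -> exists V, V p /\ smooth_on V f) -> smooth_on U f.
Proof.
move=> H i k; apply: Ck_local => x [p [ip Up] <-]; have [V [Vp Vf]] := H p Up.
by exists (loc i V); split; [exact: loc_intro|exact: Vf].
Qed.

Lemma smooth_on_ext U f g : open U -> (forall p, U p -> f p = g p) ->
  smooth_on U f -> smooth_on U g.
Proof.
move=> oU fg Uf i k; apply: Ck_ext (Uf i k); first exact: open_loc.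
by move=> x /locP[p [ip Up _ xp]] /=; rewrite xp fg.
Qed.

(** In another chart j the function is its expression in chart i precomposed with the transition
    map, which is smooth. *)
Lemma smooth_on_chart i U f : open U -> U `<=` dom i ->
  (forall k, Ck k (loc i U) (f \o xi i)) -> smooth_on U f.
Proof.
move=> oU Ui Cf j k; have oi : open (dom i) := @cdom_open _ _ _ _.
have o1 := open_loc j oU.
apply: (@Ck_ext _ _ _ _ ((f \o xi i) \o (fun x => xm i (xi j x)))) => //.
  by move=> x /locP[p [jp Up _ xp]] /=; rewrite xp cmapK //; exact: Ui.
apply: (@Ck_comp _ _ _ _ _ (loc i U)) => //; first exact: open_loc.
  by move=> x /locP[p [jp Up _ ->]]; apply: loc_intro => //; exact: Ui.
move=> a; apply: Ck_sub (@transition_smooth _ _ M j i a k) => x [p [jp Up] <-].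
by exists p => //; split => //; exact: Ui.
Qed.

Lemma smooth_on_cst U (c : R) : smooth_on U (fun=> c).
Proof. by move=> i k; exact: Ck_cst. Qed.

Lemma smooth_on_add U f g : open U -> smooth_on U f -> smooth_on U g ->
  smooth_on U (fun p => f p + g p).
Proof. by move=> oU Uf Ug i k; apply: Ck_add; [exact: open_loc|exact: Uf|exact: Ug]. Qed.

Lemma smooth_on_mul U f g : open U -> smooth_on U f -> smooth_on U g ->
  smooth_on U (fun p => f p * g p).
Proof. by move=> oU Uf Ug i k; apply: Ck_mul; [exact: open_loc|exact: Uf|exact: Ug]. Qed.

Lemma smooth_on_opp U f : open U -> smooth_on U f -> smooth_on U (fun p => - f p).
Proof. by move=> oU Uf i k; apply: Ck_opp; [exact: open_loc|exact: Uf]. Qed.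

Lemma smooth_on_sum (I : Type) (r : seq I) (P : pred I) (F : I -> M -> R) U : open U ->
  (forall a, P a -> smooth_on U (F a)) -> smooth_on U (fun p => \sum_(a <- r | P a) F a p).
Proof.
move=> oU UF i k.
apply: (@Ck_sum _ _ I r P (fun a => F a \o xi i)); first exact: open_loc.
by move=> a Pa; exact: UF.
Qed.

Lemma smooth_on_inv U f : open U -> (forall p, U p -> f p != 0) -> smooth_on U f ->
  smooth_on U (fun p => (f p)^-1).
Proof.
move=> oU f0 Uf i k; apply: Ck_inv; [exact: open_loc| |exact: Uf].
by move=> x /locP[p [_ Up _ xp]] /=; rewrite xp; exact: f0.
Qed.

Lemma smooth_on_comp1 (H : (R -> R) -> Prop) (I : set R) U (h : R -> R) f : open U ->
  (forall h, H h -> exists2 h', H h' & forall t, I t -> is_derive t 1 h (h' t)) ->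
  (forall p, U p -> I (f p)) -> H h -> smooth_on U f -> smooth_on U (fun p => h (f p)).
Proof.
move=> oU HH fI Hh Uf i k; apply: (@Ck_comp1 _ _ H I k _ h (f \o xi i)) => //.
- exact: open_loc.
- by move=> x /locP[p [_ Up _ xp]] /=; rewrite xp; exact: fI.
- exact: Uf.
Qed.

Lemma smooth_on_coord i (a : 'I_n) : smooth_on (dom i) (coord i a).
Proof.
have oi : open (dom i) := @cdom_open _ _ _ _.
apply: (@smooth_on_chart i) => //.
move=> k; apply: Ck_ext (Ck_coord k a (open_loc i oi)); first exact: open_loc.
by move=> x /locP[p [_ Up <- xp]] /=; rewrite /coord xp.
Qed.

(** The germ version of smoothness; statements about derivatives at one point ask for no more than
    this. *)
Definition smooth_at f p := exists U, [/\ open U, U p & smooth_on U f].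

Lemma smooth_at_coord i (a : 'I_n) p : dom i p -> smooth_at (coord i a) p.
Proof. by move=> ip; exists (dom i); split => //; [exact: cdom_open|exact: smooth_on_coord]. Qed.

Lemma smooth_at_mul f g p : smooth_at f p -> smooth_at g p -> smooth_at (fun q => f q * g q) p.
Proof.
move=> [U [oU Up Uf]] [V [oV Vp Vg]]; exists (U `&` V); split => //; first exact: openI.
by apply: smooth_on_mul; [exact: openI|apply: smooth_on_sub Uf => ? []|apply: smooth_on_sub Vg => ? []].
Qed.

Lemma smooth_at_ext f g p : (\forall q \near p, f q = g q) -> smooth_at f p -> smooth_at g p.
Proof.
move=> /near_exists_open[V [oV Vp fg]] [U [oU Up Uf]]; exists (U `&` V); split => //; first exact: openI.
apply: (@smooth_on_ext _ f); [exact: openI|by move=> q [_ /fg]|].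
by apply: smooth_on_sub Uf => ? [].
Qed.

Lemma smooth_on_of_at U f : (forall p, U p -> smooth_at f p) -> smooth_on U f.
Proof. by move=> H; apply: smooth_on_local => p /H[V [_ Vp Vf]]; exists V. Qed.

Lemma smooth_at_near f p : smooth_at f p -> \forall q \near p, smooth_at f q.
Proof. by move=> [U [oU Up Uf]]; apply: near_mono (near_open oU Up) => q Uq; exists U. Qed.

Lemma smooth_at_diff i f p : smooth_at f p -> dom i p -> differentiable (f \o xi i) (xm i p).
Proof.
move=> [U [oU Up Uf]] ip; apply: (Ck1_differentiable (open_loc i oU) (Uf i 1%N)).
exact: loc_intro.
Qed.

Lemma smooth_at_cont f p : smooth_at f p -> {for p, continuous f}.
Proof.
move=> Sf; pose i := chart_at p; have ip : dom i p := mem_chart_at p.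
have cf := differentiable_continuous (smooth_at_diff Sf ip).
have cg : {for p, continuous ((f \o xi i) \o xm i)}.
  by apply: cont_at_comp; [exact: cmap_cont|exact: cf].
apply: cont_at_ext cg; apply: near_mono (near_cdom ip) => q iq.
by rewrite /= cmapK.
Qed.

End SmoothFunctions.

Arguments open_loc {R n M} i {U} _.

Notation dom i := (cdom (atlas i)).

(** * Tangent vectors as derivations *)

Section Derivations.
Context {R : realType} {n : nat} {M : manifold R n}.
Implicit Types (i j : chart_index M) (p q : M) (f g : M -> R) (U V : set M) (v w : 'rV[R]_n).
Local Notation e a := (delta_mx 0 a : 'rV[R]_n).
Local Notation xm i := (cmap (atlas i)).
Local Notation xi i := (cinv (atlas i)).

Lemma der_isd f p v : smooth_at f p ->
  is_derive (xm (chart_at p) p) v (f \o xi (chart_at p)) (der f p v).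
Proof.
move=> Sf; apply: DeriveDef => //; apply: diff_derivable.
exact: (smooth_at_diff Sf (mem_chart_at p)).
Qed.

Let fcmapK f p : (f \o xi (chart_at p)) (xm (chart_at p) p) = f p.
Proof. by rewrite /= cmapK //; exact: mem_chart_at. Qed.

Lemma der_add f g p v : smooth_at f p -> smooth_at g p ->
  der (fun q => f q + g q) p v = der f p v + der g p v.
Proof. by move=> Sf Sg; case: (isd_add (der_isd v Sf) (der_isd v Sg)). Qed.

Lemma der_opp f p v : smooth_at f p -> der (fun q => - f q) p v = - der f p v.
Proof. by move=> Sf; case: (isd_opp (der_isd v Sf)). Qed.

Lemma der_mul f g p v : smooth_at f p -> smooth_at g p ->
  der (fun q => f q * g q) p v = f p * der g p v + g p * der f p v.
Proof. by move=> Sf Sg; case: (isd_mul (der_isd v Sf) (der_isd v Sg)) => _; rewrite !fcmapK. Qed.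

Lemma der_cst (c : R) p v : der (fun _ : M => c) p v = 0.
Proof. exact: derive_cst. Qed.

Lemma der_sum (I : Type) (r : seq I) (P : pred I) (F : I -> M -> R) p v :
  (forall a, P a -> smooth_at (F a) p) ->
  der (fun q => \sum_(a <- r | P a) F a q) p v = \sum_(a <- r | P a) der (F a) p v.
Proof.
move=> SF.
by have [] := @isd_sum _ _ I r P (fun a => F a \o xi (chart_at p)) (fun a => der (F a) p v)
  (xm (chart_at p) p) v (fun a Pa => der_isd v (SF a Pa)).
Qed.

Lemma der_ext f g p v : (\forall q \near p, f q = g q) -> der f p v = der g p v.
Proof.
by move=> fg; apply: near_eq_derive; exact: (near_cinv (mem_chart_at p) fg).
Qed.

Lemma der_linear f p : smooth_at f p -> forall (c : R) v w,
  der f p (c *: v + w) = c * der f p v + der f p w.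
Proof.
move=> Sf c v w; apply: derive_linear.
exact: (smooth_at_diff Sf (mem_chart_at p)).
Qed.

Lemma der0 f p : der f p 0 = 0.
Proof. exact: derive0. Qed.

Lemma derD f p v w : smooth_at f p -> der f p (v + w) = der f p v + der f p w.
Proof. by move=> Sf; have := der_linear Sf 1 v w; rewrite scale1r mul1r. Qed.

Lemma derZ f p (c : R) v : smooth_at f p -> der f p (c *: v) = c * der f p v.
Proof. by move=> Sf; have := der_linear Sf c v 0; rewrite der0 !addr0. Qed.

Lemma der_sumv (I : Type) (r : seq I) (P : pred I) (F : I -> 'rV[R]_n) f p : smooth_at f p ->
  der f p (\sum_(a <- r | P a) F a) = \sum_(a <- r | P a) der f p (F a).
Proof.
move=> Sf; apply: (big_morph (der f p)) => [v w|]; last exact: der0.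
exact: derD.
Qed.

(** Tangent vectors at p are stored in the chart [chart_at p], which may jump from point to point,
    so the raw rows of a smooth field need not even be continuous. [comp_in i] rewrites them in a
    fixed chart i; [vec_in i] is the inverse translation. *)
Definition comp_in i p v : 'rV[R]_n := \row_a der (coord i a) p v.

Lemma der_chart i f p v : smooth_at f p -> dom i p ->
  der f p v = 'D_(comp_in i p v) (f \o xi i) (xm i p).
Proof.
move=> Sf ip; pose c := chart_at p; have cp : dom c p := mem_chart_at p.
have dF a : differentiable (fun x => (xm i \o xi c) x 0 a) (xm c p).
  exact: (smooth_at_diff (smooth_at_coord a ip) cp).
have xip : (xm i \o xi c) (xm c p) = xm i p by rewrite /= cmapK.
have df : differentiable (f \o xi i) ((xm i \o xi c) (xm c p)).
  by rewrite xip; exact: smooth_at_diff.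
have [_ E] := derive_comp_row v dF df.
rewrite xip in E; rewrite /comp_in /der -/c -E; apply: near_eq_derive.
have := near_cinv cp (near_cdom ip); apply: near_mono => x ix.
by rewrite /= cmapK.
Qed.

Definition dchart i f (a : 'I_n) : M -> R := fun q => 'D_(e a) (f \o xi i) (xm i q).

Lemma der_dchart i f p v : smooth_at f p -> dom i p ->
  der f p v = \sum_a comp_in i p v 0 a * dchart i f a p.
Proof.
move=> Sf ip; rewrite (der_chart v Sf ip); have [U [oU Up Uf]] := Sf.
by rewrite (Ck1_derive _ (open_loc i oU) (Uf i 1%N) (loc_intro ip Up)).
Qed.

Lemma smooth_on_dchart i f (a : 'I_n) U : open U -> smooth_on U f ->
  smooth_on (U `&` dom i) (dchart i f a).
Proof.
move=> oU Uf; have oi : open (dom i) := @cdom_open _ _ _ _.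
have oUi := openI oU oi.
apply: (@smooth_on_chart _ _ _ i) => //.
move=> k; apply: (@Ck_ext _ _ _ _ (fun x => 'D_(e a) (f \o xi i) x)); first exact: open_loc.
  by move=> x /locP[p [_ _ xp E]]; rewrite /dchart /= E xp.
apply: CkS_derive; apply: Ck_sub (Uf i k.+1) => x [p [ip [Up _]] <-]; exact: loc_intro.
Qed.

Lemma comp_in_self p v : comp_in (chart_at p) p v = v.
Proof.
apply/rowP => a; rewrite mxE /der.
have [_ <-] := isd_coord (xm (chart_at p) p) v a.
apply: near_eq_derive; apply: near_mono (near_cmapK (mem_chart_at p)) => x [_ E].
by rewrite /coord /= E.
Qed.

Definition vec_in i p w : 'rV[R]_n :=
  \row_b 'D_w (coord (chart_at p) b \o xi i) (xm i p).

Lemma vec_inK i p w : dom i p -> comp_in i p (vec_in i p w) = w.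
Proof.
move=> ip; pose c := chart_at p; have cp : dom c p := mem_chart_at p.
apply/rowP => a; rewrite mxE.
have dF b : differentiable (fun x => (xm c \o xi i) x 0 b) (xm i p).
  exact: (smooth_at_diff (smooth_at_coord b cp) ip).
have xip : (xm c \o xi i) (xm i p) = xm c p by rewrite /= cmapK.
have df : differentiable (coord i a \o xi c) ((xm c \o xi i) (xm i p)).
  by rewrite xip; exact: (smooth_at_diff (smooth_at_coord a ip) cp).
have [_ E] := derive_comp_row w dF df.
rewrite xip in E; rewrite /vec_in /der -/c; apply: (etrans (esym E)).
have [_ <-] := isd_coord (xm i p) w a.
apply: near_eq_derive.
apply: near_mono (near_and (near_cmapK ip) (near_cinv ip (near_cdom cp))) => x [[_ E1] E2].
by rewrite /coord /= cmapK // E1.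
Qed.

Lemma vec_in_linear i p (c : R) v w : dom i p ->
  vec_in i p (c *: v + w) = c *: vec_in i p v + vec_in i p w.
Proof.
move=> ip; apply/rowP => b; rewrite !mxE derive_linear //.
exact: (smooth_at_diff (smooth_at_coord b (mem_chart_at p)) ip).
Qed.

Lemma comp_inK i p v : dom i p -> vec_in i p (comp_in i p v) = v.
Proof.
move=> ip; apply/rowP => b; rewrite -[in RHS](comp_in_self p v) mxE [RHS]mxE.
by rewrite (der_chart v (smooth_at_coord b (mem_chart_at p)) ip).
Qed.

Lemma der_vec_in i f p w : smooth_at f p -> dom i p ->
  der f p (vec_in i p w) = \sum_a w 0 a * dchart i f a p.
Proof. by move=> Sf ip; rewrite (der_dchart _ Sf ip) vec_inK. Qed.

Definition smooth_vfield_on U (X : M -> 'rV[R]_n) :=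
  forall i a, smooth_on (dom i `&` U) (fun p => der (coord i a) p (X p)).

Lemma smooth_vfieldT X : smooth_vfield X <-> smooth_vfield_on setT X.
Proof. by split=> H i a; have := H i a; rewrite ?setIT. Qed.

(** Near p the derivative is a sum of products of the components of X and the partial derivatives of
    f, all in the single chart [chart_at p] kept fixed. *)
Lemma smooth_vfield_on_der U X f : open U -> smooth_vfield_on U X -> smooth_on U f ->
  smooth_on U (fun p => der f p (X p)).
Proof.
move=> oU SX Uf; apply: smooth_on_of_at => p Up; pose i := chart_at p.
have oi : open (dom i) := @cdom_open _ _ _ _.
have oUi := openI oU oi.
exists (U `&` dom i); split => //; first by split => //; exact: mem_chart_at.
apply: (@smooth_on_ext _ _ _ _ (fun q => \sum_a comp_in i q (X q) 0 a * dchart i f a q)) => //.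
  by move=> q [Uq iq]; rewrite -der_dchart //; exists U.
apply: smooth_on_sum => // a _; apply: smooth_on_mul => //; last exact: smooth_on_dchart.
rewrite setIC; apply: smooth_on_ext (SX i a); first by rewrite setIC.
by move=> q _; rewrite mxE.
Qed.

Lemma smooth_vfield_on_vec_in i U (F : 'I_n -> M -> R) : open U -> U `<=` dom i ->
  (forall a, smooth_on U (F a)) -> smooth_vfield_on U (fun q => vec_in i q (\row_a F a q)).
Proof.
move=> oU Ui SF j b; have oj : open (dom j) := @cdom_open _ _ _ _.
have oUj := openI oj oU.
apply: (@smooth_on_ext _ _ _ _ (fun q => \sum_a F a q * dchart i (coord j b) a q)) => //.
  move=> q [jq Uq]; rewrite der_vec_in //; [|exact: smooth_at_coord|exact: Ui].
  by apply: eq_bigr => a _; rewrite mxE.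
apply: smooth_on_sum => // a _; apply: smooth_on_mul => //.
  by apply: smooth_on_sub (SF a) => q [].
apply: smooth_on_sub (smooth_on_dchart i a oj (@smooth_on_coord _ _ _ j b)) => q [jq Uq].
by split => //; exact: Ui.
Qed.

End Derivations.

(** * Bump functions, tensoriality and the Lie bracket *)

Section VectorFields.
Context {R : realType} {n : nat} {M : manifold R n}.
Implicit Types (i j : chart_index M) (p q : M) (f g : M -> R) (U V : set M) (v w : 'rV[R]_n)
  (X Y Z : M -> 'rV[R]_n).
Local Notation e a := (delta_mx 0 a : 'rV[R]_n).
Local Notation xm i := (cmap (atlas i)).
Local Notation xi i := (cinv (atlas i)).

Lemma tangent_ext p v w :
  (forall a, der (coord (chart_at p) a) p v = der (coord (chart_at p) a) p w) -> v = w.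
Proof.
by move=> H; rewrite -(comp_in_self p v) -(comp_in_self p w); apply/rowP => a; rewrite !mxE.
Qed.

(** The closed set C inside U that contains the support is part of the statement: a product with the
    bump is then smooth near every point, either in U or in the complement of C. *)
Lemma bump_at U p : open U -> U p -> exists (chi : M -> R) (C : set M),
  [/\ smooth_on setT chi, \forall q \near p, chi q = 1, closed C, C `<=` U &
   forall q, chi q != 0 -> C q].
Proof.
move=> oU Up; pose i := chart_at p; have ip : dom i p := mem_chart_at p.
have oi : open (dom i) := @cdom_open _ _ _ _.
have := near_open (open_loc i oU) (loc_intro ip Up).
move=> /nbhs_ballP[r /= r0 Hr]; pose x0 := xm i p.
(* The bump is 1 on the cube of radius r / 4 and supported in radius r / 2, inside the coordinate
   ball of radius r. *)
have r4 : 0 < r / 4 by rewrite divr_gt0.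
have [chi0 [S0 one0 supp0]] := cube_bump x0 r4.
pose K := [set x : 'rV[R]_n | `|x - x0| <= 2 * (r / 4)].
have Kloc x : K x -> loc i U x.
  move=> Kx; apply: Hr; apply/ball_rV; apply: (le_lt_trans Kx).
  by rewrite mulrA ltr_pdivrMr // mulrC ltr_pM2l // ltr_nat.
have cK : compact K.
  apply: bounded_closed_compact.
    exists (2 * (r / 4) + `|x0|); split; first exact: num_real.
    move=> N HN x Kx; apply: (le_trans _ (ltW HN)).
    by rewrite -[x](subrK x0) (le_trans (ler_normD _ _)) // lerD2r.
  have -> : K = (fun x => `|x - x0|) @^-1` [set t | t <= 2 * (r / 4)] by [].
  apply: preimage_closed; last exact: closed_le.
  by move=> x _; apply: continuous_comp; [exact: cvgB cvg_id (cvg_cst _)|exact: norm_continuous].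
pose C := xi i @` K.
(* The compact coordinate cube has compact image, and compact sets are closed because the manifold
   is Hausdorff. *)
have cC : closed C.
  apply: compact_closed; first exact: hausdorff_points.
  apply: continuous_compact => //; apply: continuous_in_subspaceT => x; rewrite inE => /Kloc[q [iq _] <-].
  by apply: cinv_cont; exists q.
have CU q : C q -> dom i q /\ U q.
  by move=> [x /Kloc/locP[q' [iq Uq _ ->]] <-].
pose chi q := if asbool (dom i q) then chi0 (xm i q) else 0.
have chiE q : dom i q -> chi q = chi0 (xm i q) by move=> iq; rewrite /chi asboolT.
have suppC q : chi q != 0 -> C q.
  rewrite /chi; case: asboolP => [iq h|_]; last by rewrite eqxx.
  by exists (xm i q); [exact: supp0|rewrite cmapK].
exists chi, C; split => //.
- apply: smooth_on_local => q _; case: (pselect (C q)) => [/CU[iq _]|nC].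
    exists (dom i); split => //; apply: (@smooth_on_chart _ _ _ i) => // k.
    apply: (@Ck_ext _ _ _ _ chi0); first exact: open_loc.
      by move=> x /locP[q' [iq' _ <- E]] /=; rewrite E chiE.
    by apply: Ck_sub (S0 k).
  exists (~` C); split => //.
  have oC : open (~` C) by rewrite openC.
  apply: (@smooth_on_ext _ _ _ _ (fun=> 0)) => //; last exact: smooth_on_cst.
  by move=> q' nC'; apply/esym/eqP; apply: contrapT => /negP/suppC.
- have N : \forall x \near xm i p, chi0 x = 1.
    have Nb : \forall x \near xm i p, ball x0 (r / 4) x by apply: near_open; [exact: ball_open|exact: ballxx].
    by apply: near_mono Nb => x /ball_rV H; apply: one0; rewrite ltW.
  by apply: near_mono (near_and (near_cdom ip) (near_cmap ip N)) => q [iq E]; rewrite chiE.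
- by move=> q /CU[].
Qed.

Section Cutoff.
Variables (U : set M) (chi : M -> R) (C : set M).
Hypotheses (oU : open U) (Schi : smooth_on setT chi) (cC : closed C) (CU : C `<=` U)
  (supp : forall q, chi q != 0 -> C q).

Lemma cutoff_smooth f V : open V -> smooth_on (V `&` U) f -> smooth_on V (fun q => chi q * f q).
Proof.
move=> oV Sf; apply: smooth_on_local => q Vq; case: (pselect (C q)) => [/CU Uq|nC].
  exists (V `&` U); split => //; apply: smooth_on_mul => //; first exact: openI.
  by apply: smooth_on_sub Schi.
exists (~` C); split => //.
have oC : open (~` C) by rewrite openC.
apply: (@smooth_on_ext _ _ _ _ (fun=> 0)) => //; last exact: smooth_on_cst.
move=> q' nC'; suff -> : chi q' = 0 by rewrite mul0r.
by apply/eqP; apply: contrapT => /negP/supp.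
Qed.

Lemma cutoff_vfield X : smooth_vfield_on U X -> smooth_vfield (fun q => chi q *: X q).
Proof.
move=> SX i a; have oi : open (dom i) := @cdom_open _ _ _ _.
apply: (@smooth_on_ext _ _ _ _ (fun q => chi q * der (coord i a) q (X q))) => //.
  by move=> q iq; rewrite derZ //; exact: smooth_at_coord.
by apply: cutoff_smooth => //; exact: SX.
Qed.

End Cutoff.

Lemma extend_vfield U p X : open U -> U p -> smooth_vfield_on U X ->
  exists Y, smooth_vfield Y /\ \forall q \near p, Y q = X q.
Proof.
move=> oU Up Sf; have [chi [C [S1 S2 S3 S4 S5]]] := bump_at oU Up.
exists (fun q => chi q *: X q); split; first exact: (cutoff_vfield oU S1 S3 S4 S5).
by apply: near_mono S2 => q ->; rewrite scale1r.
Qed.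

Lemma smooth_vfield_der X f : smooth_vfield X -> smooth_on setT f ->
  smooth_on setT (fun p => der f p (X p)).
Proof. by move=> /smooth_vfieldT SX Sf; apply: smooth_vfield_on_der SX Sf; exact: openT. Qed.

Lemma smooth_at_der X f p : smooth_vfield X -> smooth_at f p ->
  smooth_at (fun q => der f q (X q)) p.
Proof.
move=> SX [U [oU Up Uf]]; exists U; split => //.
apply: smooth_vfield_on_der => // i a; apply: smooth_on_sub (SX i a) => q [].
by [].
Qed.

Lemma smooth_at_global f p : smooth_on setT f -> smooth_at f p.
Proof. by exists setT; split => //; exact: openT. Qed.

Lemma smooth_vfield_ext X Y : (forall p, X p = Y p) -> smooth_vfield X -> smooth_vfield Y.
Proof. by move=> XY; have -> : Y = X by apply/funext => p. Qed.

Lemma smooth_vfield_add X Y : smooth_vfield X -> smooth_vfield Y -> smooth_vfield (X \+ Y).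
Proof.
move=> SX SY i a; have oi : open (dom i) := @cdom_open _ _ _ _.
apply: (@smooth_on_ext _ _ _ _ (fun p => der (coord i a) p (X p) + der (coord i a) p (Y p))) => //.
  by move=> q iq; rewrite derD //; exact: smooth_at_coord.
exact: (smooth_on_add oi (SX i a) (SY i a)).
Qed.

Lemma smooth_vfield_scale f X : smooth_on setT f -> smooth_vfield X ->
  smooth_vfield (fun q => f q *: X q).
Proof.
move=> Sf SX i a; have oi : open (dom i) := @cdom_open _ _ _ _.
apply: (@smooth_on_ext _ _ _ _ (fun p => f p * der (coord i a) p (X p))) => //.
  by move=> q iq; rewrite derZ //; exact: smooth_at_coord.
exact: (smooth_on_mul oi (smooth_on_sub (@subsetT _ _) Sf) (SX i a)).
Qed.

Lemma smooth_vfield_opp X : smooth_vfield X -> smooth_vfield (fun q => - X q).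
Proof.
move=> SX; apply: (@smooth_vfield_ext (fun q => -1 *: X q)) => [p|]; first by rewrite scaleN1r.
by apply: smooth_vfield_scale => //; exact: smooth_on_cst.
Qed.

Lemma smooth_vfield_sub X Y : smooth_vfield X -> smooth_vfield Y -> smooth_vfield (X \- Y).
Proof. by move=> SX SY; exact: (smooth_vfield_add SX (smooth_vfield_opp SY)). Qed.

Lemma smooth_vfield0 : smooth_vfield (fun _ : M => 0).
Proof.
move=> i a; apply: (@smooth_on_ext _ _ _ _ (fun=> 0)); first exact: cdom_open.
  by move=> q _; rewrite der0.
exact: smooth_on_cst.
Qed.

Lemma smooth_vfield_sum (I : Type) (r : seq I) (P : pred I) (F : I -> M -> 'rV[R]_n) :
  (forall a, P a -> smooth_vfield (F a)) -> smooth_vfield (fun p => \sum_(a <- r | P a) F a p).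
Proof.
move=> SF; elim: r => [|a r IH].
  by apply: smooth_vfield_ext smooth_vfield0 => p; rewrite big_nil.
case: (boolP (P a)) => Pa.
  by apply: smooth_vfield_ext (smooth_vfield_add (SF a Pa) IH) => p; rewrite big_cons Pa.
by apply: smooth_vfield_ext IH => p; rewrite big_cons (negbTE Pa).
Qed.

Section Tensorial.
Variables (W : lmodType R) (Phi : (M -> 'rV[R]_n) -> W) (p : M).
Hypothesis PhiD : forall X Y, smooth_vfield X -> smooth_vfield Y -> Phi (X \+ Y) = Phi X + Phi Y.
Hypothesis PhiZ : forall f X, smooth_on setT f -> smooth_vfield X ->
  Phi (fun q => f q *: X q) = f p *: Phi X.

Lemma tensorial_sum (I : Type) (r : seq I) (F : I -> M -> 'rV[R]_n) :
  (forall a, smooth_vfield (F a)) -> Phi (fun q => \sum_(a <- r) F a q) = \sum_(a <- r) Phi (F a).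
Proof.
move=> SF; elim: r => [|a r IH].
  have -> : (fun q => \sum_(a <- [::]) F a q) = (fun q => 0 *: (fun=> 0 : 'rV[R]_n) q).
    by apply/funext => q; rewrite big_nil scale0r.
  by rewrite PhiZ ?scale0r ?big_nil //; [exact: smooth_on_cst|exact: smooth_vfield0].
have -> : (fun q => \sum_(b <- a :: r) F b q) = F a \+ (fun q => \sum_(b <- r) F b q).
  by apply/funext => q; rewrite big_cons.
have Sr : smooth_vfield (fun q => \sum_(b <- r) F b q) by apply: smooth_vfield_sum => b _; exact: SF.
by rewrite big_cons -IH; exact: (PhiD (SF a) Sr).
Qed.

(** Globally chi^2 X is the sum over a of (chi X^a)(chi d_a): one factor chi extends the
    coefficients, the other the coordinate fields. At p the coefficients vanish and chi = 1, so Phi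
    X = Phi (chi^2 X) = 0. *)
Lemma tensorial0 X : smooth_vfield X -> X p = 0 -> Phi X = 0.
Proof.
move=> SX Xp; pose i := chart_at p; have ip : dom i p := mem_chart_at p.
have oi : open (dom i) := @cdom_open _ _ _ _.
have [chi [C [S1 S2 S3 S4 S5]]] := bump_at oi ip.
have chip : chi p = 1 := near_at S2.
pose E (a : 'I_n) q := chi q *: vec_in i q (\row_b (a == b)%:R).
pose c (a : 'I_n) q := chi q * der (coord i a) q (X q).
have SE a : smooth_vfield (E a).
  apply: (cutoff_vfield oi S1 S3 S4 S5).
  by apply: (@smooth_vfield_on_vec_in _ _ _ i _ (fun b _ => (a == b)%:R)) => // b; exact: smooth_on_cst.
have Sc a : smooth_on setT (c a).
  by apply: (cutoff_smooth oi S1 S3 S4 S5 openT); rewrite setTI; exact: SX.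
have XE : (fun q => (chi q * chi q) *: X q) = (fun q => \sum_a c a q *: E a q).
  apply/funext => q; case: (eqVneq (chi q) 0) => [c0|cn0].
    by rewrite c0 mul0r scale0r big1 // => a _; rewrite /c c0 mul0r scale0r.
  have iq : dom i q by apply: S4; exact: S5.
  have XqE : X q = vec_in i q (comp_in i q (X q)) by rewrite comp_inK.
  rewrite {1}XqE.
  have -> : comp_in i q (X q) = \sum_a der (coord i a) q (X q) *: (\row_b (a == b)%:R).
    apply/rowP => b; rewrite mxE summxE (bigD1 b) //= !mxE eqxx mulr1 big1 ?addr0 // => a ab.
    by rewrite !mxE (negbTE ab) mulr0.
  have lin : {morph vec_in i q : v w / v + w}.
    by move=> v w; have := vec_in_linear 1 v w iq; rewrite !scale1r.
  have linZ k v : vec_in i q (k *: v) = k *: vec_in i q v.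
    have z0 : vec_in i q 0 = 0 by apply: (addrI (vec_in i q 0)); rewrite -lin !addr0.
    by have := vec_in_linear k v 0 iq; rewrite z0 !addr0.
  have z0 : vec_in i q 0 = 0 by apply: (addrI (vec_in i q 0)); rewrite -lin !addr0.
  rewrite (big_morph _ lin z0) scaler_sumr; apply: eq_bigr => a _.
  by rewrite linZ /c /E !scalerA; congr (_ *: _); ring.
have : Phi (fun q => (chi q * chi q) *: X q) = Phi X.
  rewrite PhiZ //; first by rewrite chip mul1r scale1r.
  by apply: smooth_on_mul => //; exact: openT.
rewrite XE tensorial_sum => [<-|a]; last exact: smooth_vfield_scale.
by apply: big1 => a _; rewrite PhiZ // /c Xp der0 mulr0 scale0r.
Qed.

Lemma tensorial_eq X Y : smooth_vfield X -> smooth_vfield Y -> X p = Y p -> Phi X = Phi Y.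
Proof.
move=> SX SY XY; have SYX : smooth_vfield (X \- Y) by exact: smooth_vfield_sub.
have -> : X = Y \+ (X \- Y) by apply/funext => q /=; rewrite addrC subrK.
by rewrite PhiD // [Phi (X \- Y)]tensorial0 ?addr0 //= XY subrr.
Qed.

End Tensorial.

Lemma extend_vector p v : exists X, smooth_vfield X /\ X p = v.
Proof.
pose i := chart_at p; have ip : dom i p := mem_chart_at p.
have oi : open (dom i) := @cdom_open _ _ _ _.
have [|X [SX XE]] := @extend_vfield (dom i) p (fun q => vec_in i q (\row_a comp_in i p v 0 a)) oi ip.
  by apply: smooth_vfield_on_vec_in => // a; exact: smooth_on_cst.
exists X; split => //; rewrite (near_at XE).
have -> : \row_a comp_in i p v 0 a = comp_in i p v by apply/rowP => a; rewrite mxE.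
by rewrite comp_inK.
Qed.

Lemma dchart_sym i f p (a b : 'I_n) : smooth_at f p -> dom i p ->
  dchart i (dchart i f a) b p = dchart i (dchart i f b) a p.
Proof.
move=> [U [oU Up Uf]] ip.
have E c : \forall x \near xm i p, (dchart i f c \o xi i) x = 'D_(e c) (f \o xi i) x.
  by apply: near_mono (near_cmapK ip) => x [_ E]; rewrite /= /dchart E.
rewrite {1 3}/dchart (near_eq_derive _ (E a)) (near_eq_derive _ (E b)).
exact: (schwarz _ _ (open_loc i oU) (Uf i 2%N) (loc_intro ip Up)).
Qed.

Lemma smooth_at_dchart i f p (a : 'I_n) : smooth_at f p -> dom i p -> smooth_at (dchart i f a) p.
Proof.
move=> [U [oU Up Uf]] ip; exists (U `&` dom i); split => //; last exact: smooth_on_dchart.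
by apply: openI => //; exact: cdom_open.
Qed.

Lemma sum_bracket_aux (m : nat) (c x y PX PY u dx dy : 'I_m -> R) :
  (forall a, c a = dy a - dx a) -> \sum_a y a * PX a = \sum_a x a * PY a ->
  \sum_a c a * u a = \sum_a (y a * PX a + u a * dy a) - \sum_a (x a * PY a + u a * dx a).
Proof.
move=> E H; rewrite !big_split /= H opprD addrACA subrr add0r -sumrB.
by apply: eq_bigr => a _; rewrite E; ring.
Qed.

Lemma jacobi_aux (phi : 'rV[R]_n -> R) (L1 L2 L3 : 'rV[R]_n) (zyx zxy yxz xyz xzy yzx : R) :
  phi 0 = 0 -> (forall v w, phi (v + w) = phi v + phi w) ->
  phi L1 = zyx - zxy - (yxz - xyz) -> phi L2 = xzy - xyz - (zyx - yzx) ->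
  phi L3 = yxz - yzx - (xzy - zxy) -> phi (L1 + L2 + L3) = phi 0.
Proof. move=> p0 pD E1 E2 E3; rewrite !pD E1 E2 E3 p0; ring. Qed.

(** [lie] is defined through the coordinates of one chart. Expanding f in that chart, the second
    derivatives of f cancel by Schwarz, and the rest is the commutator on coordinate functions. *)
Lemma der_lie X Y f p : smooth_vfield X -> smooth_vfield Y -> smooth_at f p ->
  der f p (lie X Y p) = der (fun q => der f q (Y q)) p (X p) - der (fun q => der f q (X q)) p (Y p).
Proof.
move=> SX SY Sf; pose i := chart_at p; have ip : dom i p := mem_chart_at p.
have Sc a Z : smooth_vfield Z -> smooth_at (fun q => der (coord i a) q (Z q)) p.
  by move=> SZ; apply: smooth_at_der => //; exact: smooth_at_coord.
have E Z W : smooth_vfield Z -> der (fun q => der f q (Z q)) p W =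
    \sum_a (der (coord i a) p (Z p) * der (dchart i f a) p W
      + dchart i f a p * der (fun q => der (coord i a) q (Z q)) p W).
  move=> SZ; rewrite (@der_ext _ _ _ _ (fun q => \sum_a der (coord i a) q (Z q) * dchart i f a q)).
    rewrite der_sum => [|a _]; last by apply: smooth_at_mul; [exact: Sc|exact: smooth_at_dchart].
    by apply: eq_bigr => a _; rewrite der_mul //; [exact: Sc|exact: smooth_at_dchart].
  apply: near_mono (near_and (near_cdom ip) (smooth_at_near Sf)) => q [iq Sfq].
  by rewrite (der_dchart _ Sfq iq); apply: eq_bigr => a _; rewrite mxE.
apply: (etrans (der_dchart (lie X Y p) Sf ip)).
apply: (etrans _ (esym (congr2 (fun s t : R => s - t) (E Y (X p) SY) (E X (Y p) SX)))).
(* The pure second-derivative terms of the two sides agree, by symmetry of the coordinate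
   Hessian. *)
have H : \sum_a der (coord i a) p (Y p) * der (dchart i f a) p (X p) =
          \sum_a der (coord i a) p (X p) * der (dchart i f a) p (Y p).
  have D (v w : 'rV[R]_n) : \sum_a der (coord i a) p v * der (dchart i f a) p w =
      \sum_a \sum_b der (coord i a) p v * (der (coord i b) p w * dchart i (dchart i f a) b p).
    apply: eq_bigr => a _; rewrite (der_dchart _ (smooth_at_dchart a Sf ip) ip) mulr_sumr.
    by apply: eq_bigr => b _; rewrite mxE.
  apply: (etrans (D _ _)); apply: (etrans _ (esym (D _ _))).
  rewrite exchange_big; apply: eq_bigr => a _; apply: eq_bigr => b _.
  by rewrite (dchart_sym a b Sf ip); ring.
apply: (@sum_bracket_aux n (fun a => comp_in i p (lie X Y p) 0 a)
  (fun a => der (coord i a) p (X p)) (fun a => der (coord i a) p (Y p))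
  (fun a => der (dchart i f a) p (X p)) (fun a => der (dchart i f a) p (Y p))
  (fun a => dchart i f a p) (fun a => der (fun q => der (coord i a) q (X q)) p (Y p))
  (fun a => der (fun q => der (coord i a) q (Y q)) p (X p)) _ H).
by move=> a; rewrite comp_in_self mxE.
Qed.

Lemma smooth_lie X Y : smooth_vfield X -> smooth_vfield Y -> smooth_vfield (lie X Y).
Proof.
move=> SX SY i a; have oi : open (dom i) := @cdom_open _ _ _ _.
have Si : smooth_on (dom i) (coord i a) by exact: smooth_on_coord.
have Son Z : smooth_vfield Z -> smooth_vfield_on (dom i) Z.
  by move=> SZ j b; apply: smooth_on_sub (SZ j b) => q [].
apply: (@smooth_on_ext _ _ _ _ (fun q => der (fun q => der (coord i a) q (Y q)) q (X q) +
    - der (fun q => der (coord i a) q (X q)) q (Y q))) => //.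
  by move=> q iq; rewrite der_lie //; exact: smooth_at_coord.
apply: smooth_on_add => //; last apply: smooth_on_opp => //.
  exact: (smooth_vfield_on_der oi (Son X SX) (SY i a)).
exact: (smooth_vfield_on_der oi (Son Y SY) (SX i a)).
Qed.

(** Tested on coordinate functions, each double bracket becomes four triple derivatives by
    [der_lie], and the twelve terms cancel in pairs. *)
Lemma jacobi X Y Z p : smooth_vfield X -> smooth_vfield Y -> smooth_vfield Z ->
  lie (lie X Y) Z p + lie (lie Y Z) X p + lie (lie Z X) Y p = 0.
Proof.
move=> SX SY SZ; apply: (@tangent_ext p) => a; set f := coord (chart_at p) a.
have ip : dom (chart_at p) p := mem_chart_at p.
have Sf : smooth_at f p by exact: smooth_at_coord.
have Sd A q : smooth_vfield A -> smooth_at f q -> smooth_at (fun q => der f q (A q)) q.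
  by move=> SA Sq; exact: smooth_at_der.
have E A B C : smooth_vfield A -> smooth_vfield B -> smooth_vfield C ->
   der f p (lie (lie A B) C p) =
    der (fun q => der (fun q => der f q (C q)) q (B q)) p (A p)
    - der (fun q => der (fun q => der f q (C q)) q (A q)) p (B p)
    - (der (fun q => der (fun q => der f q (B q)) q (A q)) p (C p)
       - der (fun q => der (fun q => der f q (A q)) q (B q)) p (C p)).
  move=> SA SB SC; have SAB := smooth_lie SA SB.
  rewrite der_lie // der_lie //; last exact: Sd.
  congr (_ - _).
  rewrite (@der_ext _ _ _ _ (fun q => der (fun q => der f q (B q)) q (A q)
     + - der (fun q => der f q (A q)) q (B q))).
    rewrite der_add ?der_opp //.
    - by apply: smooth_at_der => //; exact: Sd.
    - by apply: smooth_at_der => //; exact: Sd.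
    - apply: (@smooth_at_ext _ _ _ (fun q => -1 * der (fun q => der f q (A q)) q (B q))).
        by apply: near_true => q; rewrite mulN1r.
      apply: smooth_at_mul; first by apply: smooth_at_global; exact: smooth_on_cst.
      by apply: smooth_at_der => //; exact: Sd.
  apply: near_mono (smooth_at_near Sf) => q Sq; by rewrite der_lie.
have fD v w := derD v w Sf.
exact: (jacobi_aux (der0 f p) fD (E X Y Z SX SY SZ) (E Y Z X SY SZ SX) (E Z X Y SZ SX SY)).
Qed.

End VectorFields.

(** * Curvature identities of a torsion-free metric connection, algebraically *)

Section ConnectionAlgebra.
Context {R : realType} {n : nat} {M : Type}.
Variables (SV : (M -> 'rV[R]_n) -> Prop) (SF : (M -> R) -> Prop).
Variables (D : (M -> R) -> M -> 'rV[R]_n -> R).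
Variables (L nb : (M -> 'rV[R]_n) -> (M -> 'rV[R]_n) -> (M -> 'rV[R]_n)).
Variable gi : M -> 'rV[R]_n -> 'rV[R]_n -> R.
Implicit Types (X Y Z W U : M -> 'rV[R]_n) (f : M -> R) (p q : M).

(** The rules obeyed by smooth functions and fields, derivatives, bracket, connection and metric,
    listed over a bare type M: the curvature identities then need no analysis, and smoothness
    conditions are discharged by [auto]. *)
Definition connection_algebra : Prop :=
  [/\ [/\ forall X Y, SV X -> SV Y -> SV (X \+ Y),
       forall f X, SF f -> SV X -> SV (fun q => f q *: X q),
       forall X Y, SV X -> SV Y -> SV (nb X Y),
       forall X Y, SV X -> SV Y -> SV (L X Y) &
       [/\ forall c : R, SF (fun=> c),
        forall f X, SF f -> SV X -> SF (fun p => D f p (X p)) &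
        forall X Y, SV X -> SV Y -> SF (fun p => gi p (X p) (Y p))]],
      [/\ forall f h p v, SF f -> SF h -> D (fun q => f q + h q) p v = D f p v + D h p v,
       forall (c : R) p v, D (fun=> c) p v = 0,
       forall f p (c : R) v w, SF f -> D f p (c *: v + w) = c * D f p v + D f p w,
       forall X Y f p, SV X -> SV Y -> SF f ->
         D f p (L X Y p) = D (fun q => D f q (Y q)) p (X p) - D (fun q => D f q (X q)) p (Y p) &
       forall X Y Z p, SV X -> SV Y -> SV Z ->
         L (L X Y) Z p + L (L Y Z) X p + L (L Z X) Y p = 0],
      [/\ forall X X' Y p, SV X -> SV X' -> SV Y -> nb (X \+ X') Y p = nb X Y p + nb X' Y p,
       forall f X Y p, SF f -> SV X -> SV Y -> nb (fun q => f q *: X q) Y p = f p *: nb X Y p,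
       forall X Y Y' p, SV X -> SV Y -> SV Y' -> nb X (Y \+ Y') p = nb X Y p + nb X Y' p &
       forall f X Y p, SF f -> SV X -> SV Y ->
         nb X (fun q => f q *: Y q) p = D f p (X p) *: Y p + f p *: nb X Y p] &
      [/\ forall X Y p, SV X -> SV Y -> nb X Y p - nb Y X p = L X Y p,
       forall X Y Z p, SV X -> SV Y -> SV Z ->
         D (fun q => gi q (Y q) (Z q)) p (X p) = gi p (nb X Y p) (Z p) + gi p (Y p) (nb X Z p),
       forall p (c : R) v v' w, gi p (c *: v + v') w = c * gi p v w + gi p v' w &
       forall p v w, gi p v w = gi p w v]].

Hypothesis H : connection_algebra.

Let SVadd X Y : SV X -> SV Y -> SV (X \+ Y). Proof. case: H => -[h _ _ _ _] _ _ _; exact: h. Qed.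
Let SVscale f X : SF f -> SV X -> SV (fun q => f q *: X q). Proof. case: H => -[_ h _ _ _] _ _ _; exact: h. Qed.
Let SVnb X Y : SV X -> SV Y -> SV (nb X Y). Proof. case: H => -[_ _ h _ _] _ _ _; exact: h. Qed.
Let SVlie X Y : SV X -> SV Y -> SV (L X Y). Proof. case: H => -[_ _ _ h _] _ _ _; exact: h. Qed.
Let SFcst (c : R) : SF (fun=> c). Proof. case: H => -[_ _ _ _ [h _ _]] _ _ _; exact: h. Qed.
Let SFD f X : SF f -> SV X -> SF (fun p => D f p (X p)). Proof. case: H => -[_ _ _ _ [_ h _]] _ _ _; exact: h. Qed.
Let SFg X Y : SV X -> SV Y -> SF (fun p => gi p (X p) (Y p)). Proof. case: H => -[_ _ _ _ [_ _ h]] _ _ _; exact: h. Qed.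
Let D_add f h p v : SF f -> SF h -> D (fun q => f q + h q) p v = D f p v + D h p v.
Proof. case: H => _ [hh _ _ _ _] _ _; exact: hh. Qed.
Let D_cst (c : R) p v : D (fun=> c) p v = 0. Proof. case: H => _ [_ h _ _ _] _ _; exact: h. Qed.
Let D_lie X Y f p : SV X -> SV Y -> SF f ->
  D f p (L X Y p) = D (fun q => D f q (Y q)) p (X p) - D (fun q => D f q (X q)) p (Y p).
Proof. by case: H => _ [_ _ _ h _] _ _; exact: h. Qed.
Let jac X Y Z p : SV X -> SV Y -> SV Z ->
  L (L X Y) Z p + L (L Y Z) X p + L (L Z X) Y p = 0.
Proof. by case: H => _ [_ _ _ _ h] _ _; exact: h. Qed.
Let nbDl X X' Y p : SV X -> SV X' -> SV Y -> nb (X \+ X') Y p = nb X Y p + nb X' Y p.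
Proof. by case: H => _ _ [h _ _ _] _; exact: h. Qed.
Let nbZl f X Y p : SF f -> SV X -> SV Y -> nb (fun q => f q *: X q) Y p = f p *: nb X Y p.
Proof. by case: H => _ _ [_ h _ _] _; exact: h. Qed.
Let nbDr X Y Y' p : SV X -> SV Y -> SV Y' -> nb X (Y \+ Y') p = nb X Y p + nb X Y' p.
Proof. by case: H => _ _ [_ _ h _] _; exact: h. Qed.
Let nbZr f X Y p : SF f -> SV X -> SV Y ->
  nb X (fun q => f q *: Y q) p = D f p (X p) *: Y p + f p *: nb X Y p.
Proof. by case: H => _ _ [_ _ _ h] _; exact: h. Qed.
Let tors X Y p : SV X -> SV Y -> nb X Y p - nb Y X p = L X Y p.
Proof. by case: H => _ _ _ [h _ _ _]; exact: h. Qed.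
Let compat X Y Z p : SV X -> SV Y -> SV Z ->
  D (fun q => gi q (Y q) (Z q)) p (X p) = gi p (nb X Y p) (Z p) + gi p (Y p) (nb X Z p).
Proof. by case: H => _ _ _ [_ h _ _]; exact: h. Qed.
Let giC p v w : gi p v w = gi p w v.
Proof. by case: H => _ _ _ [_ _ _ h]; exact: h. Qed.
Let gi_lin p (c : R) v v' w : gi p (c *: v + v') w = c * gi p v w + gi p v' w.
Proof. by case: H => _ _ _ [_ _ h _]; exact: h. Qed.

Hint Resolve SVadd SVscale SVnb SVlie SFcst SFD SFg : core.

Let giD p v v' w : gi p (v + v') w = gi p v w + gi p v' w.
Proof. by rewrite -[v]scale1r gi_lin mul1r scale1r. Qed.
Let gi0 p w : gi p 0 w = 0.
Proof. by apply: (addrI (gi p 0 w)); rewrite -giD !addr0. Qed.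
Let giZ p (c : R) v w : gi p (c *: v) w = c * gi p v w.
Proof. by rewrite -[c *: v]addr0 gi_lin gi0 addr0. Qed.
Let giN p v w : gi p (- v) w = - gi p v w.
Proof. by rewrite -scaleN1r giZ mulN1r. Qed.
Let giDr p v v' w : gi p w (v + v') = gi p w v + gi p w v'.
Proof. by rewrite !(giC p w) giD. Qed.
Let giNr p v w : gi p w (- v) = - gi p w v.
Proof. by rewrite !(giC p w) giN. Qed.

Let nbDlE X X' Y : SV X -> SV X' -> SV Y -> nb (X \+ X') Y = nb X Y \+ nb X' Y.
Proof. by move=> *; apply/funext => p; rewrite nbDl. Qed.
Let nbZlE f X Y : SF f -> SV X -> SV Y -> nb (fun q => f q *: X q) Y = (fun q => f q *: nb X Y q).
Proof. by move=> *; apply/funext => p; rewrite nbZl. Qed.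
Let nbDrE X Y Y' : SV X -> SV Y -> SV Y' -> nb X (Y \+ Y') = nb X Y \+ nb X Y'.
Proof. by move=> *; apply/funext => p; rewrite nbDr. Qed.
Let nbZrE f X Y : SF f -> SV X -> SV Y ->
  nb X (fun q => f q *: Y q) = (fun q => D f q (X q) *: Y q) \+ (fun q => f q *: nb X Y q).
Proof. by move=> *; apply/funext => p; rewrite nbZr. Qed.

(** Negation as multiplication by a constant function, so that the rules for products apply to
    it. *)
Let neg X : M -> 'rV[R]_n := fun q => -1 *: X q.
Let SVneg X : SV X -> SV (neg X). Proof. by move=> SX; apply: SVscale. Qed.
Hint Resolve SVneg : core.
Let subE X Y : X \- Y = X \+ neg Y.
Proof. by apply/funext => p; rewrite /neg /= scaleN1r. Qed.
Let SVsub X Y : SV X -> SV Y -> SV (X \- Y). Proof. by move=> *; rewrite subE; auto. Qed.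
Hint Resolve SVsub : core.
Let nbNr X Y p : SV X -> SV Y -> nb X (neg Y) p = - nb X Y p.
Proof. by move=> SX SY; rewrite /neg nbZr // D_cst scale0r add0r scaleN1r. Qed.
Let nbNl X Y p : SV X -> SV Y -> nb (neg X) Y p = - nb X Y p.
Proof. by move=> SX SY; rewrite /neg nbZl // scaleN1r. Qed.
Let nbBr X Y Y' p : SV X -> SV Y -> SV Y' -> nb X (Y \- Y') p = nb X Y p - nb X Y' p.
Proof.
by move=> SX SY SY'; rewrite subE nbDr ?nbNr //; auto.
Qed.
Let nbBl X X' Y p : SV X -> SV X' -> SV Y -> nb (X \- X') Y p = nb X Y p - nb X' Y p.
Proof. by move=> SX SX' SY; rewrite subE nbDl ?nbNl //; auto. Qed.

(** The bodies of [cv] and [dcv] repeat those of [curv] and [dcurv], which makes them equal by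
    conversion once the section is instantiated. *)
Definition cv X Y Z : M -> 'rV[R]_n :=
  nb X (nb Y Z) \- nb Y (nb X Z) \- nb (L X Y) Z.
Definition dcv U X Y Z : M -> 'rV[R]_n :=
  nb U (cv X Y Z) \- cv (nb U X) Y Z \- cv X (nb U Y) Z \- cv X Y (nb U Z).

Lemma cvF X Y Z : cv X Y Z = nb X (nb Y Z) \- nb Y (nb X Z) \- nb (L X Y) Z.
Proof. by []. Qed.
Lemma cvE X Y Z p : cv X Y Z p = nb X (nb Y Z) p - nb Y (nb X Z) p - nb (L X Y) Z p.
Proof. by []. Qed.
Lemma dcvE U X Y Z p : dcv U X Y Z p =
  nb U (cv X Y Z) p - cv (nb U X) Y Z p - cv X (nb U Y) Z p - cv X Y (nb U Z) p.
Proof. by []. Qed.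

Lemma SVcv X Y Z : SV X -> SV Y -> SV Z -> SV (cv X Y Z).
Proof. by move=> *; rewrite /cv; auto 6. Qed.
Hint Resolve SVcv : core.
(* Curvature terms now stay folded under [auto] and [rewrite]; [cvE] and [dcvE] expand them on
   demand. *)
Opaque cv dcv.

Lemma L_anti X Y : SV X -> SV Y -> L Y X = neg (L X Y).
Proof. by move=> SX SY; apply/funext => p; rewrite /neg -!tors // scaleN1r opprB. Qed.

Lemma cv_anti X Y Z p : SV X -> SV Y -> SV Z -> cv Y X Z p = - cv X Y Z p.
Proof.
move=> SX SY SZ; rewrite !cvE (L_anti SX SY) nbNl //; try by auto.
by apply/rowP => a; rewrite !mxE; ring.
Qed.

Lemma LD X X' Y : SV X -> SV X' -> SV Y -> L (X \+ X') Y = L X Y \+ L X' Y.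
Proof.
move=> SX SX' SY; apply/funext => p /=; rewrite -!tors //; try by auto.
by rewrite nbDl // nbDr //; apply/rowP => a; rewrite !mxE; ring.
Qed.

Lemma LZ f X Y : SF f -> SV X -> SV Y ->
  L (fun q => f q *: X q) Y = (fun q => f q *: L X Y q) \- (fun q => D f q (Y q) *: X q).
Proof.
move=> Sf SX SY; apply/funext => p /=; rewrite -!tors //; try by auto.
by rewrite nbZl // nbZr //; apply/rowP => a; rewrite !mxE; ring.
Qed.

Lemma cvD1 X X' Y Z p : SV X -> SV X' -> SV Y -> SV Z ->
  cv (X \+ X') Y Z p = cv X Y Z p + cv X' Y Z p.
Proof.
move=> SX SX' SY SZ; rewrite !cvE LD // (nbDlE SX SX' SZ) (nbDr p SY (SVnb SX SZ) (SVnb SX' SZ)).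
rewrite (nbDl p SX SX' (SVnb SY SZ)) (nbDl p (SVlie SX SY) (SVlie SX' SY) SZ).
by apply/rowP => a; rewrite !mxE; ring.
Qed.

Lemma cvZ1 f X Y Z p : SF f -> SV X -> SV Y -> SV Z ->
  cv (fun q => f q *: X q) Y Z p = f p *: cv X Y Z p.
Proof.
move=> Sf SX SY SZ; rewrite !cvE LZ // nbBl //; try by auto.
rewrite (nbZl p Sf) //; try by auto.
rewrite nbZlE // nbZr //; try by auto.
rewrite (nbZl p Sf) //; try by auto.
rewrite (@nbZl (fun q => D f q (Y q))) //; try by auto.
by apply/rowP => a; rewrite !mxE; ring.
Qed.

Lemma cvD2 X Y Y' Z p : SV X -> SV Y -> SV Y' -> SV Z ->
  cv X (Y \+ Y') Z p = cv X Y Z p + cv X Y' Z p.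
Proof.
move=> SX SY SY' SZ; have SYY : SV (Y \+ Y') by auto.
by rewrite (cv_anti p SYY SX SZ) cvD1 // opprD -!cv_anti.
Qed.

Lemma cvZ2 f X Y Z p : SF f -> SV X -> SV Y -> SV Z ->
  cv X (fun q => f q *: Y q) Z p = f p *: cv X Y Z p.
Proof.
move=> Sf SX SY SZ; have SfY : SV (fun q => f q *: Y q) by auto.
by rewrite (cv_anti p SfY SX SZ) cvZ1 // -scalerN -cv_anti.
Qed.

Lemma cvD3 X Y Z Z' p : SV X -> SV Y -> SV Z -> SV Z' ->
  cv X Y (Z \+ Z') p = cv X Y Z p + cv X Y Z' p.
Proof.
move=> SX SY SZ SZ'; have SLXY : SV (L X Y) by auto.
rewrite !cvE (nbDrE SY SZ SZ') (nbDrE SX SZ SZ') (nbDr p SX (SVnb SY SZ) (SVnb SY SZ')).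
rewrite (nbDr p SY (SVnb SX SZ) (SVnb SX SZ')) (nbDr p SLXY SZ SZ').
by apply/rowP => a; rewrite !mxE; ring.
Qed.

(** The first derivatives of f cancel by antisymmetry in X and Y, and the second ones form X(Yf) -
    Y(Xf) - [X, Y]f, zero by [D_lie]. *)
Lemma cvZ3 f X Y Z p : SF f -> SV X -> SV Y -> SV Z ->
  cv X Y (fun q => f q *: Z q) p = f p *: cv X Y Z p.
Proof.
move=> Sf SX SY SZ; have SLXY : SV (L X Y) by auto.
have E A B : SV A -> SV B -> nb A (nb B (fun q => f q *: Z q)) p =
   D (fun q => D f q (B q)) p (A p) *: Z p + D f p (B p) *: nb A Z p
   + (D f p (A p) *: nb B Z p + f p *: nb A (nb B Z) p).
  move=> SA SB; rewrite nbZrE // nbDr //; try by auto.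
  by rewrite (@nbZr (fun q => D f q (B q))) // ?(nbZr p Sf) //; auto.
rewrite !cvE !E // nbZr // D_lie //.
by apply/rowP => a; rewrite !mxE; ring.
Qed.

(** Torsion-freeness rewrites each nabla_{[A, B]} C as nabla_C [A, B] plus a double bracket; the
    derivatives cancel and the double brackets vanish by Jacobi. *)
Lemma bianchi1 X Y Z p : SV X -> SV Y -> SV Z ->
  cv X Y Z p + cv Y Z X p + cv Z X Y p = 0.
Proof.
move=> SX SY SZ.
have T A B : SV A -> SV B -> nb A B = nb B A \+ L A B.
  by move=> SA SB; apply/funext => q /=; rewrite -tors // addrC subrK.
have E A B C : SV A -> SV B -> SV C ->
   cv A B C p = nb A (nb B C) p - nb B (nb A C) p - nb C (L A B) p - L (L A B) C p.
  by move=> SA SB SC; rewrite !cvE (T (L A B) C) //= ?opprD ?addrA //; auto.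
have F A B C : SV A -> SV B -> SV C -> nb C (L A B) p = nb C (nb A B) p - nb C (nb B A) p.
  move=> SA SB SC; have -> : L A B = nb A B \- nb B A by apply/funext => q /=; rewrite tors.
  by rewrite nbBr //; auto.
rewrite !E // !F //; have := jac p SX SY SZ => /rowP J.
by apply/rowP => a; have := J a; rewrite !mxE => Ja; rewrite -[RHS]oppr0 -Ja; ring.
Qed.

(** For the function F = g(Z, W), X(YF) - Y(XF) = [X, Y]F. Expanding both sides by metric
    compatibility, the mixed terms cancel and exactly the two curvature terms remain. *)
Lemma cv_skew X Y Z W p : SV X -> SV Y -> SV Z -> SV W ->
  gi p (cv X Y Z p) (W p) = - gi p (Z p) (cv X Y W p).
Proof.
move=> SX SY SZ SW; pose F q := gi q (Z q) (W q).
have SFF : SF F by rewrite /F; auto.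
have E A B : SV A -> SV B -> D (fun q => D F q (B q)) p (A p) =
   gi p (nb A (nb B Z) p) (W p) + gi p (nb B Z p) (nb A W p)
   + (gi p (nb A Z p) (nb B W p) + gi p (Z p) (nb A (nb B W) p)).
  move=> SA SB; have -> : (fun q => D F q (B q)) =
     (fun q => gi q (nb B Z q) (W q) + gi q (Z q) (nb B W q)).
    by apply/funext => q; rewrite /F compat.
  by rewrite D_add ?compat //; auto.
have := D_lie p SX SY SFF; rewrite !E // /F compat; try by auto.
rewrite !cvE !(giD, giN, giDr, giNr) => /eqP.
rewrite -subr_eq0 => /eqP H0; apply/eqP; rewrite -addr_eq0; apply/eqP.
rewrite -[RHS]oppr0 -H0; ring.
Qed.

Lemma dcvZ0 f U X Y Z p : SF f -> SV U -> SV X -> SV Y -> SV Z ->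
  dcv (fun q => f q *: U q) X Y Z p = f p *: dcv U X Y Z p.
Proof.
move=> Sf SU SX SY SZ; rewrite !dcvE !(nbZlE Sf SU) //; try by auto.
rewrite (cvZ1 p Sf) ?(cvZ2 p Sf) ?(cvZ3 p Sf) //; try by auto.
by apply/rowP => a; rewrite !mxE; ring.
Qed.

Lemma dcvD0 U U' X Y Z p : SV U -> SV U' -> SV X -> SV Y -> SV Z ->
  dcv (U \+ U') X Y Z p = dcv U X Y Z p + dcv U' X Y Z p.
Proof.
move=> SU SU' SX SY SZ; rewrite !dcvE !(nbDlE SU SU') //; try by auto.
rewrite cvD1 ?cvD2 ?cvD3 //; try by auto.
by apply/rowP => a; rewrite !mxE; ring.
Qed.

Lemma dcvD1 U X X' Y Z p : SV U -> SV X -> SV X' -> SV Y -> SV Z ->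
  dcv U (X \+ X') Y Z p = dcv U X Y Z p + dcv U X' Y Z p.
Proof.
move=> SU SX SX' SY SZ; rewrite !dcvE.
have -> : cv (X \+ X') Y Z = cv X Y Z \+ cv X' Y Z by apply/funext => q; rewrite cvD1.
rewrite nbDr ?(nbDrE SU SX SX') ?cvD1 //; try by auto.
by apply/rowP => a; rewrite !mxE; ring.
Qed.

Lemma dcvZ1 f U X Y Z p : SF f -> SV U -> SV X -> SV Y -> SV Z ->
  dcv U (fun q => f q *: X q) Y Z p = f p *: dcv U X Y Z p.
Proof.
move=> Sf SU SX SY SZ; rewrite !dcvE.
have E Y' Z' : SV Y' -> SV Z' -> cv (fun q => f q *: X q) Y' Z' = (fun q => f q *: cv X Y' Z' q).
  by move=> *; apply/funext => q; rewrite cvZ1.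
rewrite !E //; try by auto.
rewrite (nbZr p Sf) ?(nbZrE Sf SU SX) ?cvD1 //; try by auto.
rewrite (@cvZ1 (fun q => D f q (U q))) ?(cvZ1 p Sf) //; try by auto.
by apply/rowP => a; rewrite !mxE; ring.
Qed.

Lemma dcv_anti U X Y Z p : SV U -> SV X -> SV Y -> SV Z -> dcv U Y X Z p = - dcv U X Y Z p.
Proof.
move=> SU SX SY SZ; rewrite !dcvE.
have -> : cv Y X Z = neg (cv X Y Z) by apply/funext => q; rewrite /neg scaleN1r cv_anti.
rewrite nbNr; try by auto.
rewrite (@cv_anti X (nb U Y)) ?(@cv_anti (nb U X) Y) ?(@cv_anti X Y) //; try by auto.
by apply/rowP => a; rewrite !mxE; ring.
Qed.

Lemma dcvD2 U X Y Y' Z p : SV U -> SV X -> SV Y -> SV Y' -> SV Z ->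
  dcv U X (Y \+ Y') Z p = dcv U X Y Z p + dcv U X Y' Z p.
Proof.
move=> SU SX SY SY' SZ; have SYY : SV (Y \+ Y') by auto.
by rewrite (dcv_anti p SU SYY SX SZ) dcvD1 // opprD -!dcv_anti.
Qed.

Lemma dcvZ2 f U X Y Z p : SF f -> SV U -> SV X -> SV Y -> SV Z ->
  dcv U X (fun q => f q *: Y q) Z p = f p *: dcv U X Y Z p.
Proof.
move=> Sf SU SX SY SZ; have SfY : SV (fun q => f q *: Y q) by auto.
by rewrite (dcv_anti p SU SfY SX SZ) dcvZ1 // -scalerN -dcv_anti.
Qed.

Lemma dcvD3 U X Y Z Z' p : SV U -> SV X -> SV Y -> SV Z -> SV Z' ->
  dcv U X Y (Z \+ Z') p = dcv U X Y Z p + dcv U X Y Z' p.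
Proof.
move=> SU SX SY SZ SZ'; rewrite !dcvE.
have -> : cv X Y (Z \+ Z') = cv X Y Z \+ cv X Y Z' by apply/funext => q; rewrite cvD3.
rewrite nbDr ?(nbDrE SU SZ SZ') ?cvD3 //; try by auto.
by apply/rowP => a; rewrite !mxE; ring.
Qed.

Lemma dcvZ3 f U X Y Z p : SF f -> SV U -> SV X -> SV Y -> SV Z ->
  dcv U X Y (fun q => f q *: Z q) p = f p *: dcv U X Y Z p.
Proof.
move=> Sf SU SX SY SZ; rewrite !dcvE.
have E X' Y' : SV X' -> SV Y' -> cv X' Y' (fun q => f q *: Z q) = (fun q => f q *: cv X' Y' Z q).
  by move=> *; apply/funext => q; rewrite cvZ3.
rewrite !E //; try by auto.
rewrite (nbZr p Sf) ?(nbZrE Sf SU SZ) ?cvD3 //; try by auto.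
rewrite (@cvZ3 (fun q => D f q (U q))) ?(cvZ3 p Sf) //; try by auto.
by apply/rowP => a; rewrite !mxE; ring.
Qed.

Lemma cyclic_sum_aux (u1 u2 u3 a1 a2 a3 b1 b2 b3 c1 c2 c3 : 'rV[R]_n) :
  u1 + u2 + u3 = 0 -> a1 + c2 + b3 = 0 -> b1 + a2 + c3 = 0 -> c1 + b2 + a3 = 0 ->
  u1 - a1 - b1 - c1 + (u2 - a2 - b2 - c2) + (u3 - a3 - b3 - c3) = 0.
Proof.
move=> /rowP H1 /rowP H2 /rowP H3 /rowP H4; apply/rowP => a.
by move: (H1 a) (H2 a) (H3 a) (H4 a); rewrite !mxE; lra.
Qed.

Lemma dcv_bianchi1 U X Y Z p : SV U -> SV X -> SV Y -> SV Z ->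
  dcv U X Y Z p + dcv U Y Z X p + dcv U Z X Y p = 0.
Proof.
move=> SU SX SY SZ.
have B0 : nb U (cv X Y Z \+ cv Y Z X \+ cv Z X Y) p = 0.
  have -> : cv X Y Z \+ cv Y Z X \+ cv Z X Y = (fun q => 0 *: U q).
    by apply/funext => q; rewrite scale0r; exact: bianchi1.
  by rewrite nbZr // D_cst !scale0r addr0.
rewrite (nbDr p SU (SVadd (SVcv SX SY SZ) (SVcv SY SZ SX)) (SVcv SZ SX SY)) in B0.
rewrite (nbDr p SU (SVcv SX SY SZ) (SVcv SY SZ SX)) in B0.
rewrite !dcvE.
exact: (cyclic_sum_aux B0 (bianchi1 p (SVnb SU SX) SY SZ) (bianchi1 p SX (SVnb SU SY) SZ)
  (bianchi1 p SX SY (SVnb SU SZ))).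
Qed.

Lemma dcv_skew U X Y Z W p : SV U -> SV X -> SV Y -> SV Z -> SV W ->
  gi p (dcv U X Y Z p) (W p) = - gi p (Z p) (dcv U X Y W p).
Proof.
move=> SU SX SY SZ SW.
have E : (fun q => gi q (cv X Y Z q) (W q) + gi q (Z q) (cv X Y W q)) = (fun=> 0).
  by apply/funext => q; rewrite cv_skew // addNr.
have E0 : D (fun q => gi q (cv X Y Z q) (W q) + gi q (Z q) (cv X Y W q)) p (U p) = 0.
  by rewrite E D_cst.
rewrite D_add ?compat // in E0; try by auto.
have h1 := cv_skew p (SVnb SU SX) SY SZ SW.
have h2 := cv_skew p SX (SVnb SU SY) SZ SW.
have h3 := cv_skew p SX SY (SVnb SU SZ) SW.
have h4 := cv_skew p SX SY SZ (SVnb SU SW).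
have G4 u a b c w : gi p (u - a - b - c) w = gi p u w - gi p a w - gi p b w - gi p c w.
  by rewrite !giD !giN.
rewrite (dcvE U X Y Z) (dcvE U X Y W) (giC p (Z p)) !G4 !(giC p _ (Z p)); lra.
Qed.

(** Differentiated curvatures expand into triple covariant derivatives, which cancel cyclically.
    Torsion-freeness merges the curvatures of the covariant derivatives into ones of brackets, and
    what is left is nabla along the Jacobi sum. *)
Lemma bianchi2 X Y Z W p : SV X -> SV Y -> SV Z -> SV W ->
  dcv X Y Z W p + dcv Y Z X W p + dcv Z X Y W p = 0.
Proof.
move=> SX SY SZ SW.
have E A B C : SV A -> SV B -> SV C -> nb A (cv B C W) p = nb A (nb B (nb C W)) p
    - nb A (nb C (nb B W)) p - nb A (nb (L B C) W) p.
  by move=> SA SB SC; rewrite cvF !nbBr //; auto 6.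
have F A B C : SV A -> SV B -> SV C -> cv (nb A B) C W p = cv (nb B A) C W p + cv (L A B) C W p.
  move=> SA SB SC; rewrite -cvD1 //; try by auto.
  by congr (cv _ _ _ _); apply/funext => q /=; rewrite -tors // addrC subrK.
rewrite !dcvE !E // (@cv_anti (nb X Z) Y) ?(@cv_anti (nb Y X) Z) ?(@cv_anti (nb Z Y) X) //; try by auto.
rewrite (F X Y Z) // (F Y Z X) // (F Z X Y) //.
have J : nb (L (L X Y) Z) W p + nb (L (L Y Z) X) W p + nb (L (L Z X) Y) W p = 0.
  rewrite -!nbDl //; try by auto 6.
  have -> : L (L X Y) Z \+ L (L Y Z) X \+ L (L Z X) Y = (fun q => 0 *: X q).
    by apply/funext => q; rewrite scale0r; exact: jac.
  by rewrite nbZl // scale0r.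
rewrite !cvE; have /rowP J' := J; apply/rowP => a; have := J' a; rewrite !mxE => Ja.
lra.
Qed.

(** The right side contains the metric and brackets only, which is why maps preserving the metric
    preserve the connection. Twice the left side is written as a sum. *)
Lemma koszul X Y Z p : SV X -> SV Y -> SV Z ->
  gi p (nb X Y p) (Z p) + gi p (nb X Y p) (Z p) =
  D (fun q => gi q (Y q) (Z q)) p (X p) + D (fun q => gi q (X q) (Z q)) p (Y p)
  - D (fun q => gi q (X q) (Y q)) p (Z p) + gi p (L X Y p) (Z p)
  - gi p (L X Z p) (Y p) - gi p (L Y Z p) (X p).
Proof.
move=> SX SY SZ; rewrite !compat // -!tors //.
have B u v w : gi p (u - v) w = gi p u w - gi p v w by rewrite giD giN.
rewrite !B !(giC p (X p)) !(giC p (Y p)); ring.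
Qed.

End ConnectionAlgebra.

(** The octahedron argument: the cyclic identities with each of the four vectors in the last slot,
    combined through the antisymmetries, leave twice the difference of the two sides. *)
Lemma pair_symmetry (R : realType) (V : Type) (F : V -> V -> V -> V -> R) :
  (forall x y z w, F y x z w = - F x y z w) ->
  (forall x y z w, F x y w z = - F x y z w) ->
  (forall x y z w, F x y z w + F y z x w + F z x y w = 0) ->
  forall x y z w, F x y z w = F z w x y.
Proof.
move=> a1 a2 b x y z w.
have := b x y z w; have := b y z w x; have := b z w x y; have := b w x y z.
have := a1 x y z w; have := a1 z w x y; have := a2 x y z w; have := a2 z w x y.
have := a1 z x y w; have := a2 z x y w; have := a1 x z w y; have := a2 x z w y;
have := a1 y z x w; have := a2 y z x w; have := a1 w y z x; have := a2 w y z x;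
have := a1 w x y z; have := a2 w x y z; have := a1 x y w z; have := a2 x w z y;
have := a1 y w x z; have := a2 y w z x;  have := a1 z y w x; have := a2 z y x w;
have := a1 w x z y; have := a2 w z y x.
by lra.
Qed.

(** * Tangent maps and the chain rule *)

Section ChainRule.
Context {R : realType} {m n : nat} {M : manifold R m} {N : manifold R n}.
Variables (U : set M) (F : M -> N).
Hypotheses (oU : open U) (SF : smooth_map U F).
Implicit Types (p : M) (f : N -> R).
Local Notation xm i := (cmap (atlas i)).
Local Notation xi i := (cinv (atlas i)).

Lemma smooth_map_near p (P : N -> Prop) : U p -> (\forall q \near F p, P q) ->
  \forall x \near p, P (F x).
Proof. by move=> Up NP; exact: (SF.1 p Up _ NP). Qed.

Lemma smooth_map_coord p j (a : 'I_n) : U p -> dom j (F p) -> smooth_at (coord j a \o F) p.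
Proof.
move=> Up jFp; have N1 := near_and (near_open oU Up) (smooth_map_near Up (near_cdom jFp)).
have [A [oA Ap AH]] := near_exists_open N1; exists A; split => //.
by apply: smooth_on_sub (SF.2 j a) => x /AH.
Qed.

Lemma smooth_at_comp p f : U p -> smooth_at f (F p) -> smooth_at (f \o F) p.
Proof.
move=> Up [V [oV Vp Vf]]; pose c := chart_at p; pose j := chart_at (F p).
have cp : dom c p := mem_chart_at p; have jFp : dom j (F p) := mem_chart_at (F p).
have N1 := near_and (near_and (near_open oU Up) (near_cdom cp))
  (smooth_map_near Up (near_and (near_open oV Vp) (near_cdom jFp))).
have [A [oA Ap AH]] := near_exists_open N1; exists A; split => //.
apply: (@smooth_on_chart _ _ _ c) => //; first by move=> x /AH[[]].
move=> k; have oL := open_loc c oA.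
apply: (@Ck_ext _ _ _ _ ((f \o xi j) \o (fun x => xm j (F (xi c x))))) => //.
  move=> x /locP[q [_ Aq _ E]] /=; rewrite E cmapK //.
  by have [_ []] := AH _ Aq.
apply: (@Ck_comp _ _ _ _ _ (loc j V)) => //; first exact: open_loc.
  move=> x /locP[q [_ Aq _ E]]; rewrite E; have [_ [Vq jq]] := AH _ Aq.
  exact: loc_intro.
  move=> a; apply: Ck_sub (SF.2 j a c k) => x [q [cq Aq] <-].
  by have [[Uq _] [_ jq]] := AH _ Aq; exists q.
exact: Vf.
Qed.

Lemma der_comp p f v : U p -> smooth_at f (F p) ->
  der (f \o F) p v = der f (F p) (tangent_map F p v).
Proof.
move=> Up Sf; pose c := chart_at p; pose j := chart_at (F p).
have cp : dom c p := mem_chart_at p; have jFp : dom j (F p) := mem_chart_at (F p).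
have dF (a : 'I_n) : differentiable (fun x => (xm j \o F \o xi c) x 0 a) (xm c p).
  exact: (smooth_at_diff (smooth_map_coord a Up jFp) cp).
have E0 : (xm j \o F \o xi c) (xm c p) = xm j (F p) by rewrite /= cmapK.
have df : differentiable (f \o xi j) ((xm j \o F \o xi c) (xm c p)).
  by rewrite E0; exact: smooth_at_diff.
have [_ E] := derive_comp_row v dF df; rewrite E0 in E.
rewrite /der -/c -/j; apply: etrans E; apply: near_eq_derive.
have := near_cinv cp (smooth_map_near Up (near_cdom jFp)); apply: near_mono => x jx.
by rewrite /= cmapK.
Qed.

Lemma tangent_map_linear p (c : R) v w : U p ->
  tangent_map F p (c *: v + w) = c *: tangent_map F p v + tangent_map F p w.
Proof.
move=> Up; apply/rowP => a; rewrite !mxE der_linear //.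
by apply: smooth_map_coord => //; exact: mem_chart_at.
Qed.

Lemma tangent_mapD p v w : U p -> tangent_map F p (v + w) = tangent_map F p v + tangent_map F p w.
Proof. by move=> Up; have := tangent_map_linear 1 v w Up; rewrite !scale1r. Qed.

Lemma tangent_map0 p : U p -> tangent_map F p 0 = 0.
Proof. by move=> Up; apply: (addrI (tangent_map F p 0)); rewrite -tangent_mapD // !addr0. Qed.

Lemma tangent_mapZ p (c : R) v : U p -> tangent_map F p (c *: v) = c *: tangent_map F p v.
Proof. by move=> Up; have := tangent_map_linear c v 0 Up; rewrite tangent_map0 // !addr0. Qed.

Lemma tangent_mapB p v w : U p -> tangent_map F p (v - w) = tangent_map F p v - tangent_map F p w.
Proof. by move=> Up; rewrite tangent_mapD // -scaleN1r tangent_mapZ // scaleN1r. Qed.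

End ChainRule.

(** * The curvature and its derivative as pointwise multilinear maps *)

Section LeviCivita.
Context {R : realType} {n : nat} {M : manifold R n}.
Variables (g : M -> 'M[R]_n) (k : nat).
Hypothesis Hg : metric k g.
Variable nabla : (M -> 'rV[R]_n) -> (M -> 'rV[R]_n) -> (M -> 'rV[R]_n).
Hypothesis LC : levi_civita g nabla.
Implicit Types (X Y Z W U : M -> 'rV[R]_n) (f : M -> R) (p q : M) (u v w x y z : 'rV[R]_n).

Lemma inner_linear p (c : R) v v' w : inner g p (c *: v + v') w = c * inner g p v w + inner g p v' w.
Proof. by rewrite /inner !mulmxDl -!scalemxAl !mxE. Qed.

(** Symmetry is encoded in the congruence of the Gram matrix to a diagonal one. *)
Lemma metric_sym p : (g p)^T = g p.
Proof.
have [_ [P Pu E]] := Hg.1 p.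
have E' : P *m (g p)^T *m P^T = P *m g p *m P^T.
  have E1 : (P *m g p *m P^T)^T = P *m (g p)^T *m P^T by rewrite !trmx_mul trmxK mulmxA.
  by rewrite -E1 E tr_diag_mx.
have PTu : P^T \in unitmx by rewrite unitmx_tr.
have := congr1 (fun A => invmx P *m A *m invmx P^T) E'.
by rewrite /= !mulmxA mulVmx // !mul1mx !mulmxK.
Qed.

Lemma inner_sym p v w : inner g p v w = inner g p w v.
Proof.
rewrite /inner -[in LHS](trmxK (v *m g p *m w^T)) mxE.
by rewrite !trmx_mul trmxK metric_sym mulmxA.
Qed.

Lemma inner_nondeg p v : (forall w, inner g p v w = 0) -> v = 0.
Proof.
move=> H; have [_ [P Pu E]] := Hg.1 p.
have gu : g p \in unitmx.
  have : P *m g p *m P^T \in unitmx.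
    rewrite E unitmxE det_diag; apply/unitrP; exists (\prod_i (\row_(a < n) (if (a < k)%N then -1 else 1 : R)) 0 i).
    by split; rewrite -big_split big1 // => i _ /=; rewrite !mxE; case: ifP => _; rewrite ?mulrNN mulr1.
  by rewrite !unitmx_mul => /andP[/andP[]].
have vg : v *m g p = 0.
  apply/rowP => a; have := H (delta_mx 0 a); rewrite /inner trmx_delta => h.
  by rewrite [RHS]mxE -h -colE [RHS]mxE.
by rewrite -[v](mulmxK gu) vg mul0mx.
Qed.

Lemma lc_algebra : connection_algebra (@smooth_vfield R n M) (smooth_on setT)
  der lie nabla (inner g).
Proof.
have [[c1 c2 c3 c4 c5] t1 m1] := LC; split; split.
- by move=> X Y; exact: smooth_vfield_add.
- by move=> f X; exact: smooth_vfield_scale.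
- by move=> X Y; exact: c1.
- by move=> X Y; exact: smooth_lie.
- split; first by move=> c; exact: smooth_on_cst.
    by move=> f X Sf SX; exact: smooth_vfield_der.
  by move=> X Y; exact: Hg.2.
- by move=> f h p v Sf Sh; apply: der_add; exact: smooth_at_global.
- by move=> c p v; exact: der_cst.
- by move=> f p c v w Sf; apply: der_linear; exact: smooth_at_global.
- by move=> X Y f p SX SY Sf; apply: der_lie => //; exact: smooth_at_global.
- by move=> X Y Z p SX SY SZ; exact: jacobi.
- by move=> X X' Y p SX SX' SY; exact: c2.
- by move=> f X Y p Sf SX SY; exact: c3.
- by move=> X Y Y' p SX SY SY'; exact: c4.
- by move=> f X Y p Sf SX SY; exact: c5.
- by move=> X Y p SX SY; exact: t1.
- by move=> X Y Z p SX SY SZ; exact: m1.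
- by move=> p c v v' w; exact: inner_linear.
- by move=> p v w; exact: inner_sym.
Qed.

Let CA := lc_algebra.

Lemma nabla_smooth X Y : smooth_vfield X -> smooth_vfield Y -> smooth_vfield (nabla X Y).
Proof. by case: LC => -[h _ _ _ _] _ _; exact: h. Qed.

Lemma nabla_tens X X' Y p : smooth_vfield X -> smooth_vfield X' -> smooth_vfield Y ->
  X p = X' p -> nabla X Y p = nabla X' Y p.
Proof.
have [[c1 c2 c3 c4 c5] t1 m1] := LC.
move=> SX SX' SY E; apply: (@tensorial_eq _ _ _ 'rV[R]_n (fun X => nabla X Y p) p) => //.
- by move=> A B SA SB; exact: c2.
- by move=> f A Sf SA; exact: c3.
Qed.

Definition extv p v := sval (cid (extend_vector p v)).
Lemma extv_smooth p v : smooth_vfield (extv p v).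
Proof. by case: (svalP (cid (extend_vector p v))). Qed.
Lemma extvE p v : extv p v p = v.
Proof. by case: (svalP (cid (extend_vector p v))). Qed.

Lemma curvF : curv nabla = cv lie nabla.
Proof. by []. Qed.
Lemma dcurvF : dcurv nabla = dcv lie nabla.
Proof. by []. Qed.

Lemma curv_smooth X Y Z : smooth_vfield X -> smooth_vfield Y -> smooth_vfield Z ->
  smooth_vfield (curv nabla X Y Z).
Proof. by rewrite curvF; exact: (SVcv CA). Qed.

Lemma curv_tens X X' Y Y' Z Z' p : smooth_vfield X -> smooth_vfield X' ->
  smooth_vfield Y -> smooth_vfield Y' -> smooth_vfield Z -> smooth_vfield Z' ->
  X p = X' p -> Y p = Y' p -> Z p = Z' p -> curv nabla X Y Z p = curv nabla X' Y' Z' p.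
Proof.
move=> SX SX' SY SY' SZ SZ' EX EY EZ; rewrite curvF.
transitivity (cv lie nabla X' Y Z p).
  apply: (@tensorial_eq _ _ _ 'rV[R]_n (fun A => cv lie nabla A Y Z p) p) => //.
  - by move=> A B SA SB; exact: (cvD1 CA).
  - by move=> f A Sf SA; exact: (cvZ1 CA).
transitivity (cv lie nabla X' Y' Z p).
  apply: (@tensorial_eq _ _ _ 'rV[R]_n (fun A => cv lie nabla X' A Z p) p) => //.
  - by move=> A B SA SB; exact: (cvD2 CA).
  - by move=> f A Sf SA; exact: (cvZ2 CA).
apply: (@tensorial_eq _ _ _ 'rV[R]_n (fun A => cv lie nabla X' Y' A p) p) => //.
- by move=> A B SA SB; exact: (cvD3 CA).
- by move=> f A Sf SA; exact: (cvZ3 CA).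
Qed.

Lemma dcurv_tens U U' X X' Y Y' Z Z' p : smooth_vfield U -> smooth_vfield U' ->
  smooth_vfield X -> smooth_vfield X' ->
  smooth_vfield Y -> smooth_vfield Y' -> smooth_vfield Z -> smooth_vfield Z' ->
  U p = U' p -> X p = X' p -> Y p = Y' p -> Z p = Z' p ->
  dcurv nabla U X Y Z p = dcurv nabla U' X' Y' Z' p.
Proof.
move=> SU SU' SX SX' SY SY' SZ SZ' EU EX EY EZ; rewrite dcurvF.
transitivity (dcv lie nabla U' X Y Z p).
  apply: (@tensorial_eq _ _ _ 'rV[R]_n (fun A => dcv lie nabla A X Y Z p) p) => //.
  - by move=> A B SA SB; exact: (dcvD0 CA).
  - by move=> f A Sf SA; exact: (dcvZ0 CA).
transitivity (dcv lie nabla U' X' Y Z p).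
  apply: (@tensorial_eq _ _ _ 'rV[R]_n (fun A => dcv lie nabla U' A Y Z p) p) => //.
  - by move=> A B SA SB; exact: (dcvD1 CA).
  - by move=> f A Sf SA; exact: (dcvZ1 CA).
transitivity (dcv lie nabla U' X' Y' Z p).
  apply: (@tensorial_eq _ _ _ 'rV[R]_n (fun A => dcv lie nabla U' X' A Z p) p) => //.
  - by move=> A B SA SB; exact: (dcvD2 CA).
  - by move=> f A Sf SA; exact: (dcvZ2 CA).
apply: (@tensorial_eq _ _ _ 'rV[R]_n (fun A => dcv lie nabla U' X' Y' A p) p) => //.
- by move=> A B SA SB; exact: (dcvD3 CA).
- by move=> f A Sf SA; exact: (dcvZ3 CA).
Qed.

(** The chosen smooth extensions [extv] are immaterial by [curv_tens]; with [Rm] and [dRm] the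
    curvature becomes linear algebra on one tangent space. *)
Definition Rm p x y z := curv nabla (extv p x) (extv p y) (extv p z) p.
Definition dRm p u x y z := dcurv nabla (extv p u) (extv p x) (extv p y) (extv p z) p.

Lemma RmE X Y Z p : smooth_vfield X -> smooth_vfield Y -> smooth_vfield Z ->
  curv nabla X Y Z p = Rm p (X p) (Y p) (Z p).
Proof.
move=> SX SY SZ.
exact: (curv_tens SX (extv_smooth _ _) SY (extv_smooth _ _) SZ (extv_smooth _ _)
  (esym (extvE _ _)) (esym (extvE _ _)) (esym (extvE _ _))).
Qed.

Lemma dRmE U X Y Z p : smooth_vfield U -> smooth_vfield X -> smooth_vfield Y -> smooth_vfield Z ->
  dcurv nabla U X Y Z p = dRm p (U p) (X p) (Y p) (Z p).
Proof.
move=> SU SX SY SZ.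
exact: (dcurv_tens SU (extv_smooth _ _) SX (extv_smooth _ _) SY (extv_smooth _ _) SZ (extv_smooth _ _)
  (esym (extvE _ _)) (esym (extvE _ _)) (esym (extvE _ _)) (esym (extvE _ _))).
Qed.

Let es := extv_smooth.
Let lin_ext p (c : R) v w : smooth_vfield ((fun q => c *: extv p v q) \+ extv p w).
Proof. by apply: smooth_vfield_add => //; apply: smooth_vfield_scale => //; exact: smooth_on_cst. Qed.
Let sc p (c : R) v : smooth_vfield (fun q => c *: extv p v q).
Proof. by apply: smooth_vfield_scale => //; exact: smooth_on_cst. Qed.
Let lin_extE p (c : R) v w : ((fun q => c *: extv p v q) \+ extv p w) p = c *: v + w.
Proof. by rewrite /= !extvE. Qed.

Lemma Rm_lin1 p (c : R) v w y z : Rm p (c *: v + w) y z = c *: Rm p v y z + Rm p w y z.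
Proof.
transitivity (curv nabla ((fun q => c *: extv p v q) \+ extv p w) (extv p y) (extv p z) p).
  by rewrite RmE // lin_extE !extvE.
by rewrite curvF (cvD1 CA) // (cvZ1 CA) //; exact: smooth_on_cst.
Qed.

Lemma Rm_lin2 p (c : R) v w y z : Rm p y (c *: v + w) z = c *: Rm p y v z + Rm p y w z.
Proof.
transitivity (curv nabla (extv p y) ((fun q => c *: extv p v q) \+ extv p w) (extv p z) p).
  by rewrite RmE // lin_extE !extvE.
by rewrite curvF (cvD2 CA) // (cvZ2 CA) //; exact: smooth_on_cst.
Qed.

Lemma Rm_lin3 p (c : R) v w y z : Rm p y z (c *: v + w) = c *: Rm p y z v + Rm p y z w.
Proof.
transitivity (curv nabla (extv p y) (extv p z) ((fun q => c *: extv p v q) \+ extv p w) p).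
  by rewrite RmE // lin_extE !extvE.
by rewrite curvF (cvD3 CA) // (cvZ3 CA) //; exact: smooth_on_cst.
Qed.

Lemma dRm_lin0 p (c : R) v w x y z : dRm p (c *: v + w) x y z = c *: dRm p v x y z + dRm p w x y z.
Proof.
transitivity (dcurv nabla ((fun q => c *: extv p v q) \+ extv p w) (extv p x) (extv p y) (extv p z) p).
  by rewrite dRmE // lin_extE !extvE.
by rewrite dcurvF (dcvD0 CA) // (dcvZ0 CA) //; exact: smooth_on_cst.
Qed.

Lemma dRm_lin1 p (c : R) v w x y z : dRm p x (c *: v + w) y z = c *: dRm p x v y z + dRm p x w y z.
Proof.
transitivity (dcurv nabla (extv p x) ((fun q => c *: extv p v q) \+ extv p w) (extv p y) (extv p z) p).
  by rewrite dRmE // lin_extE !extvE.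
by rewrite dcurvF (dcvD1 CA) // (dcvZ1 CA) //; exact: smooth_on_cst.
Qed.

Lemma dRm_lin2 p (c : R) v w x y z : dRm p x y (c *: v + w) z = c *: dRm p x y v z + dRm p x y w z.
Proof.
transitivity (dcurv nabla (extv p x) (extv p y) ((fun q => c *: extv p v q) \+ extv p w) (extv p z) p).
  by rewrite dRmE // lin_extE !extvE.
by rewrite dcurvF (dcvD2 CA) // (dcvZ2 CA) //; exact: smooth_on_cst.
Qed.

Lemma dRm_lin3 p (c : R) v w x y z : dRm p x y z (c *: v + w) = c *: dRm p x y z v + dRm p x y z w.
Proof.
transitivity (dcurv nabla (extv p x) (extv p y) (extv p z) ((fun q => c *: extv p v q) \+ extv p w) p).
  by rewrite dRmE // lin_extE !extvE.
by rewrite dcurvF (dcvD3 CA) // (dcvZ3 CA) //; exact: smooth_on_cst.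
Qed.

Lemma Rm_anti p x y z : Rm p y x z = - Rm p x y z.
Proof. exact: (cv_anti CA). Qed.
Lemma dRm_anti p u x y z : dRm p u y x z = - dRm p u x y z.
Proof. exact: (dcv_anti CA). Qed.

Lemma Rm_skew p x y z w : inner g p (Rm p x y z) w = - inner g p z (Rm p x y w).
Proof.
have := cv_skew CA p (es p x) (es p y) (es p z) (es p w).
by rewrite !extvE.
Qed.
Lemma dRm_skew p u x y z w : inner g p (dRm p u x y z) w = - inner g p z (dRm p u x y w).
Proof.
have := dcv_skew CA p (es p u) (es p x) (es p y) (es p z) (es p w).
by rewrite !extvE.
Qed.
Lemma Rm_bianchi p x y z : Rm p x y z + Rm p y z x + Rm p z x y = 0.
Proof. exact: (bianchi1 CA). Qed.
Lemma dRm_bianchi1 p u x y z : dRm p u x y z + dRm p u y z x + dRm p u z x y = 0.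
Proof. exact: (dcv_bianchi1 CA). Qed.
Lemma dRm_bianchi2 p x y z w : dRm p x y z w + dRm p y z x w + dRm p z x y w = 0.
Proof. exact: (bianchi2 CA). Qed.

Lemma inner0 p w : inner g p 0 w = 0.
Proof. by rewrite /inner !mul0mx mxE. Qed.
Lemma innerD p v v' w : inner g p (v + v') w = inner g p v w + inner g p v' w.
Proof. by have := inner_linear p 1 v v' w; rewrite scale1r mul1r. Qed.
Lemma innerN p v w : inner g p (- v) w = - inner g p v w.
Proof. by have := inner_linear p (-1) v 0 w; rewrite inner0 !addr0 scaleN1r mulN1r. Qed.
Lemma innerZ p (c : R) v w : inner g p (c *: v) w = c * inner g p v w.
Proof. by have := inner_linear p c v 0 w; rewrite inner0 !addr0. Qed.
Lemma innerDr p v v' w : inner g p w (v + v') = inner g p w v + inner g p w v'.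
Proof. by rewrite !(inner_sym p w) innerD. Qed.
Lemma innerNr p v w : inner g p w (- v) = - inner g p w v.
Proof. by rewrite !(inner_sym p w) innerN. Qed.
Lemma innerZr p (c : R) v w : inner g p w (c *: v) = c * inner g p w v.
Proof. by rewrite !(inner_sym p w) innerZ. Qed.

Lemma Rm_pair p x y z w : inner g p (Rm p x y z) w = inner g p (Rm p z w x) y.
Proof.
apply: (@pair_symmetry R _ (fun x y z w => inner g p (Rm p x y z) w)).
- by move=> *; rewrite Rm_anti innerN.
- by move=> a b c d; rewrite Rm_skew inner_sym.
- by move=> a b c d; rewrite -!innerD Rm_bianchi inner0.
Qed.

Lemma dRm_pair p u x y z w : inner g p (dRm p u x y z) w = inner g p (dRm p u z w x) y.
Proof.
apply: (@pair_symmetry R _ (fun x y z w => inner g p (dRm p u x y z) w)).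
- by move=> *; rewrite dRm_anti innerN.
- by move=> a b c d; rewrite dRm_skew inner_sym.
- by move=> a b c d; rewrite -!innerD dRm_bianchi1 inner0.
Qed.

End LeviCivita.

(** * Naturality of the connection and the curvature under local isometries *)

Section Isometry.
Context {R : realType} {n : nat} {M : manifold R n}.
Variables (g : M -> 'M[R]_n) (k : nat).
Hypothesis Hg : metric k g.
Variable nabla : (M -> 'rV[R]_n) -> (M -> 'rV[R]_n) -> (M -> 'rV[R]_n).
Hypothesis LC : levi_civita g nabla.
Variables (U : set M) (phi : M -> M).
Hypotheses (oU : open U) (iso : isometry_on g U phi).
Implicit Types (X Y Z W : M -> 'rV[R]_n) (f : M -> R) (p q : M) (u v w x y z : 'rV[R]_n).

Let SF : smooth_map U phi. Proof. by case: iso. Qed.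
Let tm := tangent_map phi.

Lemma isometry_inverse : exists psi : M -> M, [/\ open (phi @` U), smooth_map (phi @` U) psi,
  forall p, U p -> psi (phi p) = p & forall q, (phi @` U) q -> U (psi q) /\ phi (psi q) = q].
Proof.
have [oI _ [psi S1 K1] _] := iso; exists psi; split => // q [p Up <-].
by rewrite K1.
Qed.

(** The preimage is the image of w under the tangent map of the inverse [psi], since phi \o psi is
    the identity near phi p. *)
Lemma tangent_map_onto p w : U p -> exists v, tangent_map phi p v = w.
Proof.
move=> Up; have [psi [oI S1 K1 K2]] := isometry_inverse.
have Iq : (phi @` U) (phi p) by exists p.
exists (tangent_map psi (phi p) w); apply: (@tangent_ext _ _ _ (phi p)) => a.
set c := coord _ a; have Sc : smooth_at c (phi p) by apply: smooth_at_coord; exact: mem_chart_at.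
rewrite -(der_comp oU SF _ Up Sc) -{1}(K1 p Up).
have Upp : U (psi (phi p)) by rewrite K1.
have Sc' : smooth_at (c \o phi) (psi (phi p)).
  by apply: (smooth_at_comp oU SF Upp); rewrite K1.
rewrite -(der_comp oI S1 _ Iq Sc'); apply: der_ext.
by apply: near_mono (near_open oI Iq) => q /K2[_ /= ->].
Qed.

(** Asked on a neighbourhood, not at p alone, so that the relation passes to derivatives of the
    fields. *)
Definition related p X X' := \forall x \near p, X' (phi x) = tangent_map phi x (X x).

Lemma related_near p X X' : related p X X' -> \forall x \near p, related x X X'.
Proof. exact: near_near. Qed.

(** The push-forward exists on the open image only and is smooth through [psi]; a cut-off makes it a
    global field with the same germ at phi p. *)
Lemma related_exists p X : U p -> smooth_vfield X -> exists X', smooth_vfield X' /\ related p X X'.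
Proof.
move=> Up SX; have [psi [oI S1 K1 K2]] := isometry_inverse.
have Iq : (phi @` U) (phi p) by exists p.
pose Y q := tangent_map phi (psi q) (X (psi q)).
have SY : smooth_vfield_on (phi @` U) Y.
  move=> i a; apply: smooth_on_of_at => q [iq Jq].
  have [Upq Epq] := K2 q Jq.
  have Spq : smooth_at (coord i a \o phi) (psi q).
    by apply: (smooth_map_coord oU SF a Upq); rewrite Epq.
  have S2 := smooth_at_comp oI S1 Jq (smooth_at_der SX Spq).
  apply: smooth_at_ext S2.
  apply: near_mono (near_and (near_open oI Jq) (near_cdom iq)) => q' [Jq' iq'].
  have [Upq' Epq'] := K2 q' Jq'.
  have Sc : smooth_at (coord i a) (phi (psi q')) by rewrite Epq'; exact: smooth_at_coord.
  by have := der_comp oU SF (X (psi q')) Upq' Sc; rewrite Epq'.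
have [X' [SX' XE]] := extend_vfield oI Iq SY.
exists X'; split => //.
have N1 := near_and (near_open oU Up) (smooth_map_near SF Up XE).
by apply: near_mono N1 => x [Ux ->]; rewrite /Y K1.
Qed.

Lemma related_sub p X X' Y Y' : U p -> related p X X' -> related p Y Y' ->
  related p (X \- Y) (X' \- Y').
Proof.
move=> Up RX RY; have N1 := near_and (near_open oU Up) (near_and RX RY).
by apply: near_mono N1 => x [Ux [/= -> ->]]; rewrite (tangent_mapB oU SF).
Qed.

Lemma der_related p X X' f : U p -> smooth_at f (phi p) -> related p X X' ->
  der f (phi p) (X' (phi p)) = der (f \o phi) p (X p).
Proof. by move=> Up Sf RX; rewrite (near_at RX) (der_comp oU SF _ Up Sf). Qed.

Lemma der_der_related p X X' Y Y' f : U p -> smooth_at f (phi p) -> smooth_vfield X' ->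
  related p X X' -> related p Y Y' ->
  der (fun q => der f q (X' q)) (phi p) (Y' (phi p)) = der (fun q => der (f \o phi) q (X q)) p (Y p).
Proof.
move=> Up Sf SX' RX RY.
apply: (etrans (der_related Up (smooth_at_der SX' Sf) RY)).
apply: der_ext.
have N1 := near_and (near_open oU Up) (near_and (related_near RX) (smooth_map_near SF Up (smooth_at_near Sf))).
by apply: near_mono N1 => x [Ux [RXx Sfx]]; exact: (der_related Ux Sfx RXx).
Qed.

Lemma related_lie_at p X X' Y Y' : U p -> smooth_vfield X -> smooth_vfield X' ->
  smooth_vfield Y -> smooth_vfield Y' -> related p X X' -> related p Y Y' ->
  lie X' Y' (phi p) = tangent_map phi p (lie X Y p).
Proof.
move=> Up SX SX' SY SY' RX RY; apply: tangent_ext => a.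
have Sc : smooth_at (coord (chart_at (phi p)) a) (phi p) by apply: smooth_at_coord; exact: mem_chart_at.
apply: (etrans (der_lie SX' SY' Sc)).
apply: (etrans (congr2 (fun s t : R => s - t) (der_der_related Up Sc SY' RY RX) (der_der_related Up Sc SX' RX RY))).
apply: (etrans (esym (der_lie SX SY (smooth_at_comp oU SF Up Sc)))).
exact: (der_comp oU SF _ Up Sc).
Qed.

Lemma related_lie p X X' Y Y' : U p -> smooth_vfield X -> smooth_vfield X' ->
  smooth_vfield Y -> smooth_vfield Y' -> related p X X' -> related p Y Y' ->
  related p (lie X Y) (lie X' Y').
Proof.
move=> Up SX SX' SY SY' RX RY.
have N1 := near_and (near_open oU Up) (near_and (related_near RX) (related_near RY)).
by apply: near_mono N1 => x [Ux [RXx RYx]]; exact: related_lie_at.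
Qed.

Lemma inner_related p X X' Y Y' : U p -> related p X X' -> related p Y Y' ->
  inner g (phi p) (X' (phi p)) (Y' (phi p)) = inner g p (X p) (Y p).
Proof. by case: iso => _ _ _ h Up RX RY; rewrite (near_at RX) (near_at RY) h. Qed.

Lemma der_inner_related p X X' Y Y' Z Z' : U p -> smooth_vfield Y' -> smooth_vfield Z' ->
  related p X X' -> related p Y Y' -> related p Z Z' ->
  der (fun q => inner g q (Y' q) (Z' q)) (phi p) (X' (phi p)) = der (fun q => inner g q (Y q) (Z q)) p (X p).
Proof.
move=> Up SY' SZ' RX RY RZ.
have Si : smooth_at (fun q => inner g q (Y' q) (Z' q)) (phi p).
  by apply: smooth_at_global; exact: Hg.2.
apply: (etrans (der_related Up Si RX)); apply: der_ext.
have N1 := near_and (near_open oU Up) (near_and (related_near RY) (related_near RZ)).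
by apply: near_mono N1 => x [Ux [RYx RZx]]; exact: inner_related.
Qed.

Lemma koszul_aux (a a' d1 d2 d3 l1 l2 l3 d1' d2' d3' l1' l2' l3' : R) :
  a' + a' = d1' + d2' - d3' + l1' - l2' - l3' -> a + a = d1 + d2 - d3 + l1 - l2 - l3 ->
  d1' = d1 -> d2' = d2 -> d3' = d3 -> l1' = l1 -> l2' = l2 -> l3' = l3 -> a' = a.
Proof. by move=> H1 H2 E1 E2 E3 E4 E5 E6; subst; lra. Qed.

(** Each term of Koszul's formula is natural, and the test vectors exhaust the tangent space at phi
    p because the tangent map is onto; nondegeneracy concludes. *)
Lemma related_nabla_at p X X' Y Y' : U p -> smooth_vfield X -> smooth_vfield X' ->
  smooth_vfield Y -> smooth_vfield Y' -> related p X X' -> related p Y Y' ->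
  nabla X' Y' (phi p) = tangent_map phi p (nabla X Y p).
Proof.
move=> Up SX SX' SY SY' RX RY; apply/eqP; rewrite -subr_eq0; apply/eqP.
apply: (inner_nondeg Hg) => w; have [z zw] := tangent_map_onto w Up.
have SZ := extv_smooth p z; have [Z' [SZ' RZ]] := related_exists Up SZ.
have Ew : w = Z' (phi p) by rewrite (near_at RZ) extvE.
rewrite innerD innerN.
have E1 := koszul (lc_algebra Hg LC) (phi p) SX' SY' SZ'.
have E2 := koszul (lc_algebra Hg LC) p SX SY SZ.
have E4 : inner g (phi p) (tangent_map phi p (nabla X Y p)) w = inner g p (nabla X Y p) (extv p z p).
  by case: iso => _ _ _ h; rewrite Ew (near_at RZ) h.
apply/eqP; rewrite subr_eq0; apply/eqP; apply: (etrans _ (esym E4)); rewrite Ew.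
exact: (koszul_aux E1 E2 (der_inner_related Up SY' SZ' RX RY RZ)
  (der_inner_related Up SX' SZ' RY RX RZ) (der_inner_related Up SX' SY' RZ RX RY)
  (inner_related Up (related_lie Up SX SX' SY SY' RX RY) RZ)
  (inner_related Up (related_lie Up SX SX' SZ SZ' RX RZ) RY)
  (inner_related Up (related_lie Up SY SY' SZ SZ' RY RZ) RX)).
Qed.

Lemma related_nabla p X X' Y Y' : U p -> smooth_vfield X -> smooth_vfield X' ->
  smooth_vfield Y -> smooth_vfield Y' -> related p X X' -> related p Y Y' ->
  related p (nabla X Y) (nabla X' Y').
Proof.
move=> Up SX SX' SY SY' RX RY.
have N1 := near_and (near_open oU Up) (near_and (related_near RX) (related_near RY)).
by apply: near_mono N1 => x [Ux [RXx RYx]]; exact: related_nabla_at.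
Qed.

Lemma related_curv p X X' Y Y' Z Z' : U p -> smooth_vfield X -> smooth_vfield X' ->
  smooth_vfield Y -> smooth_vfield Y' -> smooth_vfield Z -> smooth_vfield Z' ->
  related p X X' -> related p Y Y' -> related p Z Z' ->
  related p (curv nabla X Y Z) (curv nabla X' Y' Z').
Proof.
move=> Up SX SX' SY SY' SZ SZ' RX RY RZ.
have N A B : smooth_vfield A -> smooth_vfield B -> smooth_vfield (nabla A B).
  by move=> *; exact: (nabla_smooth LC).
have L (A B : M -> 'rV[R]_n) : smooth_vfield A -> smooth_vfield B -> smooth_vfield (lie A B).
  by move=> *; exact: smooth_lie.
have h1 := related_nabla Up SX SX' (N _ _ SY SZ) (N _ _ SY' SZ') RX (related_nabla Up SY SY' SZ SZ' RY RZ).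
have h2 := related_nabla Up SY SY' (N _ _ SX SZ) (N _ _ SX' SZ') RY (related_nabla Up SX SX' SZ SZ' RX RZ).
have h3 := related_nabla Up (L _ _ SX SY) (L _ _ SX' SY') SZ SZ' (related_lie Up SX SX' SY SY' RX RY) RZ.
exact: (related_sub Up (related_sub Up h1 h2) h3).
Qed.

Lemma isometry_Rm p x y z : U p ->
  Rm nabla (phi p) (tm p x) (tm p y) (tm p z) = tm p (Rm nabla p x y z).
Proof.
move=> Up; have Sx := extv_smooth p x; have Sy := extv_smooth p y; have Sz := extv_smooth p z.
have [X' [SX' RX]] := related_exists Up Sx.
have [Y' [SY' RY]] := related_exists Up Sy.
have [Z' [SZ' RZ]] := related_exists Up Sz.
have := near_at (related_curv Up Sx SX' Sy SY' Sz SZ' RX RY RZ).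
by rewrite (RmE Hg LC _ SX' SY' SZ') (near_at RX) (near_at RY) (near_at RZ) !extvE.
Qed.

Lemma isometry_dRm p u x y z : U p ->
  dRm nabla (phi p) (tm p u) (tm p x) (tm p y) (tm p z) = tm p (dRm nabla p u x y z).
Proof.
move=> Up; have Su := extv_smooth p u.
have Sx := extv_smooth p x; have Sy := extv_smooth p y; have Sz := extv_smooth p z.
have [U' [SU' RU]] := related_exists Up Su.
have [X' [SX' RX]] := related_exists Up Sx.
have [Y' [SY' RY]] := related_exists Up Sy.
have [Z' [SZ' RZ]] := related_exists Up Sz.
have N A B : smooth_vfield A -> smooth_vfield B -> smooth_vfield (nabla A B).
  by move=> *; exact: (nabla_smooth LC).
have C A B D : smooth_vfield A -> smooth_vfield B -> smooth_vfield D -> smooth_vfield (curv nabla A B D).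
  by move=> *; exact: (curv_smooth Hg LC).
have RN := related_nabla Up Su SU'.
have H : related p (dcurv nabla (extv p u) (extv p x) (extv p y) (extv p z)) (dcurv nabla U' X' Y' Z').
  have h1 := RN _ _ (C _ _ _ Sx Sy Sz) (C _ _ _ SX' SY' SZ') RU (related_curv Up Sx SX' Sy SY' Sz SZ' RX RY RZ).
  have h2 := related_curv Up (N _ _ Su Sx) (N _ _ SU' SX') Sy SY' Sz SZ' (RN _ _ Sx SX' RU RX) RY RZ.
  have h3 := related_curv Up Sx SX' (N _ _ Su Sy) (N _ _ SU' SY') Sz SZ' RX (RN _ _ Sy SY' RU RY) RZ.
  have h4 := related_curv Up Sx SX' Sy SY' (N _ _ Su Sz) (N _ _ SU' SZ') RX RY (RN _ _ Sz SZ' RU RZ).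
  exact: (related_sub Up (related_sub Up (related_sub Up h1 h2) h3) h4).
have := near_at H.
by rewrite (dRmE Hg LC _ SU' SX' SY' SZ') (near_at RU) (near_at RX) (near_at RY) (near_at RZ) !extvE.
Qed.

End Isometry.

(** * R^m as a manifold, the parameter space of leaves *)

Section RowManifold.
Variables (R : realType) (m : nat).

Lemma rV_connected : connected [set: 'rV[R]_m].
Proof.
have -> : [set: 'rV[R]_m] = \bigcup_(x in [set: 'rV[R]_m]) ((fun t : R => t *: x) @` `[0, 1]).
  apply/seteqP; split => // x _; exists x => //; exists 1; last by rewrite scale1r.
  by rewrite /= in_itv /= ler01 lexx.
apply: bigcup_connected.
  by exists 0 => x _; exists 0; [rewrite /= in_itv /= ler01 lexx|rewrite scale0r].
move=> x _; apply: connected_continuous_connected; first exact: segment_connected.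
apply: continuous_subspaceT => t; exact: scalel_continuous.
Qed.

Lemma rV_second_countable : @second_countable 'rV[R]_m.
Proof.
pose b (qk : 'rV[rat]_m * nat) : set 'rV[R]_m := ball (map_mx ratr qk.1 : 'rV[R]_m) (qk.2.+1%:R^-1).
exists (range b).
  by apply: sub_countable (card_image_le _ _) _; exact: countableP.
split; first by move=> _ [qk _ <-]; exact: ball_open.
move=> x A /nbhs_ballP[r /= r0 xA].
have r2 : 0 < r / 2 by rewrite divr_gt0.
(* Radius d = 1 / (k + 1) < r / 2 around a rational centre at distance less than d from x: the ball
   contains x and lies in the ball of radius r. *)
have [k _ /(_ k (leqnn _)) kr] := near_infty_natSinv_lt (PosNum r2).
pose d : R := k.+1%:R^-1; have d0 : 0 < d by rewrite invr_gt0 ltr0n.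
have Q (a : 'I_m) : exists q : rat, `|x 0 a - ratr q| < d.
  have [|q /andP[q1 q2]] := @rat_in_itvoo _ (x 0 a - d) (x 0 a + d); first by lra.
  by exists q; rewrite ltr_distlC; apply/andP; split.
pose q : 'rV[rat]_m := \row_a sval (cid (Q a)).
have xq : `|x - map_mx ratr q| < d.
  apply/(mx_norm_lt _ d0) => a; rewrite !mxE; exact: svalP (cid (Q a)).
exists (b (q, k)).
  split; first by exists (q, k).
  by rewrite /b /=; apply/ball_rV.
move=> y; rewrite /b /= => /ball_rV qy; apply: xA; apply/ball_rV.
have -> : y - x = (y - map_mx ratr q) - (x - map_mx ratr q) by rewrite opprB addrA subrK.
apply: (le_lt_trans (ler_normB _ _)); move: kr qy xq; rewrite /= -/d => kr qy xq.
lra.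
Qed.

(** One global chart, closed by [Defined] so that its maps compute to the identity. *)
Definition rV_chart : chart R m 'rV[R]_m.
Proof.
refine (@Chart R m 'rV[R]_m setT id id openT _ (fun _ _ => erefl) _ _).
- by rewrite image_id; exact: openT.
- by move=> x _; exact: cvg_id.
- by move=> x _; exact: cvg_id.
Defined.

Definition rV_manifold : manifold R m.
Proof.
refine (@Manifold R m 'rV[R]_m _ rV_second_countable unit (fun=> rV_chart) (fun=> tt) (fun=> I) _).
  exact: norm_hausdorff.
move=> i j a k; apply: Ck_coord; rewrite setIid /= image_id; exact: openT.
Defined.

End RowManifold.

(** * The closed form g(V, .) and its local potential *)

Section ClosedForm.
Context {R : realType} {n : nat} {M : manifold R n}.
Variables (g : M -> 'M[R]_n) (k : nat).
Hypothesis Hg : metric k g.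
Variable nabla : (M -> 'rV[R]_n) -> (M -> 'rV[R]_n) -> (M -> 'rV[R]_n).
Hypothesis LC : levi_civita g nabla.
Variable V : M -> 'rV[R]_n.
Hypotheses (SV : smooth_vfield V) (VP : forall X, smooth_vfield X -> forall p, nabla X V p = 0).
Implicit Types (i : chart_index M) (p q : M).
Local Notation e a := (delta_mx 0 a : 'rV[R]_n).
Local Notation xm i := (cmap (atlas i)).
Local Notation xi i := (cinv (atlas i)).

Lemma frame_ext i q (a : 'I_n) : dom i q ->
  exists X, smooth_vfield X /\ \forall q' \near q, X q' = vec_in i q' (e a).
Proof.
move=> iq; have oi : open (dom i) := @cdom_open _ _ _ _.
have H : smooth_vfield_on (dom i) (fun q => vec_in i q (\row_b (e a) 0 b)).
  by apply: (@smooth_vfield_on_vec_in _ _ _ i _ (fun b _ => (e a) 0 b)) => // b; exact: smooth_on_cst.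
have E : \row_b (e a) 0 b = e a by apply/rowP => b; rewrite mxE.
by rewrite E in H; exact: extend_vfield oi iq H.
Qed.

Lemma der_frame i f q (a : 'I_n) : smooth_at f q -> dom i q ->
  der f q (vec_in i q (e a)) = dchart i f a q.
Proof.
move=> Sf iq; rewrite der_vec_in // (bigD1 a) //= !mxE !eqxx mul1r big1 ?addr0 // => b ba.
by rewrite mxE (negbTE ba) mul0r.
Qed.

(** Coordinate components of the one-form metrically dual to V. *)
Definition flat_form i (a : 'I_n) q := inner g q (V q) (vec_in i q (e a)).

Lemma flat_form_smooth i a : smooth_on (dom i) (flat_form i a).
Proof.
apply: smooth_on_of_at => q iq; have [X [SX XE]] := frame_ext a iq.
apply: smooth_at_ext (smooth_at_global q (Hg.2 V X SV SX)).
by apply: near_mono XE => q' E; rewrite /flat_form E.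
Qed.

Let flat_form_at i a q : dom i q -> smooth_at (flat_form i a) q.
Proof. by move=> iq; exists (dom i); split => //; [exact: cdom_open|exact: flat_form_smooth]. Qed.

Lemma lie_frame i X Y (a b : 'I_n) q : dom i q -> smooth_vfield X -> smooth_vfield Y ->
  (\forall q' \near q, X q' = vec_in i q' (e a)) -> (\forall q' \near q, Y q' = vec_in i q' (e b)) ->
  lie X Y q = 0.
Proof.
move=> iq SX SY XE YE; apply: (@tangent_ext _ _ _ q) => c.
set f := coord _ c; have Sf : smooth_at f q by apply: smooth_at_coord; exact: mem_chart_at.
have E Z (d : 'I_n) : (\forall q' \near q, Z q' = vec_in i q' (e d)) -> \forall q' \near q, der f q' (Z q') = dchart i f d q'.
  move=> ZE; apply: near_mono (near_and ZE (near_and (smooth_at_near Sf) (near_cdom iq))) => q' [-> [Sq' iq']].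
  exact: der_frame.
apply: (etrans (der_lie SX SY Sf)); rewrite der0; apply/eqP; rewrite subr_eq0; apply/eqP.
apply: (etrans (der_ext _ (E Y b YE))); apply: (etrans _ (esym (der_ext _ (E X a XE)))).
apply: (etrans (congr1 (der (dchart i f b) q) (near_at XE))).
apply: (etrans _ (congr1 (der (dchart i f a) q) (esym (near_at YE)))).
apply: (etrans (der_frame a (smooth_at_dchart b Sf iq) iq)).
apply: (etrans _ (esym (der_frame b (smooth_at_dchart a Sf iq) iq))).
exact: dchart_sym.
Qed.

(** As V is parallel, differentiating g(V, Y) along X gives g(V, nabla_X Y). The antisymmetric part
    is g(V, [X, Y]), zero for coordinate fields. *)
Lemma flat_form_closed i (a b : 'I_n) q : dom i q ->
  dchart i (flat_form i b) a q = dchart i (flat_form i a) b q.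
Proof.
move=> iq; have [X [SX XE]] := frame_ext a iq; have [Y [SY YE]] := frame_ext b iq.
have [_ tor compat] := LC.
have D A B (c d : 'I_n) : smooth_vfield A -> smooth_vfield B ->
    (\forall q' \near q, A q' = vec_in i q' (e c)) -> (\forall q' \near q, B q' = vec_in i q' (e d)) ->
    dchart i (flat_form i d) c q = inner g q (V q) (nabla A B q).
  move=> SA SB AE BE; rewrite -(der_frame _ (flat_form_at d iq) iq) -(near_at AE).
  rewrite (@der_ext _ _ _ _ (fun q => inner g q (V q) (B q))); last first.
    by apply: near_mono BE => q' E; rewrite /flat_form E.
  by rewrite compat // VP // inner0 add0r.
apply: (etrans (D X Y a b SX SY XE YE)); apply: (etrans _ (esym (D Y X b a SY SX YE XE))).
apply/eqP; rewrite -subr_eq0 -(innerNr Hg) -(innerDr Hg) tor //.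
by rewrite (lie_frame iq SX SY XE YE) (inner_sym Hg) inner0.
Qed.

Lemma inner_flat_form i q w : dom i q -> inner g q (V q) w = \sum_a comp_in i q w 0 a * flat_form i a q.
Proof.
move=> iq; rewrite -{1}(comp_inK w iq) {1}(row_sum_delta (comp_in i q w)).
have z0 : vec_in i q 0 = 0.
  by apply/rowP => b; rewrite !mxE derive0.
have lin : {morph vec_in i q : v w / v + w}.
  by move=> v w'; have := vec_in_linear 1 v w' iq; rewrite !scale1r.
rewrite (big_morph _ lin z0) (big_morph (inner g q (V q)) (fun v w => innerDr Hg q v w (V q)) (id1 := 0)); last first.
  by rewrite (inner_sym Hg) inner0.
apply: eq_bigr => a _; have := vec_in_linear (comp_in i q w 0 a) (e a) 0 iq.
by rewrite z0 !addr0 => ->; rewrite (innerZr Hg).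
Qed.

Lemma flat_form_neq0 i q : V q != 0 -> dom i q -> exists a, flat_form i a q != 0.
Proof.
move=> V0 iq; apply: contrapT => H; move/eqP: V0; apply; apply: (@inner_nondeg _ _ _ _ _ Hg q) => w.
rewrite (inner_flat_form w iq) big1 // => a _; case: (eqVneq (flat_form i a q) 0) => [->|h].
  by rewrite mulr0.
by case: H; exists a.
Qed.

Lemma potential p : exists (r : R) (u : 'rV[R]_n -> R), let i := chart_at p in
  [/\ 0 < r, ball (xm i p) r `<=` loc i (dom i), forall k, Ck k (ball (xm i p) r) u &
   forall x (a : 'I_n), ball (xm i p) r x -> is_derive x (e a) u (flat_form i a (xi i x))].
Proof.
pose i := chart_at p; have ip : dom i p := mem_chart_at p.
have oi : open (dom i) := @cdom_open _ _ _ _.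
have := near_open (open_loc i oi) (loc_intro ip ip).
move=> /nbhs_ballP[r /= r0 Hr]; exists r.
have C a j : Ck j (ball (xm i p) r) (flat_form i a \o xi i).
  exact: Ck_sub (@flat_form_smooth i a i j).
have [|u Hu] := @poincare R n (xm i p) r (fun a => flat_form i a \o xi i) (fun a => C a 2%N).
  move=> x a b Bx; have [q [iq _ xq xiq]] := (locP _ _ _).1 (Hr _ Bx).
  by have := flat_form_closed a b iq; rewrite /dchart xq.
exists u; split => // -[|j].
  apply: Ck_le; apply: (@CkS_intro _ _ _ _ _ (fun a => flat_form i a \o xi i)) => //.
  exact: ball_open.
apply: (@CkS_intro _ _ _ _ _ (fun a => flat_form i a \o xi i)) => //; first exact: ball_open.
Qed.

End ClosedForm.

(** The implicit function lives on a small ball only, whereas an integral manifold is to be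
    parametrised by all of R^m; a rescaled arctangent in each coordinate compresses the whole space
    into the ball. *)
Lemma atan_box (R : realType) (m : nat) (y0 : 'rV[R]_m) (eps : R) : 0 < eps -> exists (sig : 'rV[R]_m -> 'rV[R]_m) (dsig : 'rV[R]_m -> 'I_m -> R),
  [/\ sig 0 = y0, injective sig, forall y, ball y0 eps (sig y), forall y j, dsig y j != 0 &
   [/\ forall y v j, is_derive y v (fun y => sig y 0 j) (dsig y j * v 0 j) &
   forall l j, Ck l setT (fun y => sig y 0 j)]].
Proof.
(* The arctangent is smaller than pi in absolute value, so the factor eps / pi keeps each coordinate
   within eps. *)
move=> e0; have pi0 := pi_gt0 R; pose c := eps / pi; have c0 : 0 < c by rewrite divr_gt0.
pose sig (y : 'rV[R]_m) : 'rV[R]_m := \row_j (y0 0 j + c * atan (y 0 j)).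
pose dsig (y : 'rV[R]_m) j := c * (1 + y 0 j ^+ 2)^-1.
have pos (t : R) : 0 < 1 + t ^+ 2 by rewrite ltr_pwDl // sqr_ge0.
have D (y v : 'rV[R]_m) (j : 'I_m) : is_derive y v (fun y => sig y 0 j) (dsig y j * v 0 j).
  have E : (fun y => sig y 0 j) = (fun y => y0 0 j + c * atan (y 0 j)) by apply/funext => z; rewrite mxE.
  have cd : differentiable (fun y : 'rV[R]_m => y 0 j) y.
    exact: Ck1_differentiable openT (Ck_coord 1 j openT) I.
  have h := isd_comp1 cd (isd_coord y v j) (is_derive1_atan (y 0 j)).
  have h2 := isd_add (is_derive_cst (y0 0 j) y v) (isd_mul (is_derive_cst c y v) h).
  by rewrite E; apply: (is_derive_eq h2); rewrite add0r mulr0 addr0 /dsig /= mulrA.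
exists sig, dsig; split => //.
- by apply/rowP => j; rewrite !mxE atan0 mulr0 addr0.
- move=> y y' /rowP H; apply/rowP => j; have := H j; rewrite !mxE => /addrI/(mulfI (lt0r_neq0 c0)) E.
  by rewrite -(atanK (y 0 j)) E atanK.
- move=> y; apply/ball_rV/(mx_norm_lt _ e0) => j; rewrite !mxE addrAC subrr add0r normrM (gtr0_norm c0).
  have ha : `|atan (y 0 j)| < pi by rewrite ltr_norml; apply/andP; have := atan_gtNpi2 (y 0 j); have := atan_ltpi2 (y 0 j); lra.
  by have := ltr_pM2l c0 `|atan (y 0 j)| pi; rewrite ha /c divfK ?lt0r_neq0 // => ->.
- by move=> y j; rewrite mulf_neq0 // ?invr_eq0 lt0r_neq0.
split => // l j; suff C : Ck l.+1 setT (fun y => sig y 0 j) by exact: Ck_le.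
apply: (@CkS_intro _ _ _ _ _ (fun b y => dsig y j * (delta_mx 0 b : 'rV[R]_m) 0 j)) => //; first exact: openT.
move=> b; apply: Ck_mul; [exact: openT| |exact: Ck_cst].
apply: Ck_mul; [exact: openT|exact: Ck_cst|].
apply: Ck_inv; [exact: openT|by move=> y _; rewrite lt0r_neq0|].
apply: Ck_add; [exact: openT|exact: Ck_cst|].
have E : (fun y : 'rV[R]_m => y 0 j ^+ 2) = (fun y => y 0 j * y 0 j) by apply/funext => z; rewrite expr2.
by rewrite E; apply: Ck_mul; try exact: openT; apply: Ck_coord; exact: openT.
Qed.

(** * Leaves of V^perp as level sets *)

Section Leaf.
Context {R : realType} {m : nat} {M : manifold R m.+1}.
Variables (g : M -> 'M[R]_m.+1) (k : nat).
Hypothesis Hg : metric k g.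
Variable nabla : (M -> 'rV[R]_m.+1) -> (M -> 'rV[R]_m.+1) -> (M -> 'rV[R]_m.+1).
Hypothesis LC : levi_civita g nabla.
Variable V : M -> 'rV[R]_m.+1.
Hypotheses (SV : smooth_vfield V) (V0 : forall p, V p <> 0)
  (VP : forall X, smooth_vfield X -> forall p, nabla X V p = 0).
Local Notation xm i := (cmap (atlas i)).
Local Notation xi i := (cinv (atlas i)).

(** V is nowhere zero, so some component of the dual form is nonzero at p; the level set of the
    potential is there a graph over the other coordinates. *)
Lemma level_graph p : let i := chart_at p in exists (i0 : 'I_m.+1) (G : 'rV[R]_m -> 'rV[R]_m.+1) (d : 'rV[R]_m -> 'I_m -> R)
    (r : R) (u : 'rV[R]_m.+1 -> R),
  [/\ [/\ G 0 = xm i p, injective G, forall y, ball (xm i p) r (G y),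
      ball (xm i p) r `<=` loc i (dom i) & forall y, u (G y) = u (xm i p)],
   forall l a, Ck l setT (fun y => G y 0 a),
   forall k, Ck k (ball (xm i p) r) u,
   forall x (a : 'I_m.+1), ball (xm i p) r x ->
     is_derive x (delta_mx 0 a) u (flat_form g V i a (xi i x)) &
   [/\ forall y, flat_form g V i i0 (xi i (G y)) != 0, forall y j, d y j != 0 &
   forall y v j, is_derive y v (fun y => G y 0 (lift i0 j)) (d y j * v 0 j)]].
Proof.
move=> i; have ip : dom i p := mem_chart_at p.
have [r [u [r0 rB uS uD]]] := potential Hg LC SV VP p.
have V0' : V p != 0 by apply/eqP; exact: V0.
have [i0 h0] := flat_form_neq0 Hg V0' ip.
(* Multiplying the potential by the sign of its derivative provides the positivity that
   [implicit_function] asks for. *)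
pose om := flat_form g V i i0; pose s : R := Num.sg (om p).
have s0 : s != 0 by rewrite sgr_eq0.
have ompos : 0 < s * om p by rewrite -normrEsg normr_gt0.
have Com : Ck 0 (ball (xm i p) r) (om \o xi i).
  exact: Ck_sub rB (@flat_form_smooth _ _ _ _ _ Hg _ SV i i0 i 0%N).
have cx : {for xm i p, continuous (fun x => s * (om \o xi i) x)}.
  apply: cont_at_mul; first exact: cont_at_cst.
  by apply: Ck_cont Com _; exact: ballxx.
have := cont_at_near (eps := s * om p) ompos cx; rewrite /= cmapK // => N0.
have N1 := near_and (near_open (@ball_open _ _ (xm i p) r) (ballxx _ r0)) N0.
move: N1 => /nbhs_ballP[r' /= r'0 Hr'].
have pos x : ball (xm i p) r' x -> 0 < s * om (xi i x).
  by move=> /Hr'[_]; rewrite ltr_distlC => /andP[]; lra.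
have B' : ball (xm i p) r' `<=` ball (xm i p) r by move=> x /Hr'[].
pose u' x := s * u x.
have u'S l : Ck l (ball (xm i p) r') u'.
  by apply: Ck_mul; [exact: ball_open|exact: Ck_cst|exact: Ck_sub B' (uS l)].
have u'D x : ball (xm i p) r' x -> 0 < 'D_(delta_mx 0 i0) u' x.
  move=> Bx; have [_ ->] := isd_mul (is_derive_cst s x (delta_mx 0 i0)) (uD x i0 (B' _ Bx)).
  by rewrite mulr0 addr0; exact: pos.
have := implicit_function r'0 u'S u'D => /=; set y0 := \row_j _.
move=> [eps [phi [e0 phi0 phiS phiP]]].
have [sig [dsig [sig0 sigI sigB dsig0 [sigD sigS]]]] := atan_box y0 e0.
exists i0, (fun y => insert_coord i0 (sig y) (phi (sig y))), dsig, r', u; split.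
- split.
  + rewrite sig0 phi0; apply/rowP => a; case: (unliftP i0 a) => [j|] ->.
      by rewrite insert_coord_lift mxE.
    by rewrite insert_coord_at.
  + move=> y y' /rowP H; apply: sigI; apply/rowP => j.
    by have := H (lift i0 j); rewrite !insert_coord_lift.
  + by move=> y; have [] := phiP _ (sigB y).
  + by move=> x /B' /rB.
  + by move=> y; have [_] := phiP _ (sigB y) => /(mulfI s0).
- move=> l a; case: (unliftP i0 a) => [j|] ->.
    by apply: Ck_ext (sigS l j); [exact: openT|move=> y _; rewrite insert_coord_lift].
  apply: (@Ck_ext _ _ _ _ (phi \o sig)); first exact: openT.
    by move=> y _; rewrite insert_coord_at.
  apply: (@Ck_comp _ _ _ _ _ (ball y0 eps)) => //; first exact: openT.
  exact: ball_open.
- by move=> l; exact: Ck_sub B' (uS l).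
- by move=> x a Bx; exact: uD (B' _ Bx).
split => // [y|y v j].
  have [/pos] := phiP _ (sigB y); rewrite -/(om _) => h _; apply: contraL h => /eqP h.
  by rewrite h mulr0 ltxx.
rewrite (_ : (fun y => _) = (fun y => sig y 0 j)) //.
by apply/funext => z; rewrite insert_coord_lift.
Qed.

(** The differential of the potential is g(V, .), so vectors tangent to its level set are orthogonal
    to V; the converse is a matter of solving for the graph coordinates. One patch around p is
    enough, since it serves to compute derivatives at p. *)
Lemma leaf_through p : exists F : rV_manifold R m -> M,
  @integral_manifold R m.+1 M g V (rV_manifold R m) F /\ F (0 : 'rV[R]_m) = p.
Proof.
pose i := chart_at p; have ip : dom i p := mem_chart_at p.
have [i0 [G [d [r [u [[G0 GI GB Br uG] GS uS uD [om0 d0 GD]]]]]]] := level_graph p.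
pose F : rV_manifold R m -> M := fun y => xi i (G y).
have FP y : dom i (F y) /\ xm i (F y) = G y.
  have /locP[q [iq _ qE qE']] := Br _ (GB y).
  by rewrite /F -/i qE' -/i; split.
have Gc (y : 'rV[R]_m) : {for y, continuous G}.
  by apply: cont_at_row => a; exact: Ck_cont (GS 0%N a) I.
have Fc (y : rV_manifold R m) : {for y, continuous F}.
  apply: (@cont_at_comp _ _ _ G (xi i)); first exact: Gc.
  by apply: cinv_cont; exists (F y); [exact: (FP y).1|exact: (FP y).2].
have SF : smooth_map setT F.
  split=> [y _|j a c l]; first exact: Fc.
  have E : xm c @` (dom c `&` (setT `&` F @^-1` dom j)) = [set y | dom j (F y)].
    by rewrite !setTI /= image_id.
  rewrite E; apply: (@Ck_comp _ _ _ _ _ (loc i (dom j)) G (coord j a \o xi i)).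
  - by rewrite openE => y jy; exact: (Fc y _ (near_cdom jy)).
  - by apply: open_loc; exact: cdom_open.
  - by move=> y jy; have [iy <-] := FP y; exact: loc_intro.
  - by move=> b; apply: Ck_sub (GS l b).
  - exact: smooth_on_coord.
have compF (y : rV_manifold R m) v b : comp_in i (F y) (tangent_map F y v) 0 b = 'D_v (fun y : 'rV[R]_m => G y 0 b) y.
  have [iy _] := FP y; rewrite mxE.
  have h := der_comp openT SF v I (@smooth_at_coord _ _ _ i b (F y) iy).
  apply: (etrans (esym h)); rewrite /der; congr ('D_v _ _); apply/funext => z.
  by have [iz Ez] := FP z; rewrite /= /coord Ez.
have orthF (y : rV_manifold R m) v : inner g (F y) (V (F y)) (tangent_map F y v) = 0.
  have [iy Ey] := FP y; pose f q := u (xm i q).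
  have NB : \forall x \near xm i (F y), ball (xm i p) r x.
    by apply: near_open; [exact: ball_open|rewrite Ey; exact: GB].
  have [U [oU Uy UP]] := near_exists_open (near_and (near_cdom iy) (near_cmap iy NB)).
  have Sf : smooth_at f (F y).
    exists U; split => //; apply: (@smooth_on_chart _ _ _ i) => // [q /UP[]//|l].
    apply: (@Ck_ext _ _ _ _ u); first exact: open_loc.
      by move=> x /locP[q [iq _ <- E]]; rewrite /f /= E.
    by apply: Ck_sub (uS l) => x [q [_ /UP[_ Bq]] <-].
  rewrite (inner_flat_form Hg V _ iy).
  transitivity (der f (F y) (tangent_map F y v)).
    rewrite (der_dchart _ Sf iy); apply: eq_bigr => a _; congr (_ * _).
    have By : ball (xm i p) r (xm i (F y)) by rewrite Ey.
    have [_] := uD _ a By; rewrite cmapK // => <-; rewrite /dchart; apply: near_eq_derive.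
    by apply: near_mono (near_cmapK iy) => x [_ E]; rewrite /f /= E.
  apply: (etrans (esym (der_comp openT SF v I Sf))).
  rewrite (_ : f \o F = fun=> u (xm i p)); first exact: der_cst.
  by apply/funext => z; rewrite /f /=; have [_ ->] := FP z; exact: uG.
exists F; split; last by rewrite /F G0 cmapK.
split => //.
- exact: rV_connected.
- by move=> y y' E; apply: GI; rewrite -(FP y).2 -(FP y').2 E.
move=> y; have [iy Ey] := FP y; apply/seteqP; split => [_ [v _ <-]|w /= wV].
  by rewrite /= (inner_sym Hg); exact: orthF.
(* The free coordinates of w determine v; the component along [i0] then agrees by itself, being
   fixed by orthogonality to V. *)
pose v : 'rV[R]_m := \row_j ((d y j)^-1 * comp_in i (F y) w 0 (lift i0 j)).
have Ev j : comp_in i (F y) (tangent_map F y v) 0 (lift i0 j) = comp_in i (F y) w 0 (lift i0 j).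
  by rewrite compF; have [_ ->] := GD y v j; rewrite mxE mulVKf.
have sumw z : inner g (F y) (V (F y)) z = 0 -> comp_in i (F y) z 0 i0 =
   - (flat_form g V i i0 (F y))^-1 * \sum_j comp_in i (F y) z 0 (lift i0 j) * flat_form g V i (lift i0 j) (F y).
  rewrite (inner_flat_form Hg V _ iy) (bigD1_ord i0) //= => /eqP; rewrite addr_eq0 => /eqP H.
  by rewrite mulNr -mulrN -H mulrCA mulVf ?mulr1 //; exact: om0.
exists v => //; rewrite -[LHS](comp_inK _ iy) -[RHS](comp_inK _ iy); congr vec_in.
apply/rowP => a; case: (unliftP i0 a) => [j|] ->; first exact: Ev.
rewrite (sumw _ (orthF y v)) sumw; last by rewrite (inner_sym Hg).
by congr (_ * _); apply: eq_bigr => j _; rewrite Ev.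
Qed.

(** The bridge from homogeneity to calculus: w is tangent to the patch of [leaf_through], and f
    composed with that patch is constant near the origin. *)
Lemma leaf_constant_der f p w : smooth_at f p ->
  (\forall q \near p, same_leaf g V p q -> f q = f p) -> inner g p w (V p) = 0 -> der f p w = 0.
Proof.
move=> Sf fE; have [F [IF F0]] := leaf_through p; have [_ SF _ rF] := IF.
move=> wV; have : range (tangent_map F (0 : 'rV[R]_m)) w by rewrite rF F0.
rewrite -F0 in Sf fE *; move=> [v _ <-].
apply: (etrans (esym (der_comp openT SF v I Sf))).
rewrite (@der_ext _ _ _ _ (fun=> f (F (0 : 'rV[R]_m)))); first exact: der_cst.
apply: near_mono (smooth_map_near SF I fE) => x H; apply: H.
by exists (rV_manifold R m), F; split; [exact: IF|exists 0|exists x].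
Qed.

End Leaf.

(** * Null frames and tensors of pp-wave type *)

Section NullFrame.
Context {R : realType} {m : nat} {M : manifold R m.+2}.
Variables (g : M -> 'M[R]_m.+2) (k : nat).
Hypothesis Hg : metric k g.
Variable p : M.
Implicit Types (x y z u v w : 'rV[R]_m.+2) (K : 'rV[R]_m.+2 -> 'rV[R]_m.+2 -> 'rV[R]_m.+2 -> 'rV[R]_m.+2).
Local Notation "<< x , y >>" := (inner g p x y).

Definition null_frame v w (e : 'I_m -> 'rV[R]_m.+2) :=
  [/\ <<v, v>> = 0, <<w, v>> = 1, <<w, w>> = 0,
   forall i, <<e i, v>> = 0 /\ <<e i, w>> = 0 &
   forall i j, <<e i, e j>> = (i == j)%:R].

Lemma inner_sum (I : Type) (r : seq I) (P : pred I) (F : I -> 'rV[R]_m.+2) x :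
  <<\sum_(i <- r | P i) F i, x>> = \sum_(i <- r | P i) <<F i, x>>.
Proof. by apply: (big_morph (fun y => <<y, x>>)) => [y z|]; [exact: innerD|exact: inner0]. Qed.

Variables (v w : 'rV[R]_m.+2) (e : 'I_m -> 'rV[R]_m.+2).
Hypothesis F : null_frame v w e.

Let vw : <<v, w>> = 1. Proof. by rewrite (inner_sym Hg); case: F. Qed.

(** Pairing a vanishing combination with v, w and the e_j isolates its coefficients, so the frame is
    a basis. The difference of x and its expansion is orthogonal to this basis, hence zero. *)
Lemma null_frame_expand x : x = \sum_i <<x, e i>> *: e i + <<x, v>> *: w + <<x, w>> *: v.
Proof.
have [vv wv ww ew ee] := F.
(* The frame as rows of a matrix: v first, w second, then the e_j. *)
pose b (i : 'I_m.+2) := if unlift ord0 i is Some j then (if unlift ord0 j is Some l then e l else w) else v.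
pose C : 'M[R]_m.+2 := \matrix_i b i.
have CE u : u *m C = u 0 ord0 *: v + (u 0 (lift ord0 ord0) *: w + \sum_i u 0 (lift ord0 (lift ord0 i)) *: e i).
  rewrite mulmx_sum_row big_ord_recl big_ord_recl !rowK /b unlift_none liftK unlift_none.
  by congr (_ + (_ + _)); apply: eq_bigr => i _; rewrite !rowK /b !liftK.
have rf : row_free C.
  rewrite -kermx_eq0; apply/eqP/row_matrixP => i; rewrite row0; set u := row i _.
  have : u *m C = 0 by apply: sub_kermxP; exact: row_sub.
  rewrite CE => E.
  have P y : u 0 ord0 * <<v, y>> + (u 0 (lift ord0 ord0) * <<w, y>> + \sum_i u 0 (lift ord0 (lift ord0 i)) * <<e i, y>>) = 0.
    rewrite -[RHS](inner0 g p y) -E !innerD !innerZ inner_sum; congr (_ + (_ + _)).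
    by apply: eq_bigr => j _; rewrite innerZ.
  have h1 : u 0 (lift ord0 ord0) = 0.
    by have := P v; rewrite vv wv mulr0 mulr1 big1 ?addr0 ?add0r // => j _; rewrite (ew j).1 mulr0.
  have h0 : u 0 ord0 = 0.
    by have := P w; rewrite vw ww mulr0 mulr1 big1 ?addr0 // => j _; rewrite (ew j).2 mulr0.
  apply/rowP => a; rewrite [RHS]mxE; case: (unliftP ord0 a) => [a'|] -> //.
  case: (unliftP ord0 a') => [j|] -> //.
  have := P (e j); rewrite h0 h1 !mul0r !add0r (bigD1 j) //= ee eqxx mulr1 big1 ?addr0 // => l lj.
  by rewrite ee (negbTE lj) mulr0.
have rF : row_full C by rewrite row_full_unit -row_free_unit.
pose s := \sum_i <<x, e i>> *: e i + <<x, v>> *: w + <<x, w>> *: v.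
rewrite -/s; apply/eqP; rewrite -subr_eq0; apply/eqP; apply: (@inner_nondeg _ _ _ _ _ Hg p) => y.
have Ps : [/\ inner g p s v = <<x, v>>, inner g p s w = <<x, w>> & forall i, inner g p s (e i) = <<x, e i>>].
  rewrite /s; split=> [||j]; rewrite !innerD !innerZ inner_sum.
  - by rewrite big1 ?vv ?wv ?mulr1 ?mulr0 ?addr0 ?add0r // => i _; rewrite innerZ (ew i).1 mulr0.
  - by rewrite big1 ?vw ?ww ?mulr1 ?mulr0 ?addr0 ?add0r // => i _; rewrite innerZ (ew i).2 mulr0.
  - rewrite !(inner_sym Hg _ _ (e j)) (ew j).1 (ew j).2 !mulr0 !addr0 (bigD1 j) //= innerZ ee eqxx mulr1.
    by rewrite big1 ?addr0 1?(inner_sym Hg) // => l lj; rewrite innerZ ee (negbTE lj) mulr0.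
have /submxP[u ->] := submx_full y rF; rewrite CE.
have [Pv Pw Pe] := Ps.
have r0 z : inner g p s z = <<x, z>> -> inner g p (x - s) z = 0 by rewrite innerD innerN => ->; rewrite subrr.
rewrite !(innerDr Hg) !(innerZr Hg) (r0 _ Pv) (r0 _ Pw) !mulr0 !add0r (inner_sym Hg) inner_sum big1 // => i _.
by rewrite innerZ (inner_sym Hg) r0 ?mulr0.
Qed.

Lemma null_frame_perp x : <<x, v>> = 0 -> x = \sum_i <<x, e i>> *: e i + <<x, w>> *: v.
Proof. by move=> xv; rewrite {1}[x]null_frame_expand xv scale0r addr0. Qed.

Lemma null_frame_inner x y : <<x, v>> = 0 -> <<y, v>> = 0 ->
  <<x, y>> = \sum_i <<x, e i>> * <<y, e i>>.
Proof.
move=> xv yv; rewrite {1}(null_frame_perp xv) innerD innerZ (inner_sym Hg _ v) yv mulr0 addr0 inner_sum.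
by apply: eq_bigr => i _; rewrite innerZ (inner_sym Hg (_ : M) (e i)).
Qed.

(** The trace may be taken in any basis paired with its dual; the e_i are self-dual, while v and w
    are dual to each other. *)
Lemma null_frame_trace (Phi : 'rV[R]_m.+2 -> 'rV[R]_m.+2) :
  (forall (c : R) x y, Phi (c *: x + y) = c *: Phi x + Phi y) ->
  \sum_a Phi (delta_mx 0 a) 0 a = \sum_i <<Phi (e i), e i>> + <<Phi w, v>> + <<Phi v, w>>.
Proof.
move=> lin; have P0 : Phi 0 = 0.
  by have := lin 1 0 0; rewrite !scale1r addr0 -[LHS]addr0 => /addrI.
have PD x y : Phi (x + y) = Phi x + Phi y by have := lin 1 x y; rewrite !scale1r.
have PZ c x : Phi (c *: x) = c *: Phi x by have := lin c x 0; rewrite !addr0 P0 addr0.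
have S z y : \sum_a <<delta_mx 0 a, z>> * y 0 a = <<y, z>>.
  rewrite [in RHS](row_sum_delta y) inner_sum; apply: eq_bigr => a _.
  by rewrite innerZ mulrC.
rewrite -(S v (Phi w)) -(S w (Phi v)).
rewrite [X in X + _ + _](_ : _ = \sum_i \sum_a <<delta_mx 0 a, e i>> * Phi (e i) 0 a); last first.
  by apply: eq_bigr => i _; rewrite S.
rewrite exchange_big -!big_split; apply: eq_bigr => a _ /=.
rewrite [in LHS](null_frame_expand (delta_mx 0 a)) !PD !PZ !mxE; congr (_ + _ + _).
rewrite (big_morph Phi PD P0) summxE; apply: eq_bigr => i _.
by rewrite PZ mxE.
Qed.

(* Satisfied on a pp-wave by K = R and by K = nabla_u R, for v = V. *)
Definition pp_tensor K :=
  [/\ [/\ forall (c : R) x y z u, K (c *: x + y) z u = c *: K x z u + K y z u,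
       forall (c : R) x y z u, K z (c *: x + y) u = c *: K z x u + K z y u &
       forall (c : R) x y z u, K z u (c *: x + y) = c *: K z u x + K z u y],
   forall x y z, K y x z = - K x y z,
   forall x y z u, <<K x y z, u>> = - <<z, K x y u>>,
   forall x y z u, <<K x y z, u>> = <<K z u x, y>> &
   (forall x y, K x y v = 0) /\ (forall x y z, <<x, v>> = 0 -> <<y, v>> = 0 -> K x y z = 0)].

Variable K : 'rV[R]_m.+2 -> 'rV[R]_m.+2 -> 'rV[R]_m.+2 -> 'rV[R]_m.+2.
Hypothesis HK : pp_tensor K.

Let T y z := <<K w y z, w>>.

Let lin0 (h : 'rV[R]_m.+2 -> 'rV[R]_m.+2) :
  (forall (c : R) x y, h (c *: x + y) = c *: h x + h y) -> h 0 = 0.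
Proof. by move=> lin; have := lin 1 0 0; rewrite !scale1r addr0 -[LHS]addr0 => /addrI. Qed.

Let K1 (c : R) x y z u : K (c *: x + y) z u = c *: K x z u + K y z u.
Proof. by case: HK => -[]. Qed.
Let K2 (c : R) x y z u : K z (c *: x + y) u = c *: K z x u + K z y u.
Proof. by case: HK => -[]. Qed.
Let K3 (c : R) x y z u : K z u (c *: x + y) = c *: K z u x + K z u y.
Proof. by case: HK => -[]. Qed.

Lemma pp_tensor_perp x y z : <<K x y z, v>> = 0.
Proof. by have [_ _ sk _ [KV _]] := HK; rewrite sk KV (inner_sym Hg) inner0 oppr0. Qed.

(** Pair symmetry moves v to the slot where K takes values in v^perp. *)
Lemma pp_tensor_v2 x z : K x v z = 0.
Proof.
have [_ _ sk pr [KV _]] := HK; apply: (@inner_nondeg _ _ _ _ _ Hg p) => u.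
by rewrite pr pp_tensor_perp.
Qed.

Lemma pp_tensor_image x y z u : <<z, v>> = 0 -> <<u, v>> = 0 -> <<K x y z, u>> = 0.
Proof. by have [_ _ _ pr [_ K0]] := HK => zv uv; rewrite pr K0 // inner0. Qed.

(** Only the w-components of x and u contribute: K vanishes on v^perp in its first two slots and, by
    pair symmetry, is orthogonal to v^perp when z lies there. *)
Lemma pp_tensor_eval x y z u : <<y, v>> = 0 -> <<z, v>> = 0 ->
  <<K x y z, u>> = <<x, v>> * <<u, v>> * T y z.
Proof.
have [_ _ _ _ [_ K0]] := HK => yv zv; have [vv wv ww ew ee] := F.
have D x' : x' = <<x', v>> *: w + (\sum_i <<x', e i>> *: e i + <<x', w>> *: v).
  by rewrite {1}[x']null_frame_expand addrAC addrC.
have P x' : <<\sum_i <<x', e i>> *: e i + <<x', w>> *: v, v>> = 0.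
  by rewrite innerD innerZ vv mulr0 addr0 inner_sum big1 // => i _; rewrite innerZ (ew i).1 mulr0.
rewrite {1}(D x) K1 (K0 _ _ _ (P x) yv) addr0 innerZ -mulrA; congr (_ * _).
by rewrite {1}(D u) (innerDr Hg) (innerZr Hg) (pp_tensor_image _ _ zv (P u)) addr0.
Qed.

Lemma pp_tensor_frame y z : <<y, v>> = 0 -> <<z, v>> = 0 ->
  T y z = \sum_i \sum_j <<y, e i>> * <<z, e j>> * T (e i) (e j).
Proof.
move=> yv zv; have [_ _ _ _ [KV _]] := HK.
have z0 x u : K x 0 u = 0 by apply: (lin0 (h := fun y => K x y u)) => *; exact: K2.
have z0' x u : K x u 0 = 0 by apply: (lin0 (h := fun y => K x u y)) => *; exact: K3.
have add2 x u : {morph (fun y => K x y u) : a b / a + b}.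
  by move=> a b; have := K2 1 a b x u; rewrite !scale1r.
have add3 x u : {morph (fun y => K x u y) : a b / a + b}.
  by move=> a b; have := K3 1 a b x u; rewrite !scale1r.
have sc2 (c : R) x a u : K x (c *: a) u = c *: K x a u by have := K2 c a 0 x u; rewrite z0 !addr0.
have sc3 (c : R) x a u : K x u (c *: a) = c *: K x u a by have := K3 c a 0 x u; rewrite z0' !addr0.
rewrite /T {1}(null_frame_perp yv) addrC K2 pp_tensor_v2 scaler0 add0r.
rewrite (big_morph _ (add2 w z) (z0 w z)) inner_sum; apply: eq_bigr => i _.
rewrite sc2 innerZ {1}(null_frame_perp zv) addrC K3 KV scaler0 add0r.
rewrite (big_morph _ (add3 w (e i)) (z0' w (e i))) inner_sum mulr_sumr; apply: eq_bigr => j _.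
by rewrite sc3 innerZ mulrA.
Qed.

(** For y in v^perp all pairings of K x y reduce to values of T and to <K x y w, w>, which is zero
    by skewness. The remaining K w w z vanishes by antisymmetry. *)
Lemma pp_tensor_zero : (forall i j, T (e i) (e j) = 0) -> forall x y z, K x y z = 0.
Proof.
move=> T0; have [_ an sk pr [KV K0]] := HK.
have [vv wv ww ew ee] := F.
have T0' y z : <<y, v>> = 0 -> <<z, v>> = 0 -> T y z = 0.
  by move=> yv zv; rewrite pp_tensor_frame // big1 // => i _; rewrite big1 // => j _; rewrite T0 mulr0.
have D x' : exists2 x'', <<x'', v>> = 0 & x' = <<x', v>> *: w + x''.
  exists (x' - <<x', v>> *: w); last by rewrite addrC subrK.
  by rewrite innerD innerN innerZ wv mulr1 subrr.
have A x y z : <<y, v>> = 0 -> K x y z = 0.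
  move=> yv; apply: (@inner_nondeg _ _ _ _ _ Hg p) => u.
  have [z' zv ->] := D z; rewrite K3 innerD innerZ.
  rewrite (pp_tensor_eval _ _ yv zv) T0' // mulr0 addr0.
  rewrite sk (inner_sym Hg _ w); have [u' uv ->] := D u; rewrite K3 innerD innerZ.
  rewrite (pp_tensor_eval _ _ yv uv) T0' // mulr0 addr0.
  have : <<K x y w, w>> = - <<K x y w, w>> by rewrite {1}sk (inner_sym Hg _ w).
  move=> H; have -> : <<K x y w, w>> = 0 by lra.
  by rewrite mulr0 oppr0 mulr0.
move=> x y z; have [x' xv ->] := D x; rewrite K1 an (_ : K y w z = 0) ?oppr0 ?scaler0 ?add0r.
  by rewrite an A ?oppr0.
have [y' yv ->] := D y; rewrite K1 (_ : K y' w z = 0) ?addr0; last by rewrite an A ?oppr0.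
have : K w w z = - K w w z by rewrite -an.
by move=> /eqP; rewrite -addr_eq0 -mulr2n -scaler_nat scaler_eq0 pnatr_eq0 /= => /eqP ->; rewrite scaler0.
Qed.

End NullFrame.

(** * Existence of smooth null frames on a Lorentzian manifold *)

Section Lorentz.
Context {R : realType} {m : nat} {M : manifold R m.+2}.
Variable (g : M -> 'M[R]_m.+2).
Hypothesis Hg : lorentzian g.
Implicit Types (p q : M) (x y v w : 'rV[R]_m.+2) (X Y V W : M -> 'rV[R]_m.+2).

Lemma lorentz_coords p : exists Y : 'rV[R]_m.+2 -> 'rV[R]_m.+2,
  (forall (c : R) x, Y (c *: x) = c *: Y x) /\ injective Y /\
  forall x x', inner g p x x' = - (Y x 0 ord0 * Y x' 0 ord0)
    + \sum_j Y x 0 (lift ord0 j) * Y x' 0 (lift ord0 j).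
Proof.
have [_ [P Pu E]] := Hg.1 p; exists (fun x => x *m invmx P); split; last split.
- by move=> c x; rewrite scalemxAl.
- by move=> x x' /(congr1 (mulmx^~ P)) /=; rewrite !mulmxKV.
move=> x x'; rewrite /inner -{1}[x](mulmxKV Pu) -{1}[x'](mulmxKV Pu).
set y := x *m _; set y' := x' *m _.
have -> : y *m P *m g p *m (y' *m P)^T = y *m (P *m g p *m P^T) *m y'^T by rewrite trmx_mul !mulmxA.
rewrite E mul_mx_diag mxE big_ord_recl !mxE /= mulrN1 mulNr; congr (_ + _).
by apply: eq_bigr => j _; rewrite !mxE /= mulr1.
Qed.

(** The equality case of Cauchy-Schwarz: a non-spacelike vector orthogonal to the null vector v is
    proportional to v, and orthogonality to w then makes it zero. *)
Lemma lorentz_pos p v w x : inner g p v v = 0 -> inner g p w v = 1 -> inner g p x v = 0 ->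
  inner g p x w = 0 -> x <> 0 -> 0 < inner g p x x.
Proof.
move=> vv wv xv xw x0; have [Y [YZ [YI IE]]] := lorentz_coords p.
rewrite ltNge; apply/negP => xx; apply: x0.
set a := Y v 0 ord0; set b := fun j => Y v 0 (lift ord0 j).
set y := Y x 0 ord0; set z := fun j => Y x 0 (lift ord0 j).
have h1 : \sum_j b j * b j = a * a by move: vv; rewrite IE -/a => /eqP; rewrite addrC subr_eq0 => /eqP.
have h2 : \sum_j z j * b j = y * a by move: xv; rewrite IE -/a -/y => /eqP; rewrite addrC subr_eq0 => /eqP.
have h3 : \sum_j z j * z j <= y * y by move: xx; rewrite IE -/y addrC subr_le0.
(* Expanded, the sum is at most a^2 y^2 - 2 a^2 y^2 + y^2 a^2 = 0. *)
have H : \sum_j (a * z j - y * b j) ^+ 2 <= 0.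
  have -> : \sum_j (a * z j - y * b j) ^+ 2 = a * a * (\sum_j z j * z j) - (a * y + a * y) * (\sum_j z j * b j)
     + y * y * (\sum_j b j * b j).
    by rewrite !mulr_sumr -sumrB -big_split; apply: eq_bigr => j _ /=; ring.
  rewrite h1 h2; have := ler_wpM2l (_ : 0 <= a * a) h3; rewrite -expr2 sqr_ge0 => /(_ isT); nra.
have H0 : \sum_j (a * z j - y * b j) ^+ 2 == 0.
  by rewrite eq_le H sumr_ge0 // => j _; exact: sqr_ge0.
have zb j : a * z j = y * b j.
  move: H0; rewrite psumr_eq0 => [/allP/(_ j (mem_index_enum j))|l _]; last exact: sqr_ge0.
  by rewrite /= sqrf_eq0 subr_eq0 => /eqP.
have ax : a *: x = y *: v.
  apply: YI; rewrite !YZ; apply/rowP => i; rewrite !mxE; case: (unliftP ord0 i) => [j|] ->; first exact: zb.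
  by rewrite -/a -/y mulrC.
have yw : y = 0.
  have := congr1 (fun u => inner g p u w) ax; rewrite /= !innerZ xw mulr0 (inner_sym Hg _ v) wv mulr1.
  by [].
have : a *: x = 0 by rewrite ax yw scale0r.
move=> /eqP; rewrite scaler_eq0 => /orP[/eqP a0|/eqP //].
have b0 j : b j = 0.
  have : \sum_j b j * b j == 0 by rewrite h1 a0 mul0r.
  rewrite psumr_eq0 => [/allP/(_ j (mem_index_enum j))|l _]; last by rewrite -expr2 sqr_ge0.
  by rewrite /= mulf_eq0 orbb => /eqP.
have Y0 : Y 0 = 0 by have := YZ 0 0; rewrite !scale0r.
have v0 : v = 0.
  apply: YI; rewrite Y0; apply/rowP => i; rewrite [RHS]mxE; case: (unliftP ord0 i) => [j|] ->; first exact: b0.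
  exact: a0.
by move: wv; rewrite v0 (inner_sym Hg) inner0 => /eqP; rewrite eq_sym oner_eq0.
Qed.

(** Fewer than m + 2 linear conditions leave a nonzero solution, here a row of the kernel of g
    C^T. *)
Lemma complement_exists p (l : nat) (c : nat -> 'rV[R]_m.+2) : (l < m.+2)%N ->
  exists2 x, x != 0 & forall i, (i < l)%N -> inner g p x (c i) = 0.
Proof.
move=> lm; pose C : 'M[R]_(l, m.+2) := \matrix_i c i.
have : kermx (g p *m C^T) != 0.
  rewrite -mxrank_eq0 mxrank_ker -lt0n subn_gt0.
  by apply: leq_ltn_trans (rank_leq_col _) _.
move=> /rowV0Pn[x /sub_kermxP xC x0]; exists x => // i il.
have := congr1 (fun A : 'rV[R]_l => A 0 (Ordinal il)) xC; rewrite mulmxA [RHS]mxE mxE => <-.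
rewrite /inner mxE; apply: eq_bigr => j _; rewrite !mxE //.
Qed.

Lemma smooth_vfield_on_scale (U : set M) f X : open U -> smooth_on U f -> smooth_vfield X ->
  smooth_vfield_on U (fun q => f q *: X q).
Proof.
move=> oO Sf SX i a; have oi : open (dom i) := @cdom_open _ _ _ _.
apply: (@smooth_on_ext _ _ _ _ (fun p => f p * der (coord i a) p (X p))); first exact: openI.
  by move=> q [iq _]; rewrite derZ //; exact: smooth_at_coord.
apply: smooth_on_mul; first exact: openI.
  by apply: smooth_on_sub Sf => q [].
by apply: smooth_on_sub (SX i a) => q [].
Qed.

Lemma scale_extension p f X : smooth_at f p -> smooth_vfield X ->
  exists Y, smooth_vfield Y /\ \forall q \near p, Y q = f q *: X q.
Proof.
by move=> [U [oO Op Sf]] SX; exact: extend_vfield oO Op (smooth_vfield_on_scale oO Sf SX).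
Qed.

Lemma smooth_at_powR p f (a : R) : smooth_at f p -> 0 < f p -> smooth_at (fun q => f q `^ a) p.
Proof.
move=> Sf f0; have cf := smooth_at_cont Sf.
have N1 := near_and (cont_at_near f0 cf) (smooth_at_near Sf).
have [U [oO Op OP]] := near_exists_open N1; exists U; split => //.
apply: (@smooth_on_comp1 _ _ _ (fun h => exists c a : R, h = (fun t => c * t `^ a)) [set t | 0 < t] U (fun t => t `^ a)) => //.
- move=> _ [c [b ->]]; exists (fun t => (c * b) * t `^ (b - 1)); first by exists (c * b), (b - 1).
  move=> t t0; have h := isd_mul (is_derive_cst c t 1) (is_derive1_powR b t0).
  by apply: (is_derive_eq h); rewrite mulr0 addr0 mulrA.
- by move=> q /OP[]; rewrite /= ltr_distlC => /andP[]; lra.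
- by exists 1, a; apply/funext => t; rewrite mul1r.
by apply: smooth_on_of_at => q /OP[].
Qed.

Variable V : M -> 'rV[R]_m.+2.
Hypotheses (SV : smooth_vfield V) (V0 : forall p, V p <> 0) (VV : forall p, inner g p (V p) (V p) = 0).

Let Sg X Y : smooth_vfield X -> smooth_vfield Y -> smooth_on setT (fun q => inner g q (X q) (Y q)).
Proof. by move=> *; exact: Hg.2. Qed.

Lemma null_dual p : exists W, smooth_vfield W /\
  \forall q \near p, inner g q (W q) (V q) = 1 /\ inner g q (W q) (W q) = 0.
Proof.
have [w0 hw] : exists w0, inner g p w0 (V p) != 0.
  apply: contrapT => H; apply: (V0 (p := p)); apply: (@inner_nondeg _ _ _ _ _ Hg p) => w.
  by rewrite (inner_sym Hg); case: (eqVneq (inner g p w (V p)) 0) => // h; case: H; exists w.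
pose X := extv p w0; have SX : smooth_vfield X by exact: extv_smooth.
pose f q := inner g q (X q) (V q); have Sf := smooth_at_global p (Sg SX SV).
have fp : f p != 0 by rewrite /f /X extvE.
have Sf' : smooth_at (fun q => (f q)^-1) p.
  have nf : 0 < `|f p| by rewrite normr_gt0.
  have N1 := near_and (cont_at_near nf (smooth_at_cont Sf)) (smooth_at_near Sf).
  have [U [oO Op OP]] := near_exists_open N1; exists U; split => //.
  apply: smooth_on_inv => //; last by apply: smooth_on_of_at => q /OP[].
  by move=> q /OP[h _]; apply/eqP => E; move: h; rewrite -/(f p) -/(f q) E subr0 ltxx.
have [Y [SY YE]] := scale_extension Sf' SX.
have YV : \forall q \near p, inner g q (Y q) (V q) = 1.
  have nf : 0 < `|f p| by rewrite normr_gt0.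
  apply: near_mono (near_and YE (cont_at_near nf (smooth_at_cont Sf))) => q [-> h].
  rewrite innerZ mulVf //; apply/eqP => E; move: h; rewrite -/(f p) -/(f q) [X in _ - X]E subr0 ltxx.
  by [].
(* Near p one has <Y, V> = 1 and <V, V> = 0, so adding h V to Y changes <Y, Y> by 2 h without
   changing <Y, V>. *)
pose h q := - (inner g q (Y q) (Y q) / 2).
have Sh : smooth_on setT h.
  apply: smooth_on_opp; first exact: openT.
  by apply: smooth_on_mul; [exact: openT|exact: Sg|exact: smooth_on_cst].
exists (Y \+ (fun q => h q *: V q)); split.
  exact: (smooth_vfield_add SY (smooth_vfield_scale Sh SV)).
apply: near_mono YV => q E /=; rewrite !innerD !(innerDr Hg) !innerZ !(innerZr Hg) VV E (inner_sym Hg q (V q)) E.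
by split; rewrite /h; [ring|lra].
Qed.

(** Gram-Schmidt on a neighbourhood: a vector orthogonal at p to the fields found so far is
    extended, projected and normalised. [lorentz_pos] ensures that its square length is positive. *)
Lemma null_frame_near p : exists W (E : 'I_m -> M -> 'rV[R]_m.+2),
  [/\ smooth_vfield W, forall i, smooth_vfield (E i) &
   \forall q \near p, null_frame g q (V q) (W q) (fun i => E i q)].
Proof.
have [W [SW NW]] := null_dual p; exists W.
(* Fields indexed by natural numbers let the induction add one field at a time; the entries beyond
   the current length are junk. *)
suff [E [SE NE]] : exists E : nat -> M -> 'rV[R]_m.+2, (forall i, smooth_vfield (E i)) /\
    \forall q \near p, (forall i, (i < m)%N -> inner g q (E i q) (V q) = 0 /\ inner g q (E i q) (W q) = 0) /\
      forall i j, (i < m)%N -> (j < m)%N -> inner g q (E i q) (E j q) = (i == j)%:R.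
  exists (fun i : 'I_m => E i); split; [exact: SW|by move=> i; exact: SE|].
  apply: near_mono (near_and NW NE) => q [[WV WW] [E1 E2]].
  split; [exact: VV|exact: WV|exact: WW| |].
    by move=> i; exact: E1.
  by move=> i j; rewrite E2.
suff H l : (l <= m)%N -> exists E : nat -> M -> 'rV[R]_m.+2, (forall i, smooth_vfield (E i)) /\
    \forall q \near p, (forall i, (i < l)%N -> inner g q (E i q) (V q) = 0 /\ inner g q (E i q) (W q) = 0) /\
      forall i j, (i < l)%N -> (j < l)%N -> inner g q (E i q) (E j q) = (i == j)%:R by exact: H.
elim: l => [_|l IH lm].
  by exists (fun _ => V); split => //; apply: near_true => q; split.
have [E [SE NE]] := IH (ltnW lm).
(* The l + 2 vectors to avoid, in the order V, W, E 0, E 1, and so on; hence the shift by two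
   below. *)
pose c j := if j is j'.+1 then (if j' is i.+1 then E i p else W p) else V p.
have [x x0 xc] := complement_exists p c (lm : (l.+2 < m.+2)%N).
pose X := extv p x; have SX : smooth_vfield X by exact: extv_smooth.
pose Y q := X q - (\sum_(j < l) inner g q (X q) (E j q) *: E j q
  + inner g q (X q) (V q) *: W q + inner g q (X q) (W q) *: V q).
have SY : smooth_vfield Y.
  have h1 (j : 'I_l) := smooth_vfield_scale (Sg SX (SE j)) (SE j).
  have h2 := @smooth_vfield_sum _ _ _ _ (index_enum 'I_l) xpredT _ (fun j _ => h1 j).
  have h3 := smooth_vfield_scale (Sg SX SV) SW.
  have h4 := smooth_vfield_scale (Sg SX SW) SV.
  exact: (smooth_vfield_sub SX (smooth_vfield_add (smooth_vfield_add h2 h3) h4)).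
have YP : Y p = x.
  rewrite /Y /X extvE big1 => [|j _].
    by rewrite (xc 0%N) // (xc 1%N) // !scale0r !addr0 subr0.
  by rewrite (xc j.+2) ?scale0r // !ltnS.
have NY : \forall q \near p, [/\ inner g q (Y q) (V q) = 0, inner g q (Y q) (W q) = 0 &
    forall i, (i < l)%N -> inner g q (Y q) (E i q) = 0].
  apply: near_mono (near_and NW NE) => q [[WV WW] [E1 E2]].
  have VW : inner g q (V q) (W q) = 1 by rewrite (inner_sym Hg).
  rewrite /Y; split=> [||i il]; rewrite innerD innerN !innerD !innerZ inner_sum.
  - rewrite big1 => [|j _]; first by rewrite WV VV mulr0 mulr1 addr0 add0r subrr.
    by rewrite innerZ (E1 j _).1 ?mulr0.
  - rewrite big1 => [|j _]; first by rewrite WW VW mulr0 mulr1 !add0r subrr.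
    by rewrite innerZ (E1 j _).2 ?mulr0.
  - rewrite (bigD1 (Ordinal il)) //= big1 => [|j ji]; last first.
      rewrite innerZ E2 //; case: eqP => [h|_]; last by rewrite mulr0.
      by move: ji; rewrite -val_eqE /= h eqxx.
    rewrite innerZ E2 // eqxx (inner_sym Hg q (W q)) (inner_sym Hg q (V q)) (E1 i il).1 (E1 i il).2.
    by rewrite !mulr0 !addr0 mulr1 subrr.
have [NW0 NE0] := (near_at NW, near_at NE).
have Y0 : 0 < inner g p (Y p) (Y p).
  have [Yv Yw _] := near_at NY.
  by apply: (lorentz_pos (VV p) NW0.1 Yv Yw); rewrite YP; exact/eqP.
pose f q := inner g q (Y q) (Y q).
have Sf := smooth_at_global p (Sg SY SY).
(* The exponent - 1/2 turns the square length f of Y into 1. *)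
have [Z [SZ ZE]] := scale_extension (smooth_at_powR (- 2^-1) Sf Y0) SY.
have NZ : \forall q \near p, [/\ inner g q (Z q) (V q) = 0, inner g q (Z q) (W q) = 0,
    forall i, (i < l)%N -> inner g q (Z q) (E i q) = 0 & inner g q (Z q) (Z q) = 1].
  have Nf := cont_at_near Y0 (smooth_at_cont Sf).
  apply: near_mono (near_and Nf (near_and ZE NY)) => q [fq [-> [Yv Yw Ye]]].
  have fq0 : 0 < inner g q (Y q) (Y q) by move: fq; rewrite ltr_distlC => /andP[]; lra.
  split=> [||i il|]; rewrite innerZ ?Yv ?Yw ?Ye ?mulr0 //.
  rewrite (innerZr Hg) mulrA -powRD; last by rewrite (lt0r_neq0 fq0) implybT.
  have -> : - 2^-1 - 2^-1 = -1 :> R by lra.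
  by rewrite powRN powRr1 ?ltW // mulVf // lt0r_neq0.
exists (fun j => if j == l then Z else E j); split.
  by move=> i; case: ifP => _; [exact: SZ|exact: SE].
have L j : (j < l.+1)%N -> j != l -> (j < l)%N by rewrite ltnS ltn_neqAle => -> ->.
apply: near_mono (near_and NE NZ) => q [[E1 E2] [Zv Zw Ze Zz]]; split=> [i hi|i j hi hj].
  by case: (eqVneq i l) => [_|il]; [split|exact: E1 (L _ hi il)].
case: (eqVneq i l) => il; case: (eqVneq j l) => jl.
- by rewrite il jl eqxx.
- by rewrite il (Ze _ (L _ hj jl)) eq_sym (negbTE jl).
- by rewrite jl (inner_sym Hg) (Ze _ (L _ hi il)) (negbTE il).
- exact: E2 (L _ hi il) (L _ hj jl).
Qed.

End Lorentz.

(** * Curvature of a pp-wave in a null frame *)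

Section PpWave.
Context {R : realType} {m : nat} {M : manifold R m.+2}.
Variable (g : M -> 'M[R]_m.+2).
Hypothesis Hg : lorentzian g.
Variable nabla : (M -> 'rV[R]_m.+2) -> (M -> 'rV[R]_m.+2) -> (M -> 'rV[R]_m.+2).
Hypothesis LC : levi_civita g nabla.
Variable V : M -> 'rV[R]_m.+2.
Hypothesis PP : pp_wave g nabla V.
Implicit Types (p q : M) (u v w x y z : 'rV[R]_m.+2) (X Y Z W : M -> 'rV[R]_m.+2).

Let SV : smooth_vfield V. Proof. by have [[]] := PP. Qed.
Let V0 p : V p <> 0. Proof. by have [[_ h _ _] _ _] := PP. Qed.
Let VV p : inner g p (V p) (V p) = 0. Proof. by have [[_ _ h _] _ _] := PP. Qed.
Let VP X : smooth_vfield X -> forall p, nabla X V p = 0. Proof. by have [[_ _ _ h] _ _] := PP; exact: h. Qed.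
Let flatV X Y Z : orth_section g V X -> orth_section g V Y -> smooth_vfield Z -> forall p, curv nabla X Y Z p = 0.
Proof. by have [_ _ h] := PP; exact: h. Qed.
Let es p x : smooth_vfield (extv p x) := extv_smooth p x.
Let Sg X Y : smooth_vfield X -> smooth_vfield Y -> smooth_on setT (fun q => inner g q (X q) (Y q)).
Proof. by move=> *; exact: Hg.2. Qed.
Let SN X Y : smooth_vfield X -> smooth_vfield Y -> smooth_vfield (nabla X Y).
Proof. exact: (nabla_smooth LC). Qed.
Let SC X Y Z : smooth_vfield X -> smooth_vfield Y -> smooth_vfield Z -> smooth_vfield (curv nabla X Y Z).
Proof. exact: (curv_smooth Hg LC). Qed.

(** The combination of x and W with coefficients <W, V> and - <x, V> is orthogonal to V everywhere,
    even where W is no longer normalised, and equals x at p. *)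
Lemma orth_extension p x : inner g p x (V p) = 0 -> exists X, orth_section g V X /\ X p = x.
Proof.
move=> xV; have [W [SW NW]] := null_dual Hg SV V0 VV p.
have [WV _] := near_at NW; have Sx := es p x.
pose X := (fun q => inner g q (W q) (V q) *: extv p x q) \- (fun q => inner g q (extv p x q) (V q) *: W q).
exists X; split; last by rewrite /X /= extvE WV xV scale1r scale0r subr0.
split; first exact: (smooth_vfield_sub (smooth_vfield_scale (Sg SW SV) Sx) (smooth_vfield_scale (Sg Sx SV) SW)).
by move=> q; rewrite /X /= innerD innerN !innerZ mulrC subrr.
Qed.

Lemma nabla_zero X p : smooth_vfield X -> nabla X (fun=> 0) p = 0.
Proof.
move=> SX; have [[_ _ _ _ c5] _ _] := LC.
have := c5 (fun=> 0) X V (smooth_on_cst _ 0) SX SV p.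
by rewrite (_ : (fun q => 0 *: V q) = fun=> 0) ?der_cst ?scale0r ?addr0 //; apply/funext => q; rewrite scale0r.
Qed.

Lemma nabla_V X : smooth_vfield X -> nabla X V = (fun=> 0).
Proof. by move=> SX; apply/funext => p; exact: VP. Qed.

Lemma curv_V X Y : smooth_vfield X -> smooth_vfield Y -> curv nabla X Y V = (fun=> 0).
Proof.
move=> SX SY; apply/funext => p; rewrite /curv /=.
by rewrite (nabla_V SX) (nabla_V SY) (nabla_zero p SX) (nabla_zero p SY) (VP (smooth_lie SX SY)) !subrr.
Qed.

Lemma curv_zero X Y p : smooth_vfield X -> smooth_vfield Y -> curv nabla X Y (fun=> 0) p = 0.
Proof.
move=> SX SY; have S0 : smooth_vfield (fun _ : M => 0 : 'rV[R]_m.+2) := smooth_vfield0.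
have Z A : smooth_vfield A -> nabla A (fun=> 0) = (fun=> 0).
  by move=> SA; apply/funext => q; exact: nabla_zero.
by rewrite /curv /= (Z _ SX) (Z _ SY) (Z _ SX) (Z _ (smooth_lie SX SY)) !subrr.
Qed.

Lemma nabla_orth X Y : smooth_vfield X -> orth_section g V Y -> orth_section g V (nabla X Y).
Proof.
move=> SX [SY YV]; split; first exact: SN.
move=> p; have [_ _ compat] := LC; have := compat X Y V SX SY SV p.
rewrite VP // (inner_sym Hg p (Y p)) inner0 addr0 => <-.
rewrite (_ : (fun q => _) = fun=> 0) ?der_cst //.
by apply/funext => q; exact: YV.
Qed.

Lemma pp_tensor_Rm p : pp_tensor g p (V p) (Rm nabla p).
Proof.
split.
- split=> *; [exact: (Rm_lin1 Hg LC)|exact: (Rm_lin2 Hg LC)|exact: (Rm_lin3 Hg LC)].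
- by move=> *; exact: (Rm_anti Hg LC).
- by move=> *; exact: (Rm_skew Hg LC).
- by move=> *; exact: (Rm_pair Hg LC).
split=> [x y|x y z xV yV].
  have := RmE Hg LC p (es p x) (es p y) SV; rewrite !extvE => <-.
  by rewrite (curv_V (es p x) (es p y)).
have [X [[SX XV] Xx]] := orth_extension xV; have [Y [[SY YV] Yy]] := orth_extension yV.
have := RmE Hg LC p SX SY (es p z); rewrite Xx Yy extvE => <-.
exact: (flatV (conj SX XV) (conj SY YV) (es p z)).
Qed.

(** V parallel makes V^perp parallel, so every term of the Leibniz formula inherits the vanishing of
    R on V and on pairs from V^perp. *)
Lemma pp_tensor_dRm p u : pp_tensor g p (V p) (dRm nabla p u).
Proof.
split.
- split=> *; [exact: (dRm_lin1 Hg LC)|exact: (dRm_lin2 Hg LC)|exact: (dRm_lin3 Hg LC)].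
- by move=> *; exact: (dRm_anti Hg LC).
- by move=> *; exact: (dRm_skew Hg LC).
- by move=> *; exact: (dRm_pair Hg LC).
split=> [x y|x y z xV yV].
  have := dRmE Hg LC p (es p u) (es p x) (es p y) SV; rewrite !extvE => <-.
  have [Su [Sx Sy]] := (es p u, (es p x, es p y)).
  rewrite /dcurv /= (curv_V Sx Sy) (nabla_V Su) curv_zero // nabla_zero //.
  by rewrite (curv_V (SN Su Sx) Sy) (curv_V Sx (SN Su Sy)) !subrr.
have [X [OX Xx]] := orth_extension xV; have [Y [OY Yy]] := orth_extension yV.
have [[SX XV] [SY YV]] := (OX, OY); have [Su Sz] := (es p u, es p z).
have := dRmE Hg LC p Su SX SY Sz; rewrite Xx Yy !extvE => <-.
rewrite /dcurv /= (_ : curv nabla X Y (extv p z) = fun=> 0); last by apply/funext => q; exact: flatV.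
rewrite nabla_zero // (flatV (nabla_orth Su OX) OY Sz) (flatV OX (nabla_orth Su OY) Sz).
by rewrite (flatV OX OY (SN Su Sz)) !subr0.
Qed.

(** Of the three terms of the second Bianchi identity, the one with both u and x in the curvature
    slots vanishes because they lie in V^perp. This is the total symmetry of DT. *)
Lemma dRm_sym p u x y w : inner g p u (V p) = 0 -> inner g p x (V p) = 0 ->
  dRm nabla p u w x y = dRm nabla p x w u y.
Proof.
move=> uV xV; have := dRm_bianchi2 Hg LC p u w x y.
have [_ _ _ _ [_ H]] := pp_tensor_dRm p w; rewrite H // addr0.
by rewrite [X in _ + X](dRm_anti Hg LC) => /eqP; rewrite subr_eq0 => /eqP.
Qed.

(** [dRm_sym] moves V from the differentiation slot into a curvature slot. *)
Lemma dRm_along_V p x y w : inner g p x (V p) = 0 -> dRm nabla p (V p) w x y = 0.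
Proof.
move=> xV; rewrite (dRm_sym _ _ (VV p) xV).
exact: (pp_tensor_v2 Hg (pp_tensor_dRm p x)).
Qed.

Section Frame.
Variables (U : set M) (W : M -> 'rV[R]_m.+2) (E : 'I_m -> M -> 'rV[R]_m.+2).
Hypotheses (oU : open U) (SW : smooth_vfield W) (SE : forall i, smooth_vfield (E i)).
Hypothesis NF : forall q, U q -> null_frame g q (V q) (W q) (fun i => E i q).

(** Components of T in the screen frame; [conn X] is the matrix of the induced screen connection
    along X. *)
Definition hess i j q := inner g q (curv nabla W (E i) (E j) q) (W q).
Definition conn X i j q := inner g q (nabla X (E i) q) (E j q).

Let compat := let: And3 _ _ h := LC in h.
Let tor := let: And3 _ h _ := LC in h.

Lemma hess_smooth i j : smooth_on setT (hess i j).
Proof. exact: Sg (SC SW (SE i) (SE j)) SW. Qed.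

Lemma conn_smooth X i j : smooth_vfield X -> smooth_on setT (conn X i j).
Proof. by move=> SX; exact: Sg (SN SX (SE i)) (SE j). Qed.

Lemma hessE i j q : hess i j q = inner g q (Rm nabla q (W q) (E i q) (E j q)) (W q).
Proof. by rewrite /hess (RmE Hg LC q SW (SE i) (SE j)). Qed.

Lemma hess_sym i j q : hess i j q = hess j i q.
Proof.
rewrite !hessE (Rm_pair Hg LC) (Rm_anti Hg LC) innerN (Rm_skew Hg LC) opprK.
by rewrite (inner_sym Hg).
Qed.

Let E_perp i q : U q -> inner g q (E i q) (V q) = 0.
Proof. by move=> /NF[_ _ _ h _]; exact: (h i).1. Qed.
Let nearU q (P : M -> Prop) : U q -> (forall q', U q' -> P q') -> \forall q' \near q, P q'.
Proof. by move=> Uq H; apply: near_mono (near_open oU Uq). Qed.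

Let inner_cst_der X Y Z (c : R) q : U q -> smooth_vfield X -> smooth_vfield Y -> smooth_vfield Z ->
  (forall q, U q -> inner g q (Y q) (Z q) = c) ->
  inner g q (nabla X Y q) (Z q) + inner g q (Y q) (nabla X Z q) = 0.
Proof.
move=> Uq SX SY SZ H; rewrite -(compat SX SY SZ).
by rewrite (der_ext _ (nearU Uq H)) der_cst.
Qed.

Lemma nabla_perp X Y (c : R) q : U q -> smooth_vfield X -> smooth_vfield Y ->
  (forall q, U q -> inner g q (Y q) (V q) = c) -> inner g q (nabla X Y q) (V q) = 0.
Proof.
move=> Uq SX SY H; have := inner_cst_der Uq SX SY SV H.
by rewrite VP // (inner_sym Hg q (Y q)) inner0 addr0.
Qed.

Lemma conn_anti X i j q : U q -> smooth_vfield X -> conn X i j q = - conn X j i q.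
Proof.
move=> Uq SX; apply/eqP; rewrite -addr_eq0 /conn; apply/eqP.
rewrite [X in _ + X](inner_sym Hg).
by apply: (inner_cst_der Uq SX (SE i) (SE j) (c := (i == j)%:R)) => q' /NF[_ _ _ _ ->].
Qed.

Lemma nabla_frame_inner X Y i j q : U q -> smooth_vfield X -> smooth_vfield Y ->
  inner g q (nabla X (E i) q) (nabla Y (E j) q) = \sum_r conn X i r q * conn Y j r q.
Proof.
move=> Uq SX SY; apply: (null_frame_inner Hg (NF Uq)).
  by apply: (nabla_perp Uq SX (SE i) (c := 0)) => q'; exact: E_perp.
by apply: (nabla_perp Uq SY (SE j) (c := 0)) => q'; exact: E_perp.
Qed.

Lemma dcurv_aux (a b c d : 'rV[R]_m.+2) : a = a - b - c - d + b + c + d.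
Proof. by apply/rowP => i; rewrite !mxE; ring. Qed.

Lemma congr_add4 (a b c d a' b' c' d' : 'rV[R]_m.+2) : a = a' -> b = b' -> c = c' -> d = d' ->
  a + b + c + d = a' + b' + c' + d'.
Proof. by move=> -> -> -> ->. Qed.

Lemma add3_zero (a b c : R) : b = 0 -> c = 0 -> a + b + c = a.
Proof. by move=> -> ->; rewrite !addr0. Qed.

Lemma inner_add4 q a w b c d : b = 0 ->
  inner g q (a + b + c + d) w = inner g q a w + inner g q c w + inner g q d w.
Proof. by move=> ->; rewrite addr0 !innerD. Qed.

Lemma sum_delta_l (a c : 'I_m -> R) (t : 'I_m -> 'I_m -> R) i : (forall b, a b = (i == b)%:R) ->
  \sum_b \sum_l a b * c l * t b l = \sum_l c l * t i l.
Proof.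
move=> aE; rewrite (bigD1 i) //= [X in _ + X]big1 ?addr0 => [|b bi].
  by apply: eq_bigr => l _; rewrite aE eqxx mul1r.
by rewrite big1 // => l _; rewrite aE eq_sym (negbTE bi) !mul0r.
Qed.

Lemma sum_delta_r (a c : 'I_m -> R) (t : 'I_m -> 'I_m -> R) i : (forall b, a b = (i == b)%:R) ->
  \sum_l \sum_b c l * a b * t l b = \sum_l c l * t l i.
Proof.
move=> aE; apply: eq_bigr => l _; rewrite (bigD1 i) //= big1 ?addr0 => [|b bi].
  by rewrite aE eqxx mulr1.
by rewrite aE eq_sym (negbTE bi) mulr0 mul0r.
Qed.

(** Since <W, V> is constant, nabla_X W lies in V^perp, and both terms in which W is differentiated
    vanish; the frame fields contribute their screen components only. *)
Lemma hess_der X i j q : U q -> smooth_vfield X ->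
  der (hess i j) q (X q) = inner g q (dRm nabla q (X q) (W q) (E i q) (E j q)) (W q)
   + \sum_l conn X i l q * hess l j q + \sum_l conn X j l q * hess i l q.
Proof.
move=> Uq SX; pose C := curv nabla W (E i) (E j).
have FR := NF Uq; have PT := pp_tensor_Rm q; have [vv wv ww ew ee] := FR.
have WX : inner g q (nabla X W q) (V q) = 0.
  by apply: (nabla_perp Uq SX SW (c := 1)) => q' /NF[].
have EX l : inner g q (nabla X (E l) q) (V q) = 0.
  by apply: (nabla_perp Uq SX (SE l) (c := 0)) => q'; exact: E_perp.
have e2 : inner g q (C q) (nabla X W q) = 0.
  rewrite /C (RmE Hg LC q SW (SE i) (SE j)).
  exact: (pp_tensor_image PT _ _ (E_perp j Uq) WX).
have D : nabla X C q = dRm nabla q (X q) (W q) (E i q) (E j q) + Rm nabla q (nabla X W q) (E i q) (E j q)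
   + Rm nabla q (W q) (nabla X (E i) q) (E j q) + Rm nabla q (W q) (E i q) (nabla X (E j) q).
  transitivity (dcurv nabla X W (E i) (E j) q + curv nabla (nabla X W) (E i) (E j) q
   + curv nabla W (nabla X (E i)) (E j) q + curv nabla W (E i) (nabla X (E j)) q).
    exact: (dcurv_aux (nabla X C q)).
  exact: (congr_add4 (dRmE Hg LC q SX SW (SE i) (SE j)) (RmE Hg LC q (SN SX SW) (SE i) (SE j))
    (RmE Hg LC q SW (SN SX (SE i)) (SE j)) (RmE Hg LC q SW (SE i) (SN SX (SE j)))).
have [_ _ _ _ [_ K0]] := PT.
have e1 : inner g q (nabla X C q) (W q) = inner g q (dRm nabla q (X q) (W q) (E i q) (E j q)) (W q)
   + \sum_l conn X i l q * hess l j q + \sum_l conn X j l q * hess i l q.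
  apply: (etrans (congr1 (fun x => inner g q x (W q)) D)).
  apply: (etrans (inner_add4 q _ (W q) _ _ (K0 _ _ _ WX (E_perp i Uq)))).
  apply: (etrans (congr2 (fun s t : R => inner g q (dRm nabla q (X q) (W q) (E i q) (E j q)) (W q) + s + t)
    (pp_tensor_frame Hg FR PT (EX i) (E_perp j Uq)) (pp_tensor_frame Hg FR PT (E_perp i Uq) (EX j)))).
  have h := sum_delta_r (fun l => conn X i l q) (fun a b => inner g q (Rm nabla q (W q) (E a q) (E b q)) (W q)) (ee j).
  have h' := sum_delta_l (fun l => conn X j l q) (fun a b => inner g q (Rm nabla q (W q) (E a q) (E b q)) (W q)) (ee i).
  apply: (etrans (congr2 (fun s t : R => inner g q (dRm nabla q (X q) (W q) (E i q) (E j q)) (W q) + s + t) h h')).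
  have h2 : \sum_l conn X i l q * inner g q (Rm nabla q (W q) (E l q) (E j q)) (W q) = \sum_l conn X i l q * hess l j q.
    by apply: eq_bigr => l _; congr (_ * _); exact: esym (hessE l j q).
  have h2' : \sum_l conn X j l q * inner g q (Rm nabla q (W q) (E i q) (E l q)) (W q) = \sum_l conn X j l q * hess i l q.
    by apply: eq_bigr => l _; congr (_ * _); exact: esym (hessE i l q).
  exact: (congr2 (fun s t : R => inner g q (dRm nabla q (X q) (W q) (E i q) (E j q)) (W q) + s + t) h2 h2').
apply: (etrans (compat SX (SC SW (SE i) (SE j)) SW q)).
by apply: (etrans (congr2 +%R e1 e2)); rewrite addr0.
Qed.

(** The distribution V^perp is integrable, being parallel for a torsion-free connection. *)
Lemma bracket_perp X Y c d q : U q -> smooth_vfield X -> smooth_vfield Y ->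
  (forall q, U q -> inner g q (X q) (V q) = c) -> (forall q, U q -> inner g q (Y q) (V q) = d) ->
  inner g q (lie X Y q) (V q) = 0.
Proof.
move=> Uq SX SY HX HY; rewrite -(tor SX SY q) innerD innerN.
by rewrite (nabla_perp Uq SX SY HY) (nabla_perp Uq SY SX HX) subrr.
Qed.

Lemma der_bracket X Y f q : U q -> smooth_vfield X -> smooth_vfield Y -> smooth_at f q ->
  inner g q (lie X Y q) (V q) = 0 ->
  der (fun q => der f q (Y q)) q (X q) - der (fun q => der f q (X q)) q (Y q) =
  \sum_r inner g q (lie X Y q) (E r q) * der f q (E r q) + inner g q (lie X Y q) (W q) * der f q (V q).
Proof.
move=> Uq SX SY Sf LV; apply: (etrans (esym (der_lie SX SY Sf))).
rewrite {1}(null_frame_perp Hg (NF Uq) LV) (derD _ _ Sf) (derZ _ _ Sf) (der_sumv _ _ _ Sf).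
by congr (_ + _); apply: eq_bigr => r _; rewrite (derZ _ _ Sf).
Qed.

Lemma lie_conn k l r q : inner g q (lie (E k) (E l) q) (E r q) = conn (E k) l r q - conn (E l) k r q.
Proof. by rewrite -(tor (SE k) (SE l) q) innerD innerN. Qed.

Lemma lie_conn_V l r q : inner g q (lie V (E l) q) (E r q) = conn V l r q.
Proof. by rewrite -(tor SV (SE l) q) (VP (SE l)) subr0. Qed.

Lemma nabla_expand X Y q : U q -> smooth_vfield X -> smooth_vfield Y -> inner g q (X q) (V q) = 0 ->
  nabla X Y q = \sum_r inner g q (X q) (E r q) *: nabla (E r) Y q + inner g q (X q) (W q) *: nabla V Y q.
Proof.
move=> Uq SX SY XV; have [[c1 c2 c3 _ _] _ _] := LC.
pose a r := inner g q (X q) (E r q); pose b := inner g q (X q) (W q).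
have Sa r : smooth_vfield (fun q => a r *: E r q) := smooth_vfield_scale (smooth_on_cst _ (a r)) (SE r).
have Sb : smooth_vfield (fun q => b *: V q) := smooth_vfield_scale (smooth_on_cst _ b) SV.
have Ss := @smooth_vfield_sum _ _ _ _ (index_enum 'I_m) xpredT _ (fun r _ => Sa r).
rewrite (nabla_tens LC SX (smooth_vfield_add Ss Sb) SY); last first.
  by rewrite {1}(null_frame_perp Hg (NF Uq) XV).
apply: (etrans (c2 _ _ _ Ss Sb SY q)); congr (_ + _); last exact: (c3 (fun=> b) V Y (smooth_on_cst _ b) SV SY q).
have h := @tensorial_sum _ _ _ 'rV[R]_m.+2 (fun A => nabla A Y q) q _ _ 'I_m (index_enum 'I_m) (fun r q => a r *: E r q) Sa.
apply: etrans (h _ _) _.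
- by move=> A B SA SB; exact: c2.
- by move=> f A Sf SA; exact: c3.
- by apply: eq_bigr => r _; exact: (c3 (fun=> a r) (E r) Y (smooth_on_cst _ (a r)) (SE r) SY q).
Qed.

(** R(E_k, E_l) = 0 written in the frame. The quadratic terms involve screen components only,
    because two vectors of V^perp pair through them, and [nabla_expand] resolves the derivative
    along the bracket. *)
Lemma conn_flat k l i j q : U q ->
  der (conn (E l) i j) q (E k q) - der (conn (E k) i j) q (E l q)
  + \sum_r conn (E l) i r q * conn (E k) r j q - \sum_r conn (E k) i r q * conn (E l) r j q =
  \sum_r (conn (E k) l r q - conn (E l) k r q) * conn (E r) i j q
   + inner g q (lie (E k) (E l) q) (W q) * conn V i j q.
Proof.
move=> Uq; have D a b : der (conn (E b) i j) q (E a q) =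
   inner g q (nabla (E a) (nabla (E b) (E i)) q) (E j q) - \sum_r conn (E b) i r q * conn (E a) r j q.
  apply: (etrans (compat (SE a) (SN (SE b) (SE i)) (SE j) q)); congr (_ + _).
  apply: (etrans (nabla_frame_inner i j Uq (SE b) (SE a))); rewrite -sumrN.
  by apply: eq_bigr => r _; rewrite (conn_anti j r Uq (SE a)) mulrN.
have LV := bracket_perp Uq (SE k) (SE l) (fun q h => E_perp k h) (fun q h => E_perp l h).
have H : inner g q (curv nabla (E k) (E l) (E i) q) (E j q) = 0.
  have [_ _ _ _ [_ K0]] := pp_tensor_Rm q.
  by rewrite (RmE Hg LC q (SE k) (SE l) (SE i)) K0 ?inner0 //; exact: E_perp.
have L : inner g q (nabla (lie (E k) (E l)) (E i) q) (E j q) =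
  \sum_r (conn (E k) l r q - conn (E l) k r q) * conn (E r) i j q
   + inner g q (lie (E k) (E l) q) (W q) * conn V i j q.
  rewrite (nabla_expand Uq (smooth_lie (SE k) (SE l)) (SE i) LV) innerD innerZ inner_sum; congr (_ + _).
  by apply: eq_bigr => r _; rewrite innerZ lie_conn.
rewrite -L !D; move: H; rewrite /curv /= !innerD !innerN => /eqP.
rewrite subr_eq0 => /eqP <-; ring.
Qed.

(** Ric(W, W) in the null frame: the two terms that pair V with W vanish, and pair symmetry
    identifies the rest with the trace of T. *)
Lemma ricci_flat_trace q : ricci_flat nabla -> U q -> \sum_i hess i i q = 0.
Proof.
move=> RF Uq; have := RF q (fun a => extv q (delta_mx 0 a)) (extv q (W q)) (extv q (W q))
  (fun a => es q _) (fun a => extvE q _) (es q _) (es q _).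
have lin (c : R) x y : Rm nabla q (c *: x + y) (W q) (W q) = c *: Rm nabla q x (W q) (W q) + Rm nabla q y (W q) (W q).
  exact: (Rm_lin1 Hg LC).
have -> : \sum_a curv nabla (extv q (delta_mx 0 a)) (extv q (W q)) (extv q (W q)) q 0 a =
   \sum_a Rm nabla q (delta_mx 0 a) (W q) (W q) 0 a by [].
rewrite (null_frame_trace Hg (NF Uq) lin) => H; rewrite -[RHS]H.
have PT := pp_tensor_Rm q.
have e1 := pp_tensor_perp Hg PT (W q) (W q) (W q).
have e2 : inner g q (Rm nabla q (V q) (W q) (W q)) (W q) = 0.
  by rewrite (Rm_anti Hg LC) (pp_tensor_v2 Hg PT) oppr0 inner0.
apply: (etrans _ (esym (add3_zero _ e1 e2))); apply: eq_bigr => i _.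
exact: (etrans (hessE i i q) (Rm_pair Hg LC q (W q) (E i q) (E i q) (W q))).
Qed.

End Frame.

End PpWave.

(** * The ring of smooth functions on an open set *)

Section SmoothRing.
Context {R : realType} {n : nat} {M : manifold R n} (U : set M).
Implicit Types (f : {x : M | U x} -> R) (q : M).

(** Ring elements are functions on the subtype of points of U, so that equality means equality on U;
    this extension returns to functions on M, where smoothness and derivatives are defined. *)
Definition zero_ext f q : R := if pselect (U q) is left h then f (exist _ q h) else 0.

Lemma zero_extE f (x : {x : M | U x}) : zero_ext f (sval x) = f x.
Proof.
case: x => q h /=; rewrite /zero_ext; case: pselect => [h'|//].
by rewrite (Prop_irrelevance h h').
Qed.

(** The proof of openness is an index of the predicate, which lets the ring structure of the
    resulting type rely on it. *)
Definition smooth_pred (oU : open U) : {pred {x : M | U x} -> R} :=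
  fun f => `[< smooth_on U (zero_ext f) >].

Variable oU : open U.

Lemma smooth_subring_closed : subring_closed (smooth_pred oU).
Proof.
have E f q (h : U q) : zero_ext f q = f (exist _ q h) by exact: (zero_extE f (exist _ q h)).
split=> [|f g /asboolP Sf /asboolP Sg|f g /asboolP Sf /asboolP Sg]; apply/asboolP.
- apply: (@smooth_on_ext _ _ _ _ (fun=> 1)) => // [q Uq|]; last exact: smooth_on_cst.
  by rewrite E.
- apply: (@smooth_on_ext _ _ _ _ (fun q => zero_ext f q + - zero_ext g q)) => // [q Uq|].
    by rewrite !E.
  by apply: smooth_on_add => //; exact: smooth_on_opp.
- apply: (@smooth_on_ext _ _ _ _ (fun q => zero_ext f q * zero_ext g q)) => // [q Uq|].
    by rewrite !E.
  exact: smooth_on_mul.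
Qed.

Record smooth_ring := SmoothFun { sfun : {x : M | U x} -> R; _ : sfun \in smooth_pred oU }.
HB.instance Definition _ := [isSub of smooth_ring for sfun].
HB.instance Definition _ := [Choice of smooth_ring by <:].
HB.instance Definition _ := GRing.SubChoice_isSubComPzRing.Build _ (smooth_pred oU) smooth_ring smooth_subring_closed.

Definition sev (x : {x : M | U x}) (a : smooth_ring) : R := sfun a x.

Lemma sev_is_additive x : additive (sev x).
Proof. by []. Qed.
Lemma sev_is_multiplicative x : monoid_morphism (sev x).
Proof. by []. Qed.
HB.instance Definition _ x := GRing.isZmodMorphism.Build smooth_ring R (sev x) (sev_is_additive x).
HB.instance Definition _ x := GRing.isMonoidMorphism.Build smooth_ring R (sev x) (sev_is_multiplicative x).

Lemma sevD x a b : sev x (a + b) = sev x a + sev x b.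
Proof. exact: (rmorphD (sev x)). Qed.
Lemma sevN x a : sev x (- a) = - sev x a.
Proof. exact: (rmorphN (sev x)). Qed.
Lemma sevB x a b : sev x (a - b) = sev x a - sev x b.
Proof. by rewrite sevD sevN. Qed.
Lemma sevM x a b : sev x (a * b) = sev x a * sev x b.
Proof. exact: (rmorphM (sev x)). Qed.
Lemma sev0 x : sev x 0 = 0.
Proof. exact: (rmorph0 (sev x)). Qed.
Lemma sev1 x : sev x 1 = 1.
Proof. exact: (rmorph1 (sev x)). Qed.
Lemma sev_sum x (I : Type) (r : seq I) (P : pred I) (F : I -> smooth_ring) :
  sev x (\sum_(i <- r | P i) F i) = \sum_(i <- r | P i) sev x (F i).
Proof. exact: (rmorph_sum (sev x)). Qed.
Lemma sev_mulmx x (a b c : nat) (A : 'M[smooth_ring]_(a, b)) (B : 'M[smooth_ring]_(b, c)) :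
  map_mx (sev x) (A *m B) = map_mx (sev x) A *m map_mx (sev x) B.
Proof. exact: (map_mxM (sev x)). Qed.
Lemma sev_trace x (a : nat) (A : 'M[smooth_ring]_a) : sev x (\tr A) = \tr (map_mx (sev x) A).
Proof. by rewrite sev_sum; apply: eq_bigr => i _; rewrite mxE. Qed.

Lemma smooth_ring_eq (a b : smooth_ring) : (forall x, sev x a = sev x b) -> a = b.
Proof. by move=> H; apply: val_inj; apply/funext. Qed.

Definition sext (a : smooth_ring) : M -> R := zero_ext (sfun a).
Lemma sextE a x : sext a (sval x) = sev x a.
Proof. exact: zero_extE. Qed.
Lemma sext_smooth a : smooth_on U (sext a).
Proof. by case: a => f Sf; move/asboolP: (Sf). Qed.
Lemma sext_smooth_at a q : U q -> smooth_at (sext a) q.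
Proof. by move=> Uq; exists U; split => //; exact: sext_smooth. Qed.

Definition restrict (f : M -> R) (x : {x : M | U x}) := f (sval x).
Lemma restrict_smooth (f : M -> R) : smooth_on U f -> restrict f \in smooth_pred oU.
Proof.
move=> Sf; apply/asboolP; apply: smooth_on_ext Sf => // q Uq.
by rewrite (zero_extE (restrict f) (exist _ q Uq)).
Qed.
Definition smk (f : M -> R) (Sf : smooth_on U f) : smooth_ring := SmoothFun (restrict_smooth Sf).

Lemma sev_smk (f : M -> R) (Sf : smooth_on U f) x : sev x (smk Sf) = f (sval x).
Proof. by []. Qed.
Lemma sext_smk (f : M -> R) (Sf : smooth_on U f) q : U q -> sext (smk Sf) q = f q.
Proof. by move=> Uq; rewrite (sextE _ (exist _ q Uq)). Qed.
Lemma der_sext_smk (f : M -> R) (Sf : smooth_on U f) q v : U q -> der (sext (smk Sf)) q v = der f q v.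
Proof.
by move=> Uq; apply: der_ext; apply: near_mono (near_open oU Uq) => q' Uq'; exact: sext_smk.
Qed.

Lemma sder_smooth X a : smooth_vfield X -> smooth_on U (fun q => der (sext a) q (X q)).
Proof.
move=> SX; apply: smooth_vfield_on_der; [exact: oU| |exact: sext_smooth].
by move=> i c; apply: smooth_on_sub (SX i c) => q [].
Qed.
Definition sder X (SX : smooth_vfield X) (a : smooth_ring) := smk (sder_smooth a SX).

Lemma sev_sder X (SX : smooth_vfield X) a x : sev x (sder SX a) = der (sext a) (sval x) (X (sval x)).
Proof. by []. Qed.

Lemma sder_derivation X (SX : smooth_vfield X) : derivation (sder SX).
Proof.
split=> a b; apply: smooth_ring_eq => x; rewrite ?sevD ?sevM !sev_sder;
  have Ux : U (sval x) by case: x.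
- rewrite -der_add; [|exact: sext_smooth_at|exact: sext_smooth_at].
  apply: der_ext; apply: near_mono (near_open oU Ux) => q Uq.
  by rewrite !(sextE _ (exist _ q Uq)) sevD.
- rewrite -!sextE.
  have := der_mul (X (sval x)) (sext_smooth_at a Ux) (sext_smooth_at b Ux).
  rewrite addrC [_ * sext b _]mulrC => <-.
  apply: der_ext; apply: near_mono (near_open oU Ux) => q Uq.
  by rewrite !(sextE _ (exist _ q Uq)) sevM.
Qed.

(** Evaluation at each point reduces the claim to real numbers. *)
Lemma smooth_ring_real (I : finType) (a : I -> smooth_ring) : \sum_i a i * a i = 0 -> forall i, a i = 0.
Proof.
move=> H i; apply: smooth_ring_eq => x; rewrite sev0.
have : \sum_j sev x (a j) * sev x (a j) = 0.
  have := congr1 (sev x) H; rewrite sev0 sev_sum => {2}<-.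
  by apply: eq_bigr => j _; rewrite sevM.
move=> /eqP; rewrite psumr_eq0 => [/allP/(_ i (mem_index_enum i))|j _]; last by rewrite -expr2 sqr_ge0.
by rewrite /= mulf_eq0 orbb => /eqP.
Qed.

End SmoothRing.

Arguments smk {R n M U} oU {f} Sf.
Arguments sder {R n M U} oU {X} SX a.

(** * Effect of local isometries on null frames and on T *)

Section Transport.
Context {R : realType} {m : nat} {M : manifold R m.+2}.
Variable (g : M -> 'M[R]_m.+2).
Hypothesis Hg : lorentzian g.
Implicit Types (p q : M) (u v w x y z : 'rV[R]_m.+2).

Section FrameMap.
Variables (p q : M) (v w v' w' : 'rV[R]_m.+2) (e e' : 'I_m -> 'rV[R]_m.+2).
Hypotheses (F : null_frame g p v w e) (F' : null_frame g q v' w' e').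
Variable L : 'rV[R]_m.+2 -> 'rV[R]_m.+2.
Hypothesis L_isom : forall x y, inner g q (L x) (L y) = inner g p x y.
Variable c : R.
Hypothesis Lv : L v = c *: v'.

Definition frame_matrix : 'M[R]_m := \matrix_(i, l) inner g q (L (e i)) (e' l).

(** L multiplies v by c, so the coefficient of w' in L w must be 1 / c. *)
Lemma frame_scale : c * inner g q (L w) v' = 1.
Proof. by have [_ wv _ _ _] := F; rewrite -(innerZr Hg) -Lv L_isom. Qed.

Lemma frame_scale_neq0 : c != 0.
Proof. by apply/eqP => c0; have := frame_scale; rewrite c0 mul0r => /eqP; rewrite eq_sym oner_eq0. Qed.

Lemma frame_map_perp i : inner g q (L (e i)) v' = 0.
Proof.
have [_ _ _ ew _] := F; apply: (mulfI frame_scale_neq0).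
by rewrite -(innerZr Hg) -Lv L_isom (ew i).1 mulr0.
Qed.

Lemma frame_matrix_orth : frame_matrix *m frame_matrix^T = 1%:M.
Proof.
have [_ _ _ _ ee] := F; apply/matrixP => i j; rewrite !mxE -ee -L_isom.
rewrite (null_frame_inner Hg F' (frame_map_perp i) (frame_map_perp j)).
by apply: eq_bigr => l _; rewrite !mxE.
Qed.

Variables K K' : 'rV[R]_m.+2 -> 'rV[R]_m.+2 -> 'rV[R]_m.+2 -> 'rV[R]_m.+2.
Hypotheses (HK' : pp_tensor g q v' K') (KL : forall x y z, K' (L x) (L y) (L z) = L (K x y z)).

(** The w'-component 1 / c of L w enters twice, through x and u in [pp_tensor_eval], whence the
    factor c^-2; the screen part of L acts by the orthogonal matrix. *)
Lemma frame_transport : \matrix_(i, j) inner g p (K w (e i) (e j)) w =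
  (c^-1 * c^-1) *: (frame_matrix *m (\matrix_(i, j) inner g q (K' w' (e' i) (e' j)) w') *m frame_matrix^T).
Proof.
apply/matrixP => i j; rewrite mxE -L_isom -KL.
rewrite (pp_tensor_eval Hg F' HK' _ _ (frame_map_perp i) (frame_map_perp j)).
have -> : inner g q (L w) v' = c^-1.
  by apply: (mulfI frame_scale_neq0); rewrite frame_scale mulfV // frame_scale_neq0.
rewrite (pp_tensor_frame Hg F' HK' (frame_map_perp i) (frame_map_perp j)) [RHS]mxE; congr (_ * _).
rewrite mxE; under [RHS]eq_bigr do rewrite mxE mulr_suml.
rewrite exchange_big; apply: eq_bigr => a _; apply: eq_bigr => b _.
by rewrite !mxE mulrAC.
Qed.

End FrameMap.

Variable nabla : (M -> 'rV[R]_m.+2) -> (M -> 'rV[R]_m.+2) -> (M -> 'rV[R]_m.+2).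
Hypothesis LC : levi_civita g nabla.
Variable V : M -> 'rV[R]_m.+2.
Hypothesis PP : pp_wave g nabla V.
Variables (W : M -> 'rV[R]_m.+2) (E : 'I_m -> M -> 'rV[R]_m.+2).

Definition hess_mx q : 'M[R]_m := \matrix_(i, j) inner g q (Rm nabla q (W q) (E i q) (E j q)) (W q).
Definition dhess_mx k q : 'M[R]_m :=
  \matrix_(i, j) inner g q (dRm nabla q (E k q) (W q) (E i q) (E j q)) (W q).

Local Notation frame q := (null_frame g q (V q) (W q) (fun i => E i q)).

Lemma isometry_null_line (U : set M) phi p : open U -> isometry_on g U phi -> U p ->
  frame p -> frame (phi p) -> hess_mx p != 0 -> exists c, tangent_map phi p (V p) = c *: V (phi p).
Proof.
move=> oO iso Op F F' T0; have SF : smooth_map U phi by case: iso.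
have [i [j Tij]] : exists i j, hess_mx p i j != 0.
  apply: contrapT => H; move/eqP: T0; apply; apply/matrixP => i j; rewrite [RHS]mxE.
  by case: (eqVneq (hess_mx p i j) 0) => // h; case: H; exists i, j.
have PT := pp_tensor_Rm Hg LC PP p; have PT' := pp_tensor_Rm Hg LC PP (phi p).
(* The screen components of z are, up to sign, row i of T, which is nonzero; so <z, z> is nonzero,
   and R(W, E_i) z = - <z, z> V expresses V by curvature alone. *)
pose z := Rm nabla p (W p) (E i p) (W p).
have zV : inner g p z (V p) = 0 := pp_tensor_perp Hg PT _ _ _.
have zE l : inner g p z (E l p) = - hess_mx p i l.
  by rewrite /z (Rm_skew Hg LC) (inner_sym Hg p (W p)) mxE.
have zz : inner g p z z != 0.
  rewrite (null_frame_inner Hg F zV zV); apply/negP.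
  rewrite psumr_eq0 => [/allP/(_ j (mem_index_enum j))|l _]; last by rewrite -expr2 sqr_ge0.
  by rewrite /= mulf_eq0 orbb zE oppr_eq0 (negbTE Tij).
(* Curvature sends V^perp to vectors orthogonal to all of V^perp, that is, to multiples of V. *)
have image q x y u : frame q -> inner g q u (V q) = 0 ->
    Rm nabla q x y u = inner g q (Rm nabla q x y u) (W q) *: V q.
  move=> Fq uV; have PTq := pp_tensor_Rm Hg LC PP q.
  rewrite {1}(null_frame_perp Hg Fq (pp_tensor_perp Hg PTq x y u)) big1 ?add0r // => l _.
  rewrite (pp_tensor_image PTq _ _ uV) ?scale0r //.
  by have [_ _ _ ew _] := Fq; exact: (ew l).1.
have H := image p (W p) (E i p) z F zV.
have Hz : inner g p (Rm nabla p (W p) (E i p) z) (W p) = - inner g p z z by exact: (Rm_skew Hg LC).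
rewrite Hz in H.
have H' := isometry_Rm Hg LC oO iso (W p) (E i p) z Op.
have Lz : inner g (phi p) (tangent_map phi p z) (V (phi p)) = 0.
  have h := isometry_Rm Hg LC oO iso (W p) (E i p) (W p) Op; rewrite /= in h.
  by rewrite /z -h; exact: (pp_tensor_perp Hg PT' _ _ _).
rewrite (image _ _ _ _ F' Lz) in H'.
set d := inner g (phi p) (Rm nabla _ _ _ _) _ in H'.
exists (- (inner g p z z)^-1 * d); rewrite -scalerA H' H (tangent_mapZ oO SF _ _ Op) scalerA.
by rewrite mulrNN mulVf // scale1r.
Qed.

Lemma hess_transport p q : locally_orth_homogeneous g V -> same_leaf g V p q ->
  frame p -> frame q -> hess_mx p != 0 ->
  exists (kappa : R) (B : 'M[R]_m), [/\ kappa != 0, B *m B^T = 1%:M,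
    hess_mx p = kappa *: (B *m hess_mx q *m B^T) &
    forall k, dhess_mx k p = kappa *: (B *m (\sum_l B k l *: dhess_mx l q) *m B^T)].
Proof.
move=> HH SL F F' T0; have [U [phi [oO Op iso phip]]] := HH p q SL.
rewrite -phip in F' *; have [c Lv] := isometry_null_line oO iso Op F F' T0.
have SF : smooth_map U phi by case: iso.
have L_isom x y : inner g (phi p) (tangent_map phi p x) (tangent_map phi p y) = inner g p x y.
  by case: iso => _ _ _ h; exact: h.
have c0 := frame_scale_neq0 F L_isom Lv.
exists (c^-1 * c^-1), (frame_matrix (phi p) (fun i => E i p) (fun i => E i (phi p)) (tangent_map phi p)); split.
- by rewrite mulf_neq0 // invr_eq0.
- exact: (frame_matrix_orth F F' L_isom Lv).
- apply: (frame_transport F F' L_isom Lv (pp_tensor_Rm Hg LC PP (phi p))) => x y z.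
  exact: (isometry_Rm Hg LC oO iso x y z Op).
move=> k; have KL x y z : dRm nabla (phi p) (tangent_map phi p (E k p)) (tangent_map phi p x) (tangent_map phi p y) (tangent_map phi p z) = tangent_map phi p (dRm nabla p (E k p) x y z).
  exact: (isometry_dRm Hg LC oO iso _ x y z Op).
rewrite /dhess_mx (frame_transport F F' L_isom Lv (pp_tensor_dRm Hg LC PP (phi p) _) KL).
congr (_ *: (_ *m _ *m _)); apply/matrixP => i j; rewrite mxE summxE.
have Lk := null_frame_perp Hg F' (frame_map_perp F L_isom Lv k).
set u := tangent_map phi p (E k p) in Lk *.
pose h y := inner g (phi p) (dRm nabla (phi p) y (W (phi p)) (E i (phi p)) (E j (phi p))) (W (phi p)).
have hlin (a : R) y y' : h (a *: y + y') = a * h y + h y'.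
  by rewrite /h (dRm_lin0 Hg LC) inner_linear.
have h0 : h 0 = 0 by have := hlin 1 0 0; rewrite scale1r mul1r addr0 -[LHS]addr0 => /addrI.
have hD y y' : h (y + y') = h y + h y' by have := hlin 1 y y'; rewrite scale1r mul1r.
have hZ a y : h (a *: y) = a * h y by have := hlin a y 0; rewrite h0 !addr0.
(* The image of E_k may have a component along V, which does not contribute to DT. *)
have hV : h (V (phi p)) = 0.
  have [_ _ _ ew _] := F'.
  by rewrite /h (dRm_along_V Hg LC PP _ _ (ew i).1) inner0.
rewrite -/(h u) Lk hD hZ hV mulr0 addr0 (big_morph h hD h0).
by apply: eq_bigr => l _; rewrite hZ !mxE.
Qed.

End Transport.

(** * Scale and rotation invariants of T and its derivative *)

Section MatrixInvariants.
Context {R : realType} {m : nat}.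
Implicit Types (T B : 'M[R]_m) (t : 'I_m -> 'M[R]_m).

Definition mx_norm2 T : R := \tr (T *m T).
(* The gradient of log |T|^2 when t is the covariant derivative of T. *)
Definition mx_dlog T t : 'cV[R]_m := \col_k ((mx_norm2 T)^-1 * (\tr (T *m t k) + \tr (T *m t k))).

Variables (T T' : 'M[R]_m) (t t' : 'I_m -> 'M[R]_m) (kappa : R) (B : 'M[R]_m).
Hypotheses (k0 : kappa != 0) (BB : B *m B^T = 1%:M).
Hypothesis TE : T = kappa *: (B *m T' *m B^T).
Hypothesis tE : forall k, t k = kappa *: (B *m (\sum_l B k l *: t' l) *m B^T).
Hypothesis T0 : mx_norm2 T' != 0.

Let BtB : B^T *m B = 1%:M. Proof. exact: mulmx1C. Qed.
Let conj_mul X Y : (B *m X *m B^T) *m (B *m Y *m B^T) = B *m (X *m Y) *m B^T.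
Proof. by rewrite !mulmxA -[B *m X *m B^T *m B]mulmxA BtB mulmx1. Qed.
Let conj_tr X : \tr (B *m X *m B^T) = \tr X.
Proof. by rewrite mxtrace_mulC mulmxA BtB mul1mx. Qed.

Lemma norm2_transport : mx_norm2 T = kappa ^+ 2 * mx_norm2 T'.
Proof. by rewrite /mx_norm2 TE -scalemxAl -scalemxAr scalerA conj_mul mxtraceZ conj_tr expr2. Qed.

(** Degree zero in T: the factors kappa^2 of numerator and denominator cancel and only the rotation
    remains. *)
Lemma dlog_transport : mx_dlog T t = B *m mx_dlog T' t'.
Proof.
apply/matrixP => k j; rewrite !mxE norm2_transport.
have -> : \tr (T *m t k) = kappa ^+ 2 * \sum_l B k l * \tr (T' *m t' l).
  rewrite TE tE -scalemxAl -scalemxAr scalerA conj_mul mxtraceZ conj_tr expr2; congr (_ * _).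
  rewrite mulmx_sumr raddf_sum; apply: eq_bigr => l _.
  by rewrite -scalemxAr /= mxtraceZ.
rewrite invfM -mulrDr mulrA [(kappa ^+ 2)^-1 * _ * _]mulrAC mulVf ?expf_neq0 // mul1r.
rewrite -big_split mulr_sumr; apply: eq_bigr => l _; rewrite [mx_dlog _ _ _ _]mxE /=; ring.
Qed.

Let dotv_B (x y : 'cV[R]_m) : dotv (B *m x) (B *m y) = dotv x y.
Proof.
have dE (u w : 'cV[R]_m) : dotv u w = (u^T *m w) 0 0.
  by rewrite mxE; apply: eq_bigr => i _; rewrite mxE.
by rewrite !dE trmx_mul mulmxA -[x^T *m B^T *m B]mulmxA BtB mulmx1.
Qed.

Lemma dlog_norm_transport : dotv (mx_dlog T t) (mx_dlog T t) = dotv (mx_dlog T' t') (mx_dlog T' t').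
Proof. by rewrite dlog_transport dotv_B. Qed.

Let T_dlog : T *m mx_dlog T t = kappa *: (B *m (T' *m mx_dlog T' t')).
Proof.
rewrite dlog_transport {1}TE -scalemxAl; congr (_ *: _).
by rewrite !mulmxA -[B *m T' *m B^T *m B]mulmxA BtB mulmx1.
Qed.

Let ratio (x y : R) : x = kappa ^+ 2 * y -> x * (mx_norm2 T)^-1 = y * (mx_norm2 T')^-1.
Proof.
move=> ->; rewrite norm2_transport invfM mulrACA mulfV ?mul1r //.
by rewrite expf_neq0.
Qed.

Lemma cubic_transport :
  dotv (mx_dlog T t) (T *m mx_dlog T t) * dotv (mx_dlog T t) (T *m mx_dlog T t) * (mx_norm2 T)^-1 =
  dotv (mx_dlog T' t') (T' *m mx_dlog T' t') * dotv (mx_dlog T' t') (T' *m mx_dlog T' t') * (mx_norm2 T')^-1.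
Proof.
apply: ratio; rewrite T_dlog !dlog_transport dotvZr dotv_B; ring.
Qed.

Lemma quadratic_transport :
  dotv (T *m mx_dlog T t) (T *m mx_dlog T t) * (mx_norm2 T)^-1 =
  dotv (T' *m mx_dlog T' t') (T' *m mx_dlog T' t') * (mx_norm2 T')^-1.
Proof. apply: ratio; rewrite T_dlog dotvZl dotvZr dotv_B; ring. Qed.

(** The rotation acts twice, by conjugation on the matrices, removed by the trace, and on the
    derivative index, removed by the orthogonality of B. *)
Lemma energy_transport :
  (\sum_k \tr (t k *m t k)) * (mx_norm2 T)^-1 = (\sum_k \tr (t' k *m t' k)) * (mx_norm2 T')^-1.
Proof.
apply: ratio.
have E k : \tr (t k *m t k) = kappa ^+ 2 * \sum_a \sum_b B k a * B k b * \tr (t' a *m t' b).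
  rewrite tE -scalemxAl -scalemxAr scalerA conj_mul mxtraceZ conj_tr expr2; congr (_ * _).
  rewrite mulmx_suml raddf_sum; apply: eq_bigr => a _ /=.
  rewrite mulmx_sumr raddf_sum; apply: eq_bigr => b _ /=.
  by rewrite -scalemxAl -scalemxAr scalerA mxtraceZ.
under eq_bigr do rewrite E; rewrite -mulr_sumr; congr (_ * _).
rewrite exchange_big; apply: eq_bigr => a _ /=; rewrite exchange_big /= (bigD1 a) //= [X in _ + X]big1 ?addr0.
  rewrite -mulr_suml -[RHS]mul1r; congr (_ * _).
  have := congr1 (fun X : 'M[R]_m => X a a) BtB; rewrite !mxE eqxx mulr1n => <-.
  by apply: eq_bigr => k _; rewrite !mxE.
move=> b ba; rewrite -mulr_suml.
have := congr1 (fun X : 'M[R]_m => X a b) BtB; rewrite !mxE eq_sym (negbTE ba) => H.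
by rewrite (_ : \sum_k _ = 0) ?mul0r // -[RHS]H; apply: eq_bigr => k _; rewrite !mxE.
Qed.

End MatrixInvariants.

(** * The ring argument applied to the smooth functions on a null-frame neighbourhood *)

Section ScreenRing.
Context {R : realType} {m : nat} {M : manifold R m.+2}.
Variable (g : M -> 'M[R]_m.+2).
Hypothesis Hg : lorentzian g.
Variable nabla : (M -> 'rV[R]_m.+2) -> (M -> 'rV[R]_m.+2) -> (M -> 'rV[R]_m.+2).
Hypothesis LC : levi_civita g nabla.
Variable V : M -> 'rV[R]_m.+2.
Hypothesis PP : pp_wave g nabla V.
Hypothesis RF : ricci_flat nabla.
Hypothesis HH : locally_orth_homogeneous g V.
Variables (U : set M) (W : M -> 'rV[R]_m.+2) (E : 'I_m -> M -> 'rV[R]_m.+2).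
Hypotheses (oU : open U) (SW : smooth_vfield W) (SE : forall i, smooth_vfield (E i)).
Hypothesis NF : forall q, U q -> null_frame g q (V q) (W q) (fun i => E i q).
Hypothesis T0 : forall q, U q -> hess_mx g nabla W E q != 0.
Implicit Types (x y : {x : M | U x}).

Let SV : smooth_vfield V. Proof. by have [[]] := PP. Qed.
Let V0 p : V p <> 0. Proof. by have [[_ h _ _] _ _] := PP. Qed.
Let VV p : inner g p (V p) (V p) = 0. Proof. by have [[_ _ h _] _ _] := PP. Qed.
Let VP X : smooth_vfield X -> forall p, nabla X V p = 0. Proof. by have [[_ _ _ h] _ _] := PP; exact: h. Qed.
Let sub f : smooth_on setT f -> smooth_on U f := @smooth_on_sub _ _ _ setT U f (@subsetT _ U).
Let Ux x : U (sval x). Proof. by case: x. Qed.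
Let E_perp i q : U q -> inner g q (E i q) (V q) = 0.
Proof. by move=> /NF[_ _ _ h _]; exact: (h i).1. Qed.

Local Notation A := (smooth_ring oU).
Let D k : A -> A := sder oU (SE k).
Let Dv : A -> A := sder oU SV.
Let om k : 'M[A]_m := \matrix_(i, j) smk oU (sub (conn_smooth Hg LC SE i j (SE k))).
Let omv : 'M[A]_m := \matrix_(i, j) smk oU (sub (conn_smooth Hg LC SE i j SV)).
Let lieW (X Y : M -> 'rV[R]_m.+2) (SX : smooth_vfield X) (SY : smooth_vfield Y) : A :=
  smk oU (sub (Hg.2 _ _ (smooth_lie SX SY) SW)).
Let T : 'M[A]_m := \matrix_(i, j) smk oU (sub (hess_smooth Hg LC SW SE i j)).
Let f : A := \tr (T *m T).
Local Notation t := (nabla_rep D om bracket_mx T).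

Let D_derivation k : derivation (D k). Proof. exact: sder_derivation. Qed.
Let Dv_derivation : derivation Dv. Proof. exact: sder_derivation. Qed.

Let sev_om x k i j : sev x (om k i j) = conn g nabla E (E k) i j (sval x).
Proof. by rewrite mxE. Qed.
Let sev_omv x i j : sev x (omv i j) = conn g nabla E V i j (sval x).
Proof. by rewrite mxE. Qed.
Let sev_T x i j : sev x (T i j) = hess g nabla W E i j (sval x).
Proof. by rewrite mxE. Qed.

Let sder_entry (X : M -> 'rV[R]_m.+2) (SX : smooth_vfield X) x (h : M -> R) (Sh : smooth_on U h) :
  sev x (sder oU SX (smk oU Sh)) = der h (sval x) (X (sval x)).
Proof. by rewrite sev_sder; exact: der_sext_smk. Qed.

Let sev_subE x (X Y : 'M[A]_m) i j : sev x ((X - Y) i j) = sev x (X i j) - sev x (Y i j).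
Proof. by rewrite -sevB; congr (sev x _); rewrite !mxE. Qed.
Let sev_addE x (X Y : 'M[A]_m) i j : sev x ((X + Y) i j) = sev x (X i j) + sev x (Y i j).
Proof. by rewrite -sevD; congr (sev x _); rewrite !mxE. Qed.
Let sev_mulE x (X Y : 'M[A]_m) i j : sev x ((X *m Y) i j) = \sum_r sev x (X i r) * sev x (Y r j).
Proof. by rewrite mxE sev_sum; apply: eq_bigr => r _; rewrite sevM. Qed.
Let sev_scaleE x (y : A) (X : 'M[A]_m) i j : sev x ((y *: X) i j) = sev x y * sev x (X i j).
Proof. by rewrite mxE sevM. Qed.
Let sev_mapE x (d : A -> A) (X : 'M[A]_m) i j : sev x (map_mx d X i j) = sev x (d (X i j)).
Proof. by rewrite mxE. Qed.

Let om_anti k i j : om k i j = - om k j i.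
Proof.
apply: smooth_ring_eq => x; rewrite sevN !sev_om.
exact: (conn_anti Hg LC oU SE NF i j (Ux x) (SE k)).
Qed.

Let bracket k l (y : A) : D k (D l y) - D l (D k y) =
  \sum_r (om k l r - om l k r) * D r y + lieW (SE k) (SE l) * Dv y.
Proof.
apply: smooth_ring_eq => x; rewrite sevB sevD sev_sum sevM.
have Uq := Ux x.
have LV := bracket_perp Hg LC PP oU Uq (SE k) (SE l) (fun q h => E_perp k h) (fun q h => E_perp l h).
rewrite /D /Dv !sder_entry.
apply: (etrans (der_bracket Hg NF Uq (SE k) (SE l) (sext_smooth_at y Uq) LV)).
congr (_ + _); apply: eq_bigr => r _; rewrite sevM sevB !sev_om.
by rewrite (lie_conn LC SE).
Qed.

Let bracket_v l (y : A) : Dv (D l y) - D l (Dv y) =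
  \sum_r omv l r * D r y + lieW SV (SE l) * Dv y.
Proof.
apply: smooth_ring_eq => x; rewrite sevB sevD sev_sum sevM.
have Uq := Ux x.
have LV := bracket_perp Hg LC PP oU Uq SV (SE l) (fun q _ => VV q) (fun q h => E_perp l h).
rewrite /D /Dv !sder_entry.
apply: (etrans (der_bracket Hg NF Uq SV (SE l) (sext_smooth_at y Uq) LV)).
congr (_ + _); apply: eq_bigr => r _; rewrite sevM sev_omv.
by rewrite (lie_conn_V LC PP SE).
Qed.

Let flat k l : map_mx (D k) (om l) - map_mx (D l) (om k) + om l *m om k - om k *m om l =
  \sum_r (om k l r - om l k r) *: om r + lieW (SE k) (SE l) *: omv.
Proof.
apply/matrixP => i j; apply: smooth_ring_eq => x.
transitivity (sev x (D k (om l i j)) - sev x (D l (om k i j))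
  + (\sum_r sev x (om l i r) * sev x (om k r j)) - \sum_r sev x (om k i r) * sev x (om l r j)).
  by rewrite sev_subE sev_addE sev_subE !sev_mulE !sev_mapE.
transitivity (\sum_r (sev x (om k l r) - sev x (om l k r)) * sev x (om r i j)
  + sev x (lieW (SE k) (SE l)) * sev x (omv i j)); last first.
  rewrite sev_addE sev_scaleE summxE sev_sum; congr (_ + _).
  by apply: eq_bigr => r _; rewrite sev_scaleE sevB.
rewrite [om l i j]mxE [om k i j]mxE /D !sder_entry.
under eq_bigr do rewrite !sev_om; under [X in _ - X = _]eq_bigr do rewrite !sev_om.
rewrite (conn_flat Hg LC PP oU SE NF k l i j (Ux x)) sev_omv.
by congr (_ + _); apply: eq_bigr => r _; rewrite !sev_om.
Qed.

Let T_sym i j : T i j = T j i.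
Proof. by apply: smooth_ring_eq => x; rewrite !sev_T; exact: (hess_sym Hg LC SW SE). Qed.

Let T_tr : \tr T = 0.
Proof.
apply: smooth_ring_eq => x; rewrite sev0 sev_sum -[RHS](ricci_flat_trace Hg LC PP SW SE NF RF (Ux x)).
by apply: eq_bigr => i _; rewrite sev_T.
Qed.

(** [hess_der] read in the ring; antisymmetry of the connection turns its two sums into the
    commutator with T. It serves the directions E_k and V alike. *)
Let hess_entry x (X : M -> 'rV[R]_m.+2) (SX : smooth_vfield X) (w : 'M[A]_m) i j :
  (forall i j, sev x (w i j) = conn g nabla E X i j (sval x)) ->
  sev x ((map_mx (sder oU SX) T - bracket_mx w T) i j) =
  inner g (sval x) (dRm nabla (sval x) (X (sval x)) (W (sval x)) (E i (sval x)) (E j (sval x))) (W (sval x)).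
Proof.
move=> wE; have Uq := Ux x.
transitivity (sev x (sder oU SX (T i j)) - (\sum_l sev x (w i l) * sev x (T l j) - \sum_l sev x (T i l) * sev x (w l j))).
  by rewrite /bracket_mx !sev_subE !sev_mulE sev_mapE.
rewrite [T i j]mxE sder_entry (hess_der Hg LC PP oU SW SE NF i j Uq SX).
have -> : \sum_l sev x (w i l) * sev x (T l j) = \sum_l conn g nabla E X i l (sval x) * hess g nabla W E l j (sval x).
  by apply: eq_bigr => l _; rewrite wE sev_T.
have -> : \sum_l sev x (T i l) * sev x (w l j) = - \sum_l conn g nabla E X j l (sval x) * hess g nabla W E i l (sval x).
  rewrite -sumrN; apply: eq_bigr => l _; rewrite wE sev_T.
  by rewrite (conn_anti Hg LC oU SE NF l j Uq SX) mulrN mulrC.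
by rewrite opprK opprD addrACA -addrA addrA; ring.
Qed.

Let sev_t x k i j : sev x (t k i j) = dhess_mx g nabla W E k (sval x) i j.
Proof. by rewrite [RHS]mxE; apply: hess_entry => i' j'; exact: sev_om. Qed.

Let T_v : map_mx Dv T = bracket_mx omv T.
Proof.
apply/eqP; rewrite -subr_eq0; apply/eqP/matrixP => i j; rewrite [RHS]mxE.
apply: smooth_ring_eq => x; rewrite sev0 hess_entry => [|i' j']; last exact: sev_omv.
by rewrite (dRm_along_V Hg LC PP _ _ (E_perp i (Ux x))) inner0.
Qed.

Let t_sym k i j : t k i j = t i k j.
Proof.
apply: smooth_ring_eq => x; rewrite !sev_t [LHS]mxE [RHS]mxE.
by rewrite (dRm_sym Hg LC PP _ _ (E_perp k (Ux x)) (E_perp i (Ux x))).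
Qed.

Let map_T x : map_mx (sev x) T = hess_mx g nabla W E (sval x).
Proof. by apply/matrixP => i j; rewrite mxE sev_T (hessE Hg LC SW SE) [RHS]mxE. Qed.
Let map_t x k : map_mx (sev x) (t k) = dhess_mx g nabla W E k (sval x).
Proof. by apply/matrixP => i j; rewrite mxE sev_t. Qed.

Let sev_f x : sev x f = mx_norm2 (hess_mx g nabla W E (sval x)).
Proof. by rewrite /f sev_trace sev_mulmx map_T. Qed.

Let hess_mx_sym q i j : hess_mx g nabla W E q i j = hess_mx g nabla W E q j i.
Proof.
have := hess_sym Hg LC SW SE i j q; rewrite !(hessE Hg LC SW SE) => h.
by rewrite mxE h mxE.
Qed.

(** T is symmetric, so the trace of its square is the sum of the squares of its entries. *)
Let norm_neq0 q : U q -> mx_norm2 (hess_mx g nabla W E q) != 0.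
Proof.
move=> Uq; apply/negP => /eqP H; move/eqP: (T0 Uq); apply; apply/matrixP => i j; rewrite [RHS]mxE.
have : \sum_i \sum_j hess_mx g nabla W E q i j * hess_mx g nabla W E q i j = 0.
  rewrite -[RHS]H; apply: eq_bigr => a _; rewrite mxE; apply: eq_bigr => b _.
  by congr (_ * _); exact: hess_mx_sym.
move/eqP; rewrite psumr_eq0 => [|a _]; last by apply: sumr_ge0 => b _; rewrite -expr2 sqr_ge0.
move=> /allP/(_ i (mem_index_enum i)) /=; rewrite psumr_eq0 => [|b _]; last by rewrite -expr2 sqr_ge0.
by move=> /allP/(_ j (mem_index_enum j)) /=; rewrite mulf_eq0 orbb => /eqP.
Qed.

Let finv_smooth : smooth_on U (fun q => (sext f q)^-1).
Proof.
apply: smooth_on_inv => //; last exact: sext_smooth.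
by move=> q Uq; rewrite (sextE f (exist _ q Uq)) sev_f; exact: norm_neq0.
Qed.
Let finv : A := smk oU finv_smooth.

Let sev_finv x : sev x finv = (mx_norm2 (hess_mx g nabla W E (sval x)))^-1.
Proof. by rewrite sev_smk sextE sev_f. Qed.

Let f_inv : f * finv = 1.
Proof.
apply: smooth_ring_eq => x; rewrite sevM sev1 sev_f sev_finv mulfV //.
exact: norm_neq0.
Qed.

(** Comparison is needed only between points of U, since nearby points of the leaf already lie in
    U. *)
Let leaf_const (y : A) : (forall x x', same_leaf g V (sval x) (sval x') -> sev x y = sev x' y) ->
  forall k, D k y = 0.
Proof.
move=> H k; apply: smooth_ring_eq => x; rewrite sev0 sev_sder.
have Uq := Ux x.
apply: (leaf_constant_der Hg LC SV V0 VP (sext_smooth_at y Uq)); last exact: E_perp.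
apply: near_mono (near_open oU Uq) => q Uq' SL.
by rewrite (sextE y (exist _ q Uq')) (sextE y x); apply/esym/H.
Qed.

Let a : 'cV[A]_m := \col_k (finv * D k f).

Let map_a x : map_mx (sev x) a = mx_dlog (hess_mx g nabla W E (sval x)) (fun k => dhess_mx g nabla W E k (sval x)).
Proof.
apply/matrixP => k j; rewrite !mxE sevM sev_finv (tr_sqr_deriv om D_derivation (erefl f)) sevD.
by rewrite sev_trace sev_mulmx map_T map_t.
Qed.

Let sev_dotv x (u v : 'cV[A]_m) : sev x (dotv u v) = dotv (map_mx (sev x) u) (map_mx (sev x) v).
Proof. by rewrite /dotv sev_sum; apply: eq_bigr => j _; rewrite sevM !mxE. Qed.

Let transport x x' : same_leaf g V (sval x) (sval x') -> exists (kappa : R) (B : 'M[R]_m),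
  [/\ kappa != 0, B *m B^T = 1%:M,
    hess_mx g nabla W E (sval x) = kappa *: (B *m hess_mx g nabla W E (sval x') *m B^T) &
    forall k, dhess_mx g nabla W E k (sval x) =
      kappa *: (B *m (\sum_l B k l *: dhess_mx g nabla W E l (sval x')) *m B^T)].
Proof.
move=> SL; have h := hess_transport Hg LC PP HH SL.
exact: (h W E (NF (Ux x)) (NF (Ux x')) (T0 (Ux x))).
Qed.

(** The four constancy hypotheses of [flat_screen_parallel] are the four transport identities,
    evaluated at two points of a leaf. *)
Lemma dhess_zero k i j q : U q -> dhess_mx g nabla W E k q i j = 0.
Proof.
move=> Uq; pose x : {x : M | U x} := exist _ q Uq.
suff -> : dhess_mx g nabla W E k q i j = sev x (t k i j).
  rewrite (@flat_screen_parallel A m D Dv om omv _ _ D_derivation Dv_derivation om_anti bracket bracket_v flat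
    T f finv (@smooth_ring_real _ _ _ _ oU) T_sym T_tr T_v t_sym erefl f_inv _ _ _ _ k i j) ?sev0 //.
  - apply: leaf_const => y y' /transport[kap [B [k0 BB TE tE]]].
    by rewrite !sev_dotv !map_a; exact: (dlog_norm_transport k0 BB TE tE).
  - apply: leaf_const => y y' /transport[kap [B [k0 BB TE tE]]].
    have Es z : sev z (\sum_k \tr (t k *m t k)) = \sum_k \tr (dhess_mx g nabla W E k (sval z) *m dhess_mx g nabla W E k (sval z)).
      by rewrite sev_sum; apply: eq_bigr => l _; rewrite sev_trace sev_mulmx map_t.
    by rewrite !sevM !Es !sev_finv; exact: (energy_transport k0 BB TE tE).
  - apply: leaf_const => y y' /transport[kap [B [k0 BB TE tE]]].
    by rewrite !sevM !sev_finv !sev_dotv !sev_mulmx !map_a !map_T; exact: (cubic_transport k0 BB TE tE).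
  - apply: leaf_const => y y' /transport[kap [B [k0 BB TE tE]]].
    by rewrite !sevM !sev_finv !sev_dotv !sev_mulmx !map_a !map_T; exact: (quadratic_transport k0 BB TE tE).
by rewrite sev_t.
Qed.

End ScreenRing.

(** * Conclusion: the plane wave condition *)

Section PlaneWave.
Context {R : realType} {m : nat} {M : manifold R m.+2}.
Variable (g : M -> 'M[R]_m.+2).
Hypothesis Hg : lorentzian g.
Variable nabla : (M -> 'rV[R]_m.+2) -> (M -> 'rV[R]_m.+2) -> (M -> 'rV[R]_m.+2).
Hypothesis LC : levi_civita g nabla.
Variable V : M -> 'rV[R]_m.+2.
Hypothesis PP : pp_wave g nabla V.
Hypothesis RF : ricci_flat nabla.
Hypothesis HH : locally_orth_homogeneous g V.

(** The tangent map of an isometry from p to q is onto, so every curvature value at q is the image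
    of one at p. *)
Lemma flat_leaf p q : same_leaf g V p q -> (forall x y z, Rm nabla p x y z = 0) ->
  forall x y z, Rm nabla q x y z = 0.
Proof.
move=> SL H x y z; have [U [phi [oU Up iso phip]]] := HH SL.
have SF : smooth_map U phi by case: iso.
have [x' <-] := tangent_map_onto oU iso x Up; have [y' <-] := tangent_map_onto oU iso y Up.
have [z' <-] := tangent_map_onto oU iso z Up; rewrite -phip.
by rewrite (isometry_Rm Hg LC oU iso x' y' z' Up) H (tangent_map0 oU SF Up).
Qed.

Lemma pp_wave_frame p : exists (U : set M) (W : M -> 'rV[R]_m.+2) (E : 'I_m -> M -> 'rV[R]_m.+2),
  [/\ open U, U p, smooth_vfield W, forall i, smooth_vfield (E i) &
   forall q, U q -> null_frame g q (V q) (W q) (fun i => E i q)].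
Proof.
have [[SV V0 VV VP] _ _] := PP.
have [W [E [SW SE NF]]] := null_frame_near Hg SV V0 VV p.
by have [U [oU Up H]] := near_exists_open NF; exists U, W, E; split.
Qed.

Lemma dhess_vanishes p (U : set M) (W : M -> 'rV[R]_m.+2) (E : 'I_m -> M -> 'rV[R]_m.+2) : open U -> U p ->
  smooth_vfield W -> (forall i, smooth_vfield (E i)) ->
  (forall q, U q -> null_frame g q (V q) (W q) (fun i => E i q)) ->
  forall k i j, dhess_mx g nabla W E k p i j = 0.
Proof.
move=> oU Up SW SE NF k i j; have [[SV V0 VV VP] _ _] := PP.
case: (eqVneq (hess_mx g nabla W E p) 0) => T0; last first.
  have [a [b Tab]] : exists a b, hess g nabla W E a b p != 0.
    apply: contrapT => H; move/eqP: T0; apply; apply/matrixP => a b; rewrite [RHS]mxE mxE.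
    rewrite -(hessE Hg LC SW SE); case: (eqVneq (hess g nabla W E a b p) 0) => // h.
    by case: H; exists a, b.
  have Sh := smooth_at_global p (hess_smooth Hg LC SW SE a b).
  have n0 : 0 < `|hess g nabla W E a b p| by rewrite normr_gt0.
  (* By continuity a nonzero entry of T at p stays nonzero nearby; on this smaller set f is
     invertible, as the ring argument requires. *)
  have [U' [oU' Up' H]] := near_exists_open (near_and (near_open oU Up) (cont_at_near n0 (smooth_at_cont Sh))).
  apply: (@dhess_zero _ _ _ _ Hg _ LC _ PP RF HH U' W E oU' SW SE _ _ k i j p Up').
    by move=> q /H[/NF].
  move=> q /H[_ h]; apply/eqP => Tq.
  have := congr1 (fun X : 'M[R]_m => X a b) Tq; rewrite mxE [RHS]mxE -(hessE Hg LC SW SE) => E0.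
  by move: h; rewrite E0 subr0 ltxx.
have F := NF p Up; have PT := pp_tensor_Rm Hg LC PP p.
have h0 a b : hess g nabla W E a b p = 0.
  by have := congr1 (fun X : 'M[R]_m => X a b) T0; rewrite mxE [RHS]mxE -(hessE Hg LC SW SE).
have Rp : forall x y z, Rm nabla p x y z = 0.
  by apply: (pp_tensor_zero Hg F PT) => a b; rewrite -(hessE Hg LC SW SE).
(* The entries of T vanish along the leaf through p, hence so does their derivative; with T = 0 at p
   the connection terms in [hess_der] drop, leaving DT. *)
have D : der (hess g nabla W E i j) p (E k p) = 0.
  apply: (leaf_constant_der Hg LC SV V0 VP).
  - exact: smooth_at_global p (hess_smooth Hg LC SW SE i j).
  - apply: near_true => q SL; rewrite h0 (hessE Hg LC SW SE) (flat_leaf SL Rp).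
    exact: inner0.
  - by have [_ _ _ ew _] := F; exact: (ew k).1.
rewrite mxE; have := hess_der Hg LC PP oU SW SE NF i j Up (SE k); rewrite D.
rewrite big1 => [|l _]; last by rewrite h0 mulr0.
rewrite big1 => [|l _]; last by rewrite h0 mulr0.
by rewrite !addr0.
Qed.

(** For fixed u the derivative is a tensor of pp-wave type, so its screen matrix decides. Expanding
    u in the frame leaves the E_l, treated by [dhess_vanishes], and V, treated by [dRm_along_V]. *)
Lemma dRm_vanishes p u x y z : inner g p u (V p) = 0 -> dRm nabla p u x y z = 0.
Proof.
move=> uV; have [U [W [E [oU Up SW SE NF]]]] := pp_wave_frame p.
have F := NF p Up; have [_ _ _ ew _] := F; apply: (pp_tensor_zero Hg F (pp_tensor_dRm Hg LC PP p u)) => i j.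
have h1 (c : R) a b : inner g p (dRm nabla p (c *: a + b) (W p) (E i p) (E j p)) (W p) =
   c * inner g p (dRm nabla p a (W p) (E i p) (E j p)) (W p) + inner g p (dRm nabla p b (W p) (E i p) (E j p)) (W p).
  by rewrite (dRm_lin0 Hg LC) inner_linear.
pose h a := inner g p (dRm nabla p a (W p) (E i p) (E j p)) (W p).
have h0 : h 0 = 0 by have := h1 1 0 0; rewrite scale1r mul1r addr0 -[LHS]addr0 => /addrI.
have hD a b : h (a + b) = h a + h b by have := h1 1 a b; rewrite scale1r mul1r.
have hZ c a : h (c *: a) = c * h a by have := h1 c a 0; rewrite -!/(h _) h0 !addr0.
have hV : h (V p) = 0 by rewrite /h (dRm_along_V Hg LC PP _ _ (ew i).1) inner0.
rewrite -/(h u) (null_frame_perp Hg F uV) hD hZ hV mulr0 addr0 (big_morph h hD h0) big1 // => l _.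
rewrite hZ; have := dhess_vanishes oU Up SW SE NF l i j; rewrite mxE => E0.
by rewrite /h E0 mulr0.
Qed.

End PlaneWave.

Theorem corollary1 (R : realType) (n : nat) (M : manifold R n)
    (g : M -> 'M[R]_n) (g_lorentzian : lorentzian g)
    (nabla : (M -> 'rV[R]_n) -> (M -> 'rV[R]_n) -> (M -> 'rV[R]_n))
    (nabla_levi_civita : levi_civita g nabla)
    (V : M -> 'rV[R]_n) (M_pp_wave : pp_wave g nabla V)
    (M_indecomposable : strongly_indecomposable g)
    (M_ricci_flat : ricci_flat nabla)
    (M_homogeneous : locally_orth_homogeneous g V) :
  plane_wave g nabla V.
Proof.
split=> // U X Y Z [SU UV] SX SY SZ p.
case: n M g g_lorentzian nabla nabla_levi_civita V M_pp_wave M_ricci_flat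
  M_homogeneous U X Y Z SU UV SX SY SZ p {M_indecomposable} => [|[|m]] M g Hg nabla LC V PP RF HH U X Y Z SU UV SX SY SZ p.
(* In dimension 0 the index cannot be 1. *)
- by have [] := Hg.1 p.
(* In dimension 1 every vector is a multiple of V, so a null V would make the metric degenerate. *)
- have [[_ V0 VV _] _ _] := PP; case: (V0 p); apply: (@inner_nondeg _ _ _ _ _ Hg p) => w.
  have v0 : V p 0 0 != 0.
    by apply/eqP => h; apply: (V0 p); apply/rowP => a; rewrite ord1 h mxE.
  have -> : w = (w 0 0 / V p 0 0) *: V p.
    by apply/rowP => a; rewrite ord1 mxE divfK.
  by rewrite (innerZr Hg) VV mulr0.
rewrite (dRmE Hg LC p SU SX SY SZ); exact: (dRm_vanishes Hg LC PP RF HH).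
Qed.
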